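(* Let $\Delta=\delta^{AB}\partial_A\partial_B$ be the flat Laplacian in $n-2p$ dimensions (in the variables $x^A$, $A=1,\dots,n-2p$) and let $H=H(x^A,u^b)$, $b=1,\dots,p$. (i) When $n$ is odd, the most general solutions $h=h(\varrho,x^A,u^b)$ to the equation $$2\varrho\,h''+(2-n)h'-\Delta(H+h)=0\qquad ( * )$$ with $h(\varrho)\to 0$ when $\varrho\downarrow 0$ are given as $$h=\sum_{k=1}^{\infty}\frac{\Delta^kH}{k!\prod_{i=1}^k(2i-n)}\varrho^k+\varrho^{n/2}\Big(\alpha+\sum_{k=1}^\infty\frac{\Delta^k\alpha}{k!\prod_{i=1}^k(2i+n)}\varrho^k\Big),$$ where $\alpha=\alpha(x^A,u^b)$ is an arbitrary function of its variables. In particular, when $H$ is analytic, a unique solution that is analytic in $\varrho$ in a neighbourhood of $\varrho=0$ with $h(0)=0$ is given by $\alpha\equiv 0$. (ii) When $n=2s$ is even, the most general solutions $h$ to $( * )$ with $h(\varrho)\to0$ when $\varrho\downarrow 0$ are given by $$\begin{aligned}h=&\sum_{k=1}^{s-1}\frac{\Delta^kH}{k!\prod_{i=1}^k(2i-n)}\varrho^k+\varrho^{s}\Big(\alpha+\sum_{k=1}^\infty\frac{\Delta^k\alpha}{k!\prod_{i=1}^k(2i+n)}\varrho^k\Big)\\&+c_n\varrho^{s}\Big(\sum_{k=0}^\infty\big(\log(\varrho)-q_k\big)\frac{\Delta^{s+k}H}{k!\prod_{i=1}^k(2i+n)}\varrho^k\Big)+c_n\varrho^{s}\;Q\ast\sum_{k=0}^\infty\frac{\Delta^{s+k}H}{k!\prod_{i=1}^k(2i+n)}\varrho^k,\end{aligned}$$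 where $\alpha=\alpha(x^A,u^b)$ and $Q=Q(x^A,u^b)$ are arbitrary functions of their variables, $\ast$ denotes the convolution of two functions with respect to the $x^A$-variables, and the constants are given as $$c_n=-\frac{1}{(s-1)!\prod_{i=0}^{s-1}(2i-n)},\qquad q_0=0,\qquad q_k=\sum_{i=1}^k\frac{n+4i}{i(n+2i)}\ \text{ for } k=1,2,\dots.$$ In particular, only when $\Delta^{s}H\equiv0$ are there solutions that are analytic in $\varrho$ in a neighbourhood of $\varrho=0$ and with $h(0)=0$. These solutions are not unique but are parametrized by analytic functions $\alpha$.
   Context: Here $p$ is a natural number with $1\le p\le n/2$, the variables are $x^1,\dots,x^{n-2p}$, $u^1,\dots,u^p$ and $\varrho$, and the prime denotes differentiation with respect to $\varrho$. Empty products equal $1$.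
   Formalization: Solutions h are taken analytic in x, uniformly as ϱ↓0 (so α is too): a smooth non-analytic α gives a solution the series misses. For smooth H, α the claim is for formal log-power series in ϱ. Q∗Δ^sH must converge absolutely with x-derivatives. Formulas hold near ϱ=0. *)

(* Defs.v *)
From HB Require Import structures.
From mathcomp Require Import all_boot all_order all_algebra.
From mathcomp Require Import all_classical all_reals all_analysis.

Set Implicit Arguments.
Unset Strict Implicit.
Unset Printing Implicit Defensive.

Import Order.TTheory GRing.Theory Num.Theory.
Import numFieldNormedType.Exports.

Local Open Scope classical_set_scope.
Local Open Scope ring_scope.

Section SpatialCalculus.
Context {R : realType} {m : nat}.
Implicit Types (f : 'rV[R]_m -> R) (x : 'rV[R]_m).

Definition partial (A : 'I_m) f : 'rV[R]_m -> R :=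
  fun x => 'D_(delta_mx 0 A) f x.

Definition laplacian f : 'rV[R]_m -> R :=
  fun x => \sum_(A < m) partial A (partial A f) x.

(* C^oo : every iterated partial derivative exists and is differentiable. *)
Definition smooth f : Prop :=
  forall (l : seq 'I_m) x, differentiable (foldr partial f l) x.

(* On the polydisc of radius r around x0, f is the sum of a multivariate power
   series sum_b c_b (x - x0)^b with sum_b |c_b| r^|b| <= M; the absolutely
   convergent sum is taken over the boxes {0, .., N-1}^m. *)
Definition powerseries_le f x0 (r M : R) : Prop :=
  exists2 c : {ffun 'I_m -> nat} -> R,
    (\esum_(b in setT) (`|c b| * r ^+ (\sum_(i < m) b i))%:E <= M%:E)%E &
    forall x, ball x0 r x ->
      (\sum_(b : {ffun 'I_m -> 'I_N})
         c [ffun i => val (b i)] * \prod_(i < m) (x 0 i - x0 0 i) ^+ b i)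
      @[N --> \oo] --> f x.

Definition analytic f : Prop :=
  forall x0, exists r M : R, 0 < r /\ powerseries_le f x0 r M.

End SpatialCalculus.

Section Convolution.
Context {R : realType}.

(* Lebesgue measure on R^m, by iterated integration of the sections. *)
Fixpoint lebesgue_tuple (m : nat) : set (m.-tuple R) -> \bar R :=
  match m with
  | 0%N => fun A => \d_ ([tuple] : 0.-tuple R) A
  | m'.+1 => fun A =>
      (\int[@lebesgue_measure R]_t
         lebesgue_tuple [set y : m'.-tuple R | A [tuple of t :: y]])%E
  end.

Definition row_of_tuple (m : nat) (y : m.-tuple R) : 'rV[R]_m :=
  \row_(i < m) tnth y i.

Definition conv_integrand (m : nat) (Q f : 'rV[R]_m -> R) (x : 'rV[R]_m) :
    m.-tuple R -> R :=
  fun y => Q (row_of_tuple y) * f (x - row_of_tuple y).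

Definition convolution (m : nat) (Q f : 'rV[R]_m -> R) : 'rV[R]_m -> R :=
  fun x => fine (\int[@lebesgue_tuple m]_y (conv_integrand Q f x y)%:E)%E.

(* Q * f converges absolutely, with all x-derivatives taken on f, locally
   uniformly in x. *)
Definition smooth_convolvable (m : nat) (Q f : 'rV[R]_m -> R) : Prop :=
  measurable_fun setT (fun y : m.-tuple R => Q (row_of_tuple y)) /\
  forall (l : seq 'I_m) (x0 : 'rV[R]_m),
    exists (r : R) (g : m.-tuple R -> R),
      [/\ 0 < r,
          (@lebesgue_tuple m).-integrable setT (EFin \o g) &
          forall y x, ball x0 r x ->
            `|conv_integrand Q (foldr partial f l) x y| <= g y].

(* Q * f converges absolutely as an integral of germs of analytic functions of
   x, normed by the majorant norm of powerseries_le. *)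
Definition analytic_convolvable (m : nat) (Q f : 'rV[R]_m -> R) : Prop :=
  measurable_fun setT (fun y : m.-tuple R => Q (row_of_tuple y)) /\
  forall x0 : 'rV[R]_m,
    exists (r : R) (g : m.-tuple R -> R),
      [/\ 0 < r,
          (@lebesgue_tuple m).-integrable setT (EFin \o g) &
          forall y, powerseries_le (fun x => conv_integrand Q f x y) x0 r (g y)].

End Convolution.

Section Constants.
Context {R : realType}.
Implicit Types n k s : nat.

Definition denom_minus n k : R :=
  k`!%:R * \prod_(1 <= i < k.+1) ((2 * i)%:R - n%:R).

Definition denom_plus n k : R :=
  k`!%:R * \prod_(1 <= i < k.+1) ((2 * i)%:R + n%:R).

Definition c_ n s : R :=
  - ((s.-1)`!%:R * \prod_(0 <= i < s) ((2 * i)%:R - n%:R))^-1.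

Definition q_ n k : R :=
  \sum_(1 <= i < k.+1) (n + 4 * i)%:R / (i * (n + 2 * i))%:R.

End Constants.

(* Functions of (x, u), with x in R^m and the parameter u in R^p; Laplacian,
   smoothness, analyticity and convolution only concern x. *)
Section Equation.
Context {R : realType} {m p : nat}.
Implicit Types (n s k : nat) (rho : R) (x : 'rV[R]_m) (u : 'rV[R]_p).
Implicit Types (H alpha Q : 'rV[R]_m -> 'rV[R]_p -> R).
Implicit Types (h : R -> 'rV[R]_m -> 'rV[R]_p -> R).

Definition lap k H x u : R := iter k laplacian (H ^~ u) x.

Definition smooth_x H := forall u, smooth (H ^~ u).
Definition analytic_x H := forall u, analytic (H ^~ u).

Definition equation_at n H h rho x u : Prop :=
  let hx := fun t : R => h t x u in
  [/\ derivable hx rho 1,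
      derivable (derive1 hx) rho 1 &
      2 * rho * derive1 (derive1 hx) rho + (2 - n%:R) * derive1 hx rho
      - laplacian (fun y => H y u + h rho y u) x = 0].

(* Solutions near rho = 0, rho > 0, that are analytic in x, locally uniformly
   as rho tends to 0. *)
Definition solution n H h : Prop :=
  [/\ forall u x0, \forall rho \near 0^'+ & x \near x0,
        equation_at n H h rho x u,
      forall u x0, exists r M : R, 0 < r /\
        \forall rho \near 0^'+, powerseries_le (fun x => h rho x u) x0 r M &
      forall u x, h rho x u @[rho --> 0^'+] --> (0 : R)].

Definition analytic_in_rho h : Prop :=
  forall u x0, exists2 r : R, 0 < r &
    \forall x \near x0, exists a : nat -> R, forall rho, `|rho| < r ->
      (\sum_(0 <= k < N) a k * rho ^+ k) @[N --> \oo] --> h rho x u.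

Definition analytic_solution n H h : Prop :=
  [/\ solution n H h,
      forall u x0, \forall rho \near (0 : R) & x \near x0,
        equation_at n H h rho x u,
      analytic_in_rho h &
      forall u x, h 0 x u = 0].

Definition term_minus n H rho x u k : R :=
  lap k H x u / denom_minus n k * rho ^+ k.

Definition term_plus n H rho x u k : R :=
  lap k H x u / denom_plus n k * rho ^+ k.

Definition odd_formula n H alpha rho x u : R :=
  limn (fun N => \sum_(1 <= k < N) term_minus n H rho x u k)
  + rho `^ (n%:R / 2)
    * (alpha x u + limn (fun N => \sum_(1 <= k < N) term_plus n alpha rho x u k)).

Definition odd_formula_converges n H alpha rho x u : Prop :=
  cvgn (fun N => \sum_(1 <= k < N) term_minus n H rho x u k) /\
  cvgn (fun N => \sum_(1 <= k < N) term_plus n alpha rho x u k).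

Definition even_formula n s H alpha Q rho x u : R :=
  \sum_(1 <= k < s) term_minus n H rho x u k
  + rho ^+ s
    * (alpha x u + limn (fun N => \sum_(1 <= k < N) term_plus n alpha rho x u k))
  + c_ n s * rho ^+ s
    * limn (fun N => \sum_(0 <= k < N)
              (ln rho - q_ n k) * term_plus n (lap s H) rho x u k)
  + c_ n s * rho ^+ s
    * convolution (Q ^~ u) (fun y =>
        limn (fun N => \sum_(0 <= k < N) term_plus n (lap s H) rho y u k)) x.

Definition even_formula_converges n s H alpha Q rho x u : Prop :=
  [/\ cvgn (fun N => \sum_(1 <= k < N) term_plus n alpha rho x u k),
      cvgn (fun N => \sum_(0 <= k < N)
              (ln rho - q_ n k) * term_plus n (lap s H) rho x u k),
      forall y, Q y u != 0 ->
        cvgn (fun N => \sum_(0 <= k < N) term_plus n (lap s H) rho (x - y) u k) &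
      (@lebesgue_tuple R m).-integrable setT (EFin \o
        conv_integrand (Q ^~ u)
          (fun y =>
          limn (fun N => \sum_(0 <= k < N) term_plus n (lap s H) rho y u k)) x)].

(* The formulas hold near rho = 0 for the filter F, which is 0^'+ or nbhs 0. *)
Definition given_by_odd (F : set_system R) n H alpha h : Prop :=
  forall u x0, \forall rho \near F & x \near x0,
    odd_formula_converges n H alpha rho x u /\
    h rho x u = odd_formula n H alpha rho x u.

Definition given_by_even (F : set_system R) n s H alpha Q h : Prop :=
  forall u x0, \forall rho \near F & x \near x0,
    even_formula_converges n s H alpha Q rho x u /\
    h rho x u = even_formula n s H alpha Q rho x u.

End Equation.

(* When H is merely smooth, the series above are formal: a l j is the
   coefficient of rho^l (log rho)^j. *)
Section Formal.
Context {R : realType} {m p : nat}.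
Implicit Types (n s k j : nat) (l : R) (x : 'rV[R]_m) (u : 'rV[R]_p).
Implicit Types (H alpha Q : 'rV[R]_m -> 'rV[R]_p -> R).

Definition formal := R -> nat -> 'rV[R]_m -> 'rV[R]_p -> R.
Implicit Types a : formal.

Definition formal_log_series a : Prop :=
  (forall l j, smooth_x (a l j)) /\
  (forall L : R,
     finite_set [set lj : R * nat | lj.1 <= L /\ a lj.1 lj.2 <> (fun _ _ => 0)]).

(* d/drho *)
Definition formal_derive a : formal := fun l j x u =>
  (l + 1) * a (l + 1) j x u + j.+1%:R * a (l + 1) j.+1 x u.

Definition formal_const H : formal := fun l j x u =>
  if (l == 0) && (j == 0)%N then H x u else 0.

Definition formal_equation n H a : Prop := forall l j x u,
  2 * formal_derive (formal_derive a) (l - 1) j x u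
  + (2 - n%:R) * formal_derive a l j x u
  - laplacian (fun y => formal_const H l j y u + a l j y u) x = 0.

Definition formal_solution n H a : Prop :=
  [/\ formal_log_series a,
      formal_equation n H a &
      forall l j x u, l <= 0 -> a l j x u = 0].

Definition odd_expansion n H alpha : formal := fun l j x u =>
  if j is 0%N then
    if l \is a Num.nat then
      let k := Num.truncn l in
      if (1 <= k)%N then lap k H x u / denom_minus n k else 0
    else if l - n%:R / 2 \is a Num.nat then
      let k := Num.truncn (l - n%:R / 2) in
      lap k alpha x u / denom_plus n k
    else 0
  else 0.

Definition even_expansion n s H alpha Q : formal := fun l j x u =>
  if l \is a Num.nat then
    let i := Num.truncn l in
    if (i < s)%N then
      if (j == 0%N) && (1 <= i)%N then lap i H x u / denom_minus n i else 0
    else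
      let k := (i - s)%N in
      let D := fun y => lap (s + k) H y u / denom_plus n k in
      match j with
      | 0%N => lap k alpha x u / denom_plus n k - c_ n s * q_ n k * D x
               + c_ n s * convolution (Q ^~ u) D x
      | 1%N => c_ n s * D x
      | _ => 0
      end
  else 0.

End Formal.

(* Main.v *)
(*
  Write L g = 2 t g'' + (2 - n) g', so that the equation is L h = Delta (H + h), and z = t^(n/2); L kills 1 and z.

  Solutions are expansions.  If L g >= 0 then g is convex as a function of z.  Comparing a function c with
  multiples of t^a shows: if |L c| <= K t^(a-1) and c -> 0, then |c| <= K' t^a when a < n/2, and
  c = alpha z + O(t^a) when a > n/2.  The uniform bound on the power series of h in x gives Cauchy estimates
  for all x-derivatives of h, and these satisfy the differentiated equation (as uniform limits of difference
  quotients).  The equation bounds Delta H by sup |h| near t = 0, so Delta H satisfies Cauchy estimates too, and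
  the particular expansion built from H converges.  The difference d of h and this expansion satisfies L d = Delta d;
  bootstrapping the exponent a past n/2 yields d = alpha z + o(z).  Subtracting the expansion generated by alpha leaves
  a solution that is o(z), and iterating the comparison bounds it by
  C^k (2k)! / (k!)^2 t^k for every k, so that it vanishes for small t.

  The coefficients of the series in (Delta^k f) t^k decay like C^k / (2k)!, which compensates for the Cauchy estimates
  of Delta^k f.  The convolution with Q commutes with these series and with the Laplacian, hence only changes alpha
  by c_n Q * Delta^s H; a solution is therefore represented with Q = 0.

  Formal series: two solutions with the same coefficient of t^(n/2) agree, by induction on the exponent, since
  the equation is regular at every exponent l > 0 except l = n/2.

  Analyticity in t: for n odd, z (alpha + ...) is not a power series unless alpha = 0; for n even, a power series that
  equals t^s (alpha + ... + c_n ln t (Delta^s H + ...)) forces ln t * Delta^s H to stay bounded.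
*)
Require Import Defs.
From HB Require Import structures.
From mathcomp Require Import all_boot all_order all_algebra.
From mathcomp Require Import all_classical all_reals all_analysis.
From mathcomp Require Import measurable_realfun ring lra zify.
Set Implicit Arguments.
Unset Strict Implicit.
Unset Printing Implicit Defensive.
Import Order.TTheory GRing.Theory Num.Theory.
Import numFieldNormedType.Exports.
Local Open Scope classical_set_scope.
Local Open Scope ring_scope.

(** * Iterated partial derivatives *)

(** A solution has two t-derivatives at each fixed x and is analytic in x at each fixed t, but
    nothing is known about t-derivatives of its x-derivatives. This is why the comparison is stated
    for values at three points, an inequality that survives uniform limits, and why the
    differentiated equation is only claimed approximately ([mild]). All estimates hold on one fixed
    ball for all x-derivatives at once: each use of the equation trades two x-derivatives for one
    power of t, so that k uses cost a factor (2 k)!, and the ball never has to shrink. Integrating k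
    times beyond t^(n/2) returns a factor 1 / (k!)^2 up to powers; the quotient is merely geometric,
    which is just enough for uniqueness at small t. As H is only smooth, every estimate drawn from a
    given solution starts from Delta H, which the equation controls. A single expansion with a
    constant c, equal to 0 for odd n and to c_n for even n, serves both parities. *)

Notation pd l f := (foldr partial f l).

Section Basics.
Context {R : realType} {m : nat}.
Implicit Types (f g : 'rV[R]_m -> R) (x v : 'rV[R]_m) (l : seq 'I_m) (B : nat -> R).

Lemma ler_coord_norm x (A : 'I_m) : `|x 0 A| <= `|x|.
Proof.
rewrite [leRHS]mx_normrE.
by rewrite (le_bigmax _ (fun ij : 'I_1 * 'I_m => `|x ij.1 ij.2|) (0, A)).
Qed.

Lemma rV_norm_le x e : 0 <= e -> (forall A : 'I_m, `|x 0 A| <= e) -> `|x| <= e.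
Proof.
move=> e0 xe; rewrite [leLHS]mx_normrE; apply/bigmax_leP; split => //.
by move=> [i j] _ /=; rewrite (ord1 i).
Qed.

Lemma norm_delta_mx_le (A : 'I_m) : `|delta_mx 0 A : 'rV[R]_m| <= 1.
Proof.
apply: rV_norm_le => // B; rewrite mxE /=.
by case: (B == A); rewrite ?normr1 ?normr0.
Qed.

Lemma ballE x0 (r : R) x : ball x0 r x <-> `|x - x0| < r.
Proof. by rewrite -ball_normE /ball_ /= distrC. Qed.

Lemma near_in_ball x0 (r : R) x (P : 'rV[R]_m -> Prop) :
  ball x0 r x -> (forall y, ball x0 r y -> P y) -> \forall y \near x, P y.
Proof.
move=> /ballE xr H; have e0 : 0 < r - `|x - x0| by rewrite subr_gt0.
apply/nbhs_ballP; exists (r - `|x - x0|) => //= y /ballE xy; apply/H/ballE.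
have -> : y - x0 = (y - x) + (x - x0) by rewrite addrA subrK.
by apply: le_lt_trans (ler_normD _ _) _; rewrite -ltrBrDr.
Qed.

Lemma pd_eq_ball f g x0 (r : R) l :
  (forall y, ball x0 r y -> f y = g y) ->
  forall y, ball x0 r y -> pd l f y = pd l g y.
Proof.
move=> fg; elim: l => [//|A l IH] y xy /=.
by apply: near_eq_derive; apply: near_in_ball xy _ => z /IH.
Qed.

Lemma near_eq_differentiable f g x :
  (\forall y \near x, f y = g y) -> differentiable f x -> differentiable g x.
Proof.
move=> fg /diff_locallyP [df1 df2]; have fgx := nbhs_singleton fg.
have H : 'd g x = 'd f x :> (_ -> _).
  apply: diff_unique; first exact: df1.
  apply/eqaddoP => e e0; move/eqaddoP/(_ e e0) : df2 => df2.
  have fg0 : \forall h \near (0 : 'rV[R]_m), f (h + x) = g (h + x).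
    by have := fg; rewrite (near_shift 0 x) subr0.
  near=> h; rewrite !fctE -fgx /= -(near fg0 h) //; near: h.
  exact: df2.
apply/diff_locallyP; rewrite H; split => //.
apply/eqaddoP => e e0; move/eqaddoP/(_ e e0) : df2 => df2.
have fg0 : \forall h \near (0 : 'rV[R]_m), f (h + x) = g (h + x).
  by have := fg; rewrite (near_shift 0 x) subr0.
near=> h; rewrite !fctE -fgx /= -(near fg0 h) //; near: h.
exact: df2.
Unshelve. all: by end_near. Qed.

Lemma flat_differentiable g x (K r : R) : 0 < r ->
  (forall v, `|v| < r -> `|g (v + x) - g x| <= K * `|v| ^+ 2) ->
  differentiable g x /\ forall v, 'D_v g x = 0.
Proof.
move=> r0 H.
have K0 : forall e : R, 0 < e -> \forall h \near (0 : 'rV[R]_m),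
    `|g (h + x) - g x| <= e * `|h|.
  move=> e e0; have d0 : 0 < Num.min r (e / (`|K| + 1)).
    by rewrite lt_min r0 /= divr_gt0// ltr_wpDl.
  apply/nbhs_ballP; exists (Num.min r (e / (`|K| + 1))) => //= h /ballE.
  rewrite subr0 lt_min => /andP[hr he]; apply: le_trans (H _ hr) _.
  rewrite expr2 mulrA ler_wpM2r//; apply: le_trans (ler_norm _) _.
  rewrite normrM normr_id; move: he; rewrite ltr_pdivlMr ?ltr_wpDl// => /ltW.
  apply: le_trans; rewrite mulrC ler_wpM2l// lerDl//.
have cst0 : continuous (\0 : 'rV[R]_m -> R) by exact: (@cst_continuous _ _ (0 : R)).
have H0 : 'd g x = \0 :> (_ -> _).
  apply: diff_unique; first exact: cst0.
  apply/eqaddoP => e e0; have := K0 e e0; apply: filterS => h.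
  by rewrite !fctE /= addr0.
have dg : differentiable g x.
  apply/diff_locallyP; rewrite H0; split; first exact: cst0.
  apply/eqaddoP => e e0; have := K0 e e0; apply: filterS => h.
  by rewrite !fctE /= addr0.
by split => // v; rewrite deriveE // H0.
Qed.

Lemma is_derive_coord (A : 'I_m) x v : is_derive x v (fun y : 'rV[R]_m => y 0 A) (v 0 A).
Proof.
pose M := fun y : 'rV[R]_m => y.
have Md : derivable M x v by apply: derivable_id.
have := derive_mx Md; rewrite derive_id => /rowP/(_ A); rewrite !mxE => ->.
apply: DeriveDef => //; exact: (derivable_mxP _ _ _).1 Md 0 A.
Qed.

(** A quadratic remainder subtracts to a flat function, so it yields differentiability and the
    partials together. This criterion is used for limits and for integrals with a parameter, because
    an inequality passes to both. *)
Lemma quad_differentiable f x (d : 'I_m -> R) (K r : R) : 0 < r ->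
  (forall v, `|v| < r -> `|f (v + x) - f x - \sum_(A < m) v 0 A * d A| <= K * `|v| ^+ 2) ->
  differentiable f x /\ forall A, partial A f x = d A.
Proof.
move=> r0 H.
pose lin := \sum_(A < m) (d A *: (fun y : 'rV[R]_m => y 0 A)).
have linE y : lin y = \sum_(A < m) y 0 A * d A.
  by rewrite /lin fct_sumE; apply: eq_bigr => A _; rewrite mulrC.
have dlin y : differentiable lin y.
  by apply: differentiable_sum => A; apply: differentiableZ; exact: differentiable_coord.
have [dg gE] : differentiable (f - lin) x /\ forall v, 'D_v (f - lin) x = 0.
  apply: (@flat_differentiable _ _ K r) => // v vr.
  rewrite !fctE !linE; have := H v vr; congr (`|_| <= _).
  under [X in _ = _ - X - _]eq_bigr do rewrite mxE mulrDl.
  rewrite big_split /=; ring.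
have fE : f = (f - lin) + lin by rewrite subrK.
split; first by rewrite fE; exact: differentiableD.
move=> A; rewrite /partial fE deriveD; [|exact: diff_derivable..].
rewrite gE add0r /lin derive_sum; last first.
  by move=> i; apply: derivableZ; case: (is_derive_coord i x (delta_mx 0 A)).
rewrite (bigD1 A) //= big1 ?addr0.
  rewrite deriveZ; last by case: (is_derive_coord A x (delta_mx 0 A)).
  by have [_ ->] := is_derive_coord A x (delta_mx 0 A); rewrite mxE !eqxx /= -[LHS]/(_ * _) mulr1.
move=> i iA; rewrite deriveZ; last by case: (is_derive_coord i x (delta_mx 0 A)).
by have [_ ->] := is_derive_coord i x (delta_mx 0 A); rewrite mxE (negbTE iA) /= -[LHS]/(_ * _) mulr0.
Qed.

Lemma is_derive_line f x v (t : R) : differentiable f (x + t *: v) ->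
  is_derive t 1 (fun s : R => f (x + s *: v)) (\sum_(A < m) v 0 A * partial A f (x + t *: v)).
Proof.
move=> df.
have E : (fun h : R => h^-1 *: (((fun s : R => f (x + s *: v)) \o shift t) (h *: (1 : R)) - f (x + t *: v)))
   = (fun h : R => h^-1 *: ((f \o shift (x + t *: v)) (h *: v) - f (x + t *: v))).
  apply/funext => h /=; congr (_ *: (f _ - _)).
  by rewrite scalerDl [h *: 1]mulr1 addrCA.
have dv := @diff_derivable _ _ _ _ _ v df.
apply: DeriveDef; first by rewrite /derivable E.
rewrite /derive E -/(derive f (x + t *: v) v) deriveE //.
move: ('d f (x + t *: v)) (fun u => deriveE u df) => df' dfE.
rewrite {1}(row_sum_delta v) linear_sum; apply: eq_bigr => A _.
by rewrite linearZ /= /partial dfE.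
Qed.

Lemma mvt_le (phi dphi : R -> R) (K : R) :
  (forall t : R, 0 <= t <= 1 -> is_derive t 1 phi (dphi t)) ->
  (forall t : R, 0 <= t <= 1 -> `|dphi t| <= K) ->
  `|phi 1 - phi 0| <= K.
Proof.
move=> d1 d2.
have [c ci ->] : exists2 c, c \in `[0, 1]%R & phi 1 - phi 0 = dphi c * (1 - 0).
  apply: MVT_segment => //.
    by move=> t; rewrite in_itv /= => /andP[t0 t1]; apply: d1; rewrite !ltW.
  apply: derivable_within_continuous => t; rewrite in_itv /= => t01.
  by have [] := d1 t t01.
by rewrite subr0 mulr1; apply: d2; rewrite in_itv /= in ci.
Qed.

Definition smooth_on f x0 (r : R) := forall l x, ball x0 r x -> differentiable (pd l f) x.

(** The bound depends only on the number of derivatives and the ball is the same for all orders, so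
    that estimates for all derivatives are carried along at once. *)
Definition smooth_bd f x0 (r : R) B := smooth_on f x0 r /\
  forall l x, ball x0 r x -> `|pd l f x| <= B (size l).

Lemma segment_ball x0 (r : R) x v (t : R) : ball x0 r x -> ball x0 r (v + x) -> 0 <= t <= 1 ->
  ball x0 r (x + t *: v).
Proof.
move=> /ballE xr /ballE vr /andP[t0 t1]; apply/ballE.
have -> : x + t *: v - x0 = (1 - t) *: (x - x0) + t *: (v + x - x0).
  by apply/rowP => i; rewrite !mxE; ring.
apply: le_lt_trans (ler_normD _ _) _; rewrite !normrZ ger0_norm ?subr_ge0// ger0_norm//.
have [->|tn0] := eqVneq t 0; first by rewrite subr0 mul1r mul0r addr0.
rewrite (_ : r = (1 - t) * r + t * r); last by ring.
by apply: ler_ltD; [apply: ler_wpM2l; rewrite ?subr_ge0 // ltW | rewrite ltr_pM2l // lt0r tn0].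
Qed.

Lemma smooth_on_pd f x0 (r : R) l : smooth_on f x0 r -> smooth_on (pd l f) x0 r.
Proof. by move=> fs l' x xr; rewrite -foldr_cat; exact: fs. Qed.

Lemma smooth_bd_pd f x0 (r : R) B l : smooth_bd f x0 r B ->
  smooth_bd (pd l f) x0 r (fun j => B (j + size l)%N).
Proof.
move=> [fs fB]; split; first exact: smooth_on_pd.
by move=> l' x xr; rewrite -foldr_cat -size_cat; exact: fB.
Qed.

Lemma smooth_on_lip f x0 (r K : R) x v : smooth_on f x0 r ->
  (forall A y, ball x0 r y -> `|partial A f y| <= K) -> ball x0 r x -> ball x0 r (v + x) ->
  `|f (v + x) - f x| <= m%:R * K * `|v|.
Proof.
move=> fs fB xr vr.
have := @mvt_le (fun t => f (x + t *: v)) (fun t => \sum_(A < m) v 0 A * partial A f (x + t *: v))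
  (m%:R * K * `|v|).
rewrite scale1r scale0r addr0 (addrC v x); apply.
  by move=> t t01; apply: is_derive_line; apply: (fs [::]); exact: segment_ball.
move=> t t01; apply: le_trans (ler_norm_sum _ _ _) _.
apply: le_trans (_ : \sum_(A < m) `|v| * K <= _); last first.
  rewrite sumr_const card_ord -mulr_natl le_eqVlt; apply/orP; left; apply/eqP; ring.
apply: ler_sum => A _; rewrite normrM; apply: ler_pM => //; first exact: ler_coord_norm.
by apply: fB; exact: segment_ball.
Qed.

(** Mean value inequality for f (x + t v) - t S: its derivative in t is a combination of differences
    of first partials, each of order |v| by [smooth_on_lip]. *)
Lemma smooth_on_quad f x0 (r K : R) x v : smooth_on f x0 r ->
  (forall A A' y, ball x0 r y -> `|pd [:: A; A'] f y| <= K) -> ball x0 r x -> ball x0 r (v + x) ->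
  `|f (v + x) - f x - \sum_(A < m) v 0 A * partial A f x| <= m%:R ^+ 2 * K * `|v| ^+ 2.
Proof.
move=> fs fB xr vr.
pose S := \sum_(A < m) v 0 A * partial A f x.
have := @mvt_le (fun t => f (x + t *: v) - t * S)
  (fun t => \sum_(A < m) v 0 A * partial A f (x + t *: v) - S) (m%:R ^+ 2 * K * `|v| ^+ 2).
rewrite scale1r scale0r addr0 mul1r mul0r subr0 => H.
rewrite (addrC v x).
rewrite addrAC; apply: H => t t01; last first.
  rewrite -sumrB; apply: le_trans (ler_norm_sum _ _ _) _.
  apply: le_trans (_ : \sum_(A < m) `|v| * (m%:R * K * `|v|) <= _); last first.
    rewrite sumr_const card_ord -mulr_natl le_eqVlt; apply/orP; left; apply/eqP; ring.
  apply: ler_sum => A _; rewrite -mulrBr normrM; apply: ler_pM => //; first exact: ler_coord_norm.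
  have xt : ball x0 r (t *: v + x) by rewrite addrC; exact: segment_ball.
  have := smooth_on_lip (smooth_on_pd [:: A] fs) (fun A' => fB A' A) xr xt; rewrite /= (addrC _ x) => h.
  apply: le_trans h _.
  have B2 : 0 <= K by apply: le_trans (normr_ge0 _) (fB A A x xr).
  rewrite ler_wpM2l ?mulr_ge0// normrZ; case/andP: t01 => t0 t1.
  by rewrite ger0_norm // ler_piMl.
have dline := is_derive_line (fs [::] _ (segment_ball xr vr t01)).
have dS : is_derive t 1 (fun t : R => t * S) S.
  have -> : (fun t : R => t * S) = S *: (id : R -> R).
    by apply/funext => y; rewrite !fctE mulrC.
  by apply: is_derive_eq; rewrite -[LHS]/(S * 1) mulr1.
exact: is_deriveB.
Qed.

Lemma quad_smooth_bd f x0 (r : R) B x v : smooth_bd f x0 r B -> ball x0 r x -> ball x0 r (v + x) ->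
  `|f (v + x) - f x - \sum_(A < m) v 0 A * partial A f x| <= m%:R ^+ 2 * B 2%N * `|v| ^+ 2.
Proof. by move=> [fs fB]; apply: smooth_on_quad => // A A' y; exact: (fB [:: A; A']). Qed.

Lemma cvg_norm_le {T : Type} (F : set_system T) {FF : ProperFilter F} (a : T -> R) (b K : R) :
  a i @[i --> F] --> b -> (\forall i \near F, `|a i| <= K) -> `|b| <= K.
Proof.
move=> ab aK; apply/ler_addgt0Pr => e e0.
move/cvgrPdist_le : ab => /(_ e e0) be.
have [i [bi ai]] := filter_ex (filterI be aK).
by rewrite -(subrK (a i) b) addrC (le_trans (ler_normD _ _))// lerD.
Qed.

Lemma cvg_sum_ord {T : Type} (F : set_system T) {FF : Filter F} n (a : 'I_n -> T -> R) (b : 'I_n -> R) :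
  (forall A, a A i @[i --> F] --> b A) ->
  \sum_(A < n) a A i @[i --> F] --> \sum_(A < n) b A.
Proof. by move=> H; apply: cvg_big => // ; exact: add_continuous. Qed.

Lemma ball_room x0 (r : R) x : ball x0 r x ->
  exists2 d : R, 0 < d & forall v, `|v| < d -> ball x0 r (v + x).
Proof.
move=> /ballE xr; exists (r - `|x - x0|); first by rewrite subr_gt0.
move=> v vd; apply/ballE; rewrite -addrA; apply: le_lt_trans (ler_normD _ _) _.
by rewrite -ltrBrDr.
Qed.

(** Pointwise convergence suffices: the uniform bound on second derivatives makes a difference
    quotient with a fixed step approximate the partials of all [f_ i] at once, so that these are
    Cauchy along F. *)
Lemma smooth_bd_lim_step {T : Type} (F : set_system T) {FF : ProperFilter F}
    (f_ : T -> 'rV[R]_m -> R) f x0 (r : R) B :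
  (\forall i \near F, smooth_bd (f_ i) x0 r B) ->
  (forall x, ball x0 r x -> f_ i x @[i --> F] --> f x) ->
  forall x, ball x0 r x -> differentiable f x /\
  forall A, partial A (f_ i) x @[i --> F] --> partial A f x.
Proof.
move=> fB ff x xr.
have [d d0 xd] := ball_room xr.
have [B2 B20 fB2] : exists2 K, 0 <= K & \forall i \near F, forall v, `|v| < d ->
    `|f_ i (v + x) - f_ i x - \sum_(A < m) v 0 A * partial A (f_ i) x| <= K * `|v| ^+ 2.
  exists (m%:R ^+ 2 * `|B 2%N|); first by rewrite mulr_ge0 // exprn_ge0.
  apply: filterS fB => i fi v vd; apply: le_trans (quad_smooth_bd fi xr (xd _ vd)) _.
  by rewrite ler_wpM2r // ler_wpM2l ?exprn_ge0// ler_norm.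
have dA A : cvg (partial A (f_ i) x @[i --> F]).
  apply/cauchy_cvgP/cauchy_exP => e e0.
  (* The step stays below d to remain in the ball and satisfies B2 t <= e / 2, which controls the
     quadratic remainder. *)
  pose t := Num.min (d / 2) (e / 2 / (B2 + 1)).
  have t0 : 0 < t by rewrite lt_min !divr_gt0// ltr_wpDl.
  have td : `|t *: (delta_mx 0 A : 'rV[R]_m)| < d.
    rewrite normrZ gtr0_norm//; apply: le_lt_trans (_ : t < d).
      by rewrite ler_piMr ?norm_delta_mx_le// ltW.
    by rewrite /t gt_min ltr_pdivrMr// mulr_natr mulr2n ltrDl d0.
  exists (t^-1 * (f (t *: delta_mx 0 A + x) - f x)).
  have q : t^-1 * (f_ i (t *: delta_mx 0 A + x) - f_ i x) @[i --> F] -->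
      t^-1 * (f (t *: delta_mx 0 A + x) - f x).
    apply: cvgM; first exact: cvg_cst.
    by apply: cvgB; apply: ff => //; exact: xd.
  have e20 : 0 < e / 2 by rewrite divr_gt0.
  move/cvgrPdist_lt : q => /(_ (e / 2) e20) q.
  apply: filterS (filterI q fB2) => i [qi /(_ _ td)].
  rewrite (bigD1 A) //= big1 ?addr0; last first.
    by move=> j jA; rewrite !mxE (negbTE jA) andbF mulr0 mul0r.
  rewrite !mxE !eqxx mulr1 => Hq; rewrite -ball_normE /ball_ /=.
  rewrite [e]splitr -(subrKA (t^-1 * (f_ i (t *: delta_mx 0 A + x) - f_ i x))).
  apply: le_lt_trans (ler_normD _ _) _; apply: ltr_leD => //.
  rewrite -(ler_pM2l t0) -{1}(gtr0_norm t0) -normrM mulrBr mulVKf ?gt_eqF//.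
  apply: le_trans Hq _; rewrite normrZ (gtr0_norm t0) exprMn.
  apply: le_trans (_ : B2 * t ^+ 2 <= _).
    rewrite ler_wpM2l // ler_piMr ?exprn_ge0 ?(ltW t0) // exprn_ile1 ?norm_delta_mx_le//.
  rewrite expr2 mulrCA ler_wpM2l ?ltW //.
  have : t <= e / 2 / (B2 + 1) by rewrite /t ge_min lexx orbT.
  rewrite ler_pdivlMr ?ltr_wpDl// mulrDr mulr1 (mulrC B2) => h.
  by apply: lt_le_trans h; rewrite ltrDl.
pose dd A := lim (partial A (f_ i) x @[i --> F]).
have [df pf] : differentiable f x /\ forall A, partial A f x = dd A.
  apply: (quad_differentiable (K := B2) d0) => v vd.
  apply: cvg_norm_le (_ : f_ i (v + x) - f_ i x - \sum_(A < m) v 0 A * partial A (f_ i) x @[i --> F] --> _) _.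
    apply: cvgB; first by apply: cvgB; apply: ff => //; exact: xd.
    apply: cvg_sum_ord => A; apply: cvgM; [exact: cvg_cst|exact: dA].
  by apply: filterS fB2 => i; exact.
by split => // A; rewrite pf; exact: dA.
Qed.

Lemma smooth_bd_lim {T : Type} (F : set_system T) {FF : ProperFilter F}
    (f_ : T -> 'rV[R]_m -> R) f x0 (r : R) B :
  (\forall i \near F, smooth_bd (f_ i) x0 r B) ->
  (forall x, ball x0 r x -> f_ i x @[i --> F] --> f x) ->
  smooth_bd f x0 r B /\
  forall l x, ball x0 r x -> pd l (f_ i) x @[i --> F] --> pd l f x.
Proof.
move=> fB ff.
have fBl l : \forall i \near F, smooth_bd (pd l (f_ i)) x0 r (fun j => B (j + size l)%N).
  by apply: filterS fB => i /(smooth_bd_pd l).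
have H l : forall x, ball x0 r x -> pd l (f_ i) x @[i --> F] --> pd l f x.
  elim: l => [|A l IH] x xr //=; first exact: ff.
  exact: (smooth_bd_lim_step (fBl l) IH xr).2.
split => //; split => l x xr.
  exact: (smooth_bd_lim_step (fBl l) (H l) xr).1.
apply: cvg_norm_le (H l x xr) _.
by apply: filterS fB => i {}fB; exact: fB.2.
Qed.

Lemma pd_lin f g (a : R) x0 (r : R) : smooth_on f x0 r -> smooth_on g x0 r ->
  smooth_on (a *: f + g) x0 r /\
  forall l x, ball x0 r x -> pd l (a *: f + g) x = a * pd l f x + pd l g x.
Proof.
move=> fs gs.
have H : forall l x, ball x0 r x -> pd l (a *: f + g) x = (a *: pd l f + pd l g) x.
  elim => [//|A l IH] x xr /=.
  have -> : partial A (pd l (a *: f + g)) x = partial A (a *: pd l f + pd l g) x.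
    by apply: near_eq_derive; apply: near_in_ball xr _.
  rewrite /partial deriveD; last 2 first.
  - by apply: derivableZ; apply: diff_derivable; exact: fs.
  - by apply: diff_derivable; exact: gs.
  by rewrite deriveZ //; apply: diff_derivable; exact: fs.
split => // l x xr.
apply: near_eq_differentiable (_ : differentiable (a *: pd l f + pd l g) x).
  by apply: near_in_ball xr _ => y yr; rewrite H.
by apply: differentiableD; [apply: differentiableZ; exact: fs | exact: gs].
Qed.

Lemma pd_cst (c : R) x0 (r : R) : smooth_on (cst c) x0 r /\
  forall l x, (0 < size l)%N -> pd l (cst c) x = 0.
Proof.
have H : forall l, pd l (cst c : 'rV[R]_m -> R) = cst (if l is [::] then c else 0).
  elim => [//|A l IH] /=; rewrite IH; apply/funext => x; exact: derive_cst.
split => [l x xr|[//|A l] x _]; rewrite H //; exact: differentiable_cst.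
Qed.

Lemma smooth_on_cst (c : R) x0 (r : R) : smooth_on (cst c) x0 r.
Proof. exact: (pd_cst c x0 r).1. Qed.

Lemma pd_scale f (a : R) x0 (r : R) : smooth_on f x0 r ->
  smooth_on (a *: f) x0 r /\
  forall l x, ball x0 r x -> pd l (a *: f) x = a * pd l f x.
Proof.
move=> fs; have [] := pd_lin a fs (@smooth_on_cst 0 x0 r).
have -> : a *: f + cst 0 = a *: f by apply/funext => x; rewrite !fctE addr0.
move=> h1 h2; split => // l x xr; rewrite h2 //; have := (pd_cst 0 x0 r).2 l x.
case: l => [_|A l ->] //; by rewrite addr0.
Qed.

Lemma pd_add f g x0 (r : R) : smooth_on f x0 r -> smooth_on g x0 r ->
  smooth_on (f + g) x0 r /\
  forall l x, ball x0 r x -> pd l (f + g) x = pd l f x + pd l g x.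
Proof.
move=> fs gs; have [] := pd_lin 1 fs gs; rewrite scale1r => h1 h2; split => // l x xr.
by rewrite h2 // mul1r.
Qed.

Lemma pd_sum (I : Type) (s : seq I) (P : pred I) (f : I -> 'rV[R]_m -> R) x0 (r : R) :
  (forall i, smooth_on (f i) x0 r) ->
  smooth_on (\sum_(i <- s | P i) f i) x0 r /\
  forall l x, ball x0 r x -> pd l (\sum_(i <- s | P i) f i) x = \sum_(i <- s | P i) pd l (f i) x.
Proof.
move=> fs; elim: s => [|i s [IH1 IH2]].
  rewrite big_nil; split; first exact: smooth_on_cst.
  by move=> [|A l] x xr; rewrite big_nil // (pd_cst 0 x0 r).2.
rewrite big_cons; case: ifP => Pi.
  have [h1 h2] := pd_add (fs i) IH1; split => // l x xr.
  by rewrite big_cons Pi h2 // IH2.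
by split => // l x xr; rewrite big_cons Pi IH2.
Qed.

Lemma laplacianE f : laplacian f = \sum_(A < m) pd [:: A; A] f.
Proof. by apply/funext => x; rewrite fct_sumE. Qed.

Lemma smooth_on_laplacian f x0 (r : R) : smooth_on f x0 r ->
  smooth_on (laplacian f) x0 r /\
  forall l x, ball x0 r x ->
    pd l (laplacian f) x = \sum_(A < m) pd (l ++ [:: A; A]) f x.
Proof.
move=> fs; rewrite laplacianE.
have [h1 h2] := pd_sum (index_enum _) xpredT (fun A : 'I_m => smooth_on_pd [:: A; A] fs).
by split => // l x xr; rewrite h2 //; apply: eq_bigr => A _; rewrite foldr_cat.
Qed.

Lemma laplacian_eq_ball f g x0 (r : R) :
  (forall y, ball x0 r y -> f y = g y) ->
  forall y, ball x0 r y -> laplacian f y = laplacian g y.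
Proof.
by move=> fg y yr; apply: eq_bigr => A _; apply: (@pd_eq_ball _ _ x0 r [:: A; A]).
Qed.

Lemma iter_laplacian_eq_ball k f g x0 (r : R) :
  (forall y, ball x0 r y -> f y = g y) ->
  forall y, ball x0 r y -> iter k laplacian f y = iter k laplacian g y.
Proof. by elim: k => [//|k IH] fg /=; apply: laplacian_eq_ball; exact: IH. Qed.

Lemma laplacian_lin f g (a : R) x0 (r : R) : smooth_on f x0 r -> smooth_on g x0 r ->
  forall x, ball x0 r x -> laplacian (a *: f + g) x = a * laplacian f x + laplacian g x.
Proof.
move=> fs gs x xr; rewrite /laplacian mulr_sumr -big_split /=; apply: eq_bigr => A _.
exact: ((pd_lin a fs gs).2 [:: A; A] x xr).
Qed.

Lemma laplacian_add f g x0 (r : R) : smooth_on f x0 r -> smooth_on g x0 r ->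
  forall x, ball x0 r x -> laplacian (f + g) x = laplacian f x + laplacian g x.
Proof. by move=> fs gs x xr; have := laplacian_lin 1 fs gs xr; rewrite scale1r mul1r. Qed.

Lemma laplacian_scale f (a : R) x0 (r : R) : smooth_on f x0 r ->
  forall x, ball x0 r x -> laplacian (a *: f) x = a * laplacian f x.
Proof.
move=> fs x xr; rewrite /laplacian mulr_sumr; apply: eq_bigr => A _.
exact: ((pd_scale a fs).2 [:: A; A] x xr).
Qed.

Lemma laplacian_cst0 : laplacian (cst 0 : 'rV[R]_m -> R) = cst 0.
Proof.
apply/funext => x; rewrite /laplacian big1 // => A _.
exact: (pd_cst 0 x 1).2 [:: A; A] x isT.
Qed.

Lemma smooth_on_iter_laplacian k f x0 (r : R) :
  smooth_on f x0 r -> smooth_on (iter k laplacian f) x0 r.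
Proof. by move=> fs; elim: k => [//|k IH] /=; exact: (smooth_on_laplacian IH).1. Qed.

Lemma smooth_bd_laplacian f x0 (r : R) B : smooth_bd f x0 r B ->
  smooth_bd (laplacian f) x0 r (fun j => m%:R * B j.+2).
Proof.
move=> [fs fB]; have [h1 h2] := smooth_on_laplacian fs; split => // l x xr.
rewrite h2 //; apply: le_trans (ler_norm_sum _ _ _) _.
apply: le_trans (_ : \sum_(A < m) B (size l).+2 <= _).
  by apply: ler_sum => A _; have := fB (l ++ [:: A; A]) x xr; rewrite size_cat addn2.
by rewrite sumr_const card_ord mulr_natl.
Qed.

Lemma smooth_bd_iter_laplacian k f x0 (r : R) B : smooth_bd f x0 r B ->
  smooth_bd (iter k laplacian f) x0 r (fun j => m%:R ^+ k * B (j + 2 * k)%N).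
Proof.
move=> fB; elim: k => [|k IH] /=.
  by rewrite (_ : (fun j => _) = B) //; apply/funext => j; rewrite mul1r addn0.
have := smooth_bd_laplacian IH; congr smooth_bd; apply/funext => j.
by rewrite exprS -mulrA !addSn mulnS !addnS.
Qed.

Lemma smooth_bdS f x0 (r r' : R) B B' : r' <= r -> (forall j, B j <= B' j) ->
  smooth_bd f x0 r B -> smooth_bd f x0 r' B'.
Proof.
move=> rr BB [fs fB]; split => l x xr.
  by apply: fs; exact: le_ball xr.
by apply: le_trans (BB _); apply: fB; exact: le_ball xr.
Qed.

Lemma smooth_bd_lin f g (a : R) x0 (r : R) B B' : smooth_bd f x0 r B -> smooth_bd g x0 r B' ->
  smooth_bd (a *: f + g) x0 r (fun j => `|a| * B j + B' j).
Proof.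
move=> [fs fB] [gs gB]; have [h1 h2] := pd_lin a fs gs; split => // l x xr.
rewrite h2 //; apply: le_trans (ler_normD _ _) _; apply: lerD; last exact: gB.
by rewrite normrM ler_wpM2l // fB.
Qed.

Lemma smooth_bd_eq f g x0 (r : R) B : (forall y, ball x0 r y -> f y = g y) ->
  smooth_bd f x0 r B -> smooth_bd g x0 r B.
Proof.
move=> fg [fs fB]; split => l x xr.
  apply: near_eq_differentiable (fs l x xr); apply: near_in_ball xr _.
  exact: pd_eq_ball.
by rewrite -(pd_eq_ball l fg) // fB.
Qed.

Lemma smooth_smooth_on f x0 (r : R) : smooth f -> smooth_on f x0 r.
Proof. by move=> fs l x _; exact: fs. Qed.

Lemma smooth_on_smooth f (r : R) : 0 < r -> (forall x0, smooth_on f x0 r) -> smooth f.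
Proof. by move=> r0 fs l x; apply: (fs x); exact: ballxx. Qed.

Lemma pd_translate f (y : 'rV[R]_m) l x :
  pd l (fun x => f (x - y)) x = pd l f (x - y).
Proof.
elim: l x => [//|A l IH] x /=; rewrite /partial.
have -> : pd l (fun x => f (x - y)) = (fun x => pd l f (x - y)) by exact/funext.
rewrite -/(partial A _ _) /partial.
have E : (fun h : R => h^-1 *: (((fun x => pd l f (x - y)) \o shift x) (h *: delta_mx 0 A) - pd l f (x - y)))
   = (fun h : R => h^-1 *: ((pd l f \o shift (x - y)) (h *: delta_mx 0 A) - pd l f (x - y))).
  by apply/funext => h /=; rewrite addrA.
by rewrite /derive E.
Qed.

End Basics.

(** * One-variable Taylor estimate and factorial bounds *)

Lemma is_derive_expf {R : realType} (k : nat) (t : R) :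
  is_derive t 1 (fun t : R => t ^+ k.+1 / k.+1`!%:R) (t ^+ k / k`!%:R).
Proof.
have -> : (fun t : R => t ^+ k.+1 / k.+1`!%:R) = (k.+1`!%:R^-1) *: (fun t : R => t ^+ k.+1).
  by apply/funext => s; rewrite !fctE mulrC.
have dX : is_derive t 1 (fun t : R => t ^+ k.+1) (k.+1%:R * t ^+ k).
  apply: DeriveDef; first exact: exprn_derivable.
  by rewrite exp_derive /= [LHS]mulr1.
have -> : t ^+ k / k`!%:R = k.+1`!%:R^-1 *: (k.+1%:R * t ^+ k).
  have k0 : k.+1%:R != 0 :> R by rewrite pnatr_eq0.
  have f0 : k`!%:R != 0 :> R by rewrite pnatr_eq0 -lt0n fact_gt0.
  by rewrite -[RHS]/(_ * _) factS natrM; field; rewrite nat1r k0 f0.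
exact: is_deriveZ.
Qed.

Lemma is_derive_taylor_sum {R : realType} (g : nat -> R) (N : nat) (t : R) :
  is_derive t 1 (fun t : R => \sum_(k < N.+1) g k * (t ^+ k / k`!%:R))
    (\sum_(k < N) g k.+1 * (t ^+ k / k`!%:R)).
Proof.
elim: N => [|N IH].
  rewrite big_ord0; have -> : (fun t : R => \sum_(k < 1) g k * (t ^+ k / k`!%:R)) = cst (g 0%N).
    by apply/funext => s; rewrite big_ord1 expr0 fact0 divr1 mulr1.
  exact: is_derive_cst.
have -> : (fun t : R => \sum_(k < N.+2) g k * (t ^+ k / k`!%:R)) =
   (fun t : R => \sum_(k < N.+1) g k * (t ^+ k / k`!%:R)) + g N.+1 *: (fun t : R => t ^+ N.+1 / N.+1`!%:R).
  by apply/funext => s; rewrite big_ord_recr.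
rewrite big_ord_recr /=; apply: is_deriveD; exact: is_deriveZ (is_derive_expf N t).
Qed.

(** The derivatives are given as a sequence g, each term differentiating to the next, so that
    derivatives along a segment can be inserted directly. *)
Lemma taylor_le {R : realType} (N : nat) (g : nat -> R -> R) (K : R) :
  (forall k (s : R), 0 <= s <= 1 -> is_derive s 1 (g k) (g k.+1 s)) ->
  (forall s : R, 0 <= s <= 1 -> `|g N s| <= K) ->
  forall t : R, 0 <= t <= 1 ->
  `|g 0%N t - \sum_(k < N) g k 0 * (t ^+ k / k`!%:R)| <= K * (t ^+ N / N`!%:R).
Proof.
elim: N g => [|N IH] g dg gK t t01.
  by rewrite big_ord0 subr0 expr0 fact0 divr1 mulr1; exact: gK.
have {}IH := IH (fun k => g k.+1) (fun k => dg k.+1) gK.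
pose p (s : R) := g 0%N s - \sum_(k < N.+1) g k 0 * (s ^+ k / k`!%:R).
pose p' (s : R) := g 1%N s - \sum_(k < N) g k.+1 0 * (s ^+ k / k`!%:R).
have dp (s : R) : 0 <= s <= 1 -> is_derive s 1 p (p' s).
  move=> s01; apply: is_deriveB; first exact: dg.
  exact: (is_derive_taylor_sum (fun k => g k 0)).
have p0 : p 0 = 0.
  rewrite /p big_ord_recl expr0 fact0 divr1 mulr1 big1 ?addr0 ?subrr // => k _.
  by rewrite exprS mul0r mul0r mulr0.
have K0 : 0 <= K by apply: le_trans (gK 0 _) => //; rewrite lexx ler01.
(* For either sign e, K s^(N+1) / (N+1)! - e p vanishes at 0 and has a nonnegative derivative by the
   induction hypothesis. *)
have mono (e : R) : e = 1 \/ e = -1 -> e * p t <= K * (t ^+ N.+1 / N.+1`!%:R).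
  move=> ee; pose q (s : R) := K * (s ^+ N.+1 / N.+1`!%:R) - e * p s.
  have dq (s : R) : 0 <= s <= 1 -> is_derive s 1 q (K * (s ^+ N / N`!%:R) - e * p' s).
    move=> s01; apply: (@is_deriveB _ _ _ (K *: (fun s : R => s ^+ N.+1 / N.+1`!%:R)) (e *: p)).
      exact: is_deriveZ (is_derive_expf N s).
    exact: is_deriveZ (dp s s01).
  case/andP: (t01) => t0 t1.
  have dq' (s : R) : s \in `]0, t[ -> 0 <= s <= 1.
    by rewrite in_itv /= => /andP[s0 st]; rewrite (ltW s0) /= ltW // (lt_le_trans st).
  have H : q 0 <= q t.
    apply: (@ger0_derive1_le_cc _ q 0 t); rewrite ?in_itv /= ?lexx ?t0 //.
    - by move=> s /dq' /dq [].
    - move=> s /dq' s01; rewrite derive1E; have [_ ->] := dq s s01; rewrite subr_ge0.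
      apply: le_trans (ler_norm _) _; rewrite normrM.
      have -> : `|e| = 1 by case: ee => ->; rewrite ?normrN normr1.
      by rewrite mul1r; exact: IH.
    - apply: derivable_within_continuous => s; rewrite in_itv /= => /andP[s0 st].
      by have [] := dq s; rewrite ?s0 //= (le_trans st).
  have q0 : q 0 = 0 by rewrite /q p0 mulr0 exprS !mul0r mulr0 subrr.
  by move: H; rewrite q0 /q subr_ge0.
rewrite ler_norml; apply/andP; split; last by have := mono 1 (or_introl erefl); rewrite mul1r.
by rewrite lerNl; have := mono (-1) (or_intror erefl); rewrite mulN1r.
Qed.

Lemma leq_bin_exp2 n k : ('C(n, k) <= 2 ^ n)%N.
Proof.
elim: n k => [|n IH] [|k]; rewrite ?bin0 ?bin0n ?expn_gt0 // binS expnS mul2n -addnn.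
exact: leq_add.
Qed.

(** A binomial coefficient is at most 2^(a + b). Splitting a factorial thus costs a geometric factor
    only, which the constant C of a Cauchy estimate absorbs. *)
Lemma leq_fact_add a b : ((a + b)`! <= 2 ^ (a + b) * (a`! * b`!))%N.
Proof.
have := bin_fact (leq_addr b a); rewrite addKn => <-.
by rewrite leq_mul2r leq_bin_exp2 orbT.
Qed.

(** * Power series and Cauchy estimates *)

Section Monomials.
Context {R : realType} {m : nat}.
Implicit Types (f : 'rV[R]_m -> R) (x : 'rV[R]_m) (b : 'I_m -> nat).

Definition monomial (x0 : 'rV[R]_m) (c : R) b : 'rV[R]_m -> R :=
  fun x => c * \prod_(i < m) (x 0 i - x0 0 i) ^+ b i.

Lemma differentiable_monomial x0 (c : R) b x : differentiable (monomial x0 c b) x.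
Proof.
have dprod (I : Type) (s : seq I) (F : I -> 'rV[R]_m -> R) : (forall i, differentiable (F i) x) ->
    differentiable (fun x => \prod_(i <- s) F i x) x.
  move=> dF; elim: s => [|i s IH].
    have -> : (fun x => \prod_(i <- [::]) F i x) = cst 1 by apply/funext => y; rewrite big_nil.
    exact: differentiable_cst.
  have -> : (fun x => \prod_(j <- i :: s) F j x) = F i \* (fun x => \prod_(j <- s) F j x).
    by apply/funext => y; rewrite big_cons.
  exact: differentiableM.
apply: differentiableM; first exact: differentiable_cst.
apply: dprod => i.
apply: (@differentiable_comp _ _ _ _ (fun x : 'rV[R]_m => x 0 i - x0 0 i) (fun t : R => t ^+ b i)); last first.
  by apply/derivable1_diffP; exact: exprn_derivable.
apply: differentiableB; first exact: differentiable_coord.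
exact: differentiable_cst.
Qed.

Lemma partial_monomial x0 (c : R) b (A : 'I_m) :
  partial A (monomial x0 c b) = monomial x0 (c * (b A)%:R) (fun i => b i - (i == A))%N.
Proof.
apply/funext => x.
have d0 := differentiable_monomial x0 c b (x + 0 *: delta_mx 0 A).
have [_] := is_derive_line d0.
rewrite (bigD1 A) //= big1 ?addr0; last by move=> i iA; rewrite mxE (negbTE iA) andbF mul0r.
rewrite mxE !eqxx mul1r scale0r addr0 => <-.
pose K := c * \prod_(i < m | i != A) (x 0 i - x0 0 i) ^+ b i.
have -> : (fun s : R => monomial x0 c b (x + s *: delta_mx 0 A)) =
    K *: (fun s : R => s ^+ b A) \o shift (x 0 A - x0 0 A).
  apply/funext => s; rewrite -[RHS]/(K * (s + (x 0 A - x0 0 A)) ^+ b A) /monomial (bigD1 A) //=.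
  rewrite mulrCA mulrC /K -!mulrA; congr (_ * _); congr (_ * _).
    by apply: eq_bigr => i iA; rewrite !mxE (negbTE iA) andbF mulr0 addr0.
  by rewrite !mxE !eqxx mulr1; congr (_ ^+ _); ring.
have dE : is_derive (shift (x 0 A - x0 0 A) 0) 1 (K *: (fun s : R => s ^+ b A))
    (K *: ((b A)%:R * (x 0 A - x0 0 A) ^+ (b A).-1)).
  apply: is_deriveZ; apply: DeriveDef; first exact: exprn_derivable.
  by rewrite exp_derive /= add0r [LHS]mulr1.
have [_ ->] := is_derive1_comp dE (is_derive_shift (0 : R) 1 (x 0 A - x0 0 A)).
rewrite mulr1 -[LHS]/(_ * _) /monomial [in RHS](bigD1 A) //= eqxx subn1.
have -> : \prod_(i < m | i != A) (x 0 i - x0 0 i) ^+ (b i - (i == A)) =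
    \prod_(i < m | i != A) (x 0 i - x0 0 i) ^+ b i.
  by apply: eq_bigr => i iA; rewrite (negbTE iA) subn0.
rewrite /K; ring.
Qed.

Lemma pd_monomial x0 (c : R) b l : exists (K : nat) (b' : 'I_m -> nat),
  [/\ pd l (monomial x0 c b) = monomial x0 (c * K%:R) b',
      (K <= (\sum_i b i) ^_ (size l))%N &
      (K != 0)%N -> (\sum_i b' i + size l = \sum_i b i)%N].
Proof.
elim: l => [|A l [K [b' [IH1 IH2 IH3]]]] /=.
  by exists 1%N, b; rewrite mulr1 ffactn0 addn0; split.
exists (K * b' A)%N, (fun i => b' i - (i == A))%N; rewrite IH1 partial_monomial; split.
- by rewrite natrM mulrA.
- have [->|K0] := eqVneq K 0%N; first by rewrite mul0n.
  by rewrite ffactnSr leq_mul // -(IH3 K0) addnK (bigD1 A) //= leq_addr.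
- rewrite muln_eq0 negb_or => /andP[K0 bA0]; rewrite -(IH3 K0) addnS -addSn; congr (_ + _)%N.
  rewrite (bigD1 A) // [in RHS](bigD1 A) //= eqxx subn1 -addSn prednK ?lt0n //; congr (_ + _)%N.
  by apply: eq_bigr => i iA; rewrite (negbTE iA) subn0.
Qed.

(** In degree d a derivative of order j brings down at most d (d - 1) ... (d - j + 1) <= 2^d j!, and
    halving the radius pays for 2^d. *)
Lemma monomial_bd x0 (c r : R) b : 0 < r ->
  smooth_bd (monomial x0 c b) x0 (r / 2)
    (fun j => `|c| * r ^+ (\sum_i b i) * ((2 / r) ^+ j * j`!%:R)).
Proof.
move=> r0; split=> l x xr.
  have [K [b' [-> _ _]]] := pd_monomial x0 c b l; exact: differentiable_monomial.
have [K [b' [-> K1 K2]]] := pd_monomial x0 c b l.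
rewrite /monomial !normrM -!mulrA ler_wpM2l //.
have [->|K0] := eqVneq K 0%N.
  by rewrite normr0 mul0r !mulr_ge0 ?exprn_ge0 ?divr_ge0 // ltW.
have {}K2 := K2 K0; rewrite normr_nat normr_prod.
apply: le_trans (_ : K%:R * (r / 2) ^+ (\sum_i b' i) <= _).
  rewrite ler_wpM2l // -prodrXr; apply: ler_prod => i _; rewrite normr_ge0 /= normrX.
  rewrite lerXn2r ?nnegrE ?divr_ge0 ?(ltW r0) //; move/ballE: xr => xr.
  by have := ler_coord_norm (x - x0) i; rewrite !mxE => h; exact: le_trans h (ltW xr).
set n := (\sum_i b i)%N in K1 K2 *; set j := size l in K1 K2 *.
apply: le_trans (_ : (2 ^+ n * j`!%:R) * (r / 2) ^+ (\sum_i b' i) <= _).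
  rewrite ler_wpM2r ?exprn_ge0 ?divr_ge0 ?(ltW r0) // -natrX -natrM ler_nat.
  by apply: leq_trans K1 _; rewrite -bin_ffact leq_mul2r leq_bin_exp2 orbT.
rewrite le_eqVlt; apply/orP; left; apply/eqP.
rewrite -K2 !exprD !exprMn !exprVn; field.
by rewrite !expf_neq0 ?gt_eqF.
Qed.

(** The growth of derivatives that characterises analytic functions; 1 / C plays the role of a
    radius of convergence. *)
Definition cauchy_bd (M C : R) : nat -> R := fun j => M * (C ^+ j * j`!%:R).

Let box N (b : {ffun 'I_m -> 'I_N}) : {ffun 'I_m -> nat} := [ffun i => val (b i)].

Lemma esum_box (a : {ffun 'I_m -> nat} -> R) (N : nat) :
  (forall b : {ffun 'I_m -> nat}, 0 <= a b) ->
  (\esum_(b in (@box N) @` setT) (a b)%:E =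
    (\sum_(b : {ffun 'I_m -> 'I_N}) a [ffun i => val (b i)])%:E)%E.
Proof.
move=> a0; have box_inj : set_inj setT (@box N).
  by move=> b1 b2 _ _ /ffunP eb; apply/ffunP => i; apply: val_inj; have := eb i; rewrite !ffunE.
rewrite esum_image // esum_fset; last by move=> i _; rewrite lee_fin.
  rewrite -sumEFin (@fsbigE _ _ _ _ _ (index_enum {ffun 'I_m -> 'I_N})) ?index_enum_uniq //.
    by apply: eq_big => // b; rewrite in_setT.
  by move=> b _; rewrite mem_index_enum.
exact: finite_finset.
Qed.

Lemma le_esum_subset (a : {ffun 'I_m -> nat} -> R) (X Y : set {ffun 'I_m -> nat}) :
  (forall b : {ffun 'I_m -> nat}, 0 <= a b) -> X `<=` Y ->
  (\esum_(b in X) (a b)%:E <= \esum_(b in Y) (a b)%:E)%E.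
Proof.
move=> a0 XY; rewrite esum_mkcond [leRHS]esum_mkcond; apply: le_esum => b _.
case: ifPn => [/set_mem/XY/mem_set -> //|_]; case: ifP => // _; by rewrite lee_fin.
Qed.

Lemma box_sum_le_esum (a : {ffun 'I_m -> nat} -> R) (N : nat) (M : R) :
  (forall b : {ffun 'I_m -> nat}, 0 <= a b) ->
  (\esum_(b in setT) (a b)%:E <= M%:E)%E ->
  \sum_(b : {ffun 'I_m -> 'I_N}) a [ffun i => val (b i)] <= M.
Proof.
move=> a0 aM; rewrite -lee_fin -esum_box //; apply: le_trans aM.
exact: le_esum_subset.
Qed.

(** Any finite set of multi-indices lies in a box, so the box sums control the unordered sum. *)
Lemma esum_le_box_sum (a : {ffun 'I_m -> nat} -> R) (M : R) :
  (forall b : {ffun 'I_m -> nat}, 0 <= a b) ->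
  (forall N, (0 < N)%N -> \sum_(b : {ffun 'I_m -> 'I_N}) a [ffun i => val (b i)] <= M) ->
  (\esum_(b in setT) (a b)%:E <= M%:E)%E.
Proof.
move=> a0 aM; apply: ge_ereal_sup => _ [X [finX _] <-].
have [N N0 XN] : exists2 N, (0 < N)%N & forall b : {ffun 'I_m -> nat}, X b -> forall i, (b i < N)%N.
  have /finite_seqP [t ->] := finX.
  exists (\max_(b <- t) \max_i (b : {ffun 'I_m -> nat}) i).+1 => // b Xb i; rewrite ltnS.
  have h : (\max_i b i <= \max_(b0 <- t) \max_i (b0 : {ffun 'I_m -> nat}) i)%N.
    have bt : b \in t by exact: Xb.
    by rewrite (big_rem b bt) /= leq_maxl.
  by apply: leq_trans h; exact: (@leq_bigmax_cond _ xpredT (fun i => b i)).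
rewrite -esum_fset // => [|b _]; last by rewrite lee_fin.
apply: le_trans (le_esum_subset (Y := (@box N) @` setT) a0 _) _.
  move=> b Xb; exists [ffun i => Ordinal (XN b Xb i)] => //.
  by apply/ffunP => i; rewrite !ffunE.
by rewrite esum_box // lee_fin; exact: aM.
Qed.

(** Each box partial sum obeys the bound term by term, with total weight at most M, and
    [smooth_bd_lim] passes to the limit. *)
Lemma powerseries_smooth_bd f x0 (r M : R) : 0 < r -> powerseries_le f x0 r M ->
  smooth_bd f x0 (r / 2) (cauchy_bd M (2 / r)).
Proof.
move=> r0 [c cM fE].
pose fN N := \sum_(b : {ffun 'I_m -> 'I_N}) monomial x0 (c [ffun i => val (b i)]) (fun i => b i).
apply: (@smooth_bd_lim _ _ _ \oo _ fN _ _ _ _ _ _).1; last first.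
  move=> x xr; have := fE x; have -> : (fun N => fN N x) =
      (fun N => \sum_(b : {ffun 'I_m -> 'I_N})
         c [ffun i => val (b i)] * \prod_(i < m) (x 0 i - x0 0 i) ^+ b i).
    by apply/funext => N; rewrite /fN fct_sumE.
  by apply; apply: le_ball xr; rewrite ler_pdivrMr // mulr_natr mulr2n lerDl ltW.
apply: nearW => N.
pose g (b : {ffun 'I_m -> 'I_N}) := monomial x0 (c [ffun i => val (b i)]) (fun i => b i).
have gB (b : {ffun 'I_m -> 'I_N}) := monomial_bd x0 (c [ffun i => val (b i)]) (fun i : 'I_m => b i : nat) r0.
have [h1 h2] := pd_sum (index_enum _) xpredT (fun b : {ffun 'I_m -> 'I_N} => (gB b).1).
split => // l x xr; rewrite h2 //; apply: le_trans (ler_norm_sum _ _ _) _.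
apply: le_trans; first by apply: ler_sum => b _; exact: (gB b).2 l x xr.
rewrite -mulr_suml /cauchy_bd ler_wpM2r ?mulr_ge0 ?exprn_ge0 ?divr_ge0 ?(ltW r0) //.
have := @box_sum_le_esum (fun b : {ffun 'I_m -> nat} => `|c b| * r ^+ (\sum_(i < m) b i)) N M.
have E : \sum_(b : {ffun 'I_m -> 'I_N}) `|c [ffun i => val (b i)]| * r ^+ (\sum_(i < m) ([ffun i => val (b i)] : {ffun 'I_m -> nat}) i) =
    \sum_(b : {ffun 'I_m -> 'I_N}) `|c [ffun i => val (b i)]| * r ^+ (\sum_(i < m) b i).
  apply: eq_bigr => b _; congr (_ * _ ^+ _); apply: eq_bigr => i _; by rewrite ffunE.
rewrite E; apply => // b; by rewrite mulr_ge0 ?exprn_ge0 // ltW.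
Qed.

End Monomials.

Lemma leq_fact_sum (I : Type) (s : seq I) (b : I -> nat) :
  ((\sum_(i <- s) b i)`! <= 2 ^ (size s * \sum_(i <- s) b i) * \prod_(i <- s) (b i)`!)%N.
Proof.
elim: s => [|A s IH]; first by rewrite !big_nil.
rewrite !big_cons; apply: leq_trans (leq_fact_add _ _) _.
apply: leq_trans (leq_mul (leqnn _) (leq_mul (leqnn _) IH)) _.
rewrite (mulnCA (_`!)) !mulnA -expnD leq_mul2r leq_mul2r leq_exp2l //.
rewrite (_ : (_ <= _ * _)%N) ?orbT //= mulSn leq_add2l leq_mul2l leq_addl orbT.
by [].
Qed.

(** * Multivariate Taylor expansion, one coordinate at a time *)

Section Taylor.
Context {R : realType} {m : nat}.
Variables (f : 'rV[R]_m -> R) (x0 : 'rV[R]_m) (r M C e : R) (N : nat).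
Hypotheses (fB : smooth_bd f x0 r (cauchy_bd M C)) (N0 : (0 < N)%N).
Hypotheses (M0 : 0 <= M) (C0 : 0 <= C) (e0 : 0 <= e).
(** Weight of one order of the expansion at distance e: C e comes from the Cauchy estimate, 2^m from
    splitting the factorial of a multi-index over its m entries, and one more 2 from splitting off
    N!. *)
Let q := 2 ^+ m.+1 * C * e.
Hypothesis q2 : q <= 2^-1.
Implicit Types (x : 'rV[R]_m) (s : seq 'I_m) (b : {ffun 'I_m -> 'I_N}).

Definition multi_list s (b : 'I_m -> nat) := flatten [seq nseq (b i) i | i <- s].

Let nb b : 'I_m -> nat := fun i => b i.

Let repl s x : 'rV[R]_m := \row_i (if i \in s then x0 0 i else x 0 i).

Let supp s b := [forall i, (i \notin s) ==> (b i == 0 :> nat)].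

Let W x b : R := \prod_i ((x 0 i - x0 0 i) ^+ b i / (b i)`!%:R).

(** The expansion in the coordinates of s only: exponents vanish outside s, and the derivatives are
    taken where the coordinates of s are frozen at those of x0. It interpolates between f x, for s
    empty, and the Taylor polynomial at x0. *)
Let S s x := \sum_(b | supp s b) W x b * pd (multi_list s (nb b)) f (repl s x).

Lemma size_multi_list s (b : 'I_m -> nat) : size (multi_list s b) = (\sum_(i <- s) b i)%N.
Proof.
rewrite /multi_list; elim: s => [|A s IH]; first by rewrite big_nil.
by rewrite /= size_cat size_nseq IH big_cons.
Qed.

(** The sum factors into m geometric sums, each at most 2 because q <= 1/2. *)
Lemma geometric_box_sum : \sum_(b : {ffun 'I_m -> 'I_N}) q ^+ (\sum_i b i) <= 2 ^+ m.
Proof.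
have q0 : 0 <= q by rewrite !mulr_ge0 // exprn_ge0.
under eq_bigr do rewrite -prodrXr.
rewrite -(bigA_distr_bigA (fun (i : 'I_m) (j : 'I_N) => q ^+ j)) /=.
rewrite -[X in 2 ^+ X]card_ord -prodr_const; apply: ler_prod => i _.
rewrite sumr_ge0 => [|j _]; last by rewrite exprn_ge0.
rewrite /= -(ler_pM2l (_ : 0 < 1 - q)); last by rewrite subr_gt0 (le_lt_trans q2) // invf_lt1 ?ltr1n.
apply: le_trans (_ : 1 <= _).
  by have := subrX1 q N; have := exprn_ge0 N q0; lra.
by move: q2; lra.
Qed.

Lemma sum_supp s b : uniq s -> supp s b -> (\sum_i b i = \sum_(i <- s) b i)%N.
Proof.
rewrite /supp => us /forallP bs; rewrite [RHS]big_uniq //= (bigID (fun i => i \in s) xpredT) /= addnC big1 ?add0n //.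
by move=> i is_; apply/eqP; have := bs i; rewrite is_.
Qed.

Lemma repl_norm s x : `|x - x0| <= e -> `|repl s x - x0| <= e.
Proof.
move=> xe; apply: rV_norm_le => // i; rewrite !mxE; case: ifP => _; first by rewrite subrr normr0.
by apply: le_trans xe; have := ler_coord_norm (x - x0) i; rewrite !mxE.
Qed.

(** The one-variable Taylor formula of order N in direction A, started at the point whose coordinate
    A is frozen. The two factors of q collect the N new derivatives and those already present in
    b. *)
Lemma taylor_coord s x (A : 'I_m) b : e < r -> `|x - x0| <= e -> uniq (A :: s) -> supp s b ->
  `|W x b * pd (multi_list s (nb b)) f (repl s x) -
    \sum_(j < N) W x b * ((x 0 A - x0 0 A) ^+ j / j`!%:R) * pd (nseq j A ++ multi_list s (nb b)) f (repl (A :: s) x)|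
  <= M * q ^+ N * q ^+ (\sum_i b i).
Proof.
move=> er xe /= /andP[As us] bs.
under eq_bigr do rewrite -mulrA.
rewrite -mulr_sumr -mulrBr normrM.
pose G := pd (multi_list s (nb b)) f; pose y := repl s x; pose y' := repl (A :: s) x.
pose v := x 0 A - x0 0 A.
have yE : y = v *: delta_mx 0 A + y'.
  apply/rowP => i; rewrite !mxE eqxx inE; have [->|iA] /= := eqVneq i A.
    by rewrite (negbTE As) mulr1 /v subrK.
  by rewrite mulr0 add0r.
have yr : ball x0 r y by apply/ballE; apply: le_lt_trans er; exact: repl_norm.
have y'r : ball x0 r y' by apply/ballE; apply: le_lt_trans er; exact: repl_norm.
pose g k (t : R) := v ^+ k * pd (nseq k A) G (y' + t *: (v *: delta_mx 0 A)).
have yt (t : R) : 0 <= t <= 1 -> ball x0 r (y' + t *: (v *: delta_mx 0 A)).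
  by apply: segment_ball => //; rewrite -yE.
have ve : `|v| <= e by apply: le_trans xe; have := ler_coord_norm (x - x0) A; rewrite !mxE.
have := @taylor_le R N g (e ^+ N * cauchy_bd M C (N + size (multi_list s (nb b)))).
have -> : g 0%N = fun t => G (y' + t *: (v *: delta_mx 0 A)).
  by apply/funext => t; rewrite /g expr0 mul1r.
move=> /(_ _ _ 1); rewrite scale1r (addrC y') -yE => H.
have {}H : `|G y - \sum_(j < N) v ^+ j / j`!%:R * pd (nseq j A ++ multi_list s (nb b)) f y'| <=
    e ^+ N * cauchy_bd M C (N + size (multi_list s (nb b))) * (1 ^+ N / N`!%:R).
  have -> : \sum_(j < N) v ^+ j / j`!%:R * pd (nseq j A ++ multi_list s (nb b)) f y' =
      \sum_(k < N) g k 0 * (1 ^+ k / k`!%:R).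
    apply: eq_bigr => j _; rewrite /g scale0r addr0 expr1n mul1r foldr_cat mulrAC //.
  apply: H; last by rewrite ler01 lexx.
    move=> k t t01.
    have d := fB.1 (nseq k A ++ multi_list s (nb b)) _ (yt t t01).
    rewrite foldr_cat in d.
    have := is_derive_line d; rewrite (bigD1 A) //= big1 ?addr0; last first.
      by move=> i iA; rewrite !mxE (negbTE iA) andbF !mulr0 mul0r.
    rewrite !mxE !eqxx mulr1 => dl.
    have -> : g k = v ^+ k *: (fun t => pd (nseq k A) G (y' + t *: (v *: delta_mx 0 A))) by [].
    rewrite /g exprS mulrAC mulrC mulrA [X in is_derive _ _ _ X](_ : _ =  v ^+ k *: (v * partial A (pd (nseq k A) G) (y' + t *: (v *: delta_mx 0 A)))).
      exact: is_deriveZ.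
    by rewrite -[RHS]/(_ * _) /=; ring.
  move=> t t01; rewrite normrM normrX; apply: ler_pM => //.
    by apply: lerXn2r => //; rewrite nnegrE.
  have := fB.2 (nseq N A ++ multi_list s (nb b)) _ (yt t t01).
  by rewrite size_cat size_nseq foldr_cat.
apply: le_trans (ler_wpM2l (normr_ge0 _) H) _.
rewrite expr1n mul1r size_multi_list; set B := (\sum_i b i)%N.
rewrite (_ : (\sum_(i <- s) nb b i)%N = B); last by rewrite /B (sum_supp us bs).
have W_le : `|W x b| <= e ^+ B / (\prod_i (b i)`!)%:R.
  rewrite /W normr_prod natr_prod -prodfV /B -prodrXr -big_split /=.
  apply: ler_prod => i _; rewrite normr_ge0 /= normrM normrX normfV normr_nat.
  rewrite ler_wpM2r ?invr_ge0 // lerXn2r ?nnegrE //.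
  by apply: le_trans xe; have := ler_coord_norm (x - x0) i; rewrite !mxE.
have fact_le : ((N + B)`!%:R : R) <= 2 ^+ (m.+1 * (N + B)) * (N`!%:R * (\prod_i (b i)`!)%:R).
  rewrite -natrX -!natrM ler_nat; apply: leq_trans (leq_fact_add _ _) _.
  have h := leq_fact_sum (index_enum 'I_m) (fun i => b i : nat).
  rewrite -/B in h; apply: leq_trans (leq_mul (leqnn _) (leq_mul (leqnn _) h)) _.
  rewrite (mulnCA (N`!)) !mulnA -expnD -!mulnA leq_mul2r leq_exp2l //.
  rewrite (_ : size _ = m) ?mulSn; first by rewrite leq_add2l leq_mul2l leq_addl !orbT.
  by rewrite -sum1_size sum1_card card_ord.
have P0 : 0 < (\prod_i (b i)`!)%:R :> R.
  by rewrite ltr0n prodn_gt0 // => i; rewrite fact_gt0.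
have NF0 : 0 < N`!%:R :> R by rewrite ltr0n fact_gt0.
apply: le_trans (_ : (e ^+ B / (\prod_i (b i)`!)%:R) * (e ^+ N * cauchy_bd M C (N + B) / N`!%:R) <= _).
  rewrite ler_wpM2r // !mulr_ge0 ?invr_ge0 ?exprn_ge0 //.
rewrite /cauchy_bd /q.
have -> : e ^+ B / (\prod_i (b i)`!)%:R * (e ^+ N * (M * (C ^+ (N + B) * (N + B)`!%:R)) / N`!%:R) =
   M * (C ^+ (N + B) * e ^+ (N + B)) * ((N + B)`!%:R / (N`!%:R * (\prod_i (b i)`!)%:R)).
  by rewrite !exprD; field; rewrite !gt_eqF.
have -> : M * (2 ^+ m.+1 * C * e) ^+ N * (2 ^+ m.+1 * C * e) ^+ B =
   M * (C ^+ (N + B) * e ^+ (N + B)) * 2 ^+ (m.+1 * (N + B)).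
  rewrite -mulrA -exprD !exprMn -exprM; ring.
rewrite ler_wpM2l ?mulr_ge0 ?exprn_ge0 // ler_pdivrMr ?mulr_gt0 //.
Qed.

(** A multi-index supported on A :: s amounts to one supported on s together with the exponent of A;
    [N0] provides the zero exponent that is put back at A. *)
Lemma box_sum_cons s x (A : 'I_m) : A \notin s ->
  S (A :: s) x = \sum_(b | supp s b) \sum_(j < N)
    W x b * ((x 0 A - x0 0 A) ^+ j / j`!%:R) * pd (nseq j A ++ multi_list s (nb b)) f (repl (A :: s) x).
Proof.
move=> As; rewrite pair_big /=.
pose h (p : {ffun 'I_m -> 'I_N} * 'I_N) := [ffun i => if i == A then p.2 else p.1 i].
pose h' b := ([ffun i => if i == A then Ordinal N0 else b i], b A).
rewrite /S (reindex_onto h h') /=; last first.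
  move=> b _; apply/ffunP => i; rewrite !ffunE /=.
  by have [->|iA] := eqVneq i A; rewrite ?ffunE ?(negbTE iA).
have condE p : supp (A :: s) (h p) && (h' (h p) == p) = supp s p.1 && true.
  rewrite andbT; case: p => b j /=; apply/andP/forallP => [[/forallP h1 /eqP h2] i|h1].
    apply/implyP => is_; have [->|iA] := eqVneq i A.
      by have := congr1 (fun p : {ffun 'I_m -> 'I_N} * 'I_N => p.1 A : nat) h2; rewrite /= ffunE eqxx => <-.
    by have := h1 i; rewrite inE (negbTE iA) /= ffunE (negbTE iA) /= is_.
  split.
    apply/forallP => i; rewrite inE negb_or ffunE; apply/implyP => /andP[iA is_].
    by rewrite (negbTE iA) /=; have := h1 i; rewrite is_.
  apply/eqP; congr (_, _); last by rewrite ffunE eqxx.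
  apply/ffunP => i; rewrite !ffunE; have [->|//] := eqVneq i A.
  by apply: val_inj => /=; have := h1 A; rewrite As => /eqP ->.
apply: eq_big => // p; rewrite condE andbT => /forallP sp.
have pA : p.1 A = 0%N :> nat by have := sp A; rewrite As => /eqP.
congr (_ * _).
  rewrite /W (bigD1 A) //= [in RHS](bigD1 A) //= !ffunE eqxx pA expr0 fact0 divr1 mul1r mulrC.
  by congr (_ * _); apply: eq_bigr => i iA; rewrite !ffunE (negbTE iA).
congr (pd _ f _); rewrite /multi_list /= {1}/nb ffunE eqxx; congr (_ ++ flatten _).
apply/eq_in_map => i is_; rewrite /nb ffunE.
by have [iA|//] := eqVneq i A; move: As; rewrite -iA is_.
Qed.

Lemma box_sum_step s x (A : 'I_m) : e < r -> `|x - x0| <= e -> uniq (A :: s) ->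
  `|S s x - S (A :: s) x| <= M * q ^+ N * 2 ^+ m.
Proof.
move=> er xe us; have /andP[As _] := us; rewrite box_sum_cons // /S -sumrB.
apply: le_trans (ler_norm_sum _ _ _) _.
apply: le_trans (_ : \sum_(b | supp s b) M * q ^+ N * q ^+ (\sum_i b i) <= _).
  by apply: ler_sum => b bs; apply: taylor_coord.
have q0 : 0 <= q by rewrite !mulr_ge0 // exprn_ge0.
have MN : 0 <= M * q ^+ N by rewrite mulr_ge0 // exprn_ge0.
apply: le_trans (_ : M * q ^+ N * \sum_(b : {ffun 'I_m -> 'I_N}) q ^+ (\sum_i b i) <= _).
  rewrite mulr_sumr [leRHS](bigID (fun b => supp s b)) /= lerDl sumr_ge0 // => b _.
  by rewrite mulr_ge0 // exprn_ge0.
by rewrite ler_wpM2l // geometric_box_sum.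
Qed.

Lemma box_sum_total x : e < r -> `|x - x0| <= e ->
  `|f x - \sum_(b : {ffun 'I_m -> 'I_N}) (pd (multi_list (enum 'I_m) (nb b)) f x0 / \prod_i (b i)`!%:R)
      * \prod_i (x 0 i - x0 0 i) ^+ b i| <= m%:R * (M * q ^+ N * 2 ^+ m).
Proof.
move=> er xe.
have H s : uniq s -> `|f x - S s x| <= (size s)%:R * (M * q ^+ N * 2 ^+ m).
  elim: s => [_|A s IH us].
    rewrite /S (bigD1 [ffun=> Ordinal N0]) /=; last by apply/forallP => i; rewrite ffunE eqxx implybT.
    rewrite big1 ?addr0 => [|b /andP[/forallP sb]]; last first.
      by rewrite (_ : b = [ffun=> Ordinal N0]) ?eqxx //; apply/ffunP => i; apply: val_inj;
         rewrite ffunE; have /eqP := sb i.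
    rewrite /W big1 ?mul1r => [|i _]; last by rewrite ffunE /= expr0 fact0 divr1.
    rewrite (_ : repl [::] x = x); last by apply/rowP => i; rewrite mxE in_nil.
    by rewrite subrr normr0 mul0r.
  have us' : uniq s by case/andP: us.
  rewrite -(subrKA (S s x)) /= -natr1 mulrDl mul1r; apply: le_trans (ler_normD _ _) _.
  by apply: lerD; [exact: IH | exact: box_sum_step].
have := H (enum 'I_m) (enum_uniq _); rewrite size_enum_ord; congr (`|_ - _| <= _).
apply: eq_big => [b|b _].
  by apply/forallP => i; rewrite mem_enum.
rewrite (_ : repl _ x = x0); last by apply/rowP => i; rewrite mxE mem_enum.
by rewrite /W big_split /= prodfV mulrC mulrA mulrAC.
Qed.

End Taylor.

(** The radius and the bound are chosen before f, since [solution] asks for a single pair valid for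
    all small rho. *)
Lemma cauchy_powerseries {R : realType} {m : nat} (r M C : R) : 0 < r -> 0 <= M -> 0 <= C ->
  exists r' M' : R, 0 < r' /\ forall (f : 'rV[R]_m -> R) x0, smooth_bd f x0 r (cauchy_bd M C) ->
    powerseries_le f x0 r' M'.
Proof.
move=> r0 M0 C0.
(* This radius is below r and makes q = 2^(m+1) C r' at most 1/2; C + 1 avoids a division by 0. *)
pose r' := Num.min (r / 2) ((2 ^+ m.+2 * (C + 1))^-1).
have D0 : 0 < 2 ^+ m.+2 * (C + 1) by rewrite mulr_gt0 ?exprn_gt0 // ltr_wpDl.
have r'0 : 0 < r' by rewrite lt_min divr_gt0 // invr_gt0.
have r'r : r' < r by rewrite /r' gt_min ltr_pdivrMr // mulr_natr mulr2n ltrDl r0.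
have q2 : 2 ^+ m.+1 * C * r' <= 2^-1.
  apply: le_trans (_ : 2 ^+ m.+1 * (C + 1) * r' <= _).
    by rewrite ler_wpM2r ?(ltW r'0) // ler_wpM2l ?exprn_ge0 // lerDl.
  have : r' <= (2 ^+ m.+2 * (C + 1))^-1 by rewrite /r' ge_min lexx orbT.
  have E0 : 0 < 2 ^+ m.+1 * (C + 1) by rewrite mulr_gt0 ?exprn_gt0 // ltr_wpDl.
  move=> /(ler_wpM2l (ltW E0)) h; apply: le_trans h _.
  by rewrite [2 ^+ m.+2]exprS -mulrA [in X in _ * X]invfM mulrCA divff ?mulr1 // gt_eqF.
exists r', (M * 2 ^+ m); split => // f x0 fB.
pose c (b : {ffun 'I_m -> nat}) := pd (multi_list (enum 'I_m) b) f x0 / \prod_i (b i)`!%:R.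
have q0 : 0 <= 2 ^+ m.+1 * C * r' by rewrite !mulr_ge0 ?exprn_ge0 // ltW.
exists c.
  apply: esum_le_box_sum => [b|N N0]; first by rewrite mulr_ge0 ?exprn_ge0 // ltW.
  apply: le_trans (_ : \sum_(b : {ffun 'I_m -> 'I_N}) M * (2 ^+ m.+1 * C * r') ^+ (\sum_i b i) <= _); last first.
    by rewrite -mulr_sumr ler_wpM2l // geometric_box_sum // ltW.
  apply: ler_sum => b _; rewrite (_ : (\sum_i _ i)%N = (\sum_i b i)%N); last first.
    by apply: eq_bigr => i _; rewrite ffunE.
  set B := (\sum_i b i)%N; rewrite exprMn mulrA ler_wpM2r ?exprn_ge0 ?(ltW r'0) //.
  rewrite /c normrM normfV.
  have -> : (\prod_(i < m) (([ffun i0 => val (b i0)] : {ffun 'I_m -> nat}) i)`!%:R : R) = (\prod_(i < m) (b i)`!)%:R.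
    by rewrite natr_prod; apply: eq_bigr => i _; rewrite ffunE.
  have P0 : 0 < (\prod_(i < m) (b i)`!)%:R :> R by rewrite ltr0n prodn_gt0 // => i; rewrite fact_gt0.
  rewrite (gtr0_norm P0) ler_pdivrMr //.
  apply: le_trans (fB.2 _ _ (ballxx _ r0)) _; rewrite /cauchy_bd size_multi_list.
  have -> : (\sum_(i <- enum 'I_m) ([ffun i0 => val (b i0)] : {ffun 'I_m -> nat}) i = B)%N.
    by rewrite big_enum /=; apply: eq_bigr => i _; rewrite ffunE.
  have fact_le : (B`!%:R : R) <= 2 ^+ (m.+1 * B) * (\prod_i (b i)`!)%:R.
    rewrite -natrX -natrM ler_nat.
    apply: leq_trans (leq_fact_sum (index_enum 'I_m) (fun i => b i : nat)) _.
    rewrite -/B leq_mul2r leq_exp2l // leq_mul2r -sum1_size sum1_card card_ord leqnSn !orbT //.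
  by rewrite -[leRHS]mulrA ler_wpM2l // exprMn -exprM mulrAC [leLHS]mulrC ler_wpM2r ?exprn_ge0.
move=> x /ballE xr'.
have xr'' := ltW xr'.
apply/cvgrPdist_le => e e0.
have K0 : 0 <= m%:R * M * 2 ^+ m by rewrite !mulr_ge0 // exprn_ge0.
have q1 : `|2 ^+ m.+1 * C * r'| < 1 by rewrite ger0_norm // (le_lt_trans q2) // invf_lt1 // ltr1n.
have /cvgrPdist_le/(_ (e / (m%:R * M * 2 ^+ m + 1))) := cvg_expr q1.
have /[swap]/[apply] : 0 < e / (m%:R * M * 2 ^+ m + 1) by rewrite divr_gt0 // ltr_wpDl.
move=> He; near=> N.
have N0 : (0 < N)%N by near: N; exact: nbhs_infty_gt.
have := @box_sum_total _ _ f x0 r M C r' N fB N0 M0 C0 (ltW r'0) q2 x r'r xr''.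
have -> : \sum_(b : {ffun 'I_m -> 'I_N}) (pd (multi_list (enum 'I_m) (fun i => b i : nat)) f x0 / \prod_i (b i)`!%:R)
      * \prod_i (x 0 i - x0 0 i) ^+ b i =
   \sum_(b : {ffun 'I_m -> 'I_N})
       c [ffun i => val (b i)] * \prod_(i < m) (x 0 i - x0 0 i) ^+ b i.
  apply: eq_bigr => b _; congr (_ * _); rewrite /c; congr (pd _ f x0 / _).
    by congr flatten; apply: eq_map => i; rewrite ffunE.
  by apply: eq_bigr => i _; rewrite ffunE.
move=> h; apply: le_trans h _.
have : `|0 - (2 ^+ m.+1 * C * r') ^+ N| <= e / (m%:R * M * 2 ^+ m + 1) by near: N.
rewrite sub0r normrN ger0_norm ?exprn_ge0 // ler_pdivlMr ?ltr_wpDl // => h.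
apply: le_trans h; rewrite mulrDr mulr1 -[leLHS]addr0; apply: lerD; last by rewrite exprn_ge0.
by rewrite le_eqVlt; apply/orP; left; apply/eqP; ring.
Unshelve. all: by end_near. Qed.

(** * Comparison for the radial operator *)

Section EulerOperator.
Context {R : realType}.
Variable n : nat.
Hypothesis n2 : (2 <= n)%N.
Implicit Types (g c w psi : R -> R) (t T a b : R).

Local Notation nu := (n%:R / 2 : R).
Local Notation z := (fun t : R => t `^ nu).

Definition euler_op g t : R := 2 * t * derive1 (derive1 g) t + (2 - n%:R) * (derive1 g) t.

Definition twice g t : Prop := derivable g t 1 /\ derivable (derive1 g) t 1.

Lemma gt0_powRD a b t : 0 < t -> t `^ (a + b) = t `^ a * t `^ b.
Proof. by move=> t0; rewrite powRD // (gt_eqF t0) implybT. Qed.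

Lemma gt0_powRB1 a t : 0 < t -> t `^ a = t * t `^ (a - 1).
Proof.
by move=> t0; have := gt0_powRD 1 (a - 1) t0; rewrite addrC subrK powRr1 ?ltW.
Qed.

Lemma near_gt0 t : 0 < t -> \forall s \near t, 0 < s.
Proof. by move=> t0; exact: lt_nbhsr. Qed.

Lemma near_in_oo t T : 0 < t < T -> \forall s \near t, 0 < s < T.
Proof.
move=> /andP[t0 tT]; near=> s; apply/andP; split; near: s; [exact: lt_nbhsr|exact: lt_nbhsl].
Unshelve. all: by end_near. Qed.

Lemma euler_powR a t : 0 < t ->
  twice (fun t => t `^ a) t /\ euler_op (fun t => t `^ a) t = a * (2 * a - n%:R) * t `^ (a - 1).
Proof.
move=> t0; have d1 (s : R) : 0 < s -> (derive1 (fun t => t `^ a)) s = a * s `^ (a - 1).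
  by move=> s0; rewrite derive1E; have [_] := is_derive1_powR a s0.
have d2 : is_derive t 1 (derive1 (fun t => t `^ a)) (a * ((a - 1) * t `^ (a - 1 - 1))).
  have h : is_derive t 1 (a *: (fun s : R => s `^ (a - 1))) (a *: ((a - 1) * t `^ (a - 1 - 1))).
    by apply: is_deriveZ; exact: is_derive1_powR.
  apply: near_eq_is_derive h.
  by near=> s; rewrite d1 //; near: s; exact: near_gt0.
have [e1 e2] := d2; split.
  split; last exact: e1.
  by have [] := is_derive1_powR a t0.
rewrite /euler_op d1 // derive1E e2.
rewrite (gt0_powRB1 (a - 1) t0).
by ring.
Unshelve. all: by end_near. Qed.

Lemma twice_lin g psi (k : R) t T : 0 < t < T ->
  (forall s, 0 < s < T -> twice g s) -> (forall s, 0 < s < T -> twice psi s) ->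
  twice (fun s => g s + k * psi s) t /\
  euler_op (fun s => g s + k * psi s) t = euler_op g t + k * euler_op psi t.
Proof.
move=> tT gT pT.
have d1 (s : R) : 0 < s < T -> is_derive s 1 (fun s => g s + k * psi s) ((derive1 g) s + k * (derive1 psi) s).
  move=> sT; rewrite !derive1E.
  have h1 : is_derive s 1 g ('D_1 g s) by apply: derivableP; exact: (gT s sT).1.
  have h2 : is_derive s 1 psi ('D_1 psi s) by apply: derivableP; exact: (pT s sT).1.
  exact: (is_deriveD h1 (is_deriveZ k h2)).
have d1' (s : R) : 0 < s < T -> (derive1 (fun s => g s + k * psi s)) s = (derive1 g) s + k * (derive1 psi) s.
  by move=> sT; rewrite derive1E; have [_] := d1 s sT.
have d2 : is_derive t 1 (derive1 (fun s => g s + k * psi s)) ((derive1 (derive1 g)) t + k * (derive1 (derive1 psi)) t).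
  have h : is_derive t 1 ((derive1 g) + k *: (derive1 psi)) ((derive1 (derive1 g)) t + k * (derive1 (derive1 psi)) t).
    rewrite ![derive1 (derive1 _) t]derive1E.
    have h1 : is_derive t 1 (derive1 g) ('D_1 (derive1 g) t) by apply: derivableP; exact: (gT t tT).2.
    have h2 : is_derive t 1 (derive1 psi) ('D_1 (derive1 psi) t) by apply: derivableP; exact: (pT t tT).2.
    exact: (is_deriveD h1 (is_deriveZ k h2)).
  apply: near_eq_is_derive h.
  by near=> s; rewrite d1' //; near: s; exact: near_in_oo.
have [e1 e2] := d2; split.
  split; last exact: e1.
  by have [] := d1 t tT.
rewrite /euler_op d1' // derive1E e2.
by move: (derive1 (derive1 g) t) (derive1 (derive1 psi) t) (derive1 g t) (derive1 psi t) => A B C D; ring.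
Unshelve. all: by end_near. Qed.

(* Convexity of [g] as a function of [z]. *)
Definition conv3 g T := forall a b d : R, 0 < a -> a < b -> b < d -> d < T ->
  (g b - g a) * (z d - z b) <= (g d - g b) * (z b - z a).

Lemma nu_gt0 : 0 < nu.
Proof. by rewrite divr_gt0 // ltr0n (leq_trans _ n2). Qed.

Lemma z_mono a t : 0 < a -> a < t -> z a < z t.
Proof. by move=> a0 at_; rewrite gt0_ltr_powR ?nu_gt0 ?nnegrE ?ltW // (lt_trans a0). Qed.

(** The slope dg/dz is p / nu with p = t^(1 - nu) g', and p' = t^(-nu) (L g) / 2 is nonnegative.
    Difference quotients of g against z are values of this slope by Cauchy's mean value theorem. *)
Lemma conv3_euler_ge0 g T : (forall t, 0 < t < T -> twice g t) ->
  (forall t, 0 < t < T -> 0 <= euler_op g t) -> conv3 g T.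
Proof.
move=> gT Lg a b d a0 ab bd dT.
pose p t := t `^ (1 - nu) * (derive1 g) t.
have cmvt (u v : R) : 0 < u -> u < v -> v < T ->
    exists2 xi, u < xi < v & g v - g u = (z v - z u) * (p xi / nu).
  move=> u0 uv vT.
  pose phi := (g v - g u) *: (fun t : R => t `^ nu) - (z v - z u) *: g.
  have dphi (t : R) : u <= t <= v -> is_derive t 1 phi ((g v - g u) * (nu * t `^ (nu - 1)) - (z v - z u) * (derive1 g) t).
    move=> /andP[ut tv]; have t0 := lt_le_trans u0 ut.
    apply: is_deriveB; first by apply: is_deriveZ; exact: is_derive1_powR.
    apply: is_deriveZ; rewrite derive1E; apply: derivableP; apply: (gT t _).1.
    by rewrite t0 (le_lt_trans tv).
  have [xi xi1 xi2] : exists2 c, c \in `]u, v[ & phi v - phi u =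
      ((g v - g u) * (nu * c `^ (nu - 1)) - (z v - z u) * (derive1 g) c) * (v - u).
    apply: (MVT uv).
      by move=> t; rewrite in_itv /= => /andP[ut tv]; apply: dphi; rewrite !ltW.
    apply: derivable_within_continuous => t; rewrite in_itv /= => utv.
    by have [] := dphi t utv.
  rewrite in_itv /= in xi1; exists xi => //.
  have xi0 : 0 < xi by case/andP: xi1 => + _; exact: lt_trans.
  move: xi2; rewrite /phi !fctE.
  have -> : (g v - g u) *: v `^ nu - (z v - z u) *: g v - ((g v - g u) *: u `^ nu - (z v - z u) *: g u) = 0.
    by rewrite -![_ *: _]/(_ * _); ring.
  move/esym/eqP; rewrite mulf_eq0 [X in _ || X]gt_eqF ?subr_gt0 // orbF subr_eq0 => /eqP E.
  have P0 : xi `^ (nu - 1) * xi `^ (1 - nu) = 1.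
    rewrite -gt0_powRD //.
    by rewrite -opprB addNr powRr0.
  have nu0 := nu_gt0; have nun0 : nu != 0 by rewrite gt_eqF.
  rewrite /p; apply: (mulIf nun0); rewrite -!mulrA [X in _ * (_ * X)]mulrA mulrAC.
  rewrite [RHS](_ : _ = ((z v - z u) * (derive1 g) xi) * xi `^ (1 - nu)); last by field; move: nun0; rewrite mulf_eq0 => /norP[].
  by rewrite -E -!mulrA P0 mulr1.
have dp (t : R) : 0 < t < T -> is_derive t 1 p (2^-1 * t `^ (- nu) * euler_op g t).
  move=> tT; have t0 : 0 < t by case/andP: tT.
  have h1 := is_derive1_powR (1 - nu) t0.
  have h2 : is_derive t 1 (derive1 g) ((derive1 (derive1 g)) t).
    by rewrite [X in is_derive _ _ _ X]derive1E; apply: derivableP; exact: (gT t tT).2.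
  have := is_deriveM h1 h2.
  have -> : (fun t : R => t `^ (1 - nu)) * (derive1 g) = p by [].
  congr is_derive; rewrite -![_ *: _]/(_ * _) /euler_op.
  have -> : 1 - nu - 1 = - nu by ring.
  have -> : t `^ (1 - nu) = t * t `^ (- nu).
    by rewrite gt0_powRD // powRr1 ?ltW.
  by field.
have pmono (u v : R) : 0 < u -> u <= v -> v < T -> p u <= p v.
  move=> u0 uv vT.
  apply: (@ger0_derive1_le_cc _ p u v) => //; rewrite ?in_itv /= ?lexx ?uv //.
  - move=> t; rewrite in_itv /= => /andP[ut tv]; have [] := dp t => //.
    by rewrite (lt_trans u0) //= (lt_trans tv).
  - move=> t; rewrite in_itv /= => /andP[ut tv].
    have tT : 0 < t < T by rewrite (lt_trans u0) //= (lt_trans tv).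
    rewrite derive1E; have [_ ->] := dp t tT.
    by rewrite !mulr_ge0 ?powR_ge0 ?invr_ge0 // Lg.
  - apply: derivable_within_continuous => t; rewrite in_itv /= => /andP[ut tv].
    by have [] := dp t => //; rewrite (lt_le_trans u0) //= (le_lt_trans tv).
have [x1 /andP[ax1 x1b] ->] := cmvt a b a0 ab (lt_trans bd dT).
have [x2 /andP[bx2 x2d] ->] := cmvt b d (lt_trans a0 ab) bd dT.
rewrite -mulrA mulrC [leRHS]mulrAC.
have -> : p x1 / nu * (z d - z b) * (z b - z a) = (z d - z b) * (z b - z a) * (p x1 / nu) by ring.
rewrite ler_wpM2l ?mulr_ge0 ?subr_ge0 ?(ltW (z_mono _ _)) ?(lt_trans a0 ab) //.
rewrite ler_pM2r ?invr_gt0 ?nu_gt0 // pmono ?(lt_trans a0) // ?(lt_trans x2d) //.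
by rewrite ltW // (lt_trans x1b).
Qed.

(* [euler_op c = w] for uniform limits: space derivatives of solutions satisfy the equation in
   this sense although nothing is known about the [t]-regularity of [partial A (h t)]. *)
Definition mild c w T := forall eta : R, 0 < eta -> exists g, forall t, 0 < t < T ->
  [/\ twice g t, `|g t - c t| <= eta & `|euler_op g t - w t| <= eta].

Lemma mildN c w T : mild c w T -> mild (fun t => - c t) (fun t => - w t) T.
Proof.
move=> cw eta eta0; have [g gT] := cw eta eta0.
have g2 t : 0 < t < T -> twice g t by move=> /gT[].
have z2 t : 0 < t < T -> twice (cst 0 : R -> R) t.
  move=> _; split; first exact: derivable_cst.
  have -> : derive1 (cst 0 : R -> R) = cst 0 by apply/funext => s; rewrite derive1_cst.
  exact: derivable_cst.
exists (fun t => 0 + (-1) * g t) => t tT; have [h1 h2 h3] := gT t tT.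
have [t1 t2] := twice_lin (-1) tT z2 g2; split => //.
  by rewrite add0r mulN1r -opprD normrN.
have L0 : euler_op (cst 0) t = 0.
  have E : derive1 (cst 0 : R -> R) = cst 0 by apply/funext => s; rewrite derive1_cst.
  by rewrite /euler_op !E !mulr0 addr0.
by move: t2; rewrite L0 add0r mulN1r => ->; rewrite -opprD normrN.
Qed.

Lemma conv3_lim F T (K : R) :
  (forall eta : R, 0 < eta -> exists2 f, conv3 f T & forall t, 0 < t < T -> `|f t - F t| <= eta * K) ->
  conv3 F T.
Proof.
move=> H a b d a0 ab bd dT; apply/ler_addgt0Pr => e e0.
have zab : 0 <= z b - z a by rewrite subr_ge0 ltW // z_mono.
have zbd : 0 <= z d - z b by rewrite subr_ge0 ltW // z_mono // (lt_trans a0).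
(* If f differs from F by at most y |K|, the three-point inequality is off by at most 2 y |K| (z d -
   z a); the added 1 keeps D positive. *)
pose D := 2 * `|K| * (z d - z a) + 1.
have D0 : 0 < D.
  by rewrite ltr_wpDl // !mulr_ge0 // subr_ge0 ltW // z_mono // (lt_trans ab).
have [f fc fF] := H (e / D) (divr_gt0 e0 D0).
have E t : 0 < t < T -> `|f t - F t| <= e / D * `|K|.
  by move=> tT; apply: le_trans (fF t tT) _; rewrite ler_wpM2l ?ler_norm // divr_ge0 // ltW.
have := fc a b d a0 ab bd dT.
have /ler_normlP[Ea1 Ea2] := E a (introT andP (conj a0 (lt_trans ab (lt_trans bd dT)))).
have /ler_normlP[Eb1 Eb2] := E b (introT andP (conj (lt_trans a0 ab) (lt_trans bd dT))).
have /ler_normlP[Ed1 Ed2] := E d (introT andP (conj (lt_trans a0 (lt_trans ab bd)) dT)).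
have DE : e = e / D * `|K| * (2 * (z d - z a)) + e / D.
  rewrite [X in _ + X](_ : e / D = e / D * 1); last by rewrite mulr1.
  by rewrite -mulrA -mulrDr (_ : _ + 1 = D) ?divfK ?gt_eqF // /D; ring.
have eD : 0 <= e / D by rewrite divr_ge0 // ltW.
move: zab zbd Ea1 Ea2 Eb1 Eb2 Ed1 Ed2 DE eD.
move: (z a) (z b) (z d) (e / D) (F a) (F b) (F d) (f a) (f b) (f d).
move=> za zb zd y Fa Fb Fd fa fb fd zab zbd Ea1 Ea2 Eb1 Eb2 Ed1 Ed2 -> y0 h.
have h1 : (Fb - Fa) * (zd - zb) <= (fb - fa + 2 * (y * `|K|)) * (zd - zb) by rewrite ler_wpM2r //; lra.
have h2 : (fd - fb) * (zb - za) <= (Fd - Fb + 2 * (y * `|K|)) * (zb - za) by rewrite ler_wpM2r //; lra.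
lra.
Qed.

Lemma mild_conv3 c w psi T : 0 < T -> mild c w T ->
  (forall t, 0 < t < T -> twice psi t) -> (forall t, 0 < t < T -> euler_op psi t <= w t) ->
  conv3 (fun t => c t - psi t) T.
Proof.
move=> T0 cw p2 pw.
(* [phi] is bounded with [euler_op phi >= 1], and absorbs the approximation error. *)
pose k := 8 / 3 * T `^ (1 / 4).
have k0 : 0 < k by rewrite mulr_gt0 ?powR_gt0 //; lra.
apply: (@conv3_lim _ _ (1 + k * T `^ (3 / 4))) => eta eta0.
have [g gT] := cw eta eta0.
have g2 t : 0 < t < T -> twice g t by move=> /gT[].
have q2 t : 0 < t < T -> twice (fun t => t `^ (3 / 4)) t.
  by move=> /andP[t0 _]; exact: (euler_powR _ t0).1.
have gp t (tT : 0 < t < T) := twice_lin (-1) tT g2 p2.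
have gpq t (tT : 0 < t < T) := twice_lin (- (eta * k)) tT (fun s sT => (gp s sT).1) q2.
exists (fun s => g s + -1 * psi s + - (eta * k) * s `^ (3 / 4)).
  apply: conv3_euler_ge0 => t tT; first exact: (gpq t tT).1.
  have [t0 tlT] := andP tT.
  rewrite (gpq t tT).2 (gp t tT).2 (euler_powR _ t0).2.
  have [_ _ /ler_normlP[h1 h2]] := gT t tT; have h3 := pw t tT.
  (* Origin of 8/3 and T^(1/4) in k: n >= 2 gives 3/4 (n - 3/2) >= 3/8, and t^(-1/4) >= T^(-1/4). *)
  have P : 1 <= k * (3 / 4 * (n%:R - 2 * (3 / 4)) * t `^ (3 / 4 - 1)).
    have -> : 3 / 4 - 1 = - (1 / 4) :> R by lra.
    have tq : T `^ (- (1 / 4)) <= t `^ (- (1 / 4)).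
      rewrite !powRN lef_pV2 ?posrE ?powR_gt0 // ge0_ler_powR ?nnegrE //; lra.
    have n2' : 2 <= n%:R :> R by rewrite ler_nat.
    apply: le_trans (_ : k * (3 / 4 * (1 / 2) * T `^ (- (1 / 4))) <= _).
      rewrite /k powRN; have Tq : T `^ (1 / 4) != 0 by rewrite gt_eqF // powR_gt0.
      by rewrite le_eqVlt; apply/orP; left; apply/eqP; field.
    rewrite ler_wpM2l ?(ltW k0) //; apply: ler_pM; [lra|exact: powR_ge0|lra|exact: tq].
  have {}P := ler_wpM2l (ltW eta0) P.
  move: P h1 h2 h3; move: (euler_op g t) (euler_op psi t) (t `^ (3 / 4 - 1)) (w t) => A B C D P h1 h2 h3.
  lra.
move=> t tT; have [_ h _] := gT t tT; have [t0 tlT] := andP tT.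
have -> : g t + -1 * psi t + - (eta * k) * t `^ (3 / 4) - (c t - psi t) = (g t - c t) - (eta * k) * t `^ (3 / 4) by ring.
apply: le_trans (ler_normB _ _) _; rewrite mulrDr mulr1 lerD //.
rewrite ger0_norm ?mulr_ge0 ?powR_ge0 ?(ltW eta0) ?(ltW k0) // -mulrA ler_wpM2l ?(ltW eta0) // ler_wpM2l ?(ltW k0) //.
rewrite ge0_ler_powR ?nnegrE ?ltW //; lra.
Qed.

Lemma cvg_ler {U : Type} (F : set_system U) {FF : ProperFilter F} (a : U -> R) (b K : R) :
  a i @[i --> F] --> b -> (\forall i \near F, a i <= K) -> b <= K.
Proof.
move=> ab aK; apply/ler_addgt0Pr => e e0.
move/cvgrPdist_le : ab => /(_ e e0) be.
have [i [bi ai]] := filter_ex (filterI be aK).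
by rewrite -(subrK (a i) b) addrC lerD // (le_trans (ler_norm _)).
Qed.

Lemma near_0_right T : 0 < T -> \forall t \near 0^'+, 0 < t < T.
Proof.
move=> T0; near=> t; apply/andP; split; near: t; [exact: nbhs_right_gt|exact: nbhs_right_lt].
Unshelve. all: by end_near. Qed.

(** The left point tends to 0, where F and z both vanish: then F / z is nondecreasing, here written
    without division. *)
Lemma conv3_0 F T b d : conv3 F T -> F t @[t --> 0^'+] --> (0 : R) ->
  0 < b -> b < d -> d < T -> F b * z d <= F d * z b.
Proof.
move=> FT F0 b0 bd dT.
have : (F b - 0) * (z d - z b) - (F d - F b) * (z b - 0) <= 0.
  apply: (@cvg_ler _ 0^'+ _ (fun a => (F b - F a) * (z d - z b) - (F d - F b) * (z b - z a))).
    apply: cvgB; apply: cvgM; try exact: cvg_cst.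
      by apply: cvgB => //; exact: cvg_cst.
    by apply: cvgB; [exact: cvg_cst|apply: powR_cvg0; exact: nu_gt0].
  near=> a; rewrite subr_le0.
  have /andP[a0 ab] : 0 < a < b by near: a; exact: near_0_right.
  exact: FT.
by move: (z b) (z d) => zb zd; lra.
Unshelve. all: by end_near. Qed.

(** * Two-sided comparison with multiples of t^a *)

Section Comparison.
Variables (c w : R -> R) (T K M a : R).
Hypotheses (T0 : 0 < T) (K0 : 0 <= K) (cw : mild c w T).
Hypotheses (wK : forall t, 0 < t < T -> `|w t| <= K * t `^ (a - 1)).
Hypotheses (c0 : c t @[t --> 0^'+] --> (0 : R)).
Hypotheses (a0 : 0 < a) (an : 2 * a != n%:R).

(** Chosen so that L psi = K t^(a-1). For K > 0 it has the sign of 2 a - n, hence is negative below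
    the resonance. *)
Let psi (t : R) := K / (a * (2 * a - n%:R)) * t `^ a.

Lemma denom_neq0 : a * (2 * a - n%:R) != 0.
Proof. by rewrite mulf_eq0 negb_or gt_eqF //= subr_eq0. Qed.

Lemma psi_cvg0 : psi t @[t --> 0^'+] --> (0 : R).
Proof.
have := cvgM (cvg_cst (K / (a * (2 * a - n%:R)))) (powR_cvg0 a0).
by rewrite mulr0; apply; exact: at_right_proper_filter.
Qed.

Let psi_twice k t : 0 < t < T -> twice (fun t => k * psi t) t /\
  euler_op (fun t => k * psi t) t = k * K * t `^ (a - 1).
Proof.
move=> tT; have [t0 _] := andP tT.
have z2 s : 0 < s < T -> twice (cst 0 : R -> R) s.
  move=> _; split; first exact: derivable_cst.
  have -> : derive1 (cst 0 : R -> R) = cst 0 by apply/funext => u; rewrite derive1_cst.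
  exact: derivable_cst.
have q2 s : 0 < s < T -> twice (fun t => t `^ a) s.
  by move=> /andP[s0 _]; exact: (euler_powR _ s0).1.
have := twice_lin (k * (K / (a * (2 * a - n%:R)))) tT z2 q2.
have -> : (fun s => cst 0 s + k * (K / (a * (2 * a - n%:R))) * s `^ a) = (fun t => k * psi t).
  by apply/funext => s; rewrite /= add0r -mulrA.
move=> [h1 ->]; split => //.
have -> : euler_op (cst 0) t = 0.
  have E : derive1 (cst 0 : R -> R) = cst 0 by apply/funext => s; rewrite derive1_cst.
  by rewrite /euler_op !E !mulr0 addr0.
rewrite add0r (euler_powR a t0).2.
by rewrite mulrA -(mulrA k) divfK ?denom_neq0.
Qed.

(** For both signs L (psi + c) and L (psi - c) equal K t^(a-1) plus or minus w, which is
    nonnegative; psi enters [mild_conv3] through its negative. *)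
Lemma comparison_conv3 : conv3 (fun t => c t + psi t) T /\ conv3 (fun t => - c t + psi t) T.
Proof.
have p2 t (tT : 0 < t < T) := psi_twice (-1) tT.
have E f : (fun t => f t + psi t) = (fun t => f t - -1 * psi t).
  by apply/funext => t; rewrite mulN1r opprK.
rewrite E (E (fun t => - c t)); split.
  apply: (mild_conv3 T0 cw) => t tT; first exact: (p2 t tT).1.
  by rewrite (p2 t tT).2 mulN1r mulNr; have /ler_normlP[h1 h2] := wK tT; rewrite lerNl.
apply: (mild_conv3 T0 (mildN cw)) => t tT; first exact: (p2 t tT).1.
by rewrite (p2 t tT).2 mulN1r mulNr; have /ler_normlP[h1 h2] := wK tT; rewrite lerN2.
Qed.

Lemma comparison_0 b d : 0 < b -> b < d -> d < T ->
  (c b + psi b) * z d <= (c d + psi d) * z b /\ (- c b + psi b) * z d <= (- c d + psi d) * z b.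
Proof.
move=> b0 bd dT; have [h1 h2] := comparison_conv3.
split; [apply: (conv3_0 h1)|apply: (conv3_0 h2)] => //.
  by rewrite -[X in _ --> X]addr0; apply: cvgD; [exact: c0|exact: psi_cvg0].
rewrite -[X in _ --> X]addr0; apply: cvgD; last exact: psi_cvg0.
by rewrite -[X in _ --> X]oppr0; apply: cvgN; exact: c0.
Qed.

(** Monotonicity of (psi + c) / z and (psi - c) / z carries the bound at d down to b. Below the
    resonance - psi b is the main term, and d contributes a multiple of z only. *)
Lemma comparison_bound b d : 0 < b -> b < d -> d < T -> `|c d| <= M ->
  `|c b| <= - psi b + (M + psi d) / z d * z b.
Proof.
move=> b0 bd dT cM; have [h1 h2] := comparison_0 b0 bd dT.
have zd : 0 < z d by rewrite powR_gt0 // (lt_trans b0).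
have zb : 0 <= z b by exact: powR_ge0.
have /ler_normlP[M1 M2] := cM.
rewrite mulrAC -(ler_pM2r zd) [leRHS]mulrDl divfK ?gt_eqF //.
rewrite -{1}(gtr0_norm zd) -normrM; apply/ler_normlP; split.
  have : (- c d + psi d) * z b <= (M + psi d) * z b by rewrite ler_wpM2r // lerD2r.
  by move: h2; move: (z b) (z d) => x y; lra.
have : (c d + psi d) * z b <= (M + psi d) * z b by rewrite ler_wpM2r // lerD2r.
by move: h1; move: (z b) (z d) => x y; lra.
Qed.

Hypothesis na : n%:R < 2 * a.

Lemma psi_ge0 t : 0 <= psi t.
Proof. by rewrite mulr_ge0 ?powR_ge0 // divr_ge0 // mulr_ge0 ?(ltW a0) // subr_ge0 ltW. Qed.

(** Above the resonance (c + psi) / z is nondecreasing, (c - psi) / z is nonincreasing, and every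
    value of the latter is below every value of the former. The infimum of the upper values
    separates the two. *)
Lemma comparison_leading : exists al : R, forall t, 0 < t < T -> `|c t - al * z t| <= psi t.
Proof.
pose up t := (c t + psi t) / z t; pose dn t := (c t - psi t) / z t.
have zgt t : 0 < t -> 0 < z t by move=> t0; rewrite powR_gt0.
have up_mono b d : 0 < b -> b < d -> d < T -> up b <= up d.
  move=> b0 bd dT; have [h1 _] := comparison_0 b0 bd dT.
  by rewrite /up ler_pdivrMr ?zgt // mulrAC ler_pdivlMr ?zgt // (lt_trans b0).
have dn_mono b d : 0 < b -> b < d -> d < T -> dn d <= dn b.
  move=> b0 bd dT; have [_ h2] := comparison_0 b0 bd dT.
  rewrite /dn ler_pdivrMr ?(zgt _ (lt_trans b0 bd)) // mulrAC ler_pdivlMr ?zgt //.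
  by move: h2; move: (z b) (z d) => x y; lra.
have dn_up b d : 0 < b < T -> 0 < d < T -> dn b <= up d.
  move=> /andP[b0 bT] /andP[d0 dT]; pose e := Num.min b d / 2.
  have e0 : 0 < e by rewrite divr_gt0 // lt_min b0 d0.
  have eb : e < b by rewrite ltr_pdivrMr // gt_min mulr_natr mulr2n ltrDl b0.
  have ed : e < d by rewrite ltr_pdivrMr // gt_min mulr_natr mulr2n ltrDl d0 orbT.
  apply: le_trans (dn_mono e b e0 eb bT) _; apply: le_trans (up_mono e d e0 ed dT).
  by rewrite /dn /up ler_pM2r ?invr_gt0 ?zgt // lerD2l ge0_cp // psi_ge0.
have T2 : 0 < T / 2 < T by rewrite divr_gt0 //= ltr_pdivrMr // mulr_natr mulr2n ltrDl.
pose A := [set up t | t in [set t | 0 < t < T]].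
have A0 : A !=set0 by exists (up (T / 2)); exists (T / 2).
have lbA : has_lbound A by exists (dn (T / 2)) => _ [t tT <-]; exact: dn_up.
exists (inf A) => t tT; have [t0 _] := andP tT.
apply/ler_normlP; split.
  have : inf A <= up t by apply: ge_inf => //; exists t.
  rewrite /up ler_pdivlMr ?zgt //=.
  by move: (inf A) (psi t) (t `^ nu) (c t) => x1 x2 x3 x4 h; lra.
have : dn t <= inf A by apply: lb_le_inf => // _ [s sT <-]; exact: dn_up.
rewrite /dn ler_pdivrMr ?zgt //=.
by move: (inf A) (psi t) (t `^ nu) (c t) => x1 x2 x3 x4 h; lra.
Qed.

Lemma psi_z_cvg0 : psi t / z t @[t --> 0^'+] --> (0 : R).
Proof.
have an0 : 0 < a - nu by rewrite subr_gt0 ltr_pdivrMr // mulrC.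
rewrite -[X in _ --> X](mulr0 (K / (a * (2 * a - n%:R)))).
apply: cvg_trans (cvgM (cvg_cst (K / (a * (2 * a - n%:R)))) (powR_cvg0 an0)).
apply: near_eq_cvg; near=> t; have t0 : 0 < t by near: t; exact: nbhs_right_gt.
by rewrite /psi -mulrA -powRN -gt0_powRD.
Unshelve. all: by end_near. Qed.

Lemma comparison_cvg (al : R) : (forall t, 0 < t < T -> `|c t - al * z t| <= psi t) ->
  c t / z t @[t --> 0^'+] --> al.
Proof.
move=> H; apply/cvgrPdist_le => e e0; have /cvgrPdist_le/(_ e e0) pz := psi_z_cvg0.
near=> t; have tT : 0 < t < T by near: t; exact: near_0_right.
have t0 : 0 < t by case/andP: tT.
have zt : 0 < z t by rewrite powR_gt0.
have : `|0 - psi t / z t| <= e by near: t; exact: pz.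
rewrite sub0r normrN ger0_norm ?divr_ge0 ?psi_ge0 ?(ltW zt) //.
move=> h; apply: le_trans h.
have E : c t / z t - al = (c t - al * z t) / z t by rewrite mulrBl mulfK ?gt_eqF.
by rewrite distrC E normrM normfV (gtr0_norm zt) ler_pM2r ?invr_gt0 // H.
Unshelve. all: by end_near. Qed.

Lemma comparison_flat : c t / z t @[t --> 0^'+] --> (0 : R) ->
  forall t, 0 < t < T -> `|c t| <= psi t.
Proof.
move=> cz; have [al H] := comparison_leading.
have al0 : al = 0.
  exact: (cvg_unique _ (comparison_cvg H) cz).
by move=> t tT; have := H t tT; rewrite al0 mul0r subr0.
Qed.
End Comparison.

(** A source close to the constant V forces a second difference of c in z that is proportional to V,
    while M bounds all second differences. The constant k depends on T and n only, so that one k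
    serves all x-derivatives. *)
Lemma oscillation T : 0 < T -> exists2 k : R, 0 <= k & forall c w (V K M : R), mild c w T ->
  (forall t, 0 < t < T -> `|w t - V| <= K) -> (forall t, 0 < t < T -> `|c t| <= M) ->
  `|V| <= K + k * M.
Proof.
move=> T0.
pose a := T / 4; pose b := T / 2; pose d := T * 3 / 4.
have a0 : 0 < a by rewrite divr_gt0.
have ab : a < b by rewrite /a /b; lra.
have bd : b < d by rewrite /d /b; lra.
have dT : d < T by rewrite /d; lra.
have n0 : 0 < n%:R :> R by rewrite ltr0n (leq_trans _ n2).
(* L (t^n) = n^2 t^(n-1), which N bounds on the interval from 0 to T. *)
pose N := n%:R * n%:R * T `^ (n%:R - 1).
have N0 : 0 < N by rewrite !mulr_gt0 // powR_gt0.
pose S := (z d - z b) * (z b - z a) * (z d - z a).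
have zab : 0 < z b - z a by rewrite subr_gt0 z_mono.
have zbd : 0 < z d - z b by rewrite subr_gt0 z_mono // (lt_trans a0).
have zad : 0 < z d - z a by rewrite subr_gt0 z_mono // (lt_trans ab).
have S0 : 0 < S by rewrite !mulr_gt0.
have k0 : 0 <= 2 * (z d - z a) * N / S.
  by apply: mulr_ge0; [apply: mulr_ge0; [apply: mulr_ge0 => //; exact: ltW|exact: ltW]|rewrite invr_ge0 ltW].
exists (2 * (z d - z a) * N / S) => //.
have zz t : 0 < t -> t `^ n%:R = z t * z t.
  by move=> t0; rewrite /= -gt0_powRD // -splitr.
(* Lf = (V - K) (t / T)^(n - 1) for f = (V - K) z^2 / N, and the second difference of z^2 is S. *)
suff H c w (V K M : R) : mild c w T -> (forall t, 0 < t < T -> `|w t - V| <= K) ->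
    (forall t, 0 < t < T -> `|c t| <= M) -> V <= K + 2 * (z d - z a) * N / S * M.
  move=> c w V K M cw wV cM; apply/ler_normlP; split; last exact: (H c w).
  apply: (H _ _ _ _ _ (mildN cw)) => t tT; last by rewrite normrN; exact: cM.
  by rewrite opprK addrC distrC; exact: wV.
move=> cw wV cM.
have bT : 0 < b < T by rewrite (lt_trans a0) // (lt_trans bd).
have K0 : 0 <= K by apply: le_trans (wV b bT).
have M0 : 0 <= M by apply: le_trans (cM b bT).
have [VK|KV] := leP V K.
  by apply: le_trans VK _; rewrite lerDl mulr_ge0.
have VK0 : 0 < V - K by rewrite subr_gt0.
pose f (t : R) := (V - K) / N * t `^ n%:R.
have f2 t : 0 < t < T -> twice f t /\ euler_op f t <= w t.
  move=> tT; have [t0 tlT] := andP tT.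
  have z2 s : 0 < s < T -> twice (cst 0 : R -> R) s.
    move=> _; split; first exact: derivable_cst.
    have -> : derive1 (cst 0 : R -> R) = cst 0 by apply/funext => u; rewrite derive1_cst.
    exact: derivable_cst.
  have q2 s : 0 < s < T -> twice (fun t => t `^ n%:R) s.
    by move=> /andP[s0 _]; exact: (euler_powR _ s0).1.
  have := twice_lin ((V - K) / N) tT z2 q2.
  have -> : (fun s => cst 0 s + (V - K) / N * s `^ n%:R) = f.
    by apply/funext => s; rewrite /= add0r.
  move=> [h1 ->]; split => //.
  have -> : euler_op (cst 0) t = 0.
    have E : derive1 (cst 0 : R -> R) = cst 0 by apply/funext => s; rewrite derive1_cst.
    by rewrite /euler_op !E !mulr0 addr0.
  rewrite add0r (euler_powR _ t0).2.
  have h : V - K <= w t by have /ler_normlP[h1' h2'] := wV t tT; lra.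
  apply: le_trans h; rewrite -[leRHS]mulr1 -mulrA ler_wpM2l ?(ltW VK0) //.
  rewrite mulrC ler_pdivrMr // mul1r /N (_ : 2 * n%:R - n%:R = n%:R :> R); last by ring.
  rewrite ler_wpM2l ?mulr_ge0 ?(ltW n0) // ge0_ler_powR ?nnegrE ?(ltW t0) ?(ltW T0) ?(ltW tlT) //.
  by rewrite subr_ge0 ler1n (leq_trans _ n2).
have := mild_conv3 T0 cw (fun t tT => (f2 t tT).1) (fun t tT => (f2 t tT).2) a0 ab bd dT.
rewrite /f (zz a a0) (zz b (lt_trans a0 ab)) (zz d (lt_trans a0 (lt_trans ab bd))).
have /ler_normlP[ca1 ca2] := cM a (introT andP (conj a0 (lt_trans ab (lt_trans bd dT)))).
have /ler_normlP[cb1 cb2] := cM b bT.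
have /ler_normlP[cd1 cd2] := cM d (introT andP (conj (lt_trans a0 (lt_trans ab bd)) dT)).
move=> h; suff : (V - K) / N * S <= 2 * M * (z d - z a).
  rewrite mulrAC ler_pdivrMr // -ler_pdivlMr // => {}h.
  rewrite -lerBlDl; apply: le_trans h _; rewrite le_eqVlt; apply/orP; left; apply/eqP; ring.
have h1 : (c d - c b) * (z b - z a) <= 2 * M * (z b - z a) by rewrite ler_wpM2r ?(ltW zab) //; lra.
have h2 : (c a - c b) * (z d - z b) <= 2 * M * (z d - z b) by rewrite ler_wpM2r ?(ltW zbd) //; lra.
move: h h1 h2; rewrite /S; move: (z a) (z b) (z d) ((V - K) / N) (c a) (c b) (c d) => x1 x2 x3 x4 y1 y2 y3 h h1 h2.
lra.
Qed.

End EulerOperator.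

(** * Stability of Cauchy estimates under shifts and combinations *)

Section CauchyBounds.
Context {R : realType}.
Implicit Types (M C : R).

Lemma cauchy_bd_ge0 M C j : 0 <= M -> 0 <= C -> 0 <= cauchy_bd M C j.
Proof. by move=> M0 C0; rewrite /cauchy_bd !mulr_ge0 // exprn_ge0. Qed.

Lemma cauchy_bd_shift M C j k : 0 <= M -> 0 <= C ->
  cauchy_bd M C (j + k) <= cauchy_bd (M * ((2 * C) ^+ k * k`!%:R)) (2 * C) j.
Proof.
move=> M0 C0; rewrite /cauchy_bd -mulrA ler_wpM2l //.
have : ((j + k)`!%:R : R) <= 2 ^+ (j + k) * (j`!%:R * k`!%:R).
  by rewrite -natrX -!natrM ler_nat leq_fact_add.
move=> /(ler_wpM2l (exprn_ge0 (j + k) C0)); move/le_trans; apply.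
by rewrite !exprMn !exprD le_eqVlt; apply/orP; left; apply/eqP; ring.
Qed.

Lemma cauchy_bd_mono M C M' C' j : 0 <= M -> 0 <= C -> M <= M' -> C <= C' ->
  cauchy_bd M C j <= cauchy_bd M' C' j.
Proof.
move=> M0 C0 MM CC; have M'0 := le_trans M0 MM; have C'0 := le_trans C0 CC.
rewrite /cauchy_bd ler_pM ?mulr_ge0 ?exprn_ge0 // ler_wpM2r // lerXn2r //.
Qed.

(** Being dominated by some Cauchy estimate: shifts and nonnegative combinations preserve it, so the
    constants need not be followed. *)
Definition cauchy_seq (B : nat -> R) :=
  exists M C, [/\ 0 <= M, 0 <= C & forall j, B j <= cauchy_bd M C j].

Lemma cauchy_seq_bd M C : 0 <= M -> 0 <= C -> cauchy_seq (cauchy_bd M C).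
Proof. by move=> M0 C0; exists M, C. Qed.

Lemma cauchy_seq_shift B k : cauchy_seq B -> cauchy_seq (fun j => B (j + k)%N).
Proof.
move=> [M [C [M0 C0 BM]]]; exists (M * ((2 * C) ^+ k * k`!%:R)), (2 * C); split.
- by rewrite !mulr_ge0 // exprn_ge0 // mulr_ge0.
- by rewrite mulr_ge0.
- by move=> j; apply: le_trans (BM _) _; exact: cauchy_bd_shift.
Qed.

Lemma cauchy_seq_lin B B' (a b : R) : 0 <= a -> 0 <= b -> cauchy_seq B -> cauchy_seq B' ->
  cauchy_seq (fun j => a * B j + b * B' j).
Proof.
move=> a0 b0 [M [C [M0 C0 BM]]] [M' [C' [M'0 C'0 BM']]].
exists (a * M + b * M'), (Num.max C C'); split.
- by rewrite addr_ge0 // mulr_ge0.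
- by rewrite le_max C0.
move=> j; have -> : cauchy_bd (a * M + b * M') (Num.max C C') j =
    a * cauchy_bd M (Num.max C C') j + b * cauchy_bd M' (Num.max C C') j.
  by rewrite /cauchy_bd; ring.
apply: lerD; rewrite ler_wpM2l //.
  by apply: le_trans (BM j) _; apply: cauchy_bd_mono => //; rewrite le_max lexx.
by apply: le_trans (BM' j) _; apply: cauchy_bd_mono => //; rewrite le_max lexx orbT.
Qed.

Lemma cauchy_seq_scale B (a : R) : 0 <= a -> cauchy_seq B -> cauchy_seq (fun j => a * B j).
Proof.
move=> a0 [M [C [M0 C0 BM]]]; exists (a * M), C; split => //; first by rewrite mulr_ge0.
by move=> j; rewrite /cauchy_bd -mulrA ler_wpM2l //; exact: BM.
Qed.

End CauchyBounds.

(** * Uniqueness for families of solutions *)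

Section Families.
Context {R : realType} {m : nat}.
Variable n : nat.
Hypothesis n2 : (2 <= n)%N.
Implicit Types (h : R -> 'rV[R]_m -> R) (v : 'rV[R]_m -> R) (x : 'rV[R]_m) (B : nat -> R).

Local Notation nu := (n%:R / 2 : R).
Local Notation z := (fun t : R => t `^ nu).

Definition family_eq (T : R) x0 (r : R) h v := forall t x, 0 < t < T -> ball x0 r x ->
  twice (h ^~ x) t /\ euler_op n (h ^~ x) t = v x + laplacian (h t) x.

Lemma mild_quotient (c1 c2 w1 w2 : R -> R) (T s : R) : 0 < s -> mild n c1 w1 T -> mild n c2 w2 T ->
  mild n (fun t => s^-1 * (c1 t - c2 t)) (fun t => s^-1 * (w1 t - w2 t)) T.
Proof.
move=> s0 m1 m2 eta eta0.
have e0 : 0 < s * eta / 2 by rewrite divr_gt0 // mulr_gt0.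
have [g1 H1] := m1 _ e0; have [g2 H2] := m2 _ e0.
have t1 t : 0 < t < T -> twice g1 t by move=> /H1[].
have t2 t : 0 < t < T -> twice g2 t by move=> /H2[].
have t3 t (tT : 0 < t < T) := twice_lin n (-1) tT t1 t2.
have t0 t : 0 < t < T -> twice (cst 0 : R -> R) t.
  move=> _; split; first exact: derivable_cst.
  have -> : derive1 (cst 0 : R -> R) = cst 0 by apply/funext => u; rewrite derive1_cst.
  exact: derivable_cst.
have t4 t (tT : 0 < t < T) := twice_lin n s^-1 tT t0 (fun t tT => (t3 t tT).1).
exists (fun t => cst 0 t + s^-1 * (g1 t + -1 * g2 t)) => t tT.
have [_ h1 l1] := H1 t tT; have [_ h2 l2] := H2 t tT.
have L0 : euler_op n (cst 0) t = 0 :> R.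
  have E : derive1 (cst 0 : R -> R) = cst 0 by apply/funext => u; rewrite derive1_cst.
  by rewrite /euler_op !E !mulr0 addr0.
have key (a1 a2 b1 b2 : R) : `|a1 - b1| <= s * eta / 2 -> `|a2 - b2| <= s * eta / 2 ->
    `|0 + s^-1 * (a1 + -1 * a2) - s^-1 * (b1 - b2)| <= eta.
  move=> ab1 ab2; have -> : 0 + s^-1 * (a1 + -1 * a2) - s^-1 * (b1 - b2) = s^-1 * ((a1 - b1) - (a2 - b2)) by ring.
  rewrite normrM normfV (gtr0_norm s0) ler_pdivrMl //.
  by apply: le_trans (ler_normB _ _) _; rewrite [leRHS]splitr lerD.
split; first exact: (t4 t tT).1.
  exact: key.
by rewrite (t4 t tT).2 (t3 t tT).2 L0; exact: key.
Qed.

Lemma mild_uniform_limit (c w : R -> R) (T : R) :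
  (forall eta : R, 0 < eta -> exists c' w', mild n c' w' T /\
     forall t, 0 < t < T -> `|c' t - c t| <= eta /\ `|w' t - w t| <= eta) ->
  mild n c w T.
Proof.
move=> H eta eta0; have e0 : 0 < eta / 2 by rewrite divr_gt0.
have [c' [w' [m' H']]] := H _ e0; have [g gT] := m' _ e0.
exists g => t tT; have [g1 g2 g3] := gT t tT; have [h1 h2] := H' t tT.
split => //; rewrite [eta]splitr.
  by rewrite -(subrKA (c' t)); apply: le_trans (ler_normD _ _) _; exact: lerD.
by rewrite -(subrKA (w' t)); apply: le_trans (ler_normD _ _) _; exact: lerD.
Qed.

Lemma quotient_partial (f : 'rV[R]_m -> R) x0 (r : R) B x (A : 'I_m) (s : R) :
  smooth_bd f x0 r B -> ball x0 r x -> ball x0 r (s *: delta_mx 0 A + x) -> 0 < s ->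
  `|s^-1 * (f (s *: delta_mx 0 A + x) - f x) - partial A f x| <= m%:R ^+ 2 * B 2%N * s.
Proof.
move=> fB xr sr s0; have := quad_smooth_bd fB xr sr.
rewrite (bigD1 A) //= big1 ?addr0; last by move=> i iA; rewrite !mxE (negbTE iA) andbF mulr0 mul0r.
rewrite !mxE !eqxx mulr1 normrZ (gtr0_norm s0) => h.
rewrite -(ler_pM2l s0) -{1}(gtr0_norm s0) -normrM mulrBr mulVKf ?gt_eqF //.
have B2 : 0 <= B 2%N by apply: le_trans (normr_ge0 _) (fB.2 [:: A; A] x xr).
apply: le_trans h _; rewrite exprMn.
apply: le_trans (_ : m%:R ^+ 2 * B 2%N * s ^+ 2 <= _).
  rewrite ler_wpM2l ?mulr_ge0 ?exprn_ge0 // ler_piMr ?exprn_ge0 ?(ltW s0) //.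
  by rewrite exprn_ile1 ?norm_delta_mx_le.
by rewrite le_eqVlt; apply/orP; left; apply/eqP; ring.
Qed.

(** The equation at two nearby points gives the equation for the difference quotient. As the bounds
    on higher x-derivatives of h do not depend on t, these quotients converge uniformly in t, and
    [mild] is closed under such limits. *)
Lemma family_mild (T : R) x0 (r : R) B h v :
  (forall t, 0 < t < T -> smooth_bd (h t) x0 r B) -> smooth_on v x0 r ->
  family_eq T x0 r h v ->
  forall l x, ball x0 r x ->
    mild n (fun t => pd l (h t) x) (fun t => pd l v x + pd l (laplacian (h t)) x) T.
Proof.
move=> hB vs heq; elim => [|A l IH] x xr.
  move=> eta eta0; exists (h ^~ x) => t tT; have [h1 ->] := heq t x tT xr.
  by split => //; rewrite subrr normr0 ltW.
apply: mild_uniform_limit => eta eta0.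
have [d d0 xd] := ball_room xr.
pose K1 := m%:R ^+ 2 * B (2 + size l)%N.
pose K2 := m%:R ^+ 2 * (m%:R * B (2 + size l).+2).
(* One step size serves all t: K1 and K2 only involve the common bound B, and the quotient of v does
   not involve t. *)
have [s [s0 sd [sK1 sK2 sv]]] : exists s : R, [/\ 0 < s, s < d &
    [/\ K1 * s <= eta, K2 * s <= eta / 2 &
    `|s^-1 * (pd l v (s *: delta_mx 0 A + x) - pd l v x) - partial A (pd l v) x| <= eta / 2]].
  have dv := @diff_derivable _ _ _ _ _ (delta_mx 0 A) (vs l x xr).
  have e2 : 0 < eta / 2 by rewrite divr_gt0.
  have /cvgrPdist_le/(_ (eta / 2) e2) H0 := dv.
  have K (s K' : R) : 0 < s -> s <= eta / 2 / (`|K'| + 1) -> K' * s <= eta / 2.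
    move=> s0; rewrite ler_pdivlMr ?ltr_wpDl // mulrDr mulr1 => hs.
    apply: le_trans (_ : s * `|K'| <= _); first by rewrite mulrC ler_wpM2l ?ler_norm // ltW.
    by apply: le_trans hs; rewrite lerDl ltW.
  have H1 : \forall s \near 0^'+, `|partial A (pd l v) x - s^-1 * (pd l v (s *: delta_mx 0 A + x) - pd l v x)| <= eta / 2.
    have : \forall s \near 0^', `|partial A (pd l v) x - s^-1 * (pd l v (s *: delta_mx 0 A + x) - pd l v x)| <= eta / 2.
      exact: H0.
    by move=> [e e0 He]; exists e => // s se s0; apply: He => //; rewrite gt_eqF.
  have H2 (c : R) : 0 < c -> \forall s \near 0^'+, s < c by exact: nbhs_right_lt.
  have H3 (K' : R) : \forall s \near 0^'+, s <= eta / 2 / (`|K'| + 1).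
    by apply: nbhs_right_le; rewrite divr_gt0 // ltr_wpDl.
  have [s [[s0 sd] [s1 [s2 s3]]]] := filter_ex (filterI (filterI (nbhs_right_gt 0) (H2 d d0)) (filterI H1 (filterI (H3 K1) (H3 K2)))).
  exists s; split => //; split; last by rewrite distrC.
    by have := K s K1 s0 s2; lra.
  exact: K.
have sx : ball x0 r (s *: delta_mx 0 A + x).
  apply: xd; rewrite normrZ (gtr0_norm s0); apply: le_lt_trans sd.
  by rewrite ler_piMr ?norm_delta_mx_le // ltW.
pose x' := s *: delta_mx 0 A + x.
exists (fun t => s^-1 * (pd l (h t) x' - pd l (h t) x)).
exists (fun t => s^-1 * ((pd l v x' + pd l (laplacian (h t)) x') - (pd l v x + pd l (laplacian (h t)) x))).
split; first exact: mild_quotient (IH _ sx) (IH _ xr).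
move=> t tT /=; split.
  apply: le_trans (quotient_partial (smooth_bd_pd l (hB t tT)) xr sx s0) _.
  exact: sK1.
have -> : s^-1 * ((pd l v x' + pd l (laplacian (h t)) x') - (pd l v x + pd l (laplacian (h t)) x)) -
    (partial A (pd l v) x + partial A (pd l (laplacian (h t))) x) =
  (s^-1 * (pd l v x' - pd l v x) - partial A (pd l v) x) +
  (s^-1 * (pd l (laplacian (h t)) x' - pd l (laplacian (h t)) x) - partial A (pd l (laplacian (h t))) x) by ring.
apply: le_trans (ler_normD _ _) _; rewrite [eta]splitr; apply: lerD => //.
apply: le_trans (quotient_partial (smooth_bd_pd l (smooth_bd_laplacian (hB t tT))) xr sx s0) _.
exact: sK2.
Qed.

(** At fixed x the source and its x-derivatives are constants in t, and [oscillation] bounds each by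
    the matching derivatives of Delta h and h. A smooth source thereby inherits the Cauchy estimates
    of h. *)
Lemma family_source_bd (T : R) x0 (r : R) : 0 < T -> exists2 k : R, 0 <= k & forall B h v,
  (forall t, 0 < t < T -> smooth_bd (h t) x0 r B) -> smooth_on v x0 r -> family_eq T x0 r h v ->
  smooth_bd v x0 r (fun j => m%:R * B j.+2 + k * B j).
Proof.
move=> T0; have [k k0 H] := oscillation n2 T0; exists k => // B h v hB vs heq; split => // l x xr.
apply: (H _ _ _ _ _ (family_mild hB vs heq l xr)) => t tT.
  by rewrite addrAC subrr add0r; exact: (smooth_bd_laplacian (hB t tT)).2.
exact: (hB t tT).2.
Qed.

Lemma family_pd_cvg0 (T : R) x0 (r : R) B h : 0 < T ->
  (forall t, 0 < t < T -> smooth_bd (h t) x0 r B) ->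
  (forall x, ball x0 r x -> h t x @[t --> 0^'+] --> (0 : R)) ->
  forall l x, ball x0 r x -> pd l (h t) x @[t --> 0^'+] --> (0 : R).
Proof.
move=> T0 hB h0 l x xr.
have hB' : \forall t \near 0^'+, smooth_bd (h t) x0 r B.
  by near=> t; apply: hB; near: t; exact: near_0_right.
have [_ /(_ l x xr)] := @smooth_bd_lim R m R 0^'+ _ h (cst 0) x0 r B hB' h0.
case: l => [|A l]; first exact.
by rewrite (pd_cst 0 x0 r).2.
Unshelve. all: by end_near. Qed.

End Families.

(** * The homogeneous equation: leading coefficient and flat solutions *)

Section Uniqueness.
Context {R : realType} {m : nat}.
Variable n : nat.
Hypothesis n2 : (2 <= n)%N.
Variables (x0 : 'rV[R]_m) (r : R).
Implicit Types (h : R -> 'rV[R]_m -> R) (x : 'rV[R]_m) (B : nat -> R) (T : R).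

Local Notation nu := (n%:R / 2 : R).
Local Notation z := (fun t : R => t `^ nu).

Lemma family_mild0 T B h :
  (forall t, 0 < t < T -> smooth_bd (h t) x0 r B) -> family_eq n T x0 r h (cst 0) ->
  forall l x, ball x0 r x -> mild n (fun t => pd l (h t) x) (fun t => pd l (laplacian (h t)) x) T.
Proof.
move=> hB heq l x xr.
have := family_mild hB (@smooth_on_cst _ _ 0 x0 r) heq l xr; congr mild; apply/funext => t.
have := (pd_cst 0 x0 r).2 l x; case: l => [_|A l ->] //; last by rewrite add0r.
by rewrite /= add0r.
Qed.

(* The exponents k + 3/4 never meet the resonance n/2. *)
Lemma exponent_neq (k : nat) : 2 * (k%:R + 3 / 4) != n%:R :> R.
Proof.
apply/eqP => E; have : (4 * k + 3)%:R = (2 * n)%:R :> R.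
  by rewrite natrD !natrM -E; field.
by move/eqP; rewrite eqr_nat => /eqP; lia.
Qed.

(** With a = k + 3/4, a bound t^(a-1) on Delta h becomes a bound t^a on h: one power of t is gained
    for two derivatives. Below the resonance z is dominated by t^a, so the contribution of the
    endpoint d has the right order too. *)
Lemma bootstrap_step T B h (k : nat) : 0 < T -> (forall j, 0 <= B j) -> (2 * (k%:R + 3 / 4) < n%:R :> R) ->
  (forall t, 0 < t < T -> smooth_bd (h t) x0 r (fun j => B j * t `^ (k%:R - 1 / 4))) ->
  (forall t, 0 < t < T -> smooth_bd (h t) x0 r B) ->
  (forall x, ball x0 r x -> h t x @[t --> 0^'+] --> (0 : R)) ->
  family_eq n T x0 r h (cst 0) ->
  exists2 D : R, 0 <= D & forall t, 0 < t < T / 2 ->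
    smooth_bd (h t) x0 r (fun j => (D * (B j + B j.+2)) * t `^ (k.+1%:R - 1 / 4)).
Proof.
move=> T0 B0 an hk hB h0 heq.
pose a : R := k%:R + 3 / 4.
have a0 : 0 < a by rewrite /a ltr_wpDl //; lra.
pose d := T / 2; have d0 : 0 < d by rewrite divr_gt0.
have dT : d < T by rewrite /d; lra.
have X0 : 0 < a * (n%:R - 2 * a) by rewrite mulr_gt0 // subr_gt0.
have anu : 0 <= nu - a by rewrite subr_ge0 ler_pdivlMr // mulrC ltW.
(* The first summand comes from - psi, the second from the endpoint through z t <= d^(nu - a)
   t^a. *)
exists (m%:R / (a * (n%:R - 2 * a)) + d `^ (nu - a) / z d).
  by rewrite addr_ge0 ?divr_ge0 ?powR_ge0 // ltW.
move=> t /andP[t0 td]; have tT : 0 < t < T by rewrite t0 (lt_trans td).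
split; first exact: (hB t tT).1.
move=> l x xr.
have h0l := family_pd_cvg0 T0 hB h0 l xr.
have wK s : 0 < s < T -> `|pd l (laplacian (h s)) x| <= m%:R * B (size l).+2 * s `^ (a - 1).
  move=> sT; have := (smooth_bd_laplacian (hk s sT)).2 l x xr; rewrite mulrA.
  by rewrite (_ : a - 1 = k%:R - 1 / 4) // /a; field.
have zd : 0 < z d by rewrite powR_gt0.
have dT' : 0 < d < T by rewrite d0.
have K0 : 0 <= m%:R * B (size l).+2 by rewrite mulr_ge0.
have := comparison_bound n2 T0 (family_mild0 hB heq l xr) wK h0l a0 (negbT (lt_eqF an)) t0 td dT ((hB d dT').2 l x xr).
rewrite (_ : k.+1%:R - 1 / 4 = a); last by rewrite /a -natr1; field.
move/le_trans; apply.
have -> : - (m%:R * B (size l).+2 / (a * (2 * a - n%:R)) * t `^ a) =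
    m%:R / (a * (n%:R - 2 * a)) * B (size l).+2 * t `^ a.
  by rewrite -mulNr mulrAC; congr (_ * _); rewrite -[in RHS](opprB (2 * a)) mulrN invrN mulrN mulNr mulrAC.
have zt : z t <= d `^ (nu - a) * t `^ a.
  have -> : z t = t `^ (nu - a) * t `^ a by rewrite -gt0_powRD // subrK.
  by rewrite ler_wpM2r ?powR_ge0 // ge0_ler_powR ?nnegrE ?(ltW t0) ?(ltW d0) ?(ltW td).
have psid : m%:R * B (size l).+2 / (a * (2 * a - n%:R)) * d `^ a <= 0.
  rewrite -oppr_ge0 -mulNr -mulrN -invrN -mulrN opprB !mulr_ge0 ?powR_ge0 // invr_ge0 ltW //.
have P1 : 0 <= m%:R / (a * (n%:R - 2 * a)) by rewrite divr_ge0 // ltW.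
have P2 : 0 <= d `^ (nu - a) / z d by rewrite divr_ge0 ?powR_ge0.
apply: le_trans (_ : m%:R / (a * (n%:R - 2 * a)) * B (size l).+2 * t `^ a + B (size l) / z d * (d `^ (nu - a) * t `^ a) <= _).
  rewrite lerD2l; apply: le_trans (_ : B (size l) / z d * z t <= _).
    by rewrite ler_wpM2r ?powR_ge0 // ler_pM2r ?invr_gt0 // gerDl.
  by rewrite ler_wpM2l // divr_ge0 ?(ltW zd).
have ta : 0 <= t `^ a by exact: powR_ge0.
have b1 := B0 (size l); have b2 := B0 (size l).+2.
move: P1 P2 ta b1 b2; move: (d `^ (nu - a)) (z d) (t `^ a) (B (size l)) (B (size l).+2) (m%:R / (a * (n%:R - 2 * a))).
move=> y1 y2 y3 y4 y5 y6 P1 P2 ta b1 b2.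
rewrite -subr_ge0 (_ : _ - _ = (y6 * y4 + y1 / y2 * y5) * y3); last by ring.
by rewrite mulr_ge0 // addr_ge0 // mulr_ge0.
Qed.

Lemma bootstrap T B h (k : nat) : 0 < T -> cauchy_seq B -> (forall j, 0 <= B j) ->
  (k = 0%N \/ 2 * (k.-1%:R + 3 / 4) < n%:R :> R) ->
  (forall t, 0 < t < T -> smooth_bd (h t) x0 r B) ->
  (forall x, ball x0 r x -> h t x @[t --> 0^'+] --> (0 : R)) ->
  family_eq n T x0 r h (cst 0) ->
  exists T' B', [/\ 0 < T' <= T, cauchy_seq B', forall j, 0 <= B' j &
    forall t, 0 < t < T' -> smooth_bd (h t) x0 r (fun j => B' j * t `^ (k%:R - 1 / 4))].
Proof.
move=> T0 Bc B0 + hB h0 heq; elim: k => [_|k IH [//|/= kn]].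
  (* At k = 0 the exponent is -1/4, so boundedness is enough: T^(1/4) t^(-1/4) >= 1. *)
  exists T, (fun j => T `^ (1 / 4) * B j); split.
  - by rewrite T0 lexx.
  - by apply: cauchy_seq_scale => //; exact: powR_ge0.
  - by move=> j; rewrite mulr_ge0 // powR_ge0.
  move=> t tT; apply: smooth_bdS (hB t tT) => // j.
  have [t0 tlT] := andP tT.
  rewrite mulrAC ler_peMl // sub0r powRN -ler_pdivrMr ?invr_gt0 ?powR_gt0 // invrK mul1r.
  by rewrite !mul1r ge0_ler_powR ?nnegrE ?(ltW t0) ?(ltW T0) ?(ltW tlT) // invr_ge0.
have kn' : k = 0%N \/ 2 * (k.-1%:R + 3 / 4) < n%:R :> R.
  case: k kn {IH} => [|k] kn; [by left|right => /=].
  by move: kn; rewrite -natr1; lra.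
have [T' [B' [/andP[T'0 T'T] B'c B'0 hk]]] := IH kn'.
pose BB j := B j + B' j.
have BBc : cauchy_seq BB.
  have := cauchy_seq_lin (ler01 : 0 <= 1 :> R) ler01 Bc B'c; congr cauchy_seq.
  by apply/funext => j; rewrite !mul1r.
have BB0 j : 0 <= BB j by rewrite addr_ge0.
have [D D0 H] : exists2 D : R, 0 <= D & forall t, 0 < t < T' / 2 ->
    smooth_bd (h t) x0 r (fun j => (D * (BB j + BB j.+2)) * t `^ (k.+1%:R - 1 / 4)).
  apply: bootstrap_step => //.
  - move=> t tT'; apply: smooth_bdS (hk t tT') => // j; rewrite ler_wpM2r ?powR_ge0 // lerDr //.
  - move=> t /andP[t0 tT']; apply: smooth_bdS (hB t _) => // [j|]; first by rewrite lerDl.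
    by rewrite t0 (lt_le_trans tT').
  - by move=> t x /andP[t0 tT'] xr; apply: heq => //; rewrite t0 (lt_le_trans tT').
exists (T' / 2), (fun j => D * (BB j + BB j.+2)); split => //.
- by rewrite divr_gt0 //= ler_pdivrMr // (le_trans T'T) // ler_peMr ?(ltW T0) // ler1n.
- have := cauchy_seq_scale D0 (cauchy_seq_lin (ler01 : 0 <= 1 :> R) ler01 BBc (cauchy_seq_shift 2 BBc)).
  by congr cauchy_seq; apply/funext => j; rewrite !mul1r addn2.
- by move=> j; rewrite mulr_ge0 // addr_ge0.
Qed.

(** After the bootstrap one comparison beyond the resonance gives h / z a limit at every x. Bounds
    on h / z uniform in t then let [smooth_bd_lim] transfer Cauchy estimates to the limit. *)
Lemma family_leading T B h : 0 < T -> cauchy_seq B -> (forall j, 0 <= B j) ->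
  (forall t, 0 < t < T -> smooth_bd (h t) x0 r B) ->
  (forall x, ball x0 r x -> h t x @[t --> 0^'+] --> (0 : R)) ->
  family_eq n T x0 r h (cst 0) ->
  exists T' B', [/\ 0 < T' <= T, cauchy_seq B', forall j, 0 <= B' j,
    forall t, 0 < t < T' -> smooth_bd (h t) x0 r (fun j => B' j * z t) &
    exists al, smooth_bd al x0 r B' /\
      forall l x, ball x0 r x -> pd l (h t) x / z t @[t --> 0^'+] --> pd l al x].
Proof.
(* With k = n./2 the exponent k + 3/4 is the first of the sequence beyond n/2: 2 (k - 1 + 3/4) < n <
   2 (k + 3/4). *)
move=> T0 Bc B0 hB h0 heq; pose k := n./2.
have n0 := odd_double_half n; rewrite -/k in n0.
have kn : k = 0%N \/ 2 * (k.-1%:R + 3 / 4) < n%:R :> R.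
  right; have k0 : (0 < k)%N by rewrite /k half_gt0.
  rewrite -subn1 natrB // -n0 natrD -mul2n natrM; have := ler0n R (odd n); lra.
have nk : n%:R < 2 * (k%:R + 3 / 4) :> R.
  have on : (odd n)%:R <= 1 :> R by rewrite lern1 leq_b1.
  by rewrite -n0 natrD -mul2n natrM; lra.
have [T1 [B1 [/andP[T10 T1T] B1c B10 hk]]] := bootstrap T0 Bc B0 kn hB h0 heq.
pose a : R := k%:R + 3 / 4.
have a0 : 0 < a by rewrite /a ltr_wpDl //; lra.
have an : 2 * a != n%:R by exact: exponent_neq.
have hB1 t : 0 < t < T1 -> smooth_bd (h t) x0 r B.
  by move=> /andP[t0 tT]; apply: hB; rewrite t0 (lt_le_trans tT).
have heq1 : family_eq n T1 x0 r h (cst 0).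
  by move=> t x /andP[t0 tT] xr; apply: heq => //; rewrite t0 (lt_le_trans tT).
have h0l l x (xr : ball x0 r x) := family_pd_cvg0 T10 hB1 h0 l xr.
have wK l x s : ball x0 r x -> 0 < s < T1 ->
    `|pd l (laplacian (h s)) x| <= m%:R * B1 (size l).+2 * s `^ (a - 1).
  move=> xr sT; have := (smooth_bd_laplacian (hk s sT)).2 l x xr; rewrite mulrA.
  by rewrite (_ : a - 1 = k%:R - 1 / 4) // /a; field.
have K0 (l : seq 'I_m) : 0 <= m%:R * B1 (size l).+2 by rewrite mulr_ge0.
pose d := T1 / 2; have d0 : 0 < d by rewrite divr_gt0.
have dT : d < T1 by rewrite /d; lra.
have dT' : 0 < d < T1 by rewrite d0.
have zd : 0 < z d by rewrite powR_gt0.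
have X0 : 0 < a * (2 * a - n%:R) by rewrite mulr_gt0 // subr_gt0.
pose B' j := (B j + m%:R * B1 j.+2 / (a * (2 * a - n%:R)) * d `^ a) / z d.
have B'0 j : 0 <= B' j.
  rewrite divr_ge0 ?(ltW zd) // addr_ge0 // mulr_ge0 ?powR_ge0 // divr_ge0 ?(ltW X0) // mulr_ge0 //.
have hB' t : 0 < t < d -> smooth_bd (h t) x0 r (fun j => B' j * z t).
  move=> /andP[t0 td]; have tT : 0 < t < T1 by rewrite t0 (lt_trans td).
  split; first exact: (hB1 t tT).1.
  move=> l x xr.
  have := comparison_bound n2 T10 (family_mild0 hB1 heq1 l xr) (fun s sT => wK l x s xr sT) (h0l l x xr) a0 an t0 td dT ((hB1 d dT').2 l x xr).
  move/le_trans; apply.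
  rewrite gerDr oppr_le0 mulr_ge0 ?powR_ge0 // divr_ge0 ?(ltW X0) //.
have dT2 : d <= T by apply: le_trans (ltW dT) T1T.
have f_bd : \forall t \near 0^'+, smooth_bd ((z t)^-1 *: h t) x0 r B'.
  near=> t; have td : 0 < t < d by near: t; exact: near_0_right.
  have zt : 0 < z t by rewrite powR_gt0 //; case/andP: td.
  have [s1 s2] := pd_scale (z t)^-1 (hB' t td).1; split => // l x xr.
  rewrite s2 // normrM normfV (gtr0_norm zt) ler_pdivrMl // mulrC.
  exact: (hB' t td).2.
have f_cvg l x : ball x0 r x -> cvg (pd l (h t) x / z t @[t --> 0^'+]).
  move=> xr.
  have [al H] := comparison_leading n2 T10 (K0 l) (family_mild0 hB1 heq1 l xr) (fun s sT => wK l x s xr sT) (h0l l x xr) a0 an nk.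
  by apply/cvg_ex; exists al; apply: (comparison_cvg T10 (K0 l) a0 nk H).
pose al x := lim (h t x / z t @[t --> 0^'+]).
have [al1 al2] := @smooth_bd_lim R m R 0^'+ _ (fun t => (z t)^-1 *: h t) al x0 r B' f_bd
  (fun x xr => cvg_trans (near_eq_cvg (filterS (fun t _ => mulrC _ _) (near_0_right T0))) (f_cvg [::] x xr)).
exists d, B'; split => //.
- by rewrite d0.
- have c1 := cauchy_seq_shift 2 B1c.
  have e0 : 0 <= (z d)^-1 by rewrite invr_ge0 ltW.
  have e1 : 0 <= m%:R / (a * (2 * a - n%:R)) * d `^ a / z d.
    by rewrite !mulr_ge0 ?powR_ge0 // ?invr_ge0 ltW.
  have := cauchy_seq_lin e0 e1 Bc c1; congr cauchy_seq; apply/funext => j.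
  by rewrite /B' addn2; field; rewrite !gt_eqF //; move: X0; rewrite pmulr_rgt0.
exists al; split => // l x xr.
have := al2 l x xr; apply: cvg_trans; apply: near_eq_cvg; near=> t.
have td : 0 < t < d by near: t; exact: near_0_right.
by rewrite (pd_scale (z t)^-1 (hB' t td).1).2 // mulrC.
Unshelve. all: by end_near. Qed.

Lemma family_flat T M C h : 0 < T -> 0 <= M -> 0 <= C ->
  (forall t, 0 < t < T -> smooth_bd (h t) x0 r (fun j => cauchy_bd M C j * z t)) ->
  family_eq n T x0 r h (cst 0) ->
  (forall l x, ball x0 r x -> pd l (h t) x / z t @[t --> 0^'+] --> (0 : R)) ->
  exists2 T', 0 < T' & forall t x, 0 < t < T' -> ball x0 r x -> h t x = 0.
Proof.
move=> T0 M0 C0 hB heq hz.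
have z_cvg : z t @[t --> 0^'+] --> (0 : R) by apply: powR_cvg0; exact: nu_gt0.
have h0 l x : ball x0 r x -> pd l (h t) x @[t --> 0^'+] --> (0 : R).
  move=> xr; rewrite -[X in _ --> X](mul0r 0); apply: cvg_trans (cvgM (hz l x xr) z_cvg).
  apply: near_eq_cvg; near=> t.
  have t0 : 0 < t by near: t; exact: nbhs_right_gt.
  by rewrite /= divfK // gt_eqF // powR_gt0.
(* Passing from k to k + 1 multiplies by m, shifts j by 2 and divides by a (2 a - n) >= 2 (k + 1)^2,
   where a = nu + k + 1. *)
pose Bk k j := M * m%:R ^+ k * (C ^+ (j + 2 * k) * (j + 2 * k)`!%:R) / (2 ^+ k * (k`! * k`!)%:R).
have zT t : 0 < t < T -> z t <= z T.
  by move=> /andP[t0 tT]; rewrite ltW // z_mono.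
have hBT t : 0 < t < T -> smooth_bd (h t) x0 r (fun j => cauchy_bd M C j * z T).
  move=> tT; apply: smooth_bdS (hB t tT) => // j.
  by rewrite ler_wpM2l ?zT // cauchy_bd_ge0.
have H k t : 0 < t < T -> smooth_bd (h t) x0 r (fun j => Bk k j * t `^ (nu + k%:R)).
  move=> tT; split; first exact: (hB t tT).1.
  move: t tT; elim: k => [|k IH] t tT l x xr.
    have := (hB t tT).2 l x xr; rewrite /Bk /cauchy_bd addr0 muln0 addn0 !expr0 fact0.
    by rewrite mulr1 mul1r muln1 divr1.
  pose a : R := nu + k.+1%:R.
  have nun : 2 * nu = n%:R by rewrite mulrC divfK // pnatr_eq0.
  have a0 : 0 < a by rewrite ltr_pwDl // nu_gt0.
  have an : n%:R < 2 * a by rewrite /a mulrDr nun ltrDl mulr_gt0 // ltr0n.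
  have an' : 2 * a != n%:R by rewrite gt_eqF.
  have Bk0 : 0 <= m%:R * Bk k (size l).+2.
    have e1 : 0 <= M * m%:R ^+ k by rewrite mulr_ge0 // exprn_ge0.
    have e2 : 0 <= C ^+ ((size l).+2 + 2 * k) * ((size l).+2 + 2 * k)`!%:R.
      by apply: mulr_ge0 => //; exact: exprn_ge0.
    have e3 : 0 <= 2 ^+ k * (k`! * k`!)%:R :> R by rewrite mulr_ge0 // exprn_ge0.
    exact: mulr_ge0 (ler0n _ _) (divr_ge0 (mulr_ge0 e1 e2) e3).
  have wK s : 0 < s < T -> `|pd l (laplacian (h s)) x| <= m%:R * Bk k (size l).+2 * s `^ (a - 1).
    move=> sT; have hs : smooth_bd (h s) x0 r (fun j => Bk k j * s `^ (nu + k%:R)).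
      by split; [exact: (hB s sT).1 | move=> l' x' x'r; exact: IH].
    have := (smooth_bd_laplacian hs).2 l x xr; rewrite mulrA.
    by rewrite (_ : a - 1 = nu + k%:R) // /a -natr1; ring.
  have := comparison_flat n2 T0 Bk0 (family_mild0 hBT heq l xr) wK (h0 l x xr) a0 an' an (hz l x xr) tT.
  move/le_trans; apply; rewrite ler_wpM2r ?powR_ge0 //.
  have D0 : 0 < 2 * (k.+1%:R * k.+1%:R) :> R by rewrite !mulr_gt0 // ltr0n.
  have aa : 2 * (k.+1%:R * k.+1%:R) <= a * (2 * a - n%:R).
    have -> : 2 * a - n%:R = 2 * k.+1%:R by rewrite /a mulrDr nun addrAC subrr add0r.
    have k0 : 0 < k.+1%:R :> R by rewrite ltr0n.
    by rewrite [leRHS]mulrCA ler_pM2l // ler_pM2r // lerDr ltW // nu_gt0.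
  apply: le_trans (_ : m%:R * Bk k (size l).+2 / (2 * (k.+1%:R * k.+1%:R)) <= _).
    by rewrite ler_wpM2l // lef_pV2 ?posrE // (lt_le_trans D0).
  rewrite le_eqVlt; apply/orP; left; apply/eqP; rewrite /Bk.
  have -> : ((size l).+2 + 2 * k = size l + 2 * k.+1)%N by rewrite mulnS addnA addn2.
  rewrite !factS !natrM !exprS; field.
  rewrite !pnatr_eq0 -!lt0n !fact_gt0 /= expf_neq0 ?pnatr_eq0 //=.
  by rewrite nat1r pnatr_eq0.
(* Since (2 k)! <= 4^k (k!)^2, the k-th bound without x-derivatives is at most M z (q t)^k, which
   tends to 0 once q t < 1. *)
pose q := 2 * m%:R * C ^+ 2.
have q0 : 0 <= q by rewrite !mulr_ge0 // exprn_ge0.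
exists (Num.min T (q + 1)^-1).
  by rewrite lt_min T0 invr_gt0 ltr_wpDl.
move=> t x /andP[t0]; rewrite lt_min => /andP[tT tq] xr.
have tT' : 0 < t < T by rewrite t0.
have qt : `|q * t| < 1.
  rewrite ger0_norm ?mulr_ge0 ?(ltW t0) //.
  move: tq; rewrite -(ltr_pM2l (_ : 0 < q + 1)) ?ltr_wpDl // divff ?gt_eqF ?ltr_wpDl //.
  by apply: le_lt_trans; rewrite ler_wpM2r ?(ltW t0) // lerDl.
have lim0 : (M * z t) * (q * t) ^+ k @[k --> \oo] --> (0 : R).
  by rewrite -[X in _ --> X](mulr0 (M * z t)); apply: cvgM; [exact: cvg_cst|exact: cvg_expr].
apply/eqP; rewrite -normr_eq0 eq_le normr_ge0 andbT.
have K k : `|h t x| <= (M * z t) * (q * t) ^+ k.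
  have := (H k t tT').2 [::] x xr; move/le_trans; apply.
  have F0 : 0 < (k`! * k`!)%:R :> R by rewrite ltr0n muln_gt0 fact_gt0.
  have P0 : 0 < 2 ^+ k * (k`! * k`!)%:R :> R by rewrite mulr_gt0 ?exprn_gt0.
  rewrite gt0_powRD // powR_mulrn ?(ltW t0) // /Bk /= add0n.
  apply: le_trans (_ : (M * m%:R ^+ k * C ^+ (2 * k) * 2 ^+ k) * (z t * t ^+ k) <= _).
    rewrite ler_wpM2r ?mulr_ge0 ?powR_ge0 ?exprn_ge0 ?(ltW t0) //.
    rewrite ler_pdivrMr // -!mulrA ler_wpM2l // ler_wpM2l ?exprn_ge0 // ler_wpM2l ?exprn_ge0 //.
    rewrite mulrA -exprD -natrX -natrM ler_nat addnn -mul2n; have := leq_fact_add k k.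
    by rewrite addnn -mul2n.
  by rewrite le_eqVlt; apply/orP; left; apply/eqP; rewrite /q [C ^+ (2 * k)]exprM !exprMn; ring.
apply/ler_addgt0Pr => e e0; rewrite add0r.
move/cvgrPdist_le : lim0 => /(_ e e0) H1; have [k Hk] := filter_ex H1.
by apply: le_trans (K k) _; apply: le_trans (ler_norm _) _; rewrite -normrN -sub0r.
Unshelve. all: by end_near. Qed.

End Uniqueness.

(** * Power series in one variable *)

Section PowerSeries.
Context {R : realType}.
Implicit Types (a b : nat -> R) (t A q : R).

Definition psum a t : R := limn (pseries a t).

Lemma pseries_bd_cvg a A q t : 0 <= q -> (forall k, `|a k| <= A * q ^+ k) -> q * `|t| < 1 ->
  cvgn (pseries a t).
Proof.
move=> q0 aA qt; apply: normed_cvg.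
apply: (@series_le_cvg _ _ (geometric A (q * `|t|))).
- by move=> k; exact: normr_ge0.
- move=> k /=; rewrite mulr_ge0 ?exprn_ge0 ?mulr_ge0 //.
  by have := aA 0%N; rewrite expr0 mulr1; apply: le_trans.
- move=> k /=; rewrite normrM normrX exprMn mulrA ler_wpM2r ?exprn_ge0 //.
- by apply: is_cvg_geometric_series; rewrite ger0_norm ?mulr_ge0.
Qed.

Lemma pseries_le a A q t N : 0 <= q -> (forall k, `|a k| <= A * q ^+ k) -> q * `|t| <= 2^-1 ->
  `|pseries a t N| <= 2 * A.
Proof.
move=> q0 aA qt; have qt1 : q * `|t| < 1 by apply: le_lt_trans qt _; lra.
have A0 : 0 <= A by have := aA 0%N; rewrite expr0 mulr1; apply: le_trans.
rewrite /pseries /series /=; apply: le_trans (ler_norm_sum _ _ _) _.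
apply: le_trans (_ : \sum_(0 <= k < N) A * (q * `|t|) ^+ k <= _).
  by apply: ler_sum => k _; rewrite normrM normrX exprMn mulrA ler_wpM2r ?exprn_ge0.
rewrite -mulr_sumr mulrC ler_wpM2r // big_mkord.
have Q0 : 0 <= q * `|t| by rewrite mulr_ge0.
rewrite -(ler_pM2l (_ : 0 < 1 - q * `|t|)) ?subr_gt0 //.
apply: le_trans (_ : 1 <= _); last lra.
by have := subrX1 (q * `|t|) N; have := exprn_ge0 N Q0; lra.
Qed.

Lemma pseries_diffs_bd a A q : 0 <= q -> (forall k, `|a k| <= A * q ^+ k) ->
  forall k, `|pseries_diffs a k| <= (A * q) * (2 * q) ^+ k.
Proof.
move=> q0 aA k; rewrite /pseries_diffs normrM normr_nat.
apply: le_trans (_ : 2 ^+ k * (A * q ^+ k.+1) <= _).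
  by apply: ler_pM => //; rewrite -natrX ler_nat; exact: ltn_expl.
by rewrite exprMn exprS le_eqVlt; apply/orP; left; apply/eqP; ring.
Qed.

(** Convergence of the series and of its first two formal derivatives is needed at some K beyond
    |t|. Each formal derivative doubles the rate q, whence the factor 4. *)
Lemma is_derive_psum a A q t : 0 <= q -> (forall k, `|a k| <= A * q ^+ k) -> 4 * q * `|t| < 1 ->
  is_derive t 1 (psum a) (psum (pseries_diffs a) t).
Proof.
move=> q0 aA qt.
have d1 := pseries_diffs_bd q0 aA.
have q20 : 0 <= 2 * q by rewrite mulr_ge0.
have d2 := pseries_diffs_bd q20 d1.
have [K tK qK] : exists2 K : R, `|t| < `|K| & 4 * q * `|K| < 1.
  have [q00|qn0] := eqVneq q 0.
    exists (`|t| + 1); first by rewrite [ltRHS]ger0_norm ?addr_ge0 // ltrDl.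
    by rewrite q00 mulr0 mul0r.
  have q40 : 0 < 4 * q by rewrite mulr_gt0 // lt0r qn0.
  exists ((`|t| + (4 * q)^-1) / 2).
    rewrite [ltRHS]ger0_norm ?divr_ge0 ?addr_ge0 ?invr_ge0 ?(ltW q40) //.
    have : `|t| < (4 * q)^-1 by rewrite -(ltr_pM2l q40) divff ?gt_eqF.
    lra.
  rewrite [X in _ * X]ger0_norm ?divr_ge0 ?addr_ge0 ?invr_ge0 ?(ltW q40) //.
  by rewrite mulrA mulrDr divff ?gt_eqF //; move: qt; lra.
have K0 : 0 <= q * `|K| by rewrite mulr_ge0.
apply: pseries_snd_diffs (tK).
- by apply: pseries_bd_cvg aA _ => //; move: qK K0; rewrite -!mulrA; move: (q * `|K|) => y; lra.
- by apply: pseries_bd_cvg d1 _ => //; move: qK K0; rewrite -!mulrA; move: (q * `|K|) => y; lra.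
- apply: pseries_bd_cvg d2 _; first by rewrite mulr_ge0.
  by move: qK K0; rewrite -!mulrA; move: (q * `|K|) => y; lra.
Qed.

Lemma pseries_lin a b (c d : R) t u v : pseries a t N @[N --> \oo] --> u ->
  pseries b t N @[N --> \oo] --> v ->
  pseries (fun k => c * a k + d * b k) t N @[N --> \oo] --> c * u + d * v.
Proof.
move=> ca cb.
have -> : pseries (fun k => c * a k + d * b k) t =
    (fun N => c * pseries a t N + d * pseries b t N).
  apply/funext => N; rewrite /pseries /series /= !mulr_sumr -big_split /=.
  by apply: eq_bigr => k _; ring.
by apply: cvgD; apply: cvgM => //; exact: cvg_cst.
Qed.

Lemma psum_lin a b (c d : R) t : cvgn (pseries a t) -> cvgn (pseries b t) ->
  psum (fun k => c * a k + d * b k) t = c * psum a t + d * psum b t.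
Proof. by move=> ca cb; apply/cvg_lim => //; exact: pseries_lin. Qed.

Lemma psum_shift a t : cvgn (pseries (fun k => a k.+1) t) ->
  psum a t = a 0%N + t * psum (fun k => a k.+1) t.
Proof.
move=> ca; apply/cvg_lim => //; rewrite -(cvg_shiftS _ _).
have -> : [sequence pseries a t n.+1]_n = (fun N => a 0%N + t * pseries (fun k => a k.+1) t N).
  apply/funext => N; rewrite /pseries /series /= big_nat_recl //= expr0 mulr1; congr (_ + _).
  by rewrite mulr_sumr; apply: eq_bigr => k _; rewrite exprS; ring.
apply: cvgD; first exact: cvg_cst.
by apply: cvgM => //; exact: cvg_cst.
Qed.

End PowerSeries.

(** * The radial operator on power series *)

Section EulerSeries.
Context {R : realType}.
Variable n : nat.
Variables (a : nat -> R) (A q : R).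
Hypotheses (q0 : 0 <= q) (aA : forall k, `|a k| <= A * q ^+ k).
Implicit Type t : R.

Local Notation nu := (n%:R / 2 : R).
Local Notation z := (fun t : R => t `^ nu).

Let d1 := pseries_diffs_bd q0 aA.
Let q20 : 0 <= 2 * q. Proof. by rewrite mulr_ge0. Qed.

Lemma psum_derive1 t : 8 * q * `|t| < 1 ->
  derive1 (psum a) t = psum (pseries_diffs a) t.
Proof.
move=> qt; rewrite derive1E; have qt' : 4 * q * `|t| < 1.
  have : 0 <= q * `|t| by rewrite mulr_ge0.
  by move: qt; rewrite -!mulrA; move: (q * `|t|) => y; lra.
by have [_] := is_derive_psum q0 aA qt'.
Qed.

Lemma near_lt_inv t (c : R) : c * `|t| < 1 -> \forall s \near t, c * `|s| < 1.
Proof.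
move=> ct; have : (fun s => c * `|s|) @ t --> c * `|t|.
  by apply: cvgM; [exact: cvg_cst | apply: cvg_norm; exact: cvg_id].
by move/cvgr_lt => /(_ _ ct).
Qed.

Lemma psum_twice t : 8 * q * `|t| < 1 -> twice (psum a) t /\
  derive1 (derive1 (psum a)) t = psum (pseries_diffs (pseries_diffs a)) t.
Proof.
move=> qt; have y0 : 0 <= q * `|t| by rewrite mulr_ge0.
have qt1 : 4 * q * `|t| < 1 by move: qt y0; rewrite -!mulrA; move: (q * `|t|) => y; lra.
have qt2 : 4 * (2 * q) * `|t| < 1 by move: qt y0; rewrite -!mulrA; move: (q * `|t|) => y; lra.
have D : is_derive t 1 (derive1 (psum a)) (psum (pseries_diffs (pseries_diffs a)) t).
  apply: near_eq_is_derive (is_derive_psum q20 d1 qt2).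
  by near=> s; rewrite psum_derive1 //; near: s; exact: near_lt_inv.
have [D1 D2] := D; split; last by rewrite derive1E.
by split; [have [] := is_derive_psum q0 aA qt1 | exact: D1].
Unshelve. all: by end_near. Qed.

(** Multiplication by t shifts the second derivative back, so that the operator acts
    coefficientwise. The value c = 2 - n gives L, and c = 2 + n the operator that L becomes on
    multiples of z. *)
Lemma psum_second_order t (c : R) : 8 * q * `|t| < 1 ->
  2 * t * psum (pseries_diffs (pseries_diffs a)) t + c * psum (pseries_diffs a) t =
  psum (fun k => k.+1%:R * (2 * k%:R + c) * a k.+1) t.
Proof.
move=> qt; have y0 : 0 <= q * `|t| by rewrite mulr_ge0.
have d2 := pseries_diffs_bd q20 d1.
have c1 : cvgn (pseries (pseries_diffs a) t).
  by apply: pseries_bd_cvg d1 _ => //; move: qt y0; rewrite -!mulrA; move: (q * `|t|) => y; lra.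
have c2 : cvgn (pseries (pseries_diffs (pseries_diffs a)) t).
  apply: pseries_bd_cvg d2 _; first by rewrite mulr_ge0.
  by move: qt y0; rewrite -!mulrA; move: (q * `|t|) => y; lra.
(* The coefficients of t times the second derivative. *)
pose b k := k%:R * pseries_diffs a k.
have bE : (fun k => b k.+1) = pseries_diffs (pseries_diffs a) by apply/funext.
have cb : cvgn (pseries b t).
  have -> : pseries b t = (fun N => t * pseries (pseries_diffs (pseries_diffs a)) t N.-1).
    apply/funext => -[|N]; rewrite /pseries /series /=; first by rewrite !big_nil mulr0.
    rewrite big_nat_recl //= /b mul0r mul0r add0r mulr_sumr; apply: eq_bigr => k _.
    by rewrite exprS /pseries_diffs; ring.
  apply: is_cvgM; first exact: is_cvg_cst.
  by apply/cvg_ex; have /cvg_ex[l cl] := c2; exists l; rewrite -(cvg_shiftS (fun N => _ N.-1)).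
have sb := @psum_shift R b t; rewrite bE in sb; have {}sb := sb c2.
have b00 : b 0%N = 0 by rewrite /b mul0r.
rewrite b00 add0r in sb.
rewrite -mulrA -sb -psum_lin //; congr (psum _ t); apply/funext => k.
by rewrite /b /pseries_diffs; ring.
Qed.

Lemma euler_psum t : 8 * q * `|t| < 1 -> twice (psum a) t /\
  euler_op n (psum a) t = psum (fun k => k.+1%:R * (2 * k.+1%:R - n%:R) * a k.+1) t.
Proof.
move=> qt; have [h1 h2] := psum_twice qt; split => //.
rewrite /euler_op h2 psum_derive1 // psum_second_order //; congr (psum _ t).
by apply/funext => k; rewrite -[k.+1%:R]natr1; ring.
Qed.

End EulerSeries.

(** * The radial operator on products with z and on logarithms *)

Section EulerProducts.
Context {R : realType}.
Variable n : nat.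
Implicit Type t : R.

Local Notation nu := (n%:R / 2 : R).
Local Notation z := (fun t : R => t `^ nu).

Lemma twice_is_derive (Y : R -> R) t : twice Y t ->
  is_derive t 1 Y (derive1 Y t) /\ is_derive t 1 (derive1 Y) (derive1 (derive1 Y) t).
Proof. by move=> [h1 h2]; rewrite !derive1E; split; exact: derivableP. Qed.

(* [z] solves the homogeneous equation, so only derivatives of [Y] survive. *)
Lemma euler_zmul (Y : R -> R) (T t : R) : (forall s, 0 < s < T -> twice Y s) -> 0 < t < T ->
  twice (fun s => z s * Y s) t /\
  euler_op n (fun s => z s * Y s) t =
    z t * (2 * t * derive1 (derive1 Y) t + (2 + n%:R) * derive1 Y t).
Proof.
move=> Y2 tT; have [t0 tlT] := andP tT.
have D1 s : 0 < s < T -> is_derive s 1 (fun s => z s * Y s) (z s * derive1 Y s + Y s * (nu * s `^ (nu - 1))).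
  move=> sT; have [s0 _] := andP sT.
  exact: is_deriveM (is_derive1_powR nu s0) (twice_is_derive (Y2 s sT)).1.
have D1' s : 0 < s < T -> derive1 (fun s => z s * Y s) s = z s * derive1 Y s + Y s * (nu * s `^ (nu - 1)).
  by move=> sT; rewrite derive1E; have [_] := D1 s sT.
pose D2v := (z t * derive1 (derive1 Y) t + derive1 Y t * (nu * t `^ (nu - 1))) +
  (Y t * (nu * ((nu - 1) * t `^ (nu - 1 - 1))) + (nu * t `^ (nu - 1)) * derive1 Y t).
have D2 : is_derive t 1 (derive1 (fun s => z s * Y s)) D2v.
  have h : is_derive t 1 (fun s => z s * derive1 Y s + Y s * (nu * s `^ (nu - 1))) D2v.
    apply: is_deriveD.
      exact: is_deriveM (is_derive1_powR nu t0) (twice_is_derive (Y2 t tT)).2.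
    apply: is_deriveM (twice_is_derive (Y2 t tT)).1 _.
    exact: is_deriveZ (is_derive1_powR (nu - 1) t0).
  apply: near_eq_is_derive h; near=> s; rewrite D1' //; near: s; exact: near_in_oo.
have [e1 e2] := D2; split.
  by split; [have [] := D1 t tT | exact: e1].
rewrite /euler_op D1' // derive1E e2 /D2v.
rewrite (gt0_powRB1 nu t0) (gt0_powRB1 (nu - 1) t0).
have nuE : n%:R = 2 * nu by rewrite mulrC divfK // pnatr_eq0.
rewrite nuE; move: (t `^ (nu - 1 - 1)) (derive1 (derive1 Y) t) (derive1 Y t) (Y t) => y1 y2 y3 y4.
field.
Unshelve. all: by end_near. Qed.

(** Differentiating the logarithm produces n A / t + 4 A'. In the application B is the series
    weighted by q_k, built to cancel these terms except for n A(0) / t. *)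
Lemma twice_log (A B : R -> R) (T t : R) : (forall s, 0 < s < T -> twice A s) ->
  (forall s, 0 < s < T -> twice B s) -> 0 < t < T ->
  let Y := fun s => ln s * A s - B s in
  twice Y t /\
  2 * t * derive1 (derive1 Y) t + (2 + n%:R) * derive1 Y t =
    n%:R * A t / t + 4 * derive1 A t +
    ln t * (2 * t * derive1 (derive1 A) t + (2 + n%:R) * derive1 A t) -
    (2 * t * derive1 (derive1 B) t + (2 + n%:R) * derive1 B t).
Proof.
move=> A2 B2 tT Y; have [t0 tlT] := andP tT.
have D1 s : 0 < s < T -> is_derive s 1 Y (ln s * derive1 A s + A s * s^-1 - derive1 B s).
  move=> sT; have [s0 _] := andP sT.
  apply: is_deriveB (twice_is_derive (B2 s sT)).1.
  exact: is_deriveM (is_derive1_ln s0) (twice_is_derive (A2 s sT)).1.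
have D1' s : 0 < s < T -> derive1 Y s = ln s * derive1 A s + A s * s^-1 - derive1 B s.
  by move=> sT; rewrite derive1E; have [_] := D1 s sT.
pose D2v := (ln t * derive1 (derive1 A) t + derive1 A t * t^-1) +
  (A t * (- t ^- 2) + t^-1 * derive1 A t) - derive1 (derive1 B) t.
have D2 : is_derive t 1 (derive1 Y) D2v.
  have h : is_derive t 1 (fun s => ln s * derive1 A s + A s * s^-1 - derive1 B s) D2v.
    apply: is_deriveB (twice_is_derive (B2 t tT)).2.
    apply: is_deriveD.
      exact: is_deriveM (is_derive1_ln t0) (twice_is_derive (A2 t tT)).2.
    apply: is_deriveM (twice_is_derive (A2 t tT)).1 _.
    apply: is_derive_eq; first by apply: is_deriveV; rewrite gt_eqF.
    by rewrite [LHS]mulr1.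
  apply: near_eq_is_derive h; near=> s; rewrite D1' //; near: s; exact: near_in_oo.
have [e1 e2] := D2; split.
  by split; [have [] := D1 t tT | exact: e1].
rewrite D1' // derive1E e2 /D2v.
move: (derive1 (derive1 A) t) (derive1 A t) (A t) (derive1 (derive1 B) t) (derive1 B t) (ln t) => y1 y2 y3 y4 y5 y6.
by field; rewrite gt_eqF.
Unshelve. all: by end_near. Qed.

End EulerProducts.

(** * Power series in t with coefficients depending on x *)

Section SeriesFamilies.
Context {R : realType} {m : nat}.
Implicit Types (x : 'rV[R]_m) (b : nat -> 'rV[R]_m -> R) (A C q t r : R).

(** C is common to all coefficients and only q^k varies with k, so that sums over k keep Cauchy
    estimates in x. *)
Definition series_bd b x0 r A C q :=
  forall k, smooth_bd (b k) x0 r (fun j => cauchy_bd A C j * q ^+ k).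

Lemma series_bd_coef b x0 r A C q l x : series_bd b x0 r A C q -> ball x0 r x ->
  forall k, `|pd l (b k) x| <= cauchy_bd A C (size l) * q ^+ k.
Proof. by move=> bB xr k; exact: (bB k).2. Qed.

Lemma series_bd_coef0 b x0 r A C q x : series_bd b x0 r A C q -> ball x0 r x ->
  forall k, `|b k x| <= A * q ^+ k.
Proof.
move=> bB xr k; have := (bB k).2 [::] x xr.
by rewrite /cauchy_bd expr0 fact0 mulr1 mulr1.
Qed.

Lemma psum_family b x0 r A C q t : 0 <= A -> 0 <= C -> 0 <= q -> q * `|t| <= 2^-1 ->
  series_bd b x0 r A C q ->
  smooth_bd (fun x => psum (fun k => b k x) t) x0 r (cauchy_bd (2 * A) C) /\
  forall l x, ball x0 r x -> cvgn (pseries (fun k => pd l (b k) x) t) /\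
    pd l (fun x => psum (fun k => b k x) t) x = psum (fun k => pd l (b k) x) t.
Proof.
move=> A0 C0 q0 qt bB.
have qt1 : q * `|t| < 1 by apply: le_lt_trans qt _; lra.
have cB l x : ball x0 r x -> cvgn (pseries (fun k => pd l (b k) x) t).
  by move=> xr; apply: pseries_bd_cvg (series_bd_coef l bB xr) qt1.
pose fN N := \sum_(0 <= k < N) t ^+ k *: b k.
have fNE N : smooth_on (fN N) x0 r /\ forall l x, ball x0 r x ->
    pd l (fN N) x = pseries (fun k => pd l (b k) x) t N.
  have [h1 h2] := pd_sum (index_iota 0 N) xpredT (fun k => (pd_scale (t ^+ k) (bB k).1).1).
  split => // l x xr; rewrite h2 //; apply: eq_bigr => k _.
  by rewrite (pd_scale (t ^+ k) (bB k).1).2 // mulrC.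
have fB : \forall N \near \oo, smooth_bd (fN N) x0 r (cauchy_bd (2 * A) C).
  apply: nearW => N; have [h1 h2] := fNE N; split => // l x xr; rewrite h2 //.
  rewrite [cauchy_bd _ _ _](_ : _ = 2 * cauchy_bd A C (size l)); last by rewrite /cauchy_bd [RHS]mulrA.
  exact: pseries_le (series_bd_coef l bB xr) qt.
have fC x : ball x0 r x -> fN N x @[N --> \oo] --> psum (fun k => b k x) t.
  move=> xr; have -> : (fun N => fN N x) = pseries (fun k => b k x) t.
    by apply/funext => N; exact: ((fNE N).2 [::] x xr).
  exact: (cB [::] x xr).
have [h1 h2] := smooth_bd_lim fB fC.
split => // l x xr; split; first exact: cB.
apply/esym/cvg_lim => //; apply: cvg_trans (h2 l x xr); apply: near_eq_cvg; apply: nearW => N.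
exact: (fNE N).2.
Unshelve. all: by end_near. Qed.

Lemma laplacian_psum_family b x0 r A C q t : 0 <= A -> 0 <= C -> 0 <= q -> q * `|t| <= 2^-1 ->
  series_bd b x0 r A C q -> forall x, ball x0 r x ->
  pseries (fun k => laplacian (b k) x) t N @[N --> \oo] -->
    laplacian (fun x => psum (fun k => b k x) t) x.
Proof.
move=> A0 C0 q0 qt bB x xr; have [_ H] := psum_family A0 C0 q0 qt bB.
have -> : pseries (fun k => laplacian (b k) x) t =
    (fun N => \sum_(i < m) pseries (fun k => pd [:: i; i] (b k) x) t N).
  apply/funext => N; rewrite /pseries /series /= exchange_big /=; apply: eq_bigr => k _.
  by rewrite /laplacian mulr_suml.
apply: cvg_sum_ord => i.
have [c1 c2] := H [:: i; i] x xr.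
by rewrite -[partial i (partial i _) x]/(pd [:: i; i] _ x) c2; exact: c1.
Qed.

Definition lap_series (e : nat -> R) (f : 'rV[R]_m -> R) : nat -> 'rV[R]_m -> R :=
  fun k => e k *: iter k laplacian f.

(** The factor 2^(j + 2 k) from splitting (j + 2 k)! turns C into 2 C and accounts for the 4 in the
    rate; (2 k)! cancels against the decay of e. *)
Lemma lap_series_bd (e : nat -> R) (f : 'rV[R]_m -> R) x0 r M C E kap :
  0 <= M -> 0 <= C -> 0 <= E -> 0 <= kap ->
  smooth_bd f x0 r (cauchy_bd M C) -> (forall k, `|e k| <= E * kap ^+ k / ((2 * k)`!)%:R) ->
  series_bd (lap_series e f) x0 r (E * M) (2 * C) (4 * m%:R * kap * C ^+ 2).
Proof.
move=> M0 C0 E0 kap0 fB eE k.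
have := smooth_bd_iter_laplacian k fB => lB.
have [h1 h2] := pd_scale (e k) lB.1; split => // l x xr.
rewrite h2 // normrM; apply: le_trans (ler_pM _ _ (eE k) (lB.2 l x xr)) _ => //.
rewrite /cauchy_bd; set j := size l.
have F0 : 0 < (2 * k)`!%:R :> R by rewrite ltr0n fact_gt0.
have : ((j + 2 * k)`!%:R : R) <= 2 ^+ (j + 2 * k) * (j`!%:R * (2 * k)`!%:R).
  by rewrite -natrX -!natrM ler_nat leq_fact_add.
have P : 0 <= E * kap ^+ k * m%:R ^+ k * M * C ^+ (j + 2 * k) / ((2 * k)`!)%:R.
  by rewrite divr_ge0 ?(ltW F0) // !mulr_ge0 ?exprn_ge0.
move=> /(ler_wpM2l P) h.
apply: le_trans (_ : E * kap ^+ k * m%:R ^+ k * M * C ^+ (j + 2 * k) / ((2 * k)`!)%:R * (j + 2 * k)`!%:R <= _).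
  by rewrite le_eqVlt; apply/orP; left; apply/eqP; ring.
apply: le_trans h _; rewrite le_eqVlt; apply/orP; left; apply/eqP.
have -> : 4 * m%:R * kap * C ^+ 2 = 2 ^+ 2 * m%:R * kap * C ^+ 2 :> R by congr (_ * _ * _ * _); rewrite expr2; lra.
have -> : (2 ^+ 2 * m%:R * kap * C ^+ 2) ^+ k = (2 ^+ 2) ^+ k * m%:R ^+ k * kap ^+ k * (C ^+ 2) ^+ k :> R.
  by rewrite -!exprMn.
by rewrite -!exprM !exprD [(2 * C) ^+ j]exprMn; field; rewrite gt_eqF.
Qed.

Lemma laplacian_lap_series (e : nat -> R) f x0 r k x : smooth_on f x0 r -> ball x0 r x ->
  laplacian (lap_series e f k) x = e k * iter k.+1 laplacian f x.
Proof. by move=> fs xr; rewrite (laplacian_scale _ (smooth_on_iter_laplacian k fs)). Qed.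

End SeriesFamilies.

(** * Coefficients of the expansions *)

Section Coefficients.
Context {R : realType}.
Implicit Types (n k s : nat).

(* [(2 k)!] absorbs the [2 k] derivatives in the [k]-th power of the Laplacian. *)
Definition coef_bd n (e : nat -> R) := forall k, `|e k| <= 2 * (8 * n%:R) ^+ k / ((2 * k)`!)%:R.

(** The hypothesis yields N^k / (k!)^2, and the central binomial coefficient is at most 4^k. *)
Lemma inv_prod_bd (f : nat -> R) (N : R) k : 0 <= N -> (forall i, (0 < i)%N -> `|(f i)^-1| <= N / i%:R) ->
  `|(k`!%:R * \prod_(1 <= i < k.+1) f i)^-1| <= (4 * N) ^+ k / ((2 * k)`!)%:R.
Proof.
move=> N0 fN; apply: le_trans (_ : N ^+ k / (k`!%:R * k`!%:R) <= _).
  elim: k => [|k IH]; first by rewrite big_nil fact0 !mulr1 invr1 mulr1 normr1.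
  rewrite big_nat_recr //= factS natrM.
  have -> : (k.+1%:R * k`!%:R * (\prod_(1 <= i < k.+1) f i * f k.+1))^-1 =
     (k`!%:R * \prod_(1 <= i < k.+1) f i)^-1 * (k.+1%:R^-1 * (f k.+1)^-1) :> R.
    by rewrite -!invfM; congr (_^-1); ring.
  rewrite normrM; apply: le_trans (_ : N ^+ k / (k`!%:R * k`!%:R) * (k.+1%:R^-1 * (N / k.+1%:R)) <= _).
    apply: ler_pM => //; rewrite normrM ger0_norm ?invr_ge0 //.
    by rewrite ler_wpM2l ?invr_ge0 // fN.
  rewrite le_eqVlt; apply/orP; left; apply/eqP; rewrite exprS !invfM.
  move: (k.+1%:R^-1) (k`!%:R^-1) => y w; ring.
have K0 : 0 < k`!%:R * k`!%:R :> R by rewrite mulr_gt0 ?ltr0n ?fact_gt0.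
have F0 : 0 < (2 * k)`!%:R :> R by rewrite ltr0n fact_gt0.
rewrite exprMn ler_pdivrMr // mulrAC ler_pdivlMr //.
have : ((2 * k)`!%:R : R) <= 4 ^+ k * (k`!%:R * k`!%:R).
  rewrite -natrX -!natrM ler_nat; have := leq_fact_add k k.
  by rewrite addnn -mul2n expnM.
move=> /(ler_wpM2l (exprn_ge0 k N0)) h; apply: le_trans h _.
by rewrite le_eqVlt; apply/orP; left; apply/eqP; ring.
Qed.

Lemma coef_bd_le n (e : nat -> R) (N : R) : (0 < n)%N -> 0 <= N <= n%:R ->
  (forall k, `|e k| <= 2 * 2 ^+ k * ((4 * N) ^+ k / ((2 * k)`!)%:R)) -> coef_bd n e.
Proof.
move=> n0 /andP[N0 Nn] eN k; apply: le_trans (eN k) _.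
rewrite mulrA -!mulrA ler_wpM2l // !mulrA ler_wpM2r ?invr_ge0 // -exprMn lerXn2r ?nnegrE ?mulr_ge0 //.
by move: Nn; lra.
Qed.

(** The inverse of 0 is 0, which settles 2 i = n. Otherwise |2 i - n| >= 1 suffices for i <= n, and
    2 i - n >= i for i > n. *)
Lemma denom_minus_factor_bd n i : (0 < n)%N -> (0 < i)%N -> `|((2 * i)%:R - n%:R)^-1| <= n%:R / i%:R :> R.
Proof.
move=> n0 i0; have [e|/eqP ne] := eqVneq (2 * i)%N n.
  by rewrite e subrr invr0 normr0 divr_ge0.
rewrite normfV.
have h : 1 <= `|(2 * i)%:R - n%:R| :> R.
  have [lt|ge] := ltnP (2 * i) n.
    rewrite distrC -natrB ?(ltnW lt) // normr_nat ler1n subn_gt0 //.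
  rewrite -natrB // normr_nat ler1n subn_gt0 ltn_neqAle ge andbT; exact/eqP/nesym.
have h2 : i%:R <= n%:R * `|(2 * i)%:R - n%:R| :> R.
  have [le|gt] := leqP i n.
    apply: le_trans (_ : n%:R * 1 <= _); first by rewrite mulr1 ler_nat.
    by rewrite ler_wpM2l.
  rewrite -natrB ?normr_nat; last by lia.
  by rewrite -natrM ler_nat; nia.
have p0 : 0 < `|(2 * i)%:R - n%:R| :> R by apply: lt_le_trans h.
by rewrite ler_pdivlMr ?ltr0n // mulrC ler_pdivrMr.
Qed.

(** The coefficient at k = 0 is removed because H itself is no part of h. For n = 2 s the
    denominators vanish from k = s on, and as the inverse of 0 is 0 the series breaks off there by
    itself. *)
Definition dminus n k : R := (0 < k)%N%:R / denom_minus n k.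
Definition dplus n k : R := (denom_plus n k)^-1.

Lemma pow2_ge1 k : 1 <= 2 ^+ k :> R.
Proof. by rewrite exprn_ege1 // ler1n. Qed.

Lemma dminus_bd n : (0 < n)%N -> coef_bd n (dminus n).
Proof.
move=> n0; apply: (@coef_bd_le _ _ n%:R) => //; first by rewrite ler0n lexx.
move=> k; rewrite /dminus normrM.
apply: ler_pM => //; last exact: inv_prod_bd (fun i => denom_minus_factor_bd n0).
apply: le_trans (_ : 1 <= _); first by case: (0 < k)%N; rewrite ?normr1 ?normr0.
by have := pow2_ge1 k; lra.
Qed.

Lemma dplus_le n k : (0 < n)%N -> `|dplus n k| <= 4 ^+ k / ((2 * k)`!)%:R.
Proof.
move=> n0; rewrite -[4 in X in _ <= X]mulr1; apply: inv_prod_bd => // i i0.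
rewrite -natrD normfV normr_nat mul1r lef_pV2 ?posrE ?ltr0n ?ler_nat //; lia.
Qed.

Lemma dplus_bd n : (0 < n)%N -> coef_bd n (dplus n).
Proof.
move=> n0; apply: (@coef_bd_le _ _ 1) => //; first by rewrite ler01 ler1n.
move=> k; rewrite mulr1; apply: le_trans (dplus_le k n0) _.
rewrite ler_peMl ?divr_ge0 ?exprn_ge0 //.
by have := pow2_ge1 k; lra.
Qed.

Lemma q_bd n k : `|q_ n k| <= 2 * k%:R :> R.
Proof.
apply: le_trans (ler_norm_sum _ _ _) _.
apply: le_trans (_ : \sum_(1 <= i < k.+1) 2 <= _); last first.
  by rewrite big_const_nat iter_addr addr0 subSS subn0 mulr_natr.
rewrite !big_nat; apply: ler_sum => i /andP[i0 _].
rewrite normrM normfV !normr_nat ler_pdivrMr ?ltr0n; last by nia.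
by rewrite -natrM ler_nat; nia.
Qed.

(** q_k is at most 2 k, which doubling the geometric rate absorbs. *)
Lemma qdplus_bd n : (0 < n)%N -> coef_bd n (fun k => q_ n k * dplus n k).
Proof.
move=> n0; apply: (@coef_bd_le _ _ 1) => //; first by rewrite ler01 ler1n.
move=> k; rewrite mulr1 normrM; apply: ler_pM => //; last exact: dplus_le.
apply: le_trans (q_bd n k) _; rewrite ler_wpM2l // -natrX ler_nat.
by apply: ltnW; exact: ltn_expl.
Qed.

Lemma dplus0 n : dplus n 0 = 1 :> R.
Proof. by rewrite /dplus /denom_plus big_nil fact0 mulr1 invr1. Qed.

Lemma dplusS n k : (0 < n)%N -> k.+1%:R * (2 * k.+1%:R + n%:R) * dplus n k.+1 = dplus n k :> R.
Proof.
move=> n0; rewrite /dplus /denom_plus big_nat_recr //= factS natrM !invfM natrM.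
have a0 : 2 * k.+1%:R + n%:R != 0 :> R by rewrite -natrM -natrD pnatr_eq0; lia.
have b0 : k.+1%:R != 0 :> R by rewrite pnatr_eq0.
move: (k.+1%:R : R) (k`!%:R^-1) (\prod_(_ <= _ < _) _)^-1 a0 b0 => w x y a0 b0.
by field; rewrite a0 b0.
Qed.

Lemma qS n k : (0 < n)%N -> k.+1%:R * (2 * k.+1%:R + n%:R) * q_ n k.+1 =
  k.+1%:R * (2 * k.+1%:R + n%:R) * q_ n k + (n%:R + 4 * k.+1%:R) :> R.
Proof.
move=> n0; rewrite /q_ big_nat_recr //= natrM !natrD !natrM.
have a0 : n%:R + 2 * k.+1%:R != 0 :> R by rewrite -natrM -natrD pnatr_eq0; lia.
have b0 : k.+1%:R != 0 :> R by rewrite pnatr_eq0.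
by move: (k.+1%:R : R) (\sum_(_ <= _ < _) _) a0 b0 => w x a0 b0; field; rewrite a0 b0.
Qed.

(* The constant multiplying the logarithmic part, uniformly in the parity of [n]. *)
Definition log_coef n s (c : R) := (odd n /\ c = 0) \/ (n = (2 * s)%N /\ c = c_ n s).

Lemma denom_minusS n k : denom_minus n k.+1 = denom_minus n k * (k.+1%:R * (2 * k.+1%:R - n%:R)) :> R.
Proof. by rewrite /denom_minus big_nat_recr //= factS !natrM; ring. Qed.

Lemma denom_minus_eq0 s k : (0 < s <= k)%N -> denom_minus (2 * s) k = 0 :> R.
Proof.
elim: k => [|k IH] /andP[s0 sk]; first by lia.
rewrite denom_minusS; move: sk; rewrite leq_eqVlt => /orP[/eqP <-|sk].
  by rewrite natrM subrr !mulr0.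
by rewrite IH ?mul0r // s0.
Qed.

(** The factor i = 0 of the product in [c_] is - n, and the remaining factors are those of
    [denom_minus] at s - 1. *)
Lemma c_E s : (0 < s)%N -> (2 * s)%:R * c_ (2 * s) s = (denom_minus (2 * s) s.-1)^-1 :> R.
Proof.
case: s => // s _; rewrite /c_ /denom_minus /= big_nat_recl //= muln0.
rewrite -(big_add1 _ _ 0%N s.+1 xpredT (fun i => (2 * i)%:R - (2 * s.+1)%:R)) /=.
rewrite sub0r !invfM invrN.
have : (2 * s.+1)%:R != 0 :> R by rewrite pnatr_eq0.
move: (2 * s.+1)%:R (s`!%:R^-1) (\prod_(_ <= _ < _) _)^-1 => b x y b0.
by field.
Qed.

(** Off the resonance this is the recursion of the denominators. At 2 (k + 1) = n the left side is
    0, and [c_E] identifies the missing source with n c: this defect is what the logarithm has to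
    repair. *)
Lemma dminusS n s c k : (0 < n)%N -> log_coef n s c ->
  k.+1%:R * (2 * k.+1%:R - n%:R) * dminus n k.+1 =
  (denom_minus n k)^-1 - (k.+1 == s)%:R * (n%:R * c).
Proof.
move=> n0 nsc; rewrite /dminus /= mul1r denom_minusS invfM mulrC -mulrA.
have [ne|e] := eqVneq (2 * k.+1)%N n; last first.
  rewrite mulVf ?mulr1; last first.
    rewrite mulf_neq0 ?pnatr_eq0 // -natrM; rewrite subr_eq0 eqr_nat //.
  case: nsc => [[_ ->]|[n2 _]]; first by rewrite !mulr0 subr0.
  have -> : (k.+1 == s) = false by apply/negbTE/eqP => ks; move/eqP: e; apply; rewrite n2 ks.
  by rewrite mul0r subr0.
case: nsc => [[on _]|[n2 cE]]; first by move: on; rewrite -ne oddM.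
have ks : k.+1 = s by move: n2; rewrite -ne; lia.
by rewrite -natrM ne subrr mulr0 mulr0 -ks eqxx mul1r cE -ks -ne c_E //= subrr mulr0.
Qed.

Lemma eq_mul_natr_bool (b : bool) (u v : R) : (b -> u = v) -> b%:R * u = b%:R * v.
Proof. by case: b => [/(_ isT) -> //|_]; rewrite !mul0r. Qed.

Lemma denom_minus_dminus n k : (0 < k)%N -> (denom_minus n k)^-1 = dminus n k :> R.
Proof. by rewrite /dminus => ->; rewrite mul1r. Qed.

Lemma denom_minus_inv n k : (denom_minus n k)^-1 = (k == 0%N)%:R + dminus n k :> R.
Proof.
case: k => [|k] /=; last by rewrite add0r denom_minus_dminus.
by rewrite /dminus /denom_minus big_nil fact0 mulr1 invr1 mul0r addr0.
Qed.

End Coefficients.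

(** * A radius for all series, and bounds for z and z ln t *)

Section SmallRadius.
Context {R : realType}.
Implicit Types (q t : R).

(** From 16 q |t| + |t| <= 1 follow at once convergence with room to spare, two-fold
    differentiability and |t| <= 1. *)
Definition rad q : R := (16 * q + 1)^-1.

Lemma rad_gt0 q : 0 <= q -> 0 < rad q.
Proof. by move=> q0; rewrite invr_gt0; lra. Qed.

Lemma rad_le q t : 0 <= q -> `|t| <= rad q ->
  [/\ q * `|t| <= 2^-1, 8 * q * `|t| < 1 & `|t| <= 1].
Proof.
move=> q0; have d0 : 0 < 16 * q + 1 by lra.
rewrite /rad -div1r ler_pdivlMr // mulrDr mulr1 => h.
have y0 : 0 <= q * `|t| by rewrite mulr_ge0.
have t0 := normr_ge0 t.
have {}h : 16 * (q * `|t|) + `|t| <= 1 by apply: le_trans h; rewrite le_eqVlt; apply/orP; left; apply/eqP; ring.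
by split; rewrite -?mulrA; lra.
Qed.

Lemma pseries_delta (j : nat) (w t : R) :
  pseries (fun k => (k == j)%:R * w) t N @[N --> \oo] --> w * t ^+ j.
Proof.
apply: cvg_near_cst; near=> N.
have jN : (j < N)%N by near: N; exact: nbhs_infty_gt.
rewrite /pseries /series /= big_mkord (bigD1 (Ordinal jN)) //= eqxx mul1r big1 ?addr0 //.
by move=> i; rewrite -val_eqE /= => /negbTE ->; rewrite !mul0r.
Unshelve. all: by end_near. Qed.

Lemma psum0 (a : nat -> R) : psum a 0 = a 0%N.
Proof.
apply/cvg_lim => //; apply: cvg_near_cst; near=> N.
have N0 : (0 < N)%N by near: N; exact: nbhs_infty_gt.
rewrite -(prednK N0) /pseries /series /= big_nat_recl //= expr0 mulr1 big1 ?addr0 //.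
by move=> i _; rewrite expr0n /= mulr0.
Unshelve. all: by end_near. Qed.

(** This is ln y < y at y = t^(-1/2). Half a power is affordable because n >= 2 leaves z t^(-1/2)
    tending to 0. *)
Lemma ln_ge_powR t : 0 < t <= 1 -> `|ln t| <= 2 * t `^ (- 2^-1).
Proof.
move=> /andP[t0 t1]; rewrite ler0_norm ?ln_le0 //.
have := ln_sublinear (powR_gt0 (- 2^-1) t0); rewrite ln_powR => /ltW.
by move: (t `^ _) (ln t) => a b; lra.
Qed.

Lemma z_le1 n t : 0 < t <= 1 -> `|t `^ (n%:R / 2)| <= 1.
Proof.
move=> tt; by rewrite ger0_norm ?powR_ge0 // -[leRHS](powRr0 t) ger_powR // divr_ge0.
Qed.

Lemma z_ln_le n t : 0 < t <= 1 -> `|t `^ (n%:R / 2) * ln t| <= 2 * t `^ (n%:R / 2 - 2^-1).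
Proof.
move=> tt; have /andP[t0 t1] := tt.
rewrite normrM ger0_norm ?powR_ge0 //.
apply: le_trans (ler_wpM2l (powR_ge0 _ _) (ln_ge_powR tt)) _.
by rewrite mulrCA -gt0_powRD.
Qed.

Lemma half_sub_gt0 n : (2 <= n)%N -> 0 < n%:R / 2 - 2^-1 :> R.
Proof. by rewrite -(ler_nat R); lra. Qed.

End SmallRadius.

(** * Convergent expansions *)

Section Expansion.
Context {R : realType} {m : nat}.
Variable n : nat.
Hypothesis n2 : (2 <= n)%N.
Implicit Types (x : 'rV[R]_m) (f : 'rV[R]_m -> R) (A C q t r c : R).

Local Notation nu := (n%:R / 2 : R).
Local Notation z := (fun t : R => t `^ nu).
Let n0 : (0 < n)%N. Proof. exact: ltnW. Qed.

Definition lap_psum (e : nat -> R) f t x : R := psum (fun k => lap_series e f k x) t.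
Definition reg f := lap_psum (dminus n) f.
Definition hom f := lap_psum (dplus n) f.
Definition qhom f := lap_psum (fun k => q_ n k * dplus n k) f.
(** The series with factors ln t - q_k, split so that ln t multiplies a power series. *)
Definition logp f t x : R := ln t * hom f t x - qhom f t x.

Section Pieces.
Variables (x0 : 'rV[R]_m) (r A C q : R).
Hypotheses (A0 : 0 <= A) (C0 : 0 <= C) (q0 : 0 <= q).

Section OneSeries.
Variables (e : nat -> R) (f : 'rV[R]_m -> R).
Hypotheses (fs : smooth_on f x0 r) (fB : series_bd (lap_series e f) x0 r A C q).

Lemma lap_psum_family t : `|t| <= rad q -> smooth_bd (lap_psum e f t) x0 r (cauchy_bd (2 * A) C) /\
  forall l x, ball x0 r x -> cvgn (pseries (fun k => pd l (lap_series e f k) x) t) /\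
    pd l (lap_psum e f t) x = psum (fun k => pd l (lap_series e f k) x) t.
Proof. by move=> /(rad_le q0)[qt _ _]; exact: (psum_family A0 C0 q0 qt fB). Qed.

Lemma lap_psum_laplacian t x : `|t| <= rad q -> ball x0 r x ->
  pseries (fun k => e k * iter k.+1 laplacian f x) t N @[N --> \oo] --> laplacian (lap_psum e f t) x.
Proof.
move=> /(rad_le q0)[qt _ _] xr.
have := laplacian_psum_family A0 C0 q0 qt fB xr.
have -> // : (fun k => laplacian (lap_series e f k) x) = (fun k => e k * iter k.+1 laplacian f x).
by apply/funext => k; rewrite (laplacian_lap_series _ _ fs).
Qed.

Lemma lap_psum_twice t x : `|t| <= rad q -> ball x0 r x -> twice (lap_psum e f ^~ x) t.
Proof.
by move=> /(rad_le q0)[_ qt _] xr; exact: (psum_twice q0 (series_bd_coef0 fB xr) qt).1.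
Qed.

Lemma lap_psum_second_order t x (c : R) : `|t| <= rad q -> ball x0 r x ->
  2 * t * derive1 (derive1 (lap_psum e f ^~ x)) t + c * derive1 (lap_psum e f ^~ x) t =
  psum (fun k => k.+1%:R * (2 * k%:R + c) * (e k.+1 * iter k.+1 laplacian f x)) t.
Proof.
move=> /(rad_le q0)[_ qt _] xr; have aB := series_bd_coef0 fB xr.
have [_ ->] := psum_twice q0 aB qt.
by rewrite (psum_derive1 q0 aB qt) (psum_second_order q0 aB).
Qed.

Lemma lap_psum_continuous0 x l : ball x0 r x ->
  pd l (lap_psum e f t) x @[t --> (0 : R)] --> pd l (lap_series e f 0) x.
Proof.
move=> xr.
have aB := series_bd_coef l fB xr.
have D := @is_derive_psum R _ _ q 0 q0 aB; rewrite normr0 mulr0 in D.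
have {}D := D ltr01.
have : derivable (psum (fun k => pd l (lap_series e f k) x)) 0 1 by case: D.
move=> /derivable1_diffP/differentiable_continuous cts.
have {cts} : psum (fun k => pd l (lap_series e f k) x) @ (0 : R) --> psum (fun k => pd l (lap_series e f k) x) 0 := cts.
rewrite psum0.
apply: cvg_trans; apply: near_eq_cvg; near=> t.
have tq : `|t| <= rad q.
  near: t; have /cvgr_le : (fun t : R => `|t|) @ (0 : R) --> `|0 : R| by apply: cvg_norm; exact: cvg_id.
  by apply; rewrite normr0; exact: rad_gt0.
by rewrite ((lap_psum_family tq).2 l x xr).2.
Unshelve. all: by end_near. Qed.

End OneSeries.

(** The last term is the resonance defect of [dminusS], a single monomial in t; for odd n it is
    absent since c = 0. *)
Lemma reg_eq s c f : log_coef n s c -> (0 < s)%N -> smooth_on f x0 r ->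
  series_bd (lap_series (dminus n) f) x0 r A C q ->
  forall t x, `|t| <= rad q -> ball x0 r x ->
  twice (reg f ^~ x) t /\ euler_op n (reg f ^~ x) t =
    laplacian f x + laplacian (reg f t) x - n%:R * c * t ^+ s.-1 * iter s laplacian f x.
Proof.
move=> nsc s0 fs fB t x tq xr; split; first exact: (lap_psum_twice fB).
rewrite /euler_op (lap_psum_second_order fB) //.
have h1 := lap_psum_laplacian fs fB tq xr.
have h2 := @pseries_delta R 0%N (laplacian f x) t.
have h3 := @pseries_delta R s.-1 (- (n%:R * c * iter s laplacian f x)) t.
rewrite expr0 mulr1 in h2.
have -> : forall a b d e : R, a + b - n%:R * c * d * e = 1 * (1 * a + 1 * b) + 1 * (- (n%:R * c * e) * d).
  by move=> a b d e; ring.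
rewrite -(cvg_lim _ (@pseries_lin R _ _ 1 1 _ _ _ (@pseries_lin R _ _ 1 1 _ _ _ h2 h1) h3)) //.
congr (psum _ t); apply/funext => k.
have -> : 2 * k%:R + (2 - n%:R) = 2 * k.+1%:R - n%:R :> R by rewrite -[k.+1%:R]natr1; ring.
rewrite mulrA (dminusS _ n0 nsc).
have -> : (k.+1 == s) = (k == s.-1) by move: s0; case: (s).
rewrite denom_minus_inv.
have e1 : (k == 0%N)%:R * iter k.+1 laplacian f x = (k == 0%N)%:R * laplacian f x by apply: eq_mul_natr_bool => /eqP ->.
have e2 : (k == s.-1)%:R * iter k.+1 laplacian f x = (k == s.-1)%:R * iter s laplacian f x.
  by apply: eq_mul_natr_bool => /eqP ->; rewrite prednK.
move: e1 e2; move: (iter k.+1 _ _ _) (iter s _ _ _) (laplacian f x) => I1 I2 I3.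
rewrite /=; move: ((k == 0%N)%:R) ((k == s.-1)%:R) => b1 b2 e1 e2.
transitivity (b1 * I1 + dminus n k * I1 - b2 * I1 * (n%:R * c)); first by ring.
by rewrite e1 e2; ring.
Qed.

Lemma hom_eq f : smooth_on f x0 r -> series_bd (lap_series (dplus n) f) x0 r A C q ->
  forall t x, `|t| <= rad q -> ball x0 r x ->
  2 * t * derive1 (derive1 (hom f ^~ x)) t + (2 + n%:R) * derive1 (hom f ^~ x) t =
    laplacian (hom f t) x.
Proof.
move=> fs fB t x tq xr; rewrite (lap_psum_second_order fB) //.
apply/cvg_lim => //; have := lap_psum_laplacian fs fB tq xr.
suff -> : (fun k => dplus n k * iter k.+1 laplacian f x) = (fun k => k.+1%:R * (2 * k%:R + (2 + n%:R)) *
  (dplus n k.+1 * iter k.+1 laplacian f x)) by [].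
apply/funext => k.
have -> : 2 * k%:R + (2 + n%:R) = 2 * k.+1%:R + n%:R :> R by rewrite -[k.+1%:R]natr1; ring.
by rewrite [RHS]mulrA dplusS.
Qed.

(** By the recursion [qS] the weights q_k contribute n + 4 (k + 1) at order k: the part n sums to n
    ([hom] - f) / t, the part 4 (k + 1) to four times the derivative of [hom]. *)
Lemma qhom_eq f : smooth_on f x0 r -> series_bd (lap_series (dplus n) f) x0 r A C q ->
  series_bd (lap_series (fun k => q_ n k * dplus n k) f) x0 r A C q ->
  forall t x, 0 < t <= rad q -> ball x0 r x ->
  2 * t * derive1 (derive1 (qhom f ^~ x)) t + (2 + n%:R) * derive1 (qhom f ^~ x) t =
    laplacian (qhom f t) x + n%:R * (hom f t x - f x) / t + 4 * derive1 (hom f ^~ x) t.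
Proof.
move=> fs fB gB t x /andP[t0 tq] xr.
have {}tq : `|t| <= rad q by rewrite gtr0_norm.
rewrite (lap_psum_second_order gB) //.
have [_ qt _] := rad_le q0 tq.
have aB := series_bd_coef0 fB xr; have d1 := pseries_diffs_bd q0 aB.
have c1 : cvgn (pseries (fun k => lap_series (dplus n) f k.+1 x) t).
  have qt1 : q * `|t| < 1 by have [] := rad_le q0 tq; lra.
  apply: (@pseries_bd_cvg R _ (A * q) q) => // k.
  by apply: le_trans (aB k.+1) _; rewrite exprS mulrA.
have c2 : cvgn (pseries (pseries_diffs (fun k => lap_series (dplus n) f k x)) t).
  apply: pseries_bd_cvg d1 _; first by rewrite mulr_ge0.
  by have [] := rad_le q0 tq; rewrite -mulrA; lra.
have -> : hom f t x - f x = t * psum (fun k => lap_series (dplus n) f k.+1 x) t.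
  rewrite /hom /lap_psum psum_shift // /lap_series /= dplus0.
  by rewrite scale1r addrAC subrr add0r.
rewrite (psum_derive1 q0 aB qt).
have -> : n%:R * (t * psum (fun k => lap_series (dplus n) f k.+1 x) t) / t =
    n%:R * psum (fun k => lap_series (dplus n) f k.+1 x) t by field; rewrite gt_eqF.
have h1 := lap_psum_laplacian fs gB tq xr.
transitivity (1 * laplacian (qhom f t) x +
    1 * (n%:R * psum (fun k => lap_series (dplus n) f k.+1 x) t +
         4 * psum (pseries_diffs (fun k => lap_series (dplus n) f k x)) t)); last by rewrite !mul1r addrA.
rewrite -(cvg_lim _ (@pseries_lin R _ _ 1 1 _ _ _ h1 (@pseries_lin R _ _ n%:R 4 _ _ _ c1 c2))) //.
congr (psum _ t); apply/funext => k.
have -> : 2 * k%:R + (2 + n%:R) = 2 * k.+1%:R + n%:R :> R by rewrite -[k.+1%:R]natr1; ring.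
rewrite !mulrA (qS _ n0) /pseries_diffs /lap_series -(dplusS k n0).
move: (iter _ _ _ _) => w; ring.
Qed.

End Pieces.

Definition expansion s c f al t x : R :=
  reg f t x + z t * (hom al t x + c * logp (iter s laplacian f) t x).

Section Assembly.
Variables (s : nat) (c : R) (x0 : 'rV[R]_m) (r A C q : R) (f al : 'rV[R]_m -> R).
Hypotheses (nsc : log_coef n s c) (s0 : (0 < s)%N).
Hypotheses (A0 : 0 <= A) (C0 : 0 <= C) (q0 : 0 <= q).
Hypotheses (fs : smooth_on f x0 r) (als : smooth_on al x0 r).
Hypothesis (fB : series_bd (lap_series (dminus n) f) x0 r A C q).
Hypothesis (aB : series_bd (lap_series (dplus n) al) x0 r A C q).
Hypothesis (bB : series_bd (lap_series (dplus n) (iter s laplacian f)) x0 r A C q).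
Hypothesis (qB : series_bd (lap_series (fun k => q_ n k * dplus n k) (iter s laplacian f)) x0 r A C q).

Let bs : smooth_on (iter s laplacian f) x0 r := smooth_on_iter_laplacian s fs.

Let rad1 : rad q <= 1.
Proof. by rewrite /rad invf_le1; move: q0; lra. Qed.

Let in_rad t : 0 < t < rad q -> `|t| <= rad q.
Proof. by move=> /andP[t0 tq]; rewrite gtr0_norm // ltW. Qed.

Lemma expansionE t : expansion s c f al t =
  z t *: hom al t + ((c * (z t * ln t)) *: hom (iter s laplacian f) t +
   ((- (c * z t)) *: qhom (iter s laplacian f) t + reg f t)).
Proof.
apply/funext => x; rewrite /expansion /logp.
have E : forall a b d e, (z t *: a + ((c * (z t * ln t)) *: b + ((- (c * z t)) *: d + e))) x =
   z t * a x + (c * (z t * ln t) * b x + (- (c * z t) * d x + e x)) :> R by [].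
by rewrite E; ring.
Qed.

(** The summands 1, 2 |c|, |c| and 1 bound the coefficients z, c z ln t, c z and 1 of the four
    series for t <= 1. *)
Lemma expansion_smooth_bd t : 0 < t < rad q ->
  smooth_bd (expansion s c f al t) x0 r (cauchy_bd ((1 + `|c| * 2 + `|c| + 1) * (2 * A)) C).
Proof.
move=> tq; have tr := in_rad tq; have /andP[t0 tq'] := tq.
have t1 : 0 < t <= 1 by rewrite t0 (le_trans (ltW tq')).
have hb e g (gB : series_bd (lap_series e g) x0 r A C q) := (lap_psum_family A0 C0 q0 gB tr).1.
have := smooth_bd_lin (z t) (hb _ _ aB) (smooth_bd_lin (c * (z t * ln t)) (hb _ _ bB)
  (smooth_bd_lin (- (c * z t)) (hb _ _ qB) (hb _ _ fB))).
rewrite expansionE; apply: smooth_bdS => // j.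
have K0 : 0 <= cauchy_bd (2 * A) C j by rewrite cauchy_bd_ge0 ?mulr_ge0.
have z1 := z_le1 n t1.
have zl : `|z t * ln t| <= 2.
  by apply: le_trans (z_ln_le n t1) _; rewrite ger_pMr // -[leRHS](powRr0 t) ger_powR // ltW // half_sub_gt0.
have -> : forall K : R, cauchy_bd (K * (2 * A)) C j = K * cauchy_bd (2 * A) C j.
  by move=> K; rewrite /cauchy_bd [RHS]mulrA.
move: (cauchy_bd _ _ _) K0 => K K0.
have l1 : `|z t| * K <= K by rewrite ler_piMl.
have l2 : `|c * (z t * ln t)| * K <= `|c| * 2 * K by rewrite ler_wpM2r // normrM ler_wpM2l.
have l3 : `|- (c * z t)| * K <= `|c| * K by rewrite ler_wpM2r // normrN normrM ler_piMr.
by rewrite !mulrDl mul1r; move: l1 l2 l3; lra.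
Qed.

Lemma expansion_eq : family_eq n (rad q) x0 r (expansion s c f al) (laplacian f).
Proof.
move=> t x tT xr; have tr := in_rad tT; have /andP[t0 tq'] := tT.
have tw e g (gB : series_bd (lap_series e g) x0 r A C q) u : 0 < u < rad q -> twice (lap_psum e g ^~ x) u.
  by move=> /in_rad ur; apply: (lap_psum_twice q0 gB ur xr).
have twf u : 0 < u < rad q -> twice (reg f ^~ x) u by exact: tw.
have twa u : 0 < u < rad q -> twice (hom al ^~ x) u by exact: tw.
have twb u : 0 < u < rad q -> twice (hom (iter s laplacian f) ^~ x) u by exact: tw.
have twq u : 0 < u < rad q -> twice (qhom (iter s laplacian f) ^~ x) u by exact: tw.
have [r1 r2] := reg_eq A0 C0 q0 nsc s0 fs fB tr xr.
have [a1 a2] := euler_zmul n twa tT.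
have lw u : 0 < u < rad q -> twice (fun v => logp (iter s laplacian f) v x) u.
  by move=> uT; have [] := twice_log n twb twq uT.
have [b1 b2] := euler_zmul n lw tT.
have [_ l2] := twice_log n twb twq tT.
have zaw u : 0 < u < rad q -> twice (fun v => z v * hom al v x) u.
  by move=> uT; have [] := euler_zmul n twa uT.
have zlw u : 0 < u < rad q -> twice (fun v => z v * logp (iter s laplacian f) v x) u.
  by move=> uT; have [] := euler_zmul n lw uT.
have [s1 s2] := twice_lin n 1 tT twf zaw.
have s1' u (uT : 0 < u < rad q) := (twice_lin n 1 uT twf zaw).1.
have [w1 w2] := twice_lin n c tT s1' zlw.
have E : (fun v => expansion s c f al v x) = (fun v => (reg f v x + 1 * (z v * hom al v x)) +
   c * (z v * logp (iter s laplacian f) v x)).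
  by apply/funext => v; rewrite /expansion; ring.
rewrite l2 in b2.
split; first by rewrite E; exact: w1.
have lem (X S L Rg Z a b d : R) : X = S + c * L -> S = Rg + 1 * Z -> Z = a -> L = b -> Rg = d -> X = d + a + c * b.
  by move=> -> -> -> -> ->; ring.
rewrite (lem _ _ _ _ _ _ _ _ (etrans (congr1 (euler_op n ^~ t) E) w2) s2 a2 b2 r2) {lem w1 w2 s2 a2 b2 r2 l2 E}.
have h1 := hom_eq A0 C0 q0 als aB tr xr.
have h2 := hom_eq A0 C0 q0 bs bB tr xr.
have tr' : 0 < t <= rad q by rewrite t0 ltW.
have h3 := qhom_eq A0 C0 q0 bs bB qB tr' xr.
have sm e g (gB : series_bd (lap_series e g) x0 r A C q) := (lap_psum_family A0 C0 q0 gB tr).1.1.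
have [sa _] := pd_scale (- (c * z t)) (sm _ _ qB).
have [sb _] := pd_add sa (sm _ _ fB).
have [sc _] := pd_scale (c * (z t * ln t)) (sm _ _ bB).
have [sd _] := pd_add sc sb.
have [se _] := pd_scale (z t) (sm _ _ aB).
have EL : laplacian (expansion s c f al t) x = z t * laplacian (hom al t) x +
    (c * (z t * ln t) * laplacian (hom (iter s laplacian f) t) x +
    (- (c * z t) * laplacian (qhom (iter s laplacian f) t) x + laplacian (reg f t) x)).
  rewrite expansionE (laplacian_add se sd xr); congr (_ + _); first exact: (laplacian_scale _ (sm _ _ aB) xr).
  rewrite (laplacian_add sc sb xr); congr (_ + _); first exact: (laplacian_scale _ (sm _ _ bB) xr).
  rewrite (laplacian_add sa (sm _ _ fB) xr); congr (_ + _); exact: (laplacian_scale _ (sm _ _ qB) xr).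
(* Here the two defects meet: n c t^(s-1) Delta^s f from [reg] and n c z Delta^s f / t from the
   logarithm. They cancel since z = t^s for n = 2 s and c = 0 otherwise. *)
have cz : c * z t = c * t ^+ s.-1 * t.
  case: nsc => [[_ ->]|[nE _]]; first by rewrite !mul0r.
  have -> : z t = t ^+ s.
    by rewrite -powR_mulrn ?(ltW t0) //; congr (t `^ _); rewrite nE natrM mulrC mulKf // pnatr_eq0.
  by rewrite -[in LHS](prednK s0) exprS; ring.
rewrite EL; move: cz h1 h2 h3 {EL se sd sc sb sa sm}.
move: (laplacian (reg f t) x) (laplacian f x) (laplacian (hom al t) x) (laplacian (hom _ t) x) (laplacian (qhom _ t) x).
move: (derive1 (derive1 (hom al ^~ x)) t) (derive1 (hom al ^~ x) t).
move: (derive1 (derive1 (hom (iter s laplacian f) ^~ x)) t) (derive1 (hom (iter s laplacian f) ^~ x) t).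
move: (derive1 (derive1 (qhom (iter s laplacian f) ^~ x)) t) (derive1 (qhom (iter s laplacian f) ^~ x) t).
move: (iter s laplacian f x) (hom (iter s laplacian f) t x) (ln t) (z t) (t ^+ s.-1).
move=> e1 e2 e4 e5 e6 u1 u2 u3 u4 u5 u6 l1 l2' l3 l4 l5 cz h1 h2 h3.
rewrite h1 h2 h3.
have tn0 : t != 0 by rewrite gt_eqF.
apply/eqP; rewrite -subr_eq0; apply/eqP.
transitivity (n%:R * e1 / t * (c * e5 - c * e6 * t)); last by rewrite cz subrr mulr0.
by field.
Qed.

Lemma expansion_cvg0 x : ball x0 r x -> expansion s c f al t x @[t --> 0^'+] --> (0 : R).
Proof.
move=> xr.
have small e g (gB : series_bd (lap_series e g) x0 r A C q) (w : R -> R) :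
    w t @[t --> 0^'+] --> (0 : R) -> w t * lap_psum e g t x @[t --> 0^'+] --> (0 : R).
  move=> w0; have := cvgM w0 (cvg_at_right_filter (lap_psum_continuous0 (l := [::]) A0 C0 q0 gB xr)).
  by rewrite mul0r; apply; exact: at_right_proper_filter.
have z0 : z t @[t --> 0^'+] --> (0 : R) by apply: powR_cvg0; exact: nu_gt0.
have zl0 : z t * ln t @[t --> 0^'+] --> (0 : R).
  apply/cvgr0Pnorm_le => e e0.
  have /cvgr0Pnorm_le/(_ e e0) H : 2 * t `^ (nu - 2^-1) @[t --> 0^'+] --> (0 : R).
    rewrite -[X in _ --> X](mulr0 2); apply: cvgM; first exact: cvg_cst.
    by apply: powR_cvg0; exact: half_sub_gt0.
  near=> t; have t1 : 0 < t < 1 by near: t; exact: near_0_right.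
  apply: le_trans (z_ln_le n _) _; first by case/andP: t1 => -> /ltW.
  by apply: le_trans (ler_norm _) _; near: t; exact: H.
have r0 : reg f t x @[t --> 0^'+] --> (0 : R).
  have := cvg_at_right_filter (lap_psum_continuous0 (l := [::]) A0 C0 q0 fB xr).
  by rewrite /= /lap_series /dminus /= mul0r scale0r.
have -> : (fun t => expansion s c f al t x) = (fun t => z t * hom al t x +
   ((c * (z t * ln t)) * hom (iter s laplacian f) t x + ((- (c * z t)) * qhom (iter s laplacian f) t x + reg f t x))).
  by apply/funext => t; rewrite expansionE.
rewrite -[X in _ --> X]addr0; apply: cvgD; first exact: (small _ _ aB _ z0).
rewrite -[X in _ --> X]addr0; apply: cvgD; first by apply: (small _ _ bB); rewrite -[X in _ --> X](mulr0 c); apply: cvgM => //; exact: cvg_cst.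
rewrite -[X in _ --> X]addr0; apply: cvgD r0; apply: (small _ _ qB).
by rewrite -[X in _ --> X]oppr0 -[X in _ --> - X](mulr0 c); apply: cvgN; apply: cvgM => //; exact: cvg_cst.
Unshelve. all: by end_near. Qed.

End Assembly.

Lemma series_bd_mono (b : nat -> 'rV[R]_m -> R) x0 r A C q A' C' q' : 0 <= A <= A' -> 0 <= C <= C' -> 0 <= q <= q' ->
  series_bd b x0 r A C q -> series_bd b x0 r A' C' q'.
Proof.
move=> /andP[A0 AA] /andP[C0 CC] /andP[q0 qq] bB k; apply: smooth_bdS (bB k) => // j.
by apply: ler_pM; rewrite ?cauchy_bd_ge0 ?exprn_ge0 ?cauchy_bd_mono // lerXn2r ?nnegrE // (le_trans q0).
Qed.

Lemma lap_series_bd_coef e f x0 r M C : 0 <= M -> 0 <= C -> coef_bd n e ->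
  smooth_bd f x0 r (cauchy_bd M C) ->
  series_bd (lap_series e f) x0 r (2 * M) (2 * C) (4 * m%:R * (8 * n%:R) * C ^+ 2).
Proof. by move=> M0 C0 eB fB; apply: lap_series_bd => //; rewrite mulr_ge0. Qed.

(* The factor [e 0 = 0] hides [f] itself, which need not satisfy Cauchy estimates. *)
Lemma lap_series_bd_source e f x0 r M C : 0 <= M -> 0 <= C -> coef_bd n e -> e 0%N = 0 ->
  smooth_bd (laplacian f) x0 r (cauchy_bd M C) ->
  series_bd (lap_series e f) x0 r (16 * n%:R * M) (2 * C) (4 * m%:R * (8 * n%:R) * C ^+ 2 + 1).
Proof.
move=> M0 C0 eB e0 fB.
have q0 : 0 <= 4 * m%:R * (8 * n%:R) * C ^+ 2 by rewrite !mulr_ge0 ?exprn_ge0.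
have A0 : 0 <= 16 * n%:R * M by rewrite !mulr_ge0.
move=> [|k].
  rewrite /lap_series e0 scale0r; have [h1 h2] := @pd_cst R m 0 x0 r.
  split; first exact: h1.
  move=> [|i l] x xr; last by rewrite (h2 (i :: l)) // normr0 expr0 mulr1 cauchy_bd_ge0 ?mulr_ge0.
  by rewrite /= normr0 expr0 mulr1 cauchy_bd_ge0 ?mulr_ge0.
have := @lap_series_bd R m (fun k => e k.+1) (laplacian f) x0 r M C (16 * n%:R) (8 * n%:R) M0 C0.
rewrite !mulr_ge0 // => /(_ isT isT fB) H.
have {H} := H _ k; rewrite /lap_series -iterSr; move=> H.
have {H} : smooth_bd (e k.+1 *: iter k.+1 laplacian f) x0 r (fun j => cauchy_bd (16 * n%:R * M) (2 * C) j *
   (4 * m%:R * (8 * n%:R) * C ^+ 2) ^+ k).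
  apply: H => i; apply: le_trans (eB i.+1) _.
  rewrite exprS; have -> : 2 * (8 * n%:R * (8 * n%:R) ^+ i) = 16 * n%:R * (8 * n%:R) ^+ i :> R by ring.
  rewrite ler_wpM2l ?mulr_ge0 ?exprn_ge0 // lef_pV2 ?posrE ?ltr0n ?fact_gt0 // ler_nat.
  by apply: leq_fact; lia.
apply: smooth_bdS => // j; rewrite ler_wpM2l ?cauchy_bd_ge0 ?mulr_ge0 //.
apply: le_trans (_ : (4 * m%:R * (8 * n%:R) * C ^+ 2 + 1) ^+ k <= _).
  by rewrite lerXn2r ?nnegrE ?addr_ge0 // lerDl.
by rewrite [leRHS]exprS ler_peMl ?exprn_ge0 ?addr_ge0 // lerDr.
Qed.

Lemma expansion_series_bd s f al x0 r M C : (0 < s)%N -> 0 <= M -> 0 <= C ->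
  smooth_bd (laplacian f) x0 r (cauchy_bd M C) -> smooth_bd al x0 r (cauchy_bd M C) ->
  exists A C' q, [/\ 0 <= A, 0 <= C', 0 <= q & [/\ series_bd (lap_series (dminus n) f) x0 r A C' q,
    series_bd (lap_series (dplus n) al) x0 r A C' q,
    series_bd (lap_series (dplus n) (iter s laplacian f)) x0 r A C' q &
    series_bd (lap_series (fun k => q_ n k * dplus n k) (iter s laplacian f)) x0 r A C' q]].
Proof.
case: s => // s _ M0 C0 vB aB.
(* Delta^s f = Delta^(s-1) (Delta f), which reduces its Cauchy estimates to those of Delta f. *)
have [Mb [Cb [Mb0 Cb0 bb]]] : cauchy_seq (fun j => m%:R ^+ s * cauchy_bd M C (j + 2 * s)).
  by apply: cauchy_seq_scale; [exact: exprn_ge0 | apply: cauchy_seq_shift; exact: cauchy_seq_bd].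
have bB : smooth_bd (iter s.+1 laplacian f) x0 r (cauchy_bd Mb Cb).
  by rewrite iterSr; apply: smooth_bdS (smooth_bd_iter_laplacian s vB).
have d0 : dminus n 0 = 0 :> R by rewrite /dminus mul0r.
have h1 := lap_series_bd_source M0 C0 (dminus_bd n0) d0 vB.
have h2 := lap_series_bd_coef M0 C0 (dplus_bd n0) aB.
have h3 := lap_series_bd_coef Mb0 Cb0 (dplus_bd n0) bB.
have h4 := lap_series_bd_coef Mb0 Cb0 (qdplus_bd n0) bB.
pose Q c : R := 4 * m%:R * (8 * n%:R) * c ^+ 2.
have Q0 c : 0 <= Q c.
  by rewrite /Q mulr_ge0 ?sqr_ge0 // !mulr_ge0.
have e1 : 0 <= 16 * n%:R * M by rewrite !mulr_ge0.
have e2 : 0 <= 2 * M by rewrite mulr_ge0.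
have e3 : 0 <= 2 * Mb by rewrite mulr_ge0.
have f1 : 0 <= 2 * C by rewrite mulr_ge0.
have f2 : 0 <= 2 * Cb by rewrite mulr_ge0.
have QC := Q0 C; have QCb := Q0 Cb.
exists (16 * n%:R * M + 2 * M + 2 * Mb), (2 * C + 2 * Cb), (Q C + 1 + Q Cb).
have sb b A C1 q := @series_bd_mono b x0 r A C1 q (16 * n%:R * M + 2 * M + 2 * Mb) (2 * C + 2 * Cb) (Q C + 1 + Q Cb).
split; [lra | lra | lra | split].
- by apply: sb h1; rewrite -?/(Q C); apply/andP; split; lra.
- by apply: sb h2; rewrite -?/(Q C); apply/andP; split; lra.
- by apply: sb h3; rewrite -?/(Q Cb); apply/andP; split; lra.
- by apply: sb h4; rewrite -?/(Q Cb); apply/andP; split; lra.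
Qed.

Lemma cauchy_bd_join M1 C1 M2 C2 : 0 <= M1 -> 0 <= C1 -> 0 <= M2 -> 0 <= C2 -> exists M C : R,
  [/\ 0 <= M, 0 <= C, forall j, cauchy_bd M1 C1 j <= cauchy_bd M C j & forall j, cauchy_bd M2 C2 j <= cauchy_bd M C j].
Proof.
by move=> *; exists (M1 + M2), (C1 + C2); split; rewrite ?addr_ge0 // => j; apply: cauchy_bd_mono => //;
  rewrite ?lerDl ?lerDr.
Qed.

End Expansion.

(** * Lebesgue measure on tuples and convolutions *)

Section TupleMeasure.
Context {R : realType}.

Local Notation rT := (measurableTypeR R).

Section TupleCons.
Variables (m : nat) (mu : {sigma_finite_measure set (m.-tuple R) -> \bar R}).

Definition tcons (ty : rT * m.-tuple R) : m.+1.-tuple R := [tuple of ty.1 :: ty.2].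

Lemma measurable_tcons : measurable_fun setT tcons.
Proof. by apply: measurable_cons; [exact: measurable_fst | exact: measurable_snd]. Qed.

(** The product measure carried to tuples along cons; it supplies the measure structure for
    [lebesgue_tuple], which is only a set function by definition. *)
Definition tcons_measure := pushforward (@lebesgue_measure R \x mu)%E tcons.

HB.instance Definition _ := Measure.copy tcons_measure
  (measure_function_pushforward__canonical__measure_function_Measure
     (@lebesgue_measure R \x mu)%E measurable_tcons).

(** The inverse of cons is measurable, so an exhaustion of the product is transported to tuples. *)
Lemma tcons_measure_sigma_finite : sigma_finite setT tcons_measure.
Proof.
pose ucs (y : m.+1.-tuple R) : rT * m.-tuple R := (tnth y ord0, [tuple of behead y]).
have mu_ : measurable_fun setT ucs.
  by apply/measurable_fun_pairP; split; [exact: measurable_tnth | exact: measurable_behead].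
have uK ty : ucs (tcons ty) = ty.
  by case: ty => t y; rewrite /ucs /tcons /=; congr (_, _); apply: val_inj.
have [F FT Ffin] : sigma_finite setT (@lebesgue_measure R \x mu)%E.
  have /sigma_finiteP[F [TF ndF Foo]] := sigma_finiteT (@lebesgue_measure R).
  have /sigma_finiteP[G [TG ndG Goo]] := sigma_finiteT mu.
  (* The exhaustions are nondecreasing, so the diagonal rectangles cover the product. *)
  exists (fun n => F n `*` G n) => [|k].
    rewrite -setXTT TF TG predeqE => -[t y]; split; last by move=> [k _ []]; split; exists k.
    move=> [/= [k _ Fk] [l _ Gl]]; exists (maxn k l) => //; split.
      by move: t Fk; exact/subsetPset/ndF/leq_maxl.
    by move: y Gl; exact/subsetPset/ndG/leq_maxr.
  have [? ?] := Foo k; have [? ?] := Goo k; split; first exact: measurableX.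
  by rewrite product_measure1E // lte_mul_pinfty // ge0_fin_numE.
exists (fun i => ucs @^-1` F i).
  by rewrite -preimage_bigcup -FT preimage_setT.
move=> i; have [mF finF] := Ffin i; split.
  by rewrite -[X in measurable X]setTI; exact: mu_.
rewrite /tcons_measure /pushforward -comp_preimage.
by have -> : ucs \o tcons = id by apply/funext => ty; exact: uK.
Qed.

HB.instance Definition _ := Measure_isSigmaFinite.Build _ _ _ tcons_measure tcons_measure_sigma_finite.

End TupleCons.

(** The product measure integrates the measures of sections, which is the recursion of
    [lebesgue_tuple] after pulling back along cons. Sigma-finiteness is carried through the
    induction because the product construction requires it. *)
Lemma lebesgue_tuple_measure m : exists mu : {sigma_finite_measure set (m.-tuple R) -> \bar R},
  (mu : set (m.-tuple R) -> \bar R) = @lebesgue_tuple R m.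
Proof.
elim: m => [|m [mu muE]].
  by exists [the {sigma_finite_measure set (0.-tuple R) -> \bar R} of \d_([tuple] : 0.-tuple R)].
exists [the {sigma_finite_measure set (m.+1.-tuple R) -> \bar R} of tcons_measure mu].
apply/funext => A; rewrite /= /tcons_measure /pushforward /product_measure1 /=.
apply: eq_integral => t _ /=; rewrite muE; congr lebesgue_tuple.
by apply/seteqP; split => y /=; rewrite /xsection /= inE.
Qed.

Variable m : nat.

Lemma lebesgue_tuple0 : @lebesgue_tuple R m set0 = 0%E.
Proof. by have [mu <-] := lebesgue_tuple_measure m; rewrite measure0. Qed.

Lemma lebesgue_tuple_ge0 A : (0 <= @lebesgue_tuple R m A)%E.
Proof. by have [mu <-] := lebesgue_tuple_measure m; rewrite measure_ge0. Qed.

Lemma lebesgue_tuple_sigma_additive : semi_sigma_additive (@lebesgue_tuple R m).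
Proof. have [mu <-] := lebesgue_tuple_measure m; exact: measure_semi_sigma_additive. Qed.

HB.instance Definition _ := isMeasure.Build _ _ _ (@lebesgue_tuple R m)
  lebesgue_tuple0 lebesgue_tuple_ge0 lebesgue_tuple_sigma_additive.

(** Tuples carry the product sigma-algebra, whereas continuity refers to the sup norm of row
    vectors. An open set is a countable union of cubes with rational centre and radius 1 / (k + 1),
    each a finite intersection of coordinate preimages. *)
Lemma continuous_measurable_tuple (f : 'rV[R]_m -> R) (x : 'rV[R]_m) : continuous f ->
  measurable_fun setT (fun y : m.-tuple R => f (x - row_of_tuple y)).
Proof.
move=> fc; apply: (measurability _ (RGenOpens.measurableE R)) => _ /= [_ [a [b ->]] <-].
pose U := [set v : 'rV[R]_m | `]a, b[%classic (f (x - v))].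
have Uo : open U.
  rewrite (_ : U = (fun v : 'rV[R]_m => f (x - v)) @^-1` `]a, b[%classic) //.
  apply: open_comp; last exact: interval_open.
  move=> v _; have h : (x - w) @[w --> v] --> x - v by apply: (@differentiable_continuous _ _ _ _ (fun w : 'rV[R]_m => x - w)); apply: differentiableB.
  exact: (cvg_comp _ _ h (fc _)).
pose bx (qk : 'rV[rat]_m * nat) := [set y : m.-tuple R | forall i, `|tnth y i - ratr (qk.1 0 i)| < (qk.2.+1%:R)^-1].
pose F (qk : 'rV[rat]_m * nat) := [set y | (forall v : 'rV[R]_m, (forall i, `|v 0 i - ratr (qk.1 0 i)| < (qk.2.+1%:R)^-1) -> U v) /\ bx qk y].
have -> : setT `&` (fun y : m.-tuple R => f (x - row_of_tuple y)) @^-1` `]a, b[%classic = \bigcup_qk F qk.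
  rewrite setTI; apply/seteqP; split => y /=; last first.
    by move=> [[q k] _ [qU qy]]; apply: qU => i; rewrite mxE; exact: qy.
  move=> yU; have /nbhs_ballP[e /= e0 eU] : nbhs (row_of_tuple y) U by exact: open_nbhs_nbhs.
  have [k ke] : exists k : nat, (k.+1%:R)^-1 < e / 2.
    have := @near_infty_natSinv_lt R (PosNum (divr_gt0 e0 (ltr0Sn R 1))).
    by move=> /filter_ex.
  have /all_sig[q qP] (i : 'I_m) : {q : rat | `|tnth y i - ratr q| < (k.+1%:R)^-1}.
    apply: cid; have [//|q] := @rat_in_itvoo R (tnth y i - (k.+1%:R)^-1) (tnth y i + (k.+1%:R)^-1).
      by rewrite ltrBlDr -addrA ltrDl addr_gt0 // invr_gt0.
    rewrite in_itv /= => /andP[h1 h2]; exists q; rewrite distrC ltr_norml.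
    by move: (k.+1%:R^-1) h1 h2 => w h1 h2; apply/andP; split; lra.
  exists (\row_i q i, k) => //; split; last by move=> i; rewrite /= mxE.
  move=> v vq; apply: eU; apply/ballE.
  apply: (@le_lt_trans _ _ (2 * (k.+1%:R)^-1)); last by move: (k.+1%:R^-1) ke => w; lra.
  apply: rV_norm_le => [|i]; first by rewrite mulr_ge0.
  have := vq i; have := qP i; rewrite /= !mxE => h1 h2.
  have -> : v 0 i - tnth y i = (v 0 i - ratr (q i)) - (tnth y i - ratr (q i)) by ring.
  by apply: le_trans (ler_normB _ _) _; move: (k.+1%:R^-1) h1 h2 => w; lra.
apply: countable_bigcupT_measurable; first exact: countableP.
move=> [q k]; rewrite /F /=; pose P := forall v : 'rV[R]_m, (forall i, `|v 0 i - ratr (q 0 i)| < (k.+1%:R)^-1) -> U v.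
have [p|np] := pselect P; last first.
  by rewrite (_ : [set y | _] = set0) //; apply/seteqP; split => y //= -[].
rewrite (_ : [set y | _] = \bigcap_(i in [set: 'I_m]) [set y : m.-tuple R | `|tnth y i - ratr (q 0 i)| < (k.+1%:R)^-1]); last first.
  by apply/seteqP; split => y /=; [move=> [_ h] i _; exact: h | move=> h; split => // i; exact: h].
apply: fin_bigcap_measurable; first exact: finite_finset.
move=> i _.
have mt : measurable_fun setT (fun y : m.-tuple R => `|tnth y i - ratr (q 0 i)|).
  apply: measurableT_comp => //; apply: measurable_funB => //; exact: measurable_tnth.
have := mt measurableT `]-oo, (k.+1%:R)^-1[%classic (measurable_itv _); rewrite setTI.
congr measurable; apply/seteqP; split => y /=; rewrite in_itv //=.
Qed.

End TupleMeasure.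

(** * Differentiation of convolutions under the integral *)

Section Convolutions.
Context {R : realType} {m : nat}.
Implicit Types (Q f : 'rV[R]_m -> R) (x : 'rV[R]_m).

Local Notation mu := (@lebesgue_tuple R m).
Local Notation measurable_tuple Q := (measurable_fun setT (fun y : m.-tuple R => Q (row_of_tuple y))).

Lemma convolutionE Q f x : convolution Q f x = \int[mu]_y conv_integrand Q f x y.
Proof. by []. Qed.

Lemma smooth_continuous f : smooth f -> continuous f.
Proof. by move=> fs x; apply: differentiable_continuous; exact: (fs [::]). Qed.

Lemma smooth_pd f l : smooth f -> smooth (pd l f).
Proof. by move=> fs l' x; rewrite -foldr_cat; exact: fs. Qed.

Lemma smooth_laplacian f : smooth f -> smooth (laplacian f).
Proof.
by move=> fs; apply: (@smooth_on_smooth _ _ _ 1) => // x0; apply: (smooth_on_laplacian _).1; exact: smooth_smooth_on.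
Qed.

Lemma smooth_iter_laplacian k f : smooth f -> smooth (iter k laplacian f).
Proof. by move=> fs; elim: k => //= k; exact: smooth_laplacian. Qed.

Lemma conv_integrand_measurable Q f x : measurable_tuple Q -> continuous f ->
  measurable_fun setT (conv_integrand Q f x).
Proof. by move=> mQ fc; apply: measurable_funM => //; exact: continuous_measurable_tuple. Qed.

Lemma dominated_integrable (F g : m.-tuple R -> R) : measurable_fun setT F ->
  mu.-integrable setT (EFin \o g) -> (forall y, `|F y| <= g y) -> mu.-integrable setT (EFin \o F).
Proof.
move=> mF ig Fg; apply: (le_integrable _ _ _ ig) => //; first exact/measurable_EFinP.
by move=> y _ /=; rewrite lee_fin; apply: le_trans (Fg y) (ler_norm _).
Qed.

Lemma dominated_Rintegral (F g : m.-tuple R -> R) : measurable_fun setT F ->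
  mu.-integrable setT (EFin \o g) -> (forall y, `|F y| <= g y) ->
  `|\int[mu]_y F y| <= \int[mu]_y g y.
Proof.
move=> mF ig Fg; have iF := dominated_integrable mF ig Fg.
apply: le_trans (le_normr_Rintegral measurableT iF) _.
apply: le_Rintegral => //.
by have := integrable_abse iF; apply: eq_integrable.
Qed.

Lemma Rintegral_sum (I : Type) (s : seq I) (F : I -> m.-tuple R -> R) :
  (forall i, mu.-integrable setT (EFin \o F i)) ->
  mu.-integrable setT (EFin \o (fun y => \sum_(i <- s) F i y)) /\
  \int[mu]_y (\sum_(i <- s) F i y) = \sum_(i <- s) \int[mu]_y F i y.
Proof.
move=> iF; elim: s => [|i s [IH1 IH2]].
  rewrite big_nil; under eq_fun do rewrite big_nil.
  split; first exact: integrable0.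
  by rewrite /Rintegral integral0.
rewrite big_cons -IH2 -RintegralD //; split.
  have := integrableD measurableT (iF i) IH1; apply: eq_integrable => // y _.
  by rewrite /= big_cons.
by apply: eq_Rintegral => y _; rewrite big_cons.
Qed.

Lemma smooth_convolvable_common Q f (ls : seq (seq 'I_m)) x0 : smooth_convolvable Q f ->
  exists (r : R) (g : m.-tuple R -> R), [/\ 0 < r, mu.-integrable setT (EFin \o g) &
    forall l, l \in ls -> forall y x, ball x0 r x -> `|conv_integrand Q (pd l f) x y| <= g y].
Proof.
move=> [mQ H]; elim: ls => [|l ls [r [g [r0 ig gB]]]].
  by exists 1, (fun=> 0); split => //; exact: integrable0.
have [r' [g' [r'0 ig' g'B]]] := H l x0.
exists (Num.min r r'), (fun y => `|g y| + `|g' y|); split.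
- by rewrite lt_min r0.
- have := integrableD measurableT (integrable_abse ig) (integrable_abse ig').
  exact: eq_integrable.
- move=> l'; rewrite inE => /orP[/eqP -> | l'l] y x xr.
    have xr' : ball x0 r' x by apply: le_ball xr; rewrite ge_min lexx orbT.
    by apply: le_trans (g'B y x xr') _; apply: le_trans (ler_norm _) _; rewrite lerDr.
  have xr' : ball x0 r x by apply: le_ball xr; rewrite ge_min lexx.
  by apply: le_trans (gB l' l'l y x xr') _; apply: le_trans (ler_norm _) _; rewrite lerDl.
Qed.

Lemma smooth_convolvable_integrable Q f l x : smooth_convolvable Q f -> smooth f ->
  mu.-integrable setT (EFin \o conv_integrand Q (pd l f) x).
Proof.
move=> H fs; have [r [g [r0 ig gB]]] := H.2 l x.
apply: dominated_integrable ig _; last by move=> y; apply: gB; exact: ballxx.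
by apply: conv_integrand_measurable H.1 _; apply: smooth_continuous; exact: smooth_pd.
Qed.

Lemma smooth_convolvable_pd Q f l : smooth_convolvable Q f -> smooth_convolvable Q (pd l f).
Proof.
move=> [mQ H]; split => // l' x0; have [r [g [r0 ig gB]]] := H (l' ++ l) x0.
by exists r, g; split => // y x xr; rewrite -foldr_cat; exact: gB.
Qed.

Lemma translate_smooth_on f (y : 'rV[R]_m) x0 (r : R) : smooth f -> smooth_on (fun x => f (x - y)) x0 r.
Proof.
move=> fs l x _; have -> : pd l (fun x => f (x - y)) = (fun x => pd l f (x - y)).
  by apply/funext => z; exact: pd_translate.
apply: (@differentiable_comp _ _ _ _ (fun x : 'rV[R]_m => x - y) (pd l f)); last exact: fs.
exact: differentiableB.
Qed.

Lemma conv_integrand_smooth_on Q f y x0 (r : R) : smooth f ->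
  smooth_on (fun x => conv_integrand Q f x y) x0 r /\
  forall l x, ball x0 r x -> pd l (fun x => conv_integrand Q f x y) x = conv_integrand Q (pd l f) x y.
Proof.
move=> fs; have fts := @translate_smooth_on f (row_of_tuple y) x0 r fs.
have [h1 h2] := pd_scale (Q (row_of_tuple y)) fts; split => // l x xr.
by rewrite [LHS](h2 l x xr) pd_translate.
Qed.

(** The quadratic remainder of the integrand is dominated by one g for all second partials near x0;
    integrating it gives the quadratic remainder of the convolution. *)
Lemma convolution_differentiable Q f x0 : smooth_convolvable Q f -> smooth f ->
  differentiable (convolution Q f) x0 /\
  forall A, partial A (convolution Q f) x0 = convolution Q (partial A f) x0.
Proof.
move=> cQ fs; have [mQ _] := cQ.
have [r [g [r0 ig gB]]] := smooth_convolvable_common [seq [:: AA.1; AA.2] | AA <- enum [the finType of ('I_m * 'I_m)%type]] x0 cQ.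
have g2 A A' y x : ball x0 r x -> `|conv_integrand Q (pd [:: A; A'] f) x y| <= g y.
  by apply: gB; apply/mapP; exists (A, A'); rewrite ?mem_enum.
have i0 x : mu.-integrable setT (EFin \o conv_integrand Q f x) := smooth_convolvable_integrable [::] x cQ fs.
have i1 A x : mu.-integrable setT (EFin \o conv_integrand Q (partial A f) x) := smooth_convolvable_integrable [:: A] x cQ fs.
apply: (@quad_differentiable R m _ _ _ (m%:R ^+ 2 * \int[mu]_y g y) r r0) => v vr.
have xr : ball x0 r x0 by exact: ballxx.
have vxr : ball x0 r (v + x0) by apply/ballE; rewrite addrK.
pose E y := conv_integrand Q f (v + x0) y - conv_integrand Q f x0 y -
  \sum_(A < m) v 0 A * conv_integrand Q (partial A f) x0 y.
have iz A : mu.-integrable setT (EFin \o (fun y => v 0 A * conv_integrand Q (partial A f) x0 y)).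
  have := integrableZl measurableT (v 0 A) (i1 A x0); exact: eq_integrable.
have [is_ sE] := Rintegral_sum (index_enum 'I_m) iz.
have ib : mu.-integrable setT (EFin \o (fun y => conv_integrand Q f (v + x0) y - conv_integrand Q f x0 y)).
  have := integrableB measurableT (i0 (v + x0)) (i0 x0); exact: eq_integrable.
have -> : convolution Q f (v + x0) - convolution Q f x0 - \sum_(A < m) v 0 A * convolution Q (partial A f) x0 =
    \int[mu]_y E y.
  rewrite /E RintegralB // RintegralB // sE; congr (_ - _); apply: eq_bigr => A _.
  by rewrite RintegralZl.
have iE : mu.-integrable setT (EFin \o E) by have := integrableB measurableT ib is_; exact: eq_integrable.
have igz : mu.-integrable setT (EFin \o (fun y => (m%:R ^+ 2 * `|v| ^+ 2) * g y)).
  have := integrableZl measurableT (m%:R ^+ 2 * `|v| ^+ 2) ig; exact: eq_integrable.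
rewrite mulrAC -RintegralZl //; apply: dominated_Rintegral igz _.
  by move/integrableP : iE => [/measurable_EFinP].
move=> y; have [h1 h2] := conv_integrand_smooth_on Q y x0 r fs.
have := @smooth_on_quad R m _ x0 r (g y) x0 v h1 _ xr vxr.
rewrite mulrAC /E => H; have {H} := H _.
rewrite (eq_bigr (fun A => v 0 A * conv_integrand Q (partial A f) x0 y)); last first.
  by move=> A _; rewrite -[partial A _ x0]/(pd [:: A] _ x0) h2.
by apply => A A' z zr; rewrite h2 //; exact: g2.
Qed.

Lemma convolution_pd Q f l : smooth_convolvable Q f -> smooth f ->
  pd l (convolution Q f) = convolution Q (pd l f).
Proof.
move=> cQ fs; elim: l => //= A l ->; apply/funext => x.
exact: (convolution_differentiable x (smooth_convolvable_pd l cQ) (smooth_pd l fs)).2.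
Qed.

Lemma convolution_smooth Q f : smooth_convolvable Q f -> smooth f -> smooth (convolution Q f).
Proof.
move=> cQ fs l x; rewrite convolution_pd //.
exact: (convolution_differentiable x (smooth_convolvable_pd l cQ) (smooth_pd l fs)).1.
Qed.

Lemma conv_integrand_sum Q (I : Type) (s : seq I) (F : I -> 'rV[R]_m -> R) x y :
  conv_integrand Q (fun x => \sum_(i <- s) F i x) x y = \sum_(i <- s) conv_integrand Q (F i) x y.
Proof. by rewrite /conv_integrand mulr_sumr. Qed.

Lemma smooth_convolvable_laplacian Q f : smooth_convolvable Q f -> smooth f ->
  smooth_convolvable Q (laplacian f) /\ laplacian (convolution Q f) = convolution Q (laplacian f).
Proof.
move=> cQ fs; split; last first.
  apply/funext => x; rewrite convolutionE.
  have [_] := Rintegral_sum (index_enum 'I_m) (fun A => smooth_convolvable_integrable [:: A; A] x cQ fs).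
  rewrite (_ : (fun y => \sum_(i <- _) _) = conv_integrand Q (laplacian f) x); last first.
    by apply/funext => y; rewrite -conv_integrand_sum.
  move=> ->; apply: eq_bigr => A _.
  by rewrite -[partial A _ x]/(pd [:: A; A] _ x) convolution_pd.
split; first exact: cQ.1.
move=> l x0.
have [r [g [r0 ig gB]]] := smooth_convolvable_common [seq l ++ [:: A; A] | A <- enum 'I_m] x0 cQ.
exists r, (fun y => m%:R * g y); split => //.
  have := integrableZl measurableT m%:R ig; exact: eq_integrable.
move=> y x xr.
have -> : pd l (laplacian f) = (fun x => \sum_(A < m) pd (l ++ [:: A; A]) f x).
  by apply/funext => z; apply: ((smooth_on_laplacian (@smooth_smooth_on _ _ _ z 1 fs)).2 l z); exact: ballxx.
rewrite conv_integrand_sum; apply: le_trans (ler_norm_sum _ _ _) _.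
apply: le_trans (_ : \sum_(A < m) g y <= _); last by rewrite sumr_const card_ord mulr_natl.
by apply: ler_sum => A _; apply: gB => //; apply/mapP; exists A; rewrite ?mem_enum.
Qed.

Lemma convolution_iter_laplacian Q f k : smooth_convolvable Q f -> smooth f ->
  smooth_convolvable Q (iter k laplacian f) /\
  iter k laplacian (convolution Q f) = convolution Q (iter k laplacian f).
Proof.
move=> cQ fs; elim: k => //= k [IH1 ->].
exact: smooth_convolvable_laplacian IH1 (smooth_iter_laplacian k fs).
Qed.

Lemma convolutionZ Q f (c : R) x : mu.-integrable setT (EFin \o conv_integrand Q f x) ->
  convolution Q (fun x => c * f x) x = c * convolution Q f x.
Proof.
move=> iF; rewrite !convolutionE -RintegralZl //.
by apply: eq_Rintegral => y _; rewrite /conv_integrand mulrCA.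
Qed.

Lemma convolution0 f x : convolution (fun _ => 0) f x = 0.
Proof.
rewrite convolutionE; under eq_Rintegral do rewrite /conv_integrand mul0r.
by rewrite /Rintegral integral0.
Qed.

(** C = 2 / r is common to all y; only the amplitude g y varies, and it is integrable. Integration
    over y therefore keeps Cauchy estimates. *)
Lemma analytic_convolvable_bd Q f x0 : analytic_convolvable Q f -> smooth f ->
  exists (r C : R) (g : m.-tuple R -> R), [/\ 0 < r, 0 <= C, mu.-integrable setT (EFin \o g),
    forall y, 0 <= g y &
    forall y, smooth_bd (fun x => conv_integrand Q f x y) x0 r (cauchy_bd (g y) C)].
Proof.
move=> [mQ /(_ x0)[r [g [r0 ig gP]]]] fs.
have gB y : smooth_bd (fun x => conv_integrand Q f x y) x0 (r / 2) (cauchy_bd (g y) (2 / r)).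
  exact: powerseries_smooth_bd (gP y).
exists (r / 2), (2 / r), g; split => //; rewrite ?divr_gt0 ?divr_ge0 ?(ltW r0) // => y.
have := (gB y).2 [::] x0 (ballxx _ _); rewrite divr_gt0 // => /(_ isT) h.
by apply: le_trans (normr_ge0 _) (le_trans h _); rewrite /cauchy_bd expr0 fact0 !mulr1.
Qed.

Lemma analytic_smooth_convolvable Q f : analytic_convolvable Q f -> smooth f -> smooth_convolvable Q f.
Proof.
move=> aQ fs; split => [|l x0]; first exact: aQ.1.
have [r [C [g [r0 C0 ig g0 gB]]]] := analytic_convolvable_bd x0 aQ fs.
exists r, (fun y => (C ^+ size l * (size l)`!%:R) * g y); split => //.
  have := integrableZl measurableT (C ^+ size l * (size l)`!%:R) ig; exact: eq_integrable.
move=> y x xr; have := (gB y).2 l x xr.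
by rewrite (conv_integrand_smooth_on Q y x0 r fs).2 // /cauchy_bd mulrC.
Qed.

Lemma convolution_smooth_bd Q f x0 : analytic_convolvable Q f -> smooth f ->
  exists r M C : R, [/\ 0 < r, 0 <= M, 0 <= C & smooth_bd (convolution Q f) x0 r (cauchy_bd M C)].
Proof.
move=> aQ fs; have cQ := analytic_smooth_convolvable aQ fs.
have [r [C [g [r0 C0 ig g0 gB]]]] := analytic_convolvable_bd x0 aQ fs.
exists r, (\int[mu]_y g y), C; split => //; first by apply: Rintegral_ge0.
split; first by apply: smooth_smooth_on; exact: convolution_smooth.
move=> l x xr; rewrite convolution_pd // convolutionE.
have igz : mu.-integrable setT (EFin \o (fun y => (C ^+ size l * (size l)`!%:R) * g y)).
  have := integrableZl measurableT (C ^+ size l * (size l)`!%:R) ig; exact: eq_integrable.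
have -> : cauchy_bd (\int[mu]_y g y) C (size l) = \int[mu]_y ((C ^+ size l * (size l)`!%:R) * g y).
  by rewrite RintegralZl // /cauchy_bd mulrC.
apply: dominated_Rintegral igz _.
  by apply: conv_integrand_measurable cQ.1 _; apply: smooth_continuous; exact: smooth_pd.
move=> y; have := (gB y).2 l x xr.
by rewrite (conv_integrand_smooth_on Q y x0 r fs).2 // /cauchy_bd mulrC.
Qed.

Lemma conv_integrand_iter_laplacian Q f k x y : smooth f ->
  iter k laplacian (fun x => conv_integrand Q f x y) x = conv_integrand Q (iter k laplacian f) x y.
Proof.
move=> fs; suff -> : iter k laplacian (fun x => conv_integrand Q f x y) =
    (fun x => conv_integrand Q (iter k laplacian f) x y) by [].
elim: k => //= k ->; apply/funext => z.
rewrite [RHS]conv_integrand_sum; apply: eq_bigr => A _.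
have [_ H] := conv_integrand_smooth_on Q y z 1 (smooth_iter_laplacian k fs).
by rewrite -[partial A _ z]/(pd [:: A; A] _ z) H //; exact: ballxx.
Qed.

(* Term by term, by domination with the majorants of the germs [x |-> Q y * f (x - y)]. *)
Lemma convolution_lap_psum n e Q f x0 : (0 < n)%N -> coef_bd n e ->
  analytic_convolvable Q f -> smooth f -> exists r T : R, [/\ 0 < r, 0 < T &
  forall t x, `|t| <= T -> ball x0 r x ->
    [/\ forall y, Q y != 0 -> cvgn (pseries (fun k => lap_series e f k (x - y)) t),
        mu.-integrable setT (EFin \o conv_integrand Q (lap_psum e f t) x) &
        convolution Q (lap_psum e f t) x = lap_psum e (convolution Q f) t x]].
Proof.
move=> n0 eB aQ fs; have cQ := analytic_smooth_convolvable aQ fs.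
have [r [C [g [r0 C0 ig g0 gB]]]] := analytic_convolvable_bd x0 aQ fs.
pose q : R := 4 * m%:R * (8 * n%:R) * C ^+ 2.
have q0 : 0 <= q by rewrite /q mulr_ge0 ?sqr_ge0 // !mulr_ge0.
exists r, (rad q); split => //; first exact: rad_gt0.
move=> t x tq xr; have [qt _ _] := rad_le q0 tq.
have qt1 : q * `|t| < 1 by apply: le_lt_trans qt _; lra.
pose a y k := e k * conv_integrand Q (iter k laplacian f) x y.
have aB y k : `|a y k| <= 2 * g y * q ^+ k.
  have := series_bd_coef0 (lap_series_bd_coef (g0 y) C0 eB (gB y)) xr k.
  by rewrite /lap_series -[X in `|X|]/(e k * iter k laplacian (fun x => conv_integrand Q f x y) x)
    conv_integrand_iter_laplacian.
have aE y k : a y k = Q (row_of_tuple y) * lap_series e f k (x - row_of_tuple y).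
  by rewrite /a /conv_integrand /lap_series mulrCA.
(* Only the product of Q and the translate of f is controlled, so convergence of the series of f is
   recovered by dividing by a nonzero value of Q. *)
have cvgQ y : Q (row_of_tuple y) != 0 ->
    cvgn (pseries (fun k => lap_series e f k (x - row_of_tuple y)) t).
  move=> Q0; have ca := pseries_bd_cvg q0 (aB y) qt1.
  have := @pseries_lin R _ _ (Q (row_of_tuple y))^-1 0 _ _ _ ca ca.
  set b := (X in pseries X t); have -> : b = (fun k => lap_series e f k (x - row_of_tuple y)).
    by apply/funext => k; rewrite /b mul0r addr0 aE mulKf.
  by move=> h; apply/cvg_ex; eexists; exact: h.
have lima y : pseries (a y) t N @[N --> \oo] --> conv_integrand Q (lap_psum e f t) x y.
  rewrite /conv_integrand; have [Q0|Q0] := eqVneq (Q (row_of_tuple y)) 0.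
    rewrite Q0 mul0r; apply: cvg_near_cst; apply: nearW => N.
    by rewrite /pseries /series /= big1 // => k _; rewrite aE Q0 !mul0r.
  have := @pseries_lin R _ _ (Q (row_of_tuple y)) 0 _ _ _ (cvgQ y Q0) (cvgQ y Q0).
  rewrite mul0r addr0; set b := (X in pseries X t); have -> // : b = a y.
  by apply/funext => k; rewrite /b mul0r addr0 aE.
have im k : mu.-integrable setT (EFin \o conv_integrand Q (iter k laplacian f) x).
  have [ck _] := convolution_iter_laplacian k cQ fs.
  exact: (smooth_convolvable_integrable [::] x ck (smooth_iter_laplacian k fs)).
have ik k : mu.-integrable setT (EFin \o (fun y => a y k * t ^+ k)).
  have := integrableZl measurableT (e k * t ^+ k) (im k); apply: eq_integrable => // y _.
  by rewrite /= /a -EFinM; congr EFin; ring.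
have sN N := Rintegral_sum (index_iota 0 N) ik.
have FB y N : `|pseries (a y) t N| <= 2 * (2 * g y) := pseries_le N q0 (aB y) qt.
have ig4 : mu.-integrable setT (EFin \o (fun y => 2 * (2 * g y))).
  have := integrableZl measurableT (2 * 2) ig; apply: eq_integrable => // y _.
  by rewrite /= -EFinM mulrA.
have mF N : measurable_fun setT (fun y => (pseries (a y) t N)%:E).
  by have /integrableP[] := (sN N).1.
have mL : measurable_fun setT (EFin \o conv_integrand Q (lap_psum e f t) x).
  apply: (emeasurable_fun_cvg _ _ mF) => y _.
  by apply: cvg_EFin; [exact: nearW | exact: lima].
have ae1 : {ae mu, forall y, setT y -> (pseries (a y) t N)%:E @[N --> \oo] --> (conv_integrand Q (lap_psum e f t) x y)%:E}.
  by apply: aeW => y _; apply: cvg_EFin; [exact: nearW | exact: lima].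
have ae2 : {ae mu, forall y N, setT y -> (`|(pseries (a y) t N)%:E| <= (2 * (2 * g y))%:E)%E}.
  by apply: aeW => y N _; rewrite lee_fin; exact: FB.
have [h1 _ h3] := dominated_convergence measurableT mF mL ae1 ig4 ae2.
split => //.
  move=> y Qy; have yE : y = row_of_tuple [tuple y 0 i | i < m].
    by apply/rowP => i; rewrite mxE tnth_mktuple.
  by rewrite yE; apply: cvgQ; rewrite -yE.
have h3' : \int[mu]_y pseries (a y) t N @[N --> \oo] --> convolution Q (lap_psum e f t) x.
  apply: (@fine_cvg _ _ \oo _ (fun N => \int[mu]_y (pseries (a y) t N)%:E)%E).
  by rewrite /convolution fineK //; exact: integrable_fin_num.
apply/esym/cvg_lim => //; apply: cvg_trans h3'; apply: near_eq_cvg; apply: nearW => N.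
rewrite [LHS](sN N).2; apply: eq_bigr => k _.
have -> : \int[mu]_y (a y k * t ^+ k) = \int[mu]_y ((e k * t ^+ k) * conv_integrand Q (iter k laplacian f) x y).
  by apply: eq_Rintegral => y _; rewrite /a; ring.
rewrite RintegralZl // /lap_series -[X in _ = X * _]/(e k * iter k laplacian (convolution Q f) x).
by rewrite (convolution_iter_laplacian k cQ fs).2 mulrAC.
Qed.

End Convolutions.

(** * Formal solutions *)

Section FormalSolutions.
Context {R : realType} {m p : nat}.
Implicit Types (n s k j : nat) (l : R) (x : 'rV[R]_m) (u : 'rV[R]_p).
Implicit Types (H alpha Q : 'rV[R]_m -> 'rV[R]_p -> R).
Implicit Types a : @formal R m p.

(** At exponent l + 1 the operator is the factor 2 (l + 1) - n, which exposes the resonance, plus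
    couplings to the logarithmic degrees j + 1 and j + 2 only. *)
Lemma formal_equationP n H a : formal_equation n H a <-> forall l j x u,
  (2 * (l + 1) - n%:R) * ((l + 1) * a (l + 1) j x u + j.+1%:R * a (l + 1) j.+1 x u) +
  2 * j.+1%:R * ((l + 1) * a (l + 1) j.+1 x u + j.+2%:R * a (l + 1) j.+2 x u) =
  laplacian (fun y => formal_const H l j y u + a l j y u) x.
Proof.
have E l j x u : 2 * formal_derive (formal_derive a) (l - 1) j x u + (2 - n%:R) * formal_derive a l j x u =
    (2 * (l + 1) - n%:R) * ((l + 1) * a (l + 1) j x u + j.+1%:R * a (l + 1) j.+1 x u) +
    2 * j.+1%:R * ((l + 1) * a (l + 1) j.+1 x u + j.+2%:R * a (l + 1) j.+2 x u).
  by rewrite /formal_derive !subrK; ring.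
split=> h l j x u; first by apply/eqP; rewrite -subr_eq0 -E; apply/eqP; exact: h.
by rewrite E h subrr.
Qed.

Lemma log_series_degree a l : formal_log_series a -> exists J : nat, forall j, (J <= j)%N -> a l j = (fun _ _ => 0).
Proof.
move=> [_ /(_ l)/finite_seqP[s sE]]; exists (\max_(q <- s) q.2).+1 => j Jj.
apply: contrapT => nz; have : [set` s] (l, j) by rewrite -sE.
move=> /= ls; move: Jj; rewrite ltnNge => /negP; apply.
by rewrite (big_rem _ ls) /=; exact: leq_maxl.
Qed.

Lemma smooth_subZ (f g : 'rV[R]_m -> R) (c : R) : smooth f -> smooth g -> smooth (fun x => f x + c * g x).
Proof.
move=> fs gs; apply: (@smooth_on_smooth _ _ _ 1) => // x0.
have -> : (fun x => f x + c * g x) = c *: g + f by apply/funext => x; rewrite addrC.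
by apply: (pd_lin _ _ _).1; exact: smooth_smooth_on.
Qed.

Lemma smooth0 : smooth (fun _ : 'rV[R]_m => 0 : R).
Proof. by apply: (@smooth_on_smooth _ _ _ 1) => // x0; exact: (pd_cst 0 x0 1).1. Qed.

Lemma smoothZ (f : 'rV[R]_m -> R) (c : R) : smooth f -> smooth (fun x => c * f x).
Proof.
move=> fs; have := smooth_subZ c smooth0 fs.
by congr smooth; apply/funext => x; rewrite add0r.
Qed.

Lemma smooth_lap k H u : smooth_x H -> smooth (lap k H ^~ u).
Proof. by move=> Hs; apply: smooth_iter_laplacian; exact: Hs. Qed.

Lemma laplacian_smooth_lin (f g : 'rV[R]_m -> R) (c : R) x : smooth f -> smooth g ->
  laplacian (fun x => f x + c * g x) x = laplacian f x + c * laplacian g x.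
Proof.
move=> fs gs; have -> : (fun x => f x + c * g x) = c *: g + f by apply/funext => y; rewrite addrC.
rewrite (laplacian_lin c (@smooth_smooth_on _ _ _ x 1 gs) (@smooth_smooth_on _ _ _ x 1 fs)); last exact: ballxx.
by rewrite addrC.
Qed.

Lemma laplacian0 x : laplacian (fun _ : 'rV[R]_m => 0 : R) x = 0.
Proof. by rewrite laplacian_cst0. Qed.

Lemma laplacianZ (f : 'rV[R]_m -> R) (c : R) x : smooth f -> laplacian (fun x => c * f x) x = c * laplacian f x.
Proof.
by move=> fs; exact: (laplacian_scale c (@smooth_smooth_on _ _ _ x 1 fs) (ballxx _ ltr01)).
Qed.

(* Both solutions agree below order [k]; at order [l] in (k, k+1] the equation is then
   homogeneous and triangular in the logarithmic degree, and regular unless 2 l = n. *)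
Lemma formal_solution_unique n H a b : (0 < n)%N ->
  formal_solution n H a -> formal_solution n H b ->
  (forall x u, a (n%:R / 2) 0%N x u = b (n%:R / 2) 0%N x u) -> a = b.
Proof.
move=> n0 [al aeq a0] [bl beq b0] ab.
have as_ l j : smooth_x (a l j) by exact: al.1.
have bs_ l j : smooth_x (b l j) by exact: bl.1.
suff main k l j x u : l <= k%:R -> a l j x u = b l j x u.
  apply/funext => l; apply/funext => j; apply/funext => x; apply/funext => u.
  by apply: (main (Num.truncn `|l|).+1); apply: le_trans (ler_norm _) _; apply/ltW/truncnS_gt.
elim: k l j x u => [|k IH] l j x u lk; first by rewrite a0 // b0.
have [lk'|kl] := leP l k%:R; first exact: IH.
have l0 : 0 < l by apply: le_lt_trans kl.
pose d i := a l i x u - b l i x u.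
have deq i : (2 * l - n%:R) * (l * d i + i.+1%:R * d i.+1) +
    2 * i.+1%:R * (l * d i.+1 + i.+2%:R * d i.+2) = 0.
  have /formal_equationP/(_ (l - 1) i x u) := aeq; have /formal_equationP/(_ (l - 1) i x u) := beq.
  rewrite !subrK.
  have -> : (fun y => formal_const H (l - 1) i y u + a (l - 1) i y u) =
            (fun y => formal_const H (l - 1) i y u + b (l - 1) i y u).
    apply/funext => y; rewrite IH // lerBlDr natr1 //.
  move=> <- /eqP; rewrite -subr_eq0 => /eqP <-; rewrite /d; ring.
have [J dJ] : exists J : nat, forall i, (J <= i)%N -> d i = 0.
  have [Ja Ha] := log_series_degree l al; have [Jb Hb] := log_series_degree l bl.
  by exists (maxn Ja Jb) => i; rewrite geq_max => /andP[ia ib]; rewrite /d Ha // Hb // subrr.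
(* Descending induction on the logarithmic degree, which is bounded at each exponent. *)
have down (e : nat -> R) : (exists J' : nat, forall i, (J' <= i)%N -> e i = 0) ->
    (forall i, e i.+1 = 0 -> e i = 0) -> forall i, e i = 0.
  move=> [J' eJ] eS i; have : forall k' i, (J' <= i + k')%N -> e i = 0.
    elim=> [|k' IHk] i'; first by rewrite addn0; exact: eJ.
    by rewrite addnS -addSn => h; apply: eS; exact: IHk h.
  by move=> h; apply: (h J'); rewrite leq_addl.
have zmul i : d i.+1 = 0 -> l * d i + i.+1%:R * d i.+1 = 0 -> d i = 0.
  by move=> ->; rewrite mulr0 addr0 => /eqP; rewrite mulf_eq0 (gt_eqF l0) => /eqP.
suff : d j = 0 by move/eqP; rewrite subr_eq0 => /eqP.
(* At the resonance the first factor drops out. The remaining relation kills all logarithmic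
   coefficients, and the one without logarithm agrees by assumption. *)
have [ln|ln] := eqVneq (2 * l - n%:R) 0.
  have d1 i : l * d i.+1 + i.+2%:R * d i.+2 = 0.
    have := deq i; rewrite ln mul0r add0r => /eqP; rewrite mulf_eq0 => /orP[|/eqP //].
    by rewrite mulf_eq0 !pnatr_eq0.
  have dS : forall i, d i.+1 = 0.
    apply: (down (fun i => d i.+1)); first by exists J => i Ji; apply: dJ; apply: leqW.
    by move=> i di; apply: zmul.
  case: j => [|j]; last exact: dS.
  have -> : d 0%N = 0 by rewrite /d (_ : l = n%:R / 2) ?ab ?subrr //; move: ln; lra.
  by [].
(* Off the resonance the descent runs twice: first for the coefficients of the derivative, then for
   d itself. *)
have b0' : forall i, l * d i + i.+1%:R * d i.+1 = 0.
  apply: down; first by exists J => i Ji; rewrite !dJ ?(leqW Ji) // !mulr0 addr0.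
  move=> i bi; have := deq i; rewrite bi mulr0 addr0 => /eqP.
  by rewrite mulf_eq0 (negbTE ln) => /eqP.
by apply: down => [|i di]; [exists J | exact: zmul].
Qed.

Lemma smooth_lapZ k H u (c : R) : smooth_x H -> smooth (fun y => lap k H y u * c).
Proof.
move=> Hs; have := smoothZ c (smooth_lap k u Hs).
by congr smooth; apply/funext => x; rewrite mulrC.
Qed.

Lemma laplacian_lap k H u (c : R) x : smooth_x H ->
  laplacian (fun y => lap k H y u * c) x = lap k.+1 H x u * c.
Proof.
move=> Hs; rewrite mulrC -[RHS](laplacianZ c x (smooth_lap k u Hs)).
by congr (laplacian _ x); apply/funext => y; rewrite mulrC.
Qed.

Lemma nat_succ l : l \isn't a Num.nat -> l + 1 \is a Num.nat -> l = - 1.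
Proof.
move=> ln /natrP[[|k] e]; first by apply/eqP; rewrite -addr_eq0 e.
by move: ln; rewrite (_ : l = k%:R) ?natr_nat //; move: e; rewrite -natr1; lra.
Qed.

Lemma odd_half_not_nat n k : odd n -> (k%:R - n%:R / 2 : R) \isn't a Num.nat.
Proof.
move=> on; apply/negP => /natrP[i e].
have : (2 * k)%:R = (n + 2 * i)%:R :> R by rewrite natrD !natrM -e; lra.
by move/eqP; rewrite eqr_nat => /eqP h; have := congr1 odd h; rewrite oddD !oddM on.
Qed.

Lemma odd_expansionE1 n H alpha k x u :
  odd_expansion n H alpha k%:R 0 x u = lap k H x u * dminus n k.
Proof.
rewrite /odd_expansion natr_nat natrK /dminus; case: k => [|k] /=; first by rewrite mul0r mulr0.
by rewrite mul1r.
Qed.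

Lemma odd_expansionE2 n H alpha k x u : odd n ->
  odd_expansion n H alpha (n%:R / 2 + k%:R) 0 x u = lap k alpha x u * dplus n k.
Proof.
move=> on; rewrite /odd_expansion.
have -> : (n%:R / 2 + k%:R \is a @Num.nat R) = false.
  apply/negbTE/negP => /natrP[i e]; have := odd_half_not_nat i on; rewrite -e.
  by rewrite (_ : _ - _ = k%:R) ?natr_nat //; ring.
by rewrite (_ : _ + _ - _ = k%:R) ?natr_nat ?natrK //; ring.
Qed.

Lemma odd_expansionE0 n H alpha l j x u :
  (j != 0%N) || (l \isn't a Num.nat) && (l - n%:R / 2 \isn't a Num.nat) ->
  odd_expansion n H alpha l j x u = 0.
Proof.
rewrite /odd_expansion; case: j => //= /andP[/negbTE -> /negbTE ->] //.
Qed.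

Lemma odd_expansion_smooth n H alpha l j : odd n -> smooth_x H -> smooth_x alpha ->
  smooth_x (odd_expansion n H alpha l j).
Proof.
move=> on Hs als u.
have z : (j != 0%N) || (l \isn't a Num.nat) && (l - n%:R / 2 \isn't a Num.nat) ->
    smooth (odd_expansion n H alpha l j ^~ u).
  move=> h; have := smooth0; congr smooth.
  by apply/funext => x; rewrite odd_expansionE0.
have [j0|j0] := eqVneq j 0%N; last by apply: z; rewrite j0.
rewrite j0 in z *; have [/natrP[k ->]|ln] := boolP (l \is a Num.nat).
  have := smooth_lapZ k u (dminus n k) Hs; congr smooth.
  by apply/funext => x; rewrite odd_expansionE1.
have [/natrP[k e]|ln'] := boolP (l - n%:R / 2 \is a Num.nat); last by apply: z; rewrite ln ln'.
rewrite (_ : l = n%:R / 2 + k%:R); last by rewrite -e; ring.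
have := smooth_lapZ k u (dplus n k) als; congr smooth.
by apply/funext => x; rewrite odd_expansionE2.
Qed.

Lemma finite_below (o L : R) :
  finite_set [set q : R * nat | q.1 <= L /\ exists2 k : nat, q.1 = o + k%:R & (q.2 <= 1)%N].
Proof.
pose N := (Num.truncn `|L - o|).+1.
apply: (@sub_finite_set _ _ ((fun kj : nat * nat => (o + kj.1%:R, kj.2)) @` (`I_N `*` `I_2))).
  move=> [l j] /= [lL [k lk j1]]; exists (k, j); last by rewrite lk.
  split => //=; rewrite -(ltr_nat R); apply: le_lt_trans (truncnS_gt `|L - o|).
  by apply: le_trans (ler_norm _); move: lL; rewrite lk; lra.
by apply: finite_image; apply: finite_setX; exact: finite_II.
Qed.

Lemma odd_expansion_solution n H alpha : odd n -> smooth_x H -> smooth_x alpha ->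
  formal_solution n H (odd_expansion n H alpha).
Proof.
move=> on Hs als; have n0 : (0 < n)%N by case: (n) on.
split; last first.
- move=> l j x u l0; have [j0|j0] := eqVneq j 0%N; last by apply: odd_expansionE0; rewrite j0.
  rewrite j0; have [/natrP[k lk]|ln] := boolP (l \is a Num.nat).
    have k0 : k = 0%N by apply/eqP; rewrite -(@eqr_nat R) eq_le ler0n -lk l0.
    by rewrite lk k0 odd_expansionE1 /dminus mul0r mulr0.
  apply: odd_expansionE0; rewrite ln orFb; apply/negP => /natr_ge0.
  by have : 0 < n%:R :> R by [rewrite ltr0n]; move: l0; lra.
- apply/formal_equationP => l j x u.
  have zj l' i y v : i != 0%N -> odd_expansion n H alpha l' i y v = 0.
    by move=> i0; apply: odd_expansionE0; rewrite i0.
  have [j0|j0] := eqVneq j 0%N; last first.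
    rewrite !zj // !mulr0 !addr0 !mulr0 addr0.
    rewrite (_ : (fun y => _) = (fun _ => 0)) ?laplacian0 //.
    apply/funext => y; rewrite zj // addr0 /formal_const.
    by rewrite (negbTE j0) andbF.
  rewrite j0 !(zj _ 1%N) // !(zj _ 2%N) // !mulr0 !addr0 mulr0 addr0.
  have [/natrP[k lk]|ln] := boolP (l \is a Num.nat).
    rewrite lk natr1 odd_expansionE1.
    have -> : (fun y => formal_const H k%:R 0 y u + odd_expansion n H alpha k%:R 0 y u) =
        (fun y => lap k H y u * (denom_minus n k)^-1).
      apply/funext => y; rewrite odd_expansionE1 /formal_const andbT pnatr_eq0.
      case: (k) => [|k'] /=; last by rewrite add0r /dminus mul1r.
      by rewrite /dminus mul0r mulr0 addr0 /denom_minus big_nil fact0 mulr1 invr1 mulr1.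
    rewrite laplacian_lap //; have := dminusS k n0 (or_introl (conj on erefl) : log_coef n 0 (0 : R)).
    by rewrite mulr0 mulr0 subr0 => <-; ring.
  have fc0 y : formal_const H l 0 y u = 0.
    by rewrite /formal_const andbT; case: eqP ln => // ->; rewrite (natr_nat R 0).
  (* Only l = -1 leads into the natural exponents from outside, and there the factor l + 1 = 0
     annihilates the left side. *)
  have [l1n|l1n] := boolP (l + 1 \is a Num.nat).
    have lN1 := nat_succ ln l1n; have l10 : l + 1 = 0 by rewrite lN1 addNr.
    rewrite l10 mul0r mulr0.
    rewrite (_ : (fun y => _) = (fun _ => 0)) ?laplacian0 //; apply/funext => y.
    rewrite fc0 add0r odd_expansionE0 // ln /=; apply/negP => /natr_ge0.
    by rewrite lN1; have : 0 < n%:R :> R by [rewrite ltr0n]; lra.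
  have [/natrP[k lk]|ln'] := boolP (l - n%:R / 2 \is a Num.nat).
    have {}lk : l = n%:R / 2 + k%:R by rewrite -lk; ring.
    have -> : l + 1 = n%:R / 2 + k.+1%:R by rewrite lk -addrA natr1.
    have -> : (fun y => formal_const H l 0 y u + odd_expansion n H alpha l 0 y u) =
        (fun y => lap k alpha y u * dplus n k).
      by apply/funext => y; rewrite fc0 add0r lk odd_expansionE2.
    by rewrite odd_expansionE2 // laplacian_lap // -(dplusS k n0); field.
  rewrite (_ : (fun y => _) = (fun _ => 0)) ?laplacian0; last first.
    by apply/funext => y; rewrite fc0 add0r odd_expansionE0 // ln.
  (* Here l + 1 = n/2: the equation leaves alpha free because 2 (l + 1) - n vanishes. *)
  have [l1n'|l1n'] := boolP (l + 1 - n%:R / 2 \is a Num.nat).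
    have -> : 2 * (l + 1) - n%:R = 0; last by rewrite mul0r.
    have : l - n%:R / 2 = - 1 by apply: nat_succ => //; move: l1n'; rewrite addrAC.
    lra.
  by rewrite odd_expansionE0 ?mulr0 // l1n.
- split=> [l j|L]; first exact: odd_expansion_smooth.
  apply: (@sub_finite_set _ _ ([set q : R * nat | q.1 <= L /\ exists2 k : nat, q.1 = 0 + k%:R & (q.2 <= 1)%N] `|`
    [set q : R * nat | q.1 <= L /\ exists2 k : nat, q.1 = n%:R / 2 + k%:R & (q.2 <= 1)%N])).
    move=> [l j] /= [lL nz].
    have z : (j != 0%N) || (l \isn't a Num.nat) && (l - n%:R / 2 \isn't a Num.nat) -> False.
      by move=> h; apply: nz; apply/funext => x; apply/funext => u; exact: odd_expansionE0.
    have [j0|j0] := eqVneq j 0%N; last by case: z; rewrite j0.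
    have [/natrP[k lk]|ln] := boolP (l \is a Num.nat).
      by left; split => //; exists k; rewrite ?add0r ?j0.
    have [/natrP[k lk]|ln'] := boolP (l - n%:R / 2 \is a Num.nat); last by case: z; rewrite ln ln' orbT.
    by right; split => //; exists k; rewrite -?lk ?j0 //; ring.
  by rewrite finite_setU; split; exact: finite_below.
Qed.

Lemma odd_formal_solutions n H : odd n -> smooth_x H -> forall a,
  formal_solution n H a <-> exists alpha, smooth_x alpha /\ a = odd_expansion n H alpha.
Proof.
move=> on Hs a; have n0 : (0 < n)%N by case: (n) on.
split=> [as_|[al [als ->]]]; last exact: odd_expansion_solution.
have [[sm _] _ _] := as_.
exists (a (n%:R / 2) 0%N); split; first exact: sm.
apply: (formal_solution_unique n0 as_ (odd_expansion_solution on Hs (sm _ _))) => x u.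
have := odd_expansionE2 H (a (n%:R / 2) 0%N) 0 x u on; rewrite addr0 => ->.
by rewrite dplus0 mulr1.
Qed.

Lemma iter_laplacian_smooth_lin k (f g : 'rV[R]_m -> R) (c : R) : smooth f -> smooth g ->
  iter k laplacian (fun x => f x + c * g x) = (fun x => iter k laplacian f x + c * iter k laplacian g x).
Proof.
move=> fs gs; elim: k => //= k ->; apply/funext => x.
by rewrite laplacian_smooth_lin //; exact: smooth_iter_laplacian.
Qed.

#[local] Arguments lap : simpl never.

(** * Formal solutions for even n *)

Section EvenExpansion.
Variables (s : nat) (H : 'rV[R]_m -> 'rV[R]_p -> R).
Hypotheses (s0 : (0 < s)%N) (Hs : smooth_x H).
Implicit Type al : 'rV[R]_m -> 'rV[R]_p -> R.

Local Notation n := (2 * s)%N.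
Local Notation c := (c_ n s : R).
Local Notation Q0 := (fun _ _ => 0).

Lemma even_expansion_nonnat al Q l j x u : l \isn't a Num.nat -> even_expansion n s H al Q l j x u = 0.
Proof. by rewrite /even_expansion => /negbTE ->. Qed.

Lemma even_expansion_low al Q k j x u : (k < s)%N ->
  even_expansion n s H al Q k%:R j x u = if j == 0%N then lap k H x u * dminus n k else 0.
Proof.
move=> ks; rewrite /even_expansion natr_nat natrK ks /dminus; case: j => //=.
by case: (k) => [|k'] /=; rewrite ?mul0r ?mulr0 ?mul1r.
Qed.

Lemma even_expansion_high al k j x u :
  even_expansion n s H al Q0 (s + k)%:R j x u =
    match j with
    | 0%N => lap k al x u * dplus n k - c * q_ n k * (lap (s + k) H x u * dplus n k)
    | 1%N => c * (lap (s + k) H x u * dplus n k)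
    | _ => 0
    end.
Proof.
rewrite /even_expansion natr_nat natrK ltnNge leq_addr /= addKn.
by case: j => [|[|j]] //; rewrite convolution0 mulr0 addr0.
Qed.

Lemma even_expansion_smooth al l j : smooth_x al -> smooth_x (even_expansion n s H al Q0 l j).
Proof.
move=> als u; have [/natrP[i ->]|ln] := boolP (l \is a Num.nat); last first.
  by have := smooth0; congr smooth; apply/funext => x; rewrite even_expansion_nonnat.
have [is_|si] := ltnP i s.
  have [j0|j0] := boolP (j == 0%N).
    have := smooth_lapZ i u (dminus n i) Hs; congr smooth.
    by apply/funext => x; rewrite even_expansion_low // j0.
  have := smooth0; congr smooth; apply/funext => x.
  by rewrite even_expansion_low // (negbTE j0).
rewrite -(subnKC si); set k := (i - s)%N.
have h1 := smooth_lapZ k u (dplus n k) als.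
have h2 := smooth_lapZ (s + k) u (dplus n k) Hs.
case: j => [|[|j]].
- have := smooth_subZ (- (c * q_ n k)) h1 h2; congr smooth.
  by apply/funext => x; rewrite even_expansion_high mulNr.
- have := smoothZ c h2; congr smooth.
  by apply/funext => x; rewrite even_expansion_high.
- by have := smooth0; congr smooth; apply/funext => x; rewrite even_expansion_high.
Qed.

Lemma denom_minus_inv_pred : (denom_minus n s.-1)^-1 = n%:R * c :> R.
Proof. by rewrite c_E. Qed.

Lemma even_expansion_solution al : smooth_x al -> formal_solution n H (even_expansion n s H al Q0).
Proof.
move=> als; have n0 : (0 < n)%N by rewrite muln_gt0.
have nsc : log_coef n s c by right.
split; last first.
- move=> l j x u l0; have [/natrP[k lk]|ln] := boolP (l \is a Num.nat); last exact: even_expansion_nonnat.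
  have k0 : k = 0%N by apply/eqP; rewrite -(@eqr_nat R) eq_le ler0n -lk l0.
  rewrite lk k0 even_expansion_low //; case: ifP => // _.
  by rewrite /dminus mul0r mulr0.
- apply/formal_equationP => l j x u.
  have [/natrP[i li]|ln] := boolP (l \is a Num.nat); last first.
    rewrite [X in _ = laplacian X _](_ : _ = (fun _ => 0)) ?laplacian0; last first.
      apply/funext => y; rewrite even_expansion_nonnat // addr0 /formal_const.
      by case: eqP ln => // ->; rewrite (natr_nat R 0).
    have z i : even_expansion n s H al Q0 (l + 1) i x u = 0.
      have [l1n|l1n] := boolP (l + 1 \is a Num.nat); last exact: even_expansion_nonnat.
      have -> : l + 1 = 0%N%:R by rewrite (nat_succ ln l1n) addNr.
      rewrite even_expansion_low //; case: ifP => // _.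
      by rewrite /dminus mul0r mulr0.
    by rewrite !z !mulr0 !addr0 !mulr0 addr0.
  have fcE y : formal_const H l j y u = if j == 0%N then (i == 0%N)%:R * H y u else 0.
    rewrite /formal_const li pnatr_eq0; case: (i == 0%N); case: (j == 0%N) => //=; rewrite ?mul1r ?mul0r //.
  rewrite li natr1.
  have [i1s|] := ltnP i.+1 s.
    rewrite !even_expansion_low //= !mulr0 !addr0.
    have [j0|j0] := boolP (j == 0%N); last first.
      rewrite [X in _ = laplacian X _](_ : _ = (fun _ => 0)) ?laplacian0 ?mulr0 ?addr0 ?mulr0 //.
      by apply/funext => y; rewrite -li fcE li even_expansion_low ?(ltnW i1s) // (negbTE j0) addr0.
    rewrite mulr0 addr0.
    rewrite [X in _ = laplacian X _](_ : _ = (fun y => lap i H y u * (denom_minus n i)^-1)); last first.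
      apply/funext => y; rewrite -li fcE li even_expansion_low ?(ltnW i1s) // j0.
      case: (i) => [|i'] /=; last by rewrite mul0r add0r denom_minus_dminus.
      by rewrite mul1r /dminus mul0r mulr0 addr0 /denom_minus big_nil fact0 mulr1 invr1 mulr1.
    rewrite laplacian_lap //; have := dminusS i n0 nsc.
    by rewrite (ltn_eqF i1s) mul0r subr0 => <-; ring.
  (* At the resonance i + 1 = s the first factor vanishes, and the coefficient c Delta^s H of the
     logarithm has to produce the source, which it does by the choice of c. *)
  rewrite leq_eqVlt => /orP[/eqP si|si].
    rewrite -si; have si' : (i < s)%N by rewrite si.
    have -> : s%:R = (s + 0)%:R :> R by rewrite addn0.
    rewrite !even_expansion_high addn0 dplus0 mulr1.
    have -> : 2 * s%:R - n%:R = 0 :> R by rewrite natrM subrr.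
    rewrite mul0r add0r.
    case: j fcE => [|j] fcE /=.
      rewrite [X in _ = laplacian X _](_ : _ = (fun y => lap i H y u * (denom_minus n i)^-1)); last first.
        apply/funext => y; rewrite -li fcE li even_expansion_low //=.
        case: (i) => [|i'] /=; last by rewrite mul0r add0r denom_minus_dminus.
        by rewrite mul1r /dminus mul0r mulr0 addr0 /denom_minus big_nil fact0 mulr1 invr1 mulr1.
      rewrite laplacian_lap // -si (_ : i = s.-1) ?denom_minus_inv_pred ?si //.
      by rewrite natrM; ring.
    rewrite [X in _ = laplacian X _](_ : _ = (fun _ => 0)) ?laplacian0; last first.
      by apply/funext => y; rewrite -li fcE li even_expansion_low //= addr0.
    by rewrite !mulr0 addr0 mulr0.
  have [k ik] : exists k, i = (s + k)%N by exists (i - s)%N; rewrite subnKC.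
  rewrite ik -addnS !even_expansion_high.
  have i0 : (i == 0%N) = false by rewrite ik; apply/negbTE; rewrite -lt0n addn_gt0 s0.
  have iE y : formal_const H l j y u + even_expansion n s H al Q0 (s + k)%:R j y u =
      even_expansion n s H al Q0 (s + k)%:R j y u.
    by rewrite fcE i0 mul0r if_same add0r.
  rewrite -ik -li [X in _ = laplacian X _](_ : _ = (fun y => even_expansion n s H al Q0 (s + k)%:R j y u)); last first.
    by apply/funext => y; rewrite -iE li ik.
  have snE : (s + k.+1)%:R * 2 - n%:R = 2 * k.+1%:R :> R by rewrite natrD natrM; ring.
  (* Beyond s, degree 1 is the recursion of [dplus], while degree 0 also receives a contribution of
     degree 1, which the recursion [qS] of q_k compensates. *)
  case: j {iE fcE} => [|[|j]].
  - rewrite [X in _ = laplacian X _](_ : _ = (fun y => lap k al y u * dplus n k + (- (c * q_ n k)) * (lap (s + k) H y u * dplus n k))); last first.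
      by apply/funext => y; rewrite even_expansion_high; ring.
    rewrite laplacian_smooth_lin; [|exact: smooth_lapZ|exact: smooth_lapZ].
    rewrite !laplacian_lap // -addnS -(dplusS k n0).
    have := @qS R _ k n0; rewrite natrD natrM.
    move: (lap k.+1 al x u) (lap (s + k.+1) H x u) (dplus n k.+1) (q_ n k.+1) (q_ n k) (k.+1%:R : R) (s%:R : R) c.
    move=> a b d q1 q0 k1 S C E.
    transitivity (a * (k1 * (2 * k1 + 2 * S) * d) - C * b * d * (k1 * (2 * k1 + 2 * S) * q1) + C * b * d * (2 * S + 4 * k1)).
      by ring.
    by rewrite E; ring.
  - rewrite [X in _ = laplacian X _](_ : _ = (fun y => c * (lap (s + k) H y u * dplus n k))); last first.
      by apply/funext => y; rewrite even_expansion_high.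
    rewrite laplacianZ; last exact: smooth_lapZ.
    rewrite laplacian_lap // -addnS -(dplusS k n0) natrD natrM.
    by move: (lap (s + k.+1) H x u) (dplus n k.+1) => b d; ring.
  - rewrite [X in _ = laplacian X _](_ : _ = (fun _ => 0)) ?laplacian0; last first.
      by apply/funext => y; rewrite even_expansion_high.
    by rewrite !mulr0 !addr0 !mulr0 addr0.
- split=> [l j|L]; first exact: even_expansion_smooth.
  apply: (@sub_finite_set _ _ [set q : R * nat | q.1 <= L /\ exists2 k : nat, q.1 = 0 + k%:R & (q.2 <= 1)%N]); last exact: finite_below.
  move=> [l j] /= [lL nz]; split => //.
  have [/natrP[i li]|ln] := boolP (l \is a Num.nat); last first.
    by case: nz; apply/funext => x; apply/funext => u; exact: even_expansion_nonnat.
  exists i; first by rewrite add0r.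
  rewrite leqNgt; apply/negP => j1; case: nz; apply/funext => x; apply/funext => u; rewrite li.
  have [is_|si] := ltnP i s; first by rewrite even_expansion_low //; case: (j) j1.
  by rewrite -(subnKC si) even_expansion_high; case: (j) j1 => [|[]].
Qed.

Lemma fold_convolution al Q : smooth_x al -> (forall u, smooth_convolvable (Q ^~ u) (lap s H ^~ u)) ->
  let al' := fun x u => al x u + c * convolution (Q ^~ u) (lap s H ^~ u) x in
  smooth_x al' /\ even_expansion n s H al Q = even_expansion n s H al' Q0.
Proof.
move=> als cQ al'; have bs u : smooth (lap s H ^~ u) := smooth_lap s u Hs.
split=> [u|]; first by apply: smooth_subZ => //; exact: convolution_smooth.
apply/funext => l; apply/funext => j; apply/funext => x; apply/funext => u.
have [/natrP[i ->]|ln] := boolP (l \is a Num.nat); last by rewrite !even_expansion_nonnat.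
have [is_|si] := ltnP i s; first by rewrite !even_expansion_low.
rewrite -(subnKC si) even_expansion_high; set k := (i - s)%N.
rewrite /even_expansion natr_nat natrK ltnNge leq_addr /= addKn.
case: j => [|[|j]] //.
have [ck lk] := convolution_iter_laplacian k (cQ u) (bs u).
have lE : (fun y => lap (s + k) H y u / denom_plus n k) = (fun y => (denom_plus n k)^-1 * iter k laplacian (lap s H ^~ u) y).
  by apply/funext => y; rewrite mulrC /lap addnC iterD.
rewrite lE convolutionZ; last exact: (smooth_convolvable_integrable [::] x ck (smooth_iter_laplacian k (bs u))).
rewrite [lap k al' x u]/lap iter_laplacian_smooth_lin // -?lk; last exact: convolution_smooth.
by rewrite /dplus /lap; ring.
Qed.

Lemma smooth_convolvable0 (f : 'rV[R]_m -> R) : smooth_convolvable (fun _ => 0) f.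
Proof.
split=> [|l x0]; first exact: measurable_cst.
exists 1, (fun=> 0); split => //; first exact: integrable0.
by move=> y x _; rewrite /conv_integrand mul0r normr0.
Qed.

Lemma even_formal_solutions a : formal_solution n H a <-> exists alpha Q, [/\ smooth_x alpha,
  forall u, smooth_convolvable (Q ^~ u) (lap s H ^~ u) & a = even_expansion n s H alpha Q].
Proof.
have n0 : (0 < n)%N by rewrite muln_gt0.
split=> [as_|[al [Q [als cQ ->]]]]; last first.
  by have [als' ->] := fold_convolution als cQ; exact: even_expansion_solution.
have [[sm _] _ _] := as_.
exists (a (n%:R / 2) 0%N), Q0; split => [||]; [exact: sm | by move=> u; exact: smooth_convolvable0 |].
apply: (formal_solution_unique n0 as_ (even_expansion_solution (sm _ _))) => x u.
have nE : n%:R / 2 = (s + 0)%:R :> R by rewrite addn0 natrM mulrC mulKf.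
move: (a (n%:R / 2) 0%N) => g; rewrite nE even_expansion_high dplus0 /q_ big_nil.
by rewrite mulr0 mul0r subr0 mulr1.
Qed.

End EvenExpansion.

End FormalSolutions.

(** * Solutions and expansions *)

Section CauchyOn.
Context {R : realType} {m : nat}.
Implicit Types (f g al : 'rV[R]_m -> R) (x : 'rV[R]_m) (r t T : R).

Lemma near2_right (P : R -> 'rV[R]_m -> Prop) x0 :
  (\forall t \near 0^'+ & x \near x0, P t x) <->
  exists T r, [/\ 0 < T, 0 < r & forall t x, 0 < t < T -> ball x0 r x -> P t x].
Proof.
split=> [[[A B] [/= A0 B0] AB]|[T [r [T0 r0 H]]]].
  have [T /= T0 TA] := A0; have /nbhs_ballP[r /= r0 rB] := B0.
  exists T, r; split => // t x /andP[t0 tT] xr; apply: (AB (t, x)); split => /=.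
    by apply: TA => //=; rewrite sub0r normrN gtr0_norm.
  exact: rB.
exists ([set t | 0 < t < T], ball x0 r) => /=; last by move=> [t x] [/= tT xr]; exact: H.
by split; [exact: near_0_right | exact: nbhsx_ballx].
Qed.

Lemma near2_0 (P : R -> 'rV[R]_m -> Prop) x0 :
  (\forall t \near (0 : R) & x \near x0, P t x) <->
  exists T r, [/\ 0 < T, 0 < r & forall t x, `|t| < T -> ball x0 r x -> P t x].
Proof.
split=> [[[A B] [/= A0 B0] AB]|[T [r [T0 r0 H]]]].
  have /nbhs_ballP[T /= T0 TA] := A0; have /nbhs_ballP[r /= r0 rB] := B0.
  exists T, r; split => // t x tT xr; apply: (AB (t, x)); split => /=; last exact: rB.
  by apply: TA; rewrite /ball /= sub0r normrN.
exists (ball (0 : R) T, ball x0 r) => /=.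
  by split; exact: nbhsx_ballx.
move=> [t x] [/= tT xr]; apply: H => //; by move: tT; rewrite /ball /= sub0r normrN.
Qed.

Definition cauchy_on f x0 r := exists M C : R, [/\ 0 <= M, 0 <= C & smooth_bd f x0 r (cauchy_bd M C)].

Lemma cauchy_on_seq f x0 r B : cauchy_seq B -> smooth_bd f x0 r B -> cauchy_on f x0 r.
Proof. by move=> [M [C [M0 C0 BM]]] fB; exists M, C; split => //; exact: smooth_bdS fB. Qed.

Lemma cauchy_on_le f x0 r r' : r' <= r -> cauchy_on f x0 r -> cauchy_on f x0 r'.
Proof. by move=> rr [M [C [M0 C0 fB]]]; exists M, C; split => //; exact: smooth_bdS fB. Qed.

Lemma cauchy_on_eq f g x0 r : (forall y, ball x0 r y -> f y = g y) -> cauchy_on f x0 r -> cauchy_on g x0 r.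
Proof. by move=> fg [M [C [M0 C0 fB]]]; exists M, C; split => //; exact: smooth_bd_eq fB. Qed.

Lemma cauchy_on_laplacian f x0 r : cauchy_on f x0 r -> cauchy_on (laplacian f) x0 r.
Proof.
move=> [M [C [M0 C0 fB]]]; apply: cauchy_on_seq (smooth_bd_laplacian fB).
apply: cauchy_seq_scale => //.
have := cauchy_seq_shift 2 (cauchy_seq_bd M0 C0).
by congr cauchy_seq; apply/funext => j; rewrite addn2.
Qed.

Lemma cauchy_on_cst (c : R) x0 r : cauchy_on (cst c) x0 r.
Proof.
exists `|c|, 0; split => //; have [h1 h2] := @pd_cst R m c x0 r; split => //.
move=> [|A l] x xr; first by rewrite /= /cauchy_bd expr0 fact0 !mulr1.
by rewrite (h2 (A :: l)) // normr0 cauchy_bd_ge0.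
Qed.

Lemma cauchy_on_analytic f x0 : (exists r, 0 < r /\ cauchy_on f x0 r) ->
  exists r M : R, 0 < r /\ powerseries_le f x0 r M.
Proof.
move=> [r [r0 [M [C [M0 C0 fB]]]]].
have [r' [M' [r'0 H]]] := @cauchy_powerseries R m r M C r0 M0 C0.
by exists r', M'; split => //; exact: H.
Qed.

Lemma powerseries_cauchy (r M : R) x0 : 0 < r -> exists M' C : R, [/\ 0 <= M', 0 <= C & forall f,
  powerseries_le f x0 r M -> smooth_bd f x0 (r / 2) (cauchy_bd M' C)].
Proof.
move=> r0; exists `|M|, (2 / r); split; rewrite ?divr_ge0 ?(ltW r0) // => f fM.
apply: smooth_bdS (powerseries_smooth_bd r0 fM) => // j.
rewrite ler_wpM2r ?ler_norm // mulr_ge0 ?exprn_ge0 ?divr_ge0 ?(ltW r0) //.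
Qed.

Lemma analytic_cauchy_on f x0 : analytic f -> exists r, 0 < r /\ cauchy_on f x0 r.
Proof.
move=> /(_ x0)[r [M [r0 fM]]]; have [M' [C [M0 C0 H]]] := powerseries_cauchy M x0 r0.
by exists (r / 2); split; [rewrite divr_gt0 | exists M', C; split => //; exact: H].
Qed.

Lemma analytic_smooth f : analytic f -> smooth f.
Proof.
move=> fa l x; have [r [r0 [M [C [_ _ fB]]]]] := analytic_cauchy_on x fa.
by apply: fB.1; exact: ballxx.
Qed.

End CauchyOn.

(** * Solutions near a point are expansions *)

Section LocalExpansion.
Context {R : realType} {m : nat}.
Variables (n s : nat) (c : R).
Hypotheses (n2 : (2 <= n)%N) (s0 : (0 < s)%N) (nsc : log_coef n s c).
Implicit Types (f g al : 'rV[R]_m -> R) (x : 'rV[R]_m) (r t T : R).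

Local Notation nu := (n%:R / 2 : R).
Local Notation z := (fun t : R => t `^ nu).

Lemma expansion_bds f al x0 r : cauchy_on (laplacian f) x0 r -> cauchy_on al x0 r ->
  exists A C q, [/\ 0 <= A, 0 <= C, 0 <= q & [/\ series_bd (lap_series (dminus n) f) x0 r A C q,
    series_bd (lap_series (dplus n) al) x0 r A C q,
    series_bd (lap_series (dplus n) (iter s laplacian f)) x0 r A C q &
    series_bd (lap_series (fun k => q_ n k * dplus n k) (iter s laplacian f)) x0 r A C q]].
Proof.
move=> [M1 [C1 [M10 C10 fB]]] [M2 [C2 [M20 C20 aB]]].
have [M [C [M0 C0 h1 h2]]] := cauchy_bd_join M10 C10 M20 C20.
apply: (expansion_series_bd n2 s0 M0 C0); first exact: smooth_bdS fB.
exact: smooth_bdS aB.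
Qed.

Lemma expansion_family f al x0 r : smooth_on f x0 r -> cauchy_on (laplacian f) x0 r -> cauchy_on al x0 r ->
  exists T M C, [/\ 0 < T, 0 <= M, 0 <= C & [/\
    forall t, 0 < t < T -> smooth_bd (expansion n s c f al t) x0 r (cauchy_bd M C),
    family_eq n T x0 r (expansion n s c f al) (laplacian f) &
    forall x, ball x0 r x -> expansion n s c f al t x @[t --> 0^'+] --> (0 : R)]].
Proof.
move=> fs fB aB; have als : smooth_on al x0 r by have [? [? [_ _ []]]] := aB.
have [A [C [q [A0 C0 q0 [h1 h2 h3 h4]]]]] := expansion_bds fB aB.
exists (rad q), ((1 + `|c| * 2 + `|c| + 1) * (2 * A)), C; split => //.
- exact: rad_gt0.
- by rewrite !mulr_ge0 ?addr_ge0 ?mulr_ge0.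
split.
- by move=> t; exact: expansion_smooth_bd.
- exact: (expansion_eq n2 nsc s0 A0 C0 q0).
- by move=> x xr; exact: (expansion_cvg0 n2 c A0 C0 q0 h1 h2 h3 h4 xr).
Qed.

Lemma lap_psum_cvg e f x0 r : coef_bd n e -> cauchy_on f x0 r ->
  exists T M C, [/\ 0 < T, 0 <= M, 0 <= C & [/\
    forall t, `|t| <= T -> smooth_bd (lap_psum e f t) x0 r (cauchy_bd M C),
    forall t x, `|t| <= T -> ball x0 r x -> cvgn (pseries (fun k => lap_series e f k x) t) &
    forall l x, ball x0 r x -> pd l (lap_psum e f t) x @[t --> (0 : R)] --> pd l (lap_series e f 0) x]].
Proof.
move=> eB [M [C [M0 C0 fB]]]; have h := lap_series_bd_coef M0 C0 eB fB.
have q0 : 0 <= 4 * m%:R * (8 * n%:R) * C ^+ 2 by rewrite mulr_ge0 ?sqr_ge0 // !mulr_ge0.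
have A0 : 0 <= 2 * M by rewrite mulr_ge0.
have C20 : 0 <= 2 * C by rewrite mulr_ge0.
exists (rad (4 * m%:R * (8 * n%:R) * C ^+ 2)), (2 * (2 * M)), (2 * C); split; rewrite ?rad_gt0 ?mulr_ge0 //.
have H t (tq : `|t| <= _) := lap_psum_family A0 C20 q0 h tq.
split=> [t tq|t x tq xr|l x xr]; first exact: (H t tq).1.
  exact: ((H t tq).2 [::] x xr).1.
exact: (lap_psum_continuous0 A0 C20 q0 h).
Qed.

Lemma hom_cvg0 al x0 r l x : cauchy_on al x0 r -> ball x0 r x ->
  pd l (hom n al t) x @[t --> (0 : R)] --> pd l al x.
Proof.
move=> aB xr; have [T [M [C [_ _ _ [_ _ H]]]]] := lap_psum_cvg (@dplus_bd R n (ltnW n2)) aB.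
have als : smooth_on al x0 r by have [? [? [_ _ []]]] := aB.
have -> : pd l al x = pd l (lap_series (dplus n) al 0) x; last exact: H.
by rewrite /lap_series dplus0 scale1r.
Qed.

Lemma iter_laplacian_cst0 k : iter k laplacian (cst 0 : 'rV[R]_m -> R) = cst 0.
Proof. by elim: k => //= k ->; exact: laplacian_cst0. Qed.

Lemma lap_psum_cst0 (e : nat -> R) t x : lap_psum e (cst 0) t x = 0.
Proof.
apply/cvg_lim => //; apply: cvg_near_cst; apply: nearW => N.
rewrite /pseries /series /= big1 // => k _.
by rewrite /lap_series iter_laplacian_cst0 scaler0 mul0r.
Qed.

Lemma expansion_cst0 al t x : expansion n s c (cst 0) al t x = z t * hom n al t x.
Proof.
rewrite /expansion /logp /reg /hom /qhom iter_laplacian_cst0 !lap_psum_cst0.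
by rewrite mulr0 subrr mulr0 addr0 add0r.
Qed.

Lemma expansion_al f al t x : expansion n s c f al t x = expansion n s c f (cst 0) t x + z t * hom n al t x.
Proof. by rewrite /expansion /hom lap_psum_cst0; ring. Qed.

Lemma lap_psum_eq_ball e f g x0 r t x : (forall y, ball x0 r y -> f y = g y) -> ball x0 r x ->
  lap_psum e f t x = lap_psum e g t x.
Proof.
move=> fg xr; congr (psum _ t); apply/funext => k.
by rewrite /lap_series -[LHS]/(e k * iter k laplacian f x) (iter_laplacian_eq_ball k fg xr).
Qed.

(** The parts built from f cancel; dividing by z and letting t tend to 0 recovers the free
    coefficient from [hom]. *)
Lemma expansion_inj f al al' x0 r T x : 0 < T -> cauchy_on al x0 r -> cauchy_on al' x0 r -> ball x0 r x ->
  (forall t, 0 < t < T -> expansion n s c f al t x = expansion n s c f al' t x) -> al x = al' x.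
Proof.
move=> T0 aB aB' xr H.
have h := cvg_at_right_filter (hom_cvg0 (l := [::]) aB xr).
have h' := cvg_at_right_filter (hom_cvg0 (l := [::]) aB' xr).
apply: (@cvg_unique _ _ ((hom n al t x) @[t --> 0^'+]) _ _ _ h) => //.
apply: cvg_trans h'; apply: near_eq_cvg; near=> t.
have tT : 0 < t < T by near: t; exact: near_0_right.
have := H t tT; rewrite expansion_al [RHS]expansion_al => /addrI/mulfI -> //.
by rewrite gt_eqF // powR_gt0 //; case/andP: tT.
Unshelve. all: by end_near. Qed.

Lemma sub_funE f g : (fun x => f x - g x) = (- 1) *: g + f.
Proof.
apply/funext => y; rewrite -[RHS]/(- 1 * g y + f y); move: (f y) (g y) => a b; ring.
Qed.

Lemma family_eq_sub T x0 r h h' v v' : family_eq n T x0 r h v -> family_eq n T x0 r h' v' ->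
  (forall t, 0 < t < T -> smooth_on (h t) x0 r) -> (forall t, 0 < t < T -> smooth_on (h' t) x0 r) ->
  family_eq n T x0 r (fun t x => h t x - h' t x) (fun x => v x - v' x).
Proof.
move=> H H' hs hs' t x tT xr; have [_ e1] := H t x tT xr; have [_ e2] := H' t x tT xr.
have [w1 w2] := @twice_lin R n (h ^~ x) (h' ^~ x) (- 1) t T tT (fun s' sT => (H s' x sT xr).1) (fun s' sT => (H' s' x sT xr).1).
have E : (fun t => h t x - h' t x) = (fun t => h t x + -1 * h' t x) by apply/funext => t'; rewrite mulN1r.
split; first by rewrite E; exact: w1.
rewrite (etrans (congr1 (euler_op n ^~ t) E) w2) e1 e2.
rewrite (sub_funE (h t)) (laplacian_lin (- 1) (hs' t tT) (hs t tT) xr).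
by move: (laplacian (h t) x) (laplacian (h' t) x) (v x) (v' x) => *; ring.
Qed.

Lemma family_eq_le T T' x0 r r' h v : T' <= T -> r' <= r -> family_eq n T x0 r h v -> family_eq n T' x0 r' h v.
Proof.
move=> TT rr H t x /andP[t0 tT] xr; apply: H; first by rewrite t0 (lt_le_trans tT).
exact: le_ball xr.
Qed.

Lemma smooth_bd_sub f g x0 r B B' : smooth_bd f x0 r B -> smooth_bd g x0 r B' ->
  smooth_bd (fun x => f x - g x) x0 r (fun j => B j + B' j) /\
  forall l x, ball x0 r x -> pd l (fun x => f x - g x) x = pd l f x - pd l g x.
Proof.
move=> fB gB; rewrite sub_funE; split.
  apply: smooth_bdS (smooth_bd_lin (- 1) gB fB) => // j.
  by rewrite normrN1 mul1r addrC.
by move=> l x xr; rewrite ((pd_lin (- 1) gB.1 fB.1).2 l x xr); ring.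
Qed.

(* [h] minus the expansion with zero leading coefficient solves the homogeneous equation; its
   leading coefficient is [al], and what remains is flat, hence zero. *)
Lemma family_expansion h f T M C x0 r : 0 < T -> 0 <= M -> 0 <= C ->
  smooth_on f x0 r -> 0 < r ->
  (forall t, 0 < t < T -> smooth_bd (h t) x0 r (cauchy_bd M C)) ->
  family_eq n T x0 r h (laplacian f) ->
  (forall x, ball x0 r x -> h t x @[t --> 0^'+] --> (0 : R)) ->
  cauchy_on (laplacian f) x0 r /\
  exists T' al, [/\ 0 < T', cauchy_on al x0 r,
    forall x, ball x0 r x -> (h t x - expansion n s c f (cst 0) t x) / z t @[t --> 0^'+] --> al x &
    forall t x, 0 < t < T' -> ball x0 r x -> h t x = expansion n s c f al t x].
Proof.
move=> T0 M0 C0 fs r0 hB heq h0.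
have [k k0 H] := family_source_bd n2 x0 r T0.
have lfs : smooth_on (laplacian f) x0 r := (smooth_on_laplacian fs).1.
have vc : cauchy_on (laplacian f) x0 r.
  apply: cauchy_on_seq (H _ _ _ hB lfs heq).
  apply: cauchy_seq_lin => //; last exact: cauchy_seq_bd.
  have := cauchy_seq_shift 2 (cauchy_seq_bd M0 C0).
  by congr cauchy_seq; apply/funext => j; rewrite addn2.
split => //.
have [T1 [M1 [C1 [T10 M10 C10 [e1 e2 e3]]]]] := expansion_family fs vc (cauchy_on_cst 0 x0 r).
pose T2 := Num.min T T1.
have T20 : 0 < T2 by rewrite lt_min T0.
have T2T t : 0 < t < T2 -> 0 < t < T by move=> /andP[t0]; rewrite lt_min t0 => /andP[].
have T2T1 t : 0 < t < T2 -> 0 < t < T1 by move=> /andP[t0]; rewrite lt_min t0 => /andP[].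
pose d t x := h t x - expansion n s c f (cst 0) t x.
pose B j := cauchy_bd M C j + cauchy_bd M1 C1 j.
have Bc : cauchy_seq B.
  have := cauchy_seq_lin ler01 ler01 (cauchy_seq_bd M0 C0) (cauchy_seq_bd M10 C10).
  by congr cauchy_seq; apply/funext => j; rewrite !mul1r.
have B0 j : 0 <= B j by rewrite addr_ge0 ?cauchy_bd_ge0.
have dB t : 0 < t < T2 -> smooth_bd (d t) x0 r B.
  by move=> tT; exact: (smooth_bd_sub (hB t (T2T t tT)) (e1 t (T2T1 t tT))).1.
have deq : family_eq n T2 x0 r d (cst 0).
  have := @family_eq_sub T2 x0 r h (expansion n s c f (cst 0)) _ _ (family_eq_le _ (lexx r) heq) (family_eq_le _ (lexx r) e2).
  rewrite !ge_min !lexx orbT => /(_ isT isT).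
  have -> : (fun x => laplacian f x - laplacian f x) = cst 0 by apply/funext => x; rewrite subrr.
  by apply=> t tT; [exact: (hB t (T2T t tT)).1 | exact: (e1 t (T2T1 t tT)).1].
have d0 x : ball x0 r x -> d t x @[t --> 0^'+] --> (0 : R).
  by move=> xr; rewrite -[X in _ --> X](subr0 0); apply: cvgB; [exact: h0 | exact: e3].
have [T3 [B' [/andP[T30 T32] Bc' B0' dz [al [alB alcvg]]]]] := family_leading n2 T20 Bc B0 dB d0 deq.
have alc : cauchy_on al x0 r := cauchy_on_seq Bc' alB.
have c0s : smooth_on (cst 0 : 'rV[R]_m -> R) x0 r := @smooth_on_cst R m 0 x0 r.
have c0c : cauchy_on (laplacian (cst 0 : 'rV[R]_m -> R)) x0 r by rewrite laplacian_cst0; exact: cauchy_on_cst.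
have [T4 [_ [_ [T40 _ _ [_ g2 _]]]]] := expansion_family c0s c0c alc.
have [T5 [M5 [C5 [T50 M50 C50 [k1 _ _]]]]] := lap_psum_cvg (@dplus_bd R n (ltnW n2)) alc.
pose T6 := Num.min T3 (Num.min T4 T5).
have T60 : 0 < T6 by rewrite !lt_min T30 T40.
have T6P t : 0 < t < T6 -> [/\ 0 < t, 0 < t < T3, 0 < t < T2, 0 < t < T4 & `|t| <= T5].
  move=> /andP[t0 tT6]; have /and3P[h3 h4 h5] : [&& t < T3, t < T4 & t < T5] by rewrite -!lt_min.
  have t2 : 0 < t < T2 by apply/andP; split => //; exact: lt_le_trans h3 T32.
  by split; [exact: t0 | rewrite t0 | exact: t2 | rewrite t0 | rewrite gtr0_norm // ltW].
(* The homogeneous solution generated by al, that is z times [hom]; it matches d to leading order in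
   every x-derivative. *)
pose e t x := expansion n s c (cst 0) al t x.
have eE t : e t = z t *: hom n al t by apply/funext => x; rewrite /e expansion_cst0.
have eB t : 0 < t < T6 -> smooth_bd (e t) x0 r (fun j => cauchy_bd M5 C5 j * z t).
  move=> /T6P[t0 _ _ _ t5]; rewrite eE; have [p1 p2] := pd_scale (z t) (k1 t t5).1.
  split => // l x xr; rewrite p2 // normrM mulrC (ger0_norm (powR_ge0 t nu)) ler_wpM2r ?powR_ge0 //.
  exact: (k1 t t5).2.
have [M7 [C7 [M70 C70 B7]]] : cauchy_seq (fun j => B' j + cauchy_bd M5 C5 j).
  have := cauchy_seq_lin ler01 ler01 Bc' (cauchy_seq_bd M50 C50).
  by congr cauchy_seq; apply/funext => j; rewrite !mul1r.
pose d' t x := d t x - e t x.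
have sub t (tT : 0 < t < T6) := smooth_bd_sub (dz t (let: And5 _ a _ _ _ := T6P t tT in a)) (eB t tT).
have d'B t : 0 < t < T6 -> smooth_bd (d' t) x0 r (fun j => cauchy_bd M7 C7 j * z t).
  move=> tT; apply: smooth_bdS (sub t tT).1 => // j.
  by rewrite -mulrDl ler_wpM2r ?powR_ge0 // B7.
have T62 : T6 <= T2 by rewrite ge_min T32.
have T64 : T6 <= T4 by rewrite !ge_min lexx orbT.
have d'eq : family_eq n T6 x0 r d' (cst 0).
  have := @family_eq_sub T6 x0 r d e _ _ (family_eq_le T62 (lexx r) deq) (family_eq_le T64 (lexx r) g2).
  have -> : (fun x => (cst 0 : 'rV[R]_m -> R) x - laplacian (cst 0) x) = cst 0.
    by apply/funext => x; rewrite laplacian_cst0 subrr.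
  by apply => t tT; [case: (T6P t tT) => _ t3 _ _ _; exact: (dz t t3).1 | exact: (eB t tT).1].
have d'z l x : ball x0 r x -> pd l (d' t) x / z t @[t --> 0^'+] --> (0 : R).
  move=> xr; have hh := cvg_at_right_filter (hom_cvg0 (l := l) alc xr).
  rewrite -[X in _ --> X](subrr (pd l al x)); apply: cvg_trans (cvgB (alcvg l x xr) hh); apply: near_eq_cvg; near=> t.
  have tT : 0 < t < T6 by near: t; exact: near_0_right.
  have [t0 _ _ _ t5] := T6P t tT.
  rewrite (sub t tT).2 // eE (pd_scale (z t) (k1 t t5).1).2 //.
  have z0 : z t != 0 by rewrite gt_eqF // powR_gt0.
  by rewrite mulrBl [z t * _]mulrC mulfK.
have [T8 T80 flat] := family_flat n2 T60 M70 C70 d'B d'eq d'z.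
exists T8, al; split => //; first by move=> x xr; exact: (alcvg [::] x xr).
move=> t x tT xr; rewrite expansion_al -[LHS](subrK (expansion n s c f (cst 0) t x)) addrC; congr (_ + _).
have := flat t x tT xr; rewrite /d' eE => /eqP; rewrite subr_eq0 => /eqP h1.
exact: h1.
Unshelve. all: by end_near. Qed.

End LocalExpansion.

(** * Identity theorem for power series on one side of 0 *)

Section PowerSeriesIdentity.
Context {R : realType}.
Implicit Types (a b : nat -> R) (t A q T : R).

(** The terms tend to 0, hence are eventually at most 1; S takes care of the finitely many
    others. *)
Lemma pseries_cvg_bd a t : 0 < t -> cvgn (pseries a t) -> exists2 A, 0 <= A & forall k, `|a k| <= A * (t^-1) ^+ k.
Proof.
move=> t0 /cvg_series_cvg_0 c0.
have /cvgr0Pnorm_le/(_ 1 ltr01)[N _ HN] := c0.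
pose S := \sum_(i < N) `|a i * t ^+ i|; have S0 : 0 <= S by apply: sumr_ge0.
exists (1 + S); first by rewrite addr_ge0.
move=> k; rewrite exprVn ler_pdivlMr ?exprn_gt0 //.
rewrite -[X in _ * X](gtr0_norm (exprn_gt0 k t0)) -normrM.
have [kN|Nk] := ltnP k N; last by apply: le_trans (HN k Nk) _; rewrite lerDl.
apply: le_trans (_ : S <= _); last by rewrite lerDr.
by rewrite /S (bigD1 (Ordinal kN)) //= lerDl sumr_ge0.
Qed.

Lemma psum_cvg0 a A q : 0 <= q -> (forall k, `|a k| <= A * q ^+ k) -> psum a t @[t --> (0 : R)] --> a 0%N.
Proof.
move=> q0 aA; have := @is_derive_psum R a A q 0 q0 aA; rewrite normr0 mulr0 => /(_ ltr01) D.
have : derivable (psum a) 0 1 by case: D.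
move=> /derivable1_diffP/differentiable_continuous cts.
have : psum a @ (0 : R) --> psum a 0 := cts.
by rewrite psum0.
Qed.

Lemma psum_factor a A q j t : 0 <= q -> (forall k, `|a k| <= A * q ^+ k) ->
  (forall k, (k < j)%N -> a k = 0) -> `|t| <= rad q ->
  psum a t = t ^+ j * psum (fun i => a (i + j)%N) t.
Proof.
move=> q0 aA a0 tq; have [qt _ _] := rad_le q0 tq.
have qt1 : q * `|t| < 1 by apply: le_lt_trans qt _; lra.
elim: j a0 => [|j IHj] a0; first by rewrite expr0 mul1r; congr (psum _ t); apply/funext => i; rewrite addn0.
rewrite IHj => [|k kj]; last by apply: a0; exact: ltnW.
rewrite (@psum_shift _ (fun i => a (i + j)%N)).
  by rewrite add0n a0 // add0r mulrA -exprSr; congr (_ * psum _ t); apply/funext => i; rewrite addSnnS.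
apply: (@pseries_bd_cvg R _ (A * q ^+ j.+1) q) => // i.
by apply: le_trans (aA _) _; rewrite addSnnS exprD [q ^+ i * _]mulrC mulrA.
Qed.

(** Once the coefficients before k vanish, dividing by t^k leaves a series with value a k at 0 that
    is bounded by K t^(kap - k). The exponent is real because it will be n/2 or n/2 - 1/2. *)
Lemma psum_vanish a A q T (kap K : R) : 0 <= q -> (forall k, `|a k| <= A * q ^+ k) -> 0 < T ->
  (forall t, 0 < t < T -> `|psum a t| <= K * t `^ kap) -> forall k, k%:R < kap -> a k = 0.
Proof.
move=> q0 aA T0 aK k; elim/ltn_ind: k => k IH kk.
have bA i : `|a (i + k)%N| <= (A * q ^+ k) * q ^+ i.
  by apply: le_trans (aA _) _; rewrite exprD [q ^+ i * _]mulrC mulrA.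
have E t : `|t| <= rad q -> psum a t = t ^+ k * psum (fun i => a (i + k)%N) t.
  by apply: psum_factor aA _ => // i ik; apply: IH => //; apply: lt_trans kk; rewrite ltr_nat.
have c1 := cvg_at_right_filter (psum_cvg0 q0 bA).
rewrite add0n in c1; apply: (@cvg_unique _ _ (psum (fun i => a (i + k)%N) t @[t --> 0^'+]) _ _ _ c1) => //.
apply: (@squeeze_cvgr _ _ _ _ (fun t => - (K * t `^ (kap - k%:R))) (fun t => K * t `^ (kap - k%:R))).
- near=> t; have t0 : 0 < t < Num.min T (rad q) by near: t; apply: near_0_right; rewrite lt_min T0 rad_gt0.
  have /andP[t00] := t0; rewrite lt_min => /andP[tT tq].
  have tk : 0 < t ^+ k by rewrite exprn_gt0.
  rewrite -ler_norml -(ler_pM2l tk) -{1}(gtr0_norm tk) -normrM -E; last by rewrite gtr0_norm // ltW.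
  apply: le_trans (aK t _) _; first by rewrite t00.
  rewrite mulrCA -powR_mulrn ?(ltW t00) // -gt0_powRD // addrC subrK //.
- rewrite -[X in _ --> X]oppr0 -[X in _ --> - X](mulr0 K); apply: cvgN; apply: cvgM; first exact: cvg_cst.
  by apply: powR_cvg0; rewrite subr_gt0.
- rewrite -[X in _ --> X](mulr0 K); apply: cvgM; first exact: cvg_cst.
  by apply: powR_cvg0; rewrite subr_gt0.
Unshelve. all: by end_near. Qed.

Lemma psum_inj a b A B q q' T : 0 <= q -> 0 <= q' -> (forall k, `|a k| <= A * q ^+ k) ->
  (forall k, `|b k| <= B * q' ^+ k) -> 0 < T ->
  (forall t, 0 < t < T -> psum a t = psum b t) -> a = b.
Proof.
move=> q0 q'0 aA bB T0 ab; pose Q := q + q'.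
have Q0 : 0 <= Q by rewrite addr_ge0.
have A0 : 0 <= A by have := aA 0%N; rewrite expr0 mulr1; apply: le_trans.
have B0 : 0 <= B by have := bB 0%N; rewrite expr0 mulr1; apply: le_trans.
have aA' k : `|a k| <= A * Q ^+ k.
  by apply: le_trans (aA k) _; rewrite ler_wpM2l // lerXn2r ?nnegrE // lerDl.
have bB' k : `|b k| <= B * Q ^+ k.
  by apply: le_trans (bB k) _; rewrite ler_wpM2l // lerXn2r ?nnegrE // lerDr.
have dA k : `|1 * a k + -1 * b k| <= (A + B) * Q ^+ k.
  rewrite mul1r mulN1r mulrDl; apply: le_trans (ler_normB _ _) _; exact: lerD.
have qn t : `|t| <= rad Q -> Q * `|t| < 1 by move=> /(rad_le Q0)[h _ _]; apply: le_lt_trans h _; lra.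
apply/funext => k; apply/eqP; rewrite -subr_eq0; apply/eqP.
have T'0 : 0 < Num.min T (rad Q) by rewrite lt_min T0 rad_gt0.
have := @psum_vanish _ _ _ _ k.+1%:R 0 Q0 dA T'0 _ k; rewrite mul1r mulN1r; apply; last by rewrite ltr_nat.
move=> t /andP[t0]; rewrite lt_min => /andP[tT tQ].
have tQ' : `|t| <= rad Q by rewrite gtr0_norm // ltW.
rewrite psum_lin ?ab ?mul1r ?mulN1r ?subrr ?normr0 ?mul0r // ?t0 //.
  exact: pseries_bd_cvg aA' (qn _ tQ').
exact: pseries_bd_cvg bB' (qn _ tQ').
Qed.

End PowerSeriesIdentity.

(** * From expansions to the formulas of the theorem and back *)

Section Bridge.
Context {R : realType} {m p : nat}.
Variables (n : nat) (n2 : (2 <= n)%N).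
Implicit Types (x : 'rV[R]_m) (u : 'rV[R]_p) (H alpha Q B : 'rV[R]_m -> 'rV[R]_p -> R) (t : R).

(** The sum from k = 1 is a full power series because [dminus] vanishes at 0. *)
Lemma term_minus_pseries H t x u :
  (fun N => \sum_(1 <= k < N) term_minus n H t x u k) = pseries (fun k => lap_series (dminus n) (H ^~ u) k x) t.
Proof.
apply/funext => -[|N]; rewrite /pseries /series /=; first by rewrite !big_geq.
rewrite big_add1 big_nat_recl //= {1}/lap_series /dminus mul0r scale0r mul0r add0r.
apply: eq_bigr => k _; rewrite /term_minus /lap_series /= mul1r.
by rewrite -[(_ *: _) x]/((denom_minus n k.+1)^-1 * lap k.+1 H x u) [_^-1 * _]mulrC.
Qed.

Lemma term_plus_pseries0 B t x u :
  (fun N => \sum_(0 <= k < N) term_plus n B t x u k) = pseries (fun k => lap_series (dplus n) (B ^~ u) k x) t.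
Proof.
apply/funext => N; apply: eq_bigr => k _; rewrite /term_plus.
by rewrite -[RHS]/(dplus n k * lap k B x u * t ^+ k) /dplus [_^-1 * _]mulrC.
Qed.

Lemma term_plus_pseries1 alpha t x u N :
  pseries (fun k => lap_series (dplus n) (alpha ^~ u) k x) t N.+1 =
  alpha x u + \sum_(1 <= k < N.+1) term_plus n alpha t x u k.
Proof.
rewrite -term_plus_pseries0 big_nat_recl // big_add1; congr (_ + _).
by rewrite /term_plus /denom_plus big_nil fact0 mulr1 divr1 expr0 mulr1.
Qed.

Lemma term_plus_log B t x u :
  (fun N => \sum_(0 <= k < N) (ln t - q_ n k) * term_plus n B t x u k) =
  (fun N => ln t * pseries (fun k => lap_series (dplus n) (B ^~ u) k x) t N +
     -1 * pseries (fun k => lap_series (fun k => q_ n k * dplus n k) (B ^~ u) k x) t N).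
Proof.
apply/funext => N; rewrite -term_plus_pseries0 /pseries /series /= !mulr_sumr -big_split /=.
apply: eq_bigr => k _; rewrite /term_plus /lap_series.
by rewrite -[(_ *: _) x]/((q_ n k * (denom_plus n k)^-1) * lap k B x u); ring.
Qed.

Lemma term_plus_cvg alpha t x u : cvgn (pseries (fun k => lap_series (dplus n) (alpha ^~ u) k x) t) ->
  cvgn (fun N => \sum_(1 <= k < N) term_plus n alpha t x u k) /\
  alpha x u + limn (fun N => \sum_(1 <= k < N) term_plus n alpha t x u k) = hom n (alpha ^~ u) t x.
Proof.
move=> ch; have h : \sum_(1 <= k < N) term_plus n alpha t x u k @[N --> \oo] --> hom n (alpha ^~ u) t x - alpha x u.
  rewrite -(cvg_shiftS _ _).
  have -> : [sequence \sum_(1 <= k < N.+1) term_plus n alpha t x u k]_N =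
      (fun N => pseries (fun k => lap_series (dplus n) (alpha ^~ u) k x) t N.+1 - alpha x u).
    by apply/funext => N; rewrite term_plus_pseries1 addrAC subrr add0r.
  by apply: cvgB; [rewrite (cvg_shiftS (pseries _ t)) | exact: cvg_cst].
by split; [apply/cvg_ex; eexists; exact: h | rewrite (cvg_lim _ h) // addrC subrK].
Qed.

Section Expansions.
Variables (s : nat) (c : R).
Hypotheses (s0 : (0 < s)%N) (nsc : log_coef n s c).
Variable H : 'rV[R]_m -> 'rV[R]_p -> R.
Hypothesis Hs : smooth_x H.
Implicit Types h : R -> 'rV[R]_m -> 'rV[R]_p -> R.

Local Notation nu := (n%:R / 2 : R).

Let Hso u x0 (r : R) : smooth_on (H ^~ u) x0 r. Proof. exact: (smooth_smooth_on (Hs u)). Qed.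

Definition has_expansion alpha h := forall u x0, exists T r, [/\ 0 < T, 0 < r,
  cauchy_on (laplacian (H ^~ u)) x0 r, cauchy_on (alpha ^~ u) x0 r &
  forall t x, 0 < t < T -> ball x0 r x -> h t x u = expansion n s c (H ^~ u) (alpha ^~ u) t x].

Lemma equation_atE h t x u x0 (r : R) : smooth_on (fun y => h t y u) x0 r -> ball x0 r x ->
  equation_at n H h t x u <-> twice (fun t => h t x u) t /\
    euler_op n (fun t => h t x u) t = laplacian (H ^~ u) x + laplacian (fun y => h t y u) x.
Proof.
move=> hs xr.
have -> : laplacian (H ^~ u) x + laplacian (fun y => h t y u) x = laplacian (fun y => H y u + h t y u) x.
  by rewrite -(laplacian_add (@Hso u x0 r) hs xr).
rewrite /equation_at /euler_op; split=> [[h1 h2 /eqP h3]|[[h1 h2] h3]].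
  by split=> //; apply/eqP; rewrite -subr_eq0.
by split=> //; apply/eqP; rewrite subr_eq0; apply/eqP.
Qed.

Lemma solution_has_expansion h : solution n H h -> exists alpha, analytic_x alpha /\ has_expansion alpha h.
Proof.
move=> [heq hps h0].
have loc u x0 : exists T r al, [/\ 0 < T, 0 < r, cauchy_on (laplacian (H ^~ u)) x0 r, cauchy_on al x0 r &
    (forall x, ball x0 r x ->
       (h t x u - expansion n s c (H ^~ u) (cst 0) t x) / t `^ nu @[t --> 0^'+] --> al x) /\
    forall t x, 0 < t < T -> ball x0 r x -> h t x u = expansion n s c (H ^~ u) al t x].
  have /near2_right[T1 [r1 [T10 r10 e1]]] := heq u x0.
  have [r2 [M2 [r20 [e /= e0 he]]]] := hps u x0.
  have [M [C [M0 C0 psB]]] := powerseries_cauchy M2 x0 r20.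
  pose T := Num.min T1 e; pose r := Num.min r1 (r2 / 2).
  have T0 : 0 < T by rewrite lt_min T10.
  have r0 : 0 < r by rewrite lt_min r10 divr_gt0.
  have hB t : 0 < t < T -> smooth_bd (fun x => h t x u) x0 r (cauchy_bd M C).
    move=> /andP[t0]; rewrite lt_min => /andP[_ te].
    apply: (@smooth_bdS _ _ _ _ (r2 / 2)) => //; first by rewrite ge_min lexx orbT.
    by apply: psB; apply: he => //=; rewrite sub0r normrN gtr0_norm.
  have feq : family_eq n T x0 r (fun t x => h t x u) (laplacian (H ^~ u)).
    move=> t x tT xr; apply/(equation_atE (hB t tT).1 xr).
    move: tT; rewrite lt_min => /and3P[t0 tT1 _]; apply: e1; first by rewrite t0.
    by apply: le_ball xr; rewrite ge_min lexx.
  have [vc [T' [al [T'0 alc al1 al2]]]] := family_expansion n2 s0 nsc T0 M0 C0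
    (@Hso u x0 r) r0 hB feq (fun x _ => h0 u x).
  by exists T', r, al.
(* The local coefficients agree on overlaps because each is the limit of this one quotient, which
   therefore defines alpha globally. *)
pose alpha x u := lim ((h t x u - expansion n s c (H ^~ u) (cst 0) t x) / t `^ nu @[t --> 0^'+]).
have alE u x0 T r al : [/\ 0 < T, 0 < r, cauchy_on (laplacian (H ^~ u)) x0 r, cauchy_on al x0 r &
    (forall x, ball x0 r x ->
       (h t x u - expansion n s c (H ^~ u) (cst 0) t x) / t `^ nu @[t --> 0^'+] --> al x) /\
    forall t x, 0 < t < T -> ball x0 r x -> h t x u = expansion n s c (H ^~ u) al t x] ->
    forall x, ball x0 r x -> al x = alpha x u.
  by move=> [_ _ _ _ [ac _]] x xr; apply/esym/cvg_lim => //; exact: ac.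
exists alpha; split=> [u x0|u x0].
  have [T [r [al P]]] := loc u x0; have E := alE _ _ _ _ _ P; have [_ r0 _ alc _] := P.
  by apply: cauchy_on_analytic; exists r; split => //; exact: cauchy_on_eq alc.
have [T [r [al P]]] := loc u x0; have E := alE _ _ _ _ _ P; have [T0 r0 vc alc [_ h1]] := P.
exists T, r; split => //; first exact: cauchy_on_eq alc.
move=> t x tT xr; rewrite h1 // /expansion; congr (_ + _ * (_ + _)).
exact: lap_psum_eq_ball E xr.
Qed.

Lemma twice_eq (g g' : R -> R) t T : 0 < t < T -> (forall t, 0 < t < T -> g t = g' t) -> twice g t ->
  twice g' t /\ euler_op n g' t = euler_op n g t.
Proof.
move=> tT gg gt; have [d1 d2] := twice_is_derive gt.
have d1g : forall t, 0 < t < T -> derive1 g t = derive1 g' t.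
  move=> w wT; rewrite !derive1E; apply: near_eq_derive => //.
  by near=> v; apply: gg; near: v; exact: near_in_oo.
have D1 : is_derive t 1 g' (derive1 g t).
  by apply: near_eq_is_derive d1; near=> v; apply: gg; near: v; exact: near_in_oo.
have D2 : is_derive t 1 (derive1 g') (derive1 (derive1 g) t).
  by apply: near_eq_is_derive d2; near=> v; apply: d1g; near: v; exact: near_in_oo.
split; first by split; [case: D1 | case: D2].
have e2 : derive1 (derive1 g') t = derive1 (derive1 g) t by rewrite [LHS]derive1E; case: D2.
by rewrite /euler_op e2 (d1g t tT).
Unshelve. all: by end_near. Qed.

Lemma has_expansion_solution alpha h : has_expansion alpha h -> solution n H h.
Proof.
move=> hexp.
have loc u x0 : exists T r M C, [/\ 0 < T, 0 < r, 0 <= M, 0 <= C & [/\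
    forall t, 0 < t < T -> smooth_bd (fun x => h t x u) x0 r (cauchy_bd M C),
    forall t x, 0 < t < T -> ball x0 r x -> equation_at n H h t x u &
    h t x0 u @[t --> 0^'+] --> (0 : R)]].
  have [T [r [T0 r0 vc alc hE]]] := hexp u x0.
  have [T1 [M [C [T10 M0 C0 [e1 e2 e3]]]]] :=
    expansion_family n2 s0 nsc (@Hso u x0 r) vc alc.
  have P t : 0 < t < Num.min T T1 -> 0 < t < T /\ 0 < t < T1.
    by move=> /andP[t0]; rewrite lt_min t0 => /andP[].
  have T20 : 0 < Num.min T T1 by rewrite lt_min T0.
  have hB t : 0 < t < Num.min T T1 -> smooth_bd (fun x => h t x u) x0 r (cauchy_bd M C).
    by move=> /P[tT tT1]; apply: smooth_bd_eq (e1 t tT1) => y yr; rewrite hE.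
  exists (Num.min T T1), r, M, C; split => //; split => //.
    move=> t x tT xr; apply/(equation_atE (hB t tT).1 xr).
    have [q1 q2] := e2 t x (P t tT).2 xr.
    have [q3 q4] := twice_eq (P t tT).1 (fun t' tT' => esym (hE t' x tT' xr)) q1.
    have q5 : laplacian (fun y => h t y u) x = laplacian (expansion n s c (H ^~ u) (alpha ^~ u) t) x.
      by apply: (laplacian_eq_ball _ xr) => y yr; rewrite hE //; exact: (P t tT).1.
    by rewrite q5; split; [exact: q3 | exact: (etrans q4 q2)].
  apply: cvg_trans (e3 x0 (ballxx _ r0)); apply: near_eq_cvg; near=> t.
  have tT : 0 < t < T by near: t; exact: near_0_right.
  by rewrite hE //; exact: ballxx.
split=> [u x0|u x0|u x0]; have [T [r [M [C [T0 r0 M0 C0 [h1 h2 h3]]]]]] := loc u x0 => //.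
  by apply/near2_right; exists T, r.
have [r' [M' [r'0 HH]]] := @cauchy_powerseries R m r M C r0 M0 C0.
exists r', M'; split => //; near=> t; apply: HH; apply: h1; near: t; exact: near_0_right.
Unshelve. all: by end_near. Qed.

Lemma has_expansion_inj alpha alpha' h : has_expansion alpha h -> has_expansion alpha' h -> alpha = alpha'.
Proof.
move=> e e'; apply/funext => x; apply/funext => u.
have [T [r [T0 r0 _ alc hE]]] := e u x; have [T' [r' [T'0 r'0 _ alc' hE']]] := e' u x.
have m0 : 0 < Num.min T T' by rewrite lt_min T0.
have rr : 0 < Num.min r r' by rewrite lt_min r0.
apply: (@expansion_inj R m n s c n2 (H ^~ u) (alpha ^~ u) (alpha' ^~ u) x (Num.min r r') (Num.min T T') x m0).
- by apply: cauchy_on_le alc; rewrite ge_min lexx.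
- by apply: cauchy_on_le alc'; rewrite ge_min lexx orbT.
- exact: ballxx.
- move=> t /andP[t0]; rewrite lt_min => /andP[tT tT'].
  have e1 := hE t x; have e2 := hE' t x; rewrite -e1 ?t0 //; last exact: ballxx.
  by rewrite -e2 ?t0 //; exact: ballxx.
Qed.

End Expansions.

Lemma odd_formula_expansion H alpha u x0 (r : R) : cauchy_on (laplacian (H ^~ u)) x0 r ->
  cauchy_on (alpha ^~ u) x0 r -> exists2 T, 0 < T & forall t x, `|t| < T -> ball x0 r x ->
    odd_formula_converges n H alpha t x u /\
    odd_formula n H alpha t x u = reg n (H ^~ u) t x + t `^ (n%:R / 2) * hom n (alpha ^~ u) t x.
Proof.
move=> vc alc; have [A [C [q [A0 C0 q0 [h1 h2 _ _]]]]] := expansion_bds n2 (ltn0Sn 0) vc alc.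
exists (rad q); first exact: rad_gt0.
move=> t x /ltW tq xr; have [qt _ _] := rad_le q0 tq.
have qt1 : q * `|t| < 1 by apply: le_lt_trans qt _; lra.
have c1 := pseries_bd_cvg q0 (series_bd_coef0 h1 xr) qt1.
have c2 := pseries_bd_cvg q0 (series_bd_coef0 h2 xr) qt1.
have [d1 d2] := term_plus_cvg c2.
by rewrite /odd_formula_converges /odd_formula term_minus_pseries d2.
Qed.

End Bridge.

(** * The formula for even n, with its convolution *)

Section EvenBridge.
Context {R : realType} {m p : nat}.
Variable s : nat.
Hypothesis s0 : (0 < s)%N.
Implicit Types (x : 'rV[R]_m) (u : 'rV[R]_p) (H alpha Q B : 'rV[R]_m -> 'rV[R]_p -> R) (t : R).

Local Notation n := (2 * s)%N.
Local Notation c := (c_ n s : R).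

Lemma lap_psum_lin e (f g : 'rV[R]_m -> R) (k : R) t x : smooth f -> smooth g ->
  cvgn (pseries (fun k => lap_series e f k x) t) -> cvgn (pseries (fun k => lap_series e g k x) t) ->
  lap_psum e (fun x => f x + k * g x) t x = lap_psum e f t x + k * lap_psum e g t x.
Proof.
move=> fs gs cf cg; rewrite -[lap_psum e f t x]mul1r -[RHS]psum_lin //; congr (psum _ t).
apply/funext => i; rewrite /lap_series iter_laplacian_smooth_lin //.
rewrite -[LHS]/(e i * (iter i laplacian f x + k * iter i laplacian g x)).
rewrite -[RHS]/(1 * (e i * iter i laplacian f x) + k * (e i * iter i laplacian g x)).
by move: (iter i laplacian f x) (iter i laplacian g x) => a b; ring.
Qed.

(** From k = s on the denominators contain the factor 2 s - n = 0, and the inverse of 0 is 0, so the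
    infinite series stops where the finite sum does. *)
Lemma even_reg H t x u : \sum_(1 <= k < s) term_minus n H t x u k = reg n (H ^~ u) t x.
Proof.
apply/esym/cvg_lim => //; rewrite -term_minus_pseries; apply: cvg_near_cst; near=> N.
have sN : (s <= N)%N by near: N; exact: nbhs_infty_ge.
rewrite (big_cat_nat s0 sN) /= [X in _ + X]big_nat_cond [X in _ + X]big1 ?addr0 // => k /andP[/andP[sk _] _].
by rewrite /term_minus denom_minus_eq0 ?s0 // invr0 mulr0 mul0r.
Unshelve. all: by end_near. Qed.

Lemma half_n t : 0 < t -> t `^ (n%:R / 2) = t ^+ s.
Proof.
by move=> t0; rewrite -powR_mulrn ?(ltW t0) //; congr (t `^ _); rewrite natrM mulrC mulKf // pnatr_eq0.
Qed.

Lemma even_formula_expansion H alpha Q u x0 (r : R) : 0 < r -> smooth_x H -> smooth_x alpha ->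
  cauchy_on (laplacian (H ^~ u)) x0 r -> cauchy_on (alpha ^~ u) x0 r ->
  analytic_convolvable (Q ^~ u) (lap s H ^~ u) ->
  let al' := fun x => alpha x u + c * convolution (Q ^~ u) (lap s H ^~ u) x in
  exists T r', [/\ 0 < T, 0 < r', cauchy_on (laplacian (H ^~ u)) x0 r', cauchy_on al' x0 r' &
    forall t x, 0 < t < T -> ball x0 r' x -> even_formula_converges n s H alpha Q t x u /\
      even_formula n s H alpha Q t x u = expansion n s c (H ^~ u) al' t x].
Proof.
move=> r0 Hs als vc alc aQ al'; have n2 : (2 <= n)%N by lia.
have n0 : (0 < n)%N := ltnW n2.
have [A [C [q [A0 C0 q0 [_ h2 h3 h4]]]]] := expansion_bds n2 s0 vc alc.
have bs : smooth (lap s H ^~ u) := smooth_lap s u Hs.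
have cQ := analytic_smooth_convolvable aQ bs.
have cs := convolution_smooth cQ bs.
have [r1 [M1 [C1 [r10 M10 C10 cB]]]] := convolution_smooth_bd x0 aQ bs.
have [r2 [T2 [r20 T20 H2]]] := convolution_lap_psum x0 n0 (@dplus_bd R n n0) aQ bs.
have cc : cauchy_on (convolution (Q ^~ u) (lap s H ^~ u)) x0 r1 by exists M1, C1.
have [T3 [_ [_ [T30 _ _ [_ H3 _]]]]] := lap_psum_cvg (@dplus_bd R n n0) cc.
pose r' := Num.min r (Num.min r1 r2).
have [rr rr1 rr2] : [/\ r' <= r, r' <= r1 & r' <= r2].
  by rewrite /r' !ge_min !lexx !orbT.
exists (Num.min (rad q) (Num.min T2 T3)), r'; split => //.
- by rewrite !lt_min rad_gt0 // T20.
- by rewrite !lt_min r0 r10.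
- exact: cauchy_on_le vc.
- have [M2 [C2 [M20 C20 aB]]] := cauchy_on_le rr alc.
  have := smooth_bd_lin c (smooth_bdS rr1 (fun j => lexx _) cB) aB.
  have -> : c *: convolution (Q ^~ u) (lap s H ^~ u) + (alpha ^~ u) = al'.
    by apply/funext => x; rewrite /al' addrC.
  apply: cauchy_on_seq; have := cauchy_seq_lin (normr_ge0 c) ler01 (cauchy_seq_bd M10 C10) (cauchy_seq_bd M20 C20).
  by congr cauchy_seq; apply/funext => j; rewrite mul1r.
move=> t x /andP[t0]; rewrite !lt_min => /and3P[tq tT2 tT3] xr.
have tn : `|t| = t by rewrite gtr0_norm.
have tq' : `|t| <= rad q by rewrite tn ltW.
have [qt _ _] := rad_le q0 tq'; have qt1 : q * `|t| < 1 by apply: le_lt_trans qt _; lra.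
have xr0 : ball x0 r x := le_ball rr xr.
have ca := pseries_bd_cvg q0 (series_bd_coef0 h2 xr0) qt1.
have cb := pseries_bd_cvg q0 (series_bd_coef0 h3 xr0) qt1.
have cq := pseries_bd_cvg q0 (series_bd_coef0 h4 xr0) qt1.
have [d1 d2] := term_plus_cvg ca.
have /H2/(_ (le_ball rr2 xr)) [k1 k2 k3] : `|t| <= T2 by rewrite tn ltW.
have c3 : cvgn (pseries (fun k => lap_series (dplus n) (convolution (Q ^~ u) (lap s H ^~ u)) k x) t).
  by apply: H3; [rewrite tn ltW | exact: (le_ball rr1 xr)].
have homE : (fun y => limn (fun N => \sum_(0 <= k < N) term_plus n (lap s H) t y u k)) = hom n (lap s H ^~ u) t.
  by apply/funext => y; rewrite term_plus_pseries0.

have logE' : \sum_(0 <= k < N) (ln t - q_ n k) * term_plus n (lap s H) t x u k @[N --> \oo] --> logp n (lap s H ^~ u) t x.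
  rewrite term_plus_log /logp -[X in _ --> _ + X]mulN1r.
  by apply: cvgD; apply: cvgM => //; exact: cvg_cst.
split.
  split => //; last by rewrite homE.
    by apply/cvg_ex; eexists; exact: logE'.
  by move=> y Qy; rewrite term_plus_pseries0; exact: k1.
rewrite /even_formula even_reg d2 (cvg_lim _ logE') // homE k3 /expansion half_n //.
have alE : hom n al' t x = _ := lap_psum_lin c (als u) cs ca c3.
rewrite alE.
rewrite -[lap_psum (dplus n) (alpha ^~ u) t x]/(hom n (alpha ^~ u) t x).
rewrite -[iter s laplacian (H ^~ u)]/(lap s H ^~ u).
by move: (reg _ _ _ _) (hom _ _ _ _) (logp _ _ _ _) (lap_psum _ _ _ _) => a b d e; ring.
Qed.

Lemma analytic_convolvable0 (f : 'rV[R]_m -> R) : analytic_convolvable (fun _ => 0) f.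
Proof.
split=> [|x0]; first exact: measurable_cst.
exists 1, (fun=> 0); split => //; first exact: integrable0.
move=> y; exists (fun=> 0).
  by rewrite esum1 // => b _; rewrite normr0 mul0r.
move=> x _; apply: cvg_near_cst; apply: nearW => N.
by rewrite big1 /conv_integrand ?mul0r // => b _; rewrite mul0r.
Qed.

End EvenBridge.

(** * Solutions analytic in rho *)

Section AnalyticInRho.
Context {R : realType} {m p : nat}.
Variables (n : nat) (H : 'rV[R]_m -> 'rV[R]_p -> R).
Hypotheses (n2 : (2 <= n)%N) (Hs : smooth_x H).
Implicit Types (x : 'rV[R]_m) (u : 'rV[R]_p) (t r A C q : R).

Section SeriesSolution.
Variable w : nat -> 'rV[R]_m -> 'rV[R]_p -> R.
Hypothesis wB : forall u x0, exists r A C q, [/\ 0 < r, 0 <= A, 0 <= C, 0 <= q &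
  series_bd (fun k => w k ^~ u) x0 r A C q].
Hypothesis w0 : forall x u, w 0%N x u = 0.
Hypothesis wS : forall k x u, k.+1%:R * (2 * k.+1%:R - n%:R) * w k.+1 x u =
  (k == 0%N)%:R * laplacian (H ^~ u) x + laplacian (w k ^~ u) x.

Local Notation h := (fun t x u => psum (fun k => w k x u) t).

(** [wS] is the equation compared coefficient by coefficient, so it holds for t of either sign, as
    [analytic_solution] demands. *)
Lemma series_solution : analytic_solution n H h.
Proof.
have loc u x0 : exists T r M C, [/\ 0 < T, 0 < r, 0 <= M, 0 <= C & [/\
    forall t, `|t| < T -> smooth_bd (fun x => h t x u) x0 r (cauchy_bd M C),
    forall t x, `|t| < T -> ball x0 r x -> equation_at n H h t x u,
    forall x, ball x0 r x -> h t x u @[t --> (0 : R)] --> (0 : R) &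
    forall t x, `|t| < T -> ball x0 r x -> cvgn (pseries (fun k => w k x u) t)]].
  have [r [A [C [q [r0 A0 C0 q0 B]]]]] := wB u x0.
  have B0 x := @series_bd_coef0 R m _ x0 r A C q x B.
  exists (rad q), r, (2 * A), C; rewrite rad_gt0 // mulr_ge0 //; split => //.
  have hB t : `|t| < rad q -> smooth_bd (fun x => h t x u) x0 r (cauchy_bd (2 * A) C).
    by move=> /ltW/(rad_le q0)[qt _ _]; exact: (psum_family A0 C0 q0 qt B).1.
  split => //.
  - move=> t x tq xr; have [qt qt8 _] := rad_le q0 (ltW tq).
    apply/(equation_atE (h := h) n Hs (hB t tq).1 xr).
    have [e1 e2] := @euler_psum R n _ A q q0 (B0 x xr) t qt8.
    split; first exact: e1.
    rewrite e2 -[laplacian (H ^~ u) x]mul1r -[laplacian (fun y => h t y u) x]mul1r.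
    have d1 := @pseries_delta R 0%N (laplacian (H ^~ u) x) t.
    rewrite expr0 mulr1 in d1.
    have d2 := laplacian_psum_family A0 C0 q0 qt B xr.
    rewrite -(cvg_lim _ (@pseries_lin R _ _ 1 1 _ _ _ d1 d2)) //; congr (psum _ t).
    by apply/funext => k; rewrite wS !mul1r.
  - move=> x xr; have := psum_cvg0 q0 (B0 x xr); by rewrite w0.
  - move=> t x tq xr; have [qt _ _] := rad_le q0 (ltW tq).
    by apply: pseries_bd_cvg q0 (B0 x xr) _; apply: le_lt_trans qt _; lra.
have gt T t : 0 < t < T -> `|t| < T by move=> /andP[t0]; rewrite gtr0_norm.
split.
- split=> [u x0|u x0|u x0]; have [T [r [M [C [T0 r0 M0 C0 [h1 h2 h3 _]]]]]] := loc u x0.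
  + by apply/near2_right; exists T, r; split => // t x /gt; exact: h2.
  + have [r' [M' [r'0 HH]]] := @cauchy_powerseries R m r M C r0 M0 C0.
    exists r', M'; split => //; near=> t; apply: HH; apply: h1; apply: gt; near: t; exact: near_0_right.
  + by apply: cvg_at_right_filter; apply: h3; exact: ballxx.
- move=> u x0; have [T [r [M [C [T0 r0 M0 C0 [_ h2 _ _]]]]]] := loc u x0.
  by apply/near2_0; exists T, r.
- move=> u x0; have [T [r [M [C [T0 r0 M0 C0 [_ _ _ h4]]]]]] := loc u x0.
  exists T => //; apply/nbhs_ballP; exists r => // x xr; exists (fun k => w k x u) => t tT.
  exact: h4 tT xr.
- by move=> u x; rewrite psum0 w0.
Unshelve. all: by end_near. Qed.

End SeriesSolution.

Lemma psum_shiftn (a : nat -> R) (s : nat) A q t : 0 <= q -> (forall k, `|a k| <= A * q ^+ k) ->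
  `|t| <= rad (q + 1) -> psum (fun k => if (s <= k)%N then a (k - s)%N else 0) t = t ^+ s * psum a t.
Proof.
move=> q0 aA tq; have q10 : 0 <= q + 1 by rewrite addr_ge0.
have [qt _ _] := rad_le q10 tq; have qt1 : (q + 1) * `|t| < 1 by apply: le_lt_trans qt _; lra.
have A0 : 0 <= A by have := aA 0%N; rewrite expr0 mulr1; apply: le_trans.
elim: s => [|s IH]; first by rewrite expr0 mul1r; congr (psum _ t); apply/funext => k; rewrite subn0.
have bB k : `|if (s <= k)%N then a (k - s)%N else 0| <= A * (q + 1) ^+ k.
  case: ifP => sk; last by rewrite normr0 mulr_ge0 ?exprn_ge0.
  apply: le_trans (aA _) _; rewrite ler_wpM2l //; apply: le_trans (_ : (q + 1) ^+ (k - s) <= _).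
    by rewrite lerXn2r ?nnegrE // lerDl.
  by rewrite ler_weXn2l ?leq_subr // lerDr.
rewrite (@psum_shift _ (fun k => if (s < k)%N then a (k - s.+1)%N else 0)) /= ?add0r; last exact: pseries_bd_cvg bB qt1.
by rewrite exprS -mulrA -IH; congr (_ * psum _ t); apply/funext => k; rewrite ltnS subSS.
Qed.

(** * Solutions without logarithms and half-integral powers *)

Section Combined.
Variables (s : nat) (c : R) (alpha : 'rV[R]_m -> 'rV[R]_p -> R).
Hypotheses (s0 : (0 < s)%N) (nsc : log_coef n s c) (als : smooth_x alpha).
Hypothesis vc : forall u x0, exists r, 0 < r /\ cauchy_on (laplacian (H ^~ u)) x0 r.
Hypothesis alc : forall u x0, exists r, 0 < r /\ cauchy_on (alpha ^~ u) x0 r.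
(** This hypothesis removes the logarithms and the next one the half-integral powers, the two
    obstructions to a power series in t. *)
Hypothesis cH : c = 0 \/ forall x u, lap s H x u = 0.
Hypothesis pa : n = (2 * s)%N \/ alpha = (fun _ _ => 0).

Let n0 : (0 < n)%N := ltnW n2.

(* The coefficients of a solution without logarithmic part; for [n = 2 s] the first term vanishes
   from [k = s] on, since [denom_minus n k = 0] there. *)
Definition combined (k : nat) x u : R := lap_series (dminus n) (H ^~ u) k x +
  (if (s <= k)%N then lap_series (dplus n) (alpha ^~ u) (k - s) x else 0).

Lemma combined_local u x0 r : cauchy_on (laplacian (H ^~ u)) x0 r -> cauchy_on (alpha ^~ u) x0 r ->
  exists A C q, [/\ 0 <= A, 0 <= C, 0 <= q, series_bd (fun k => combined k ^~ u) x0 r A C q &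
    forall t x, `|t| <= rad q -> ball x0 r x ->
      psum (fun k => combined k x u) t = reg n (H ^~ u) t x + t ^+ s * hom n (alpha ^~ u) t x].
Proof.
move=> v a; have [A [C [q [A0 C0 q0 [h1 h2 _ _]]]]] := expansion_bds n2 s0 v a.
have q10 : 0 <= q + 1 by rewrite addr_ge0.
have qq k : q ^+ k <= (q + 1) ^+ k by rewrite lerXn2r ?nnegrE // lerDl.
exists (2 * A), C, (q + 1); split => //; first by rewrite mulr_ge0.
  move=> k; have cb0 j : 0 <= cauchy_bd A C j by rewrite cauchy_bd_ge0.
  have sB : smooth_bd (if (s <= k)%N then lap_series (dplus n) (alpha ^~ u) (k - s) else cst 0) x0 r
      (fun j => cauchy_bd A C j * (q + 1) ^+ k).
    case: ifP => sk.
      apply: smooth_bdS (h2 (k - s)%N) => // j; rewrite ler_wpM2l //; apply: le_trans (qq _) _.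
      by rewrite ler_weXn2l ?leq_subr // lerDr.
    have [z1 z2] := @pd_cst R m 0 x0 r; split => // -[|i l] x xr.
      by rewrite /= normr0 mulr_ge0 ?exprn_ge0.
    by rewrite (z2 (i :: l)) // normr0 mulr_ge0 ?exprn_ge0.
  have := smooth_bd_lin 1 (h1 k) sB.
  have -> : 1 *: lap_series (dminus n) (H ^~ u) k +
      (if (s <= k)%N then lap_series (dplus n) (alpha ^~ u) (k - s) else cst 0) = combined k ^~ u.
    by rewrite scale1r; apply/funext => x; rewrite /combined; case: ifP.
  apply: smooth_bdS => // j; rewrite normr1 mul1r.
  have -> : cauchy_bd (2 * A) C j = cauchy_bd A C j + cauchy_bd A C j by rewrite /cauchy_bd; ring.
  by rewrite mulrDl lerD2r ler_wpM2l.
move=> t x tq xr; have [qt _ _] := rad_le q10 tq.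
have qt1 : (q + 1) * `|t| < 1 by apply: le_lt_trans qt _; lra.
have b1 k : `|lap_series (dminus n) (H ^~ u) k x| <= A * (q + 1) ^+ k.
  by apply: le_trans (series_bd_coef0 h1 xr k) _; rewrite ler_wpM2l.
have b2 k : `|if (s <= k)%N then lap_series (dplus n) (alpha ^~ u) (k - s) x else 0| <= A * (q + 1) ^+ k.
  case: ifP => sk; last by rewrite normr0 mulr_ge0 ?exprn_ge0.
  apply: le_trans (series_bd_coef0 h2 xr _) _; rewrite ler_wpM2l //; apply: le_trans (qq _) _.
  by rewrite ler_weXn2l ?leq_subr // lerDr.
rewrite -(psum_shiftn s q0 (series_bd_coef0 h2 xr) tq).
have := psum_lin 1 1 (pseries_bd_cvg q10 b1 qt1) (pseries_bd_cvg q10 b2 qt1).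
rewrite !mul1r => <-; congr (psum _ t); apply/funext => k; by rewrite /combined !mul1r.
Qed.

Lemma combined_solution : analytic_solution n H (fun t x u => psum (fun k => combined k x u) t).
Proof.
apply: series_solution => [u x0|x u|k x u].
- have [r1 [r10 v]] := vc u x0; have [r2 [r20 a]] := alc u x0.
  have m1 : Num.min r1 r2 <= r1 by rewrite ge_min lexx.
  have m2 : Num.min r1 r2 <= r2 by rewrite ge_min lexx orbT.
  have [A [C [q [A0 C0 q0 B _]]]] := combined_local (cauchy_on_le m1 v) (cauchy_on_le m2 a).
  by exists (Num.min r1 r2), A, C, q; split => //; rewrite lt_min r10.
- rewrite /combined leqNgt s0 addr0 /lap_series -[LHS]/(dminus n 0 * H x u).
  by rewrite /dminus !mul0r.
have E : laplacian (combined k ^~ u) x = dminus n k * lap k.+1 H x u +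
    (if (s <= k)%N then dplus n (k - s) * lap (k - s).+1 alpha x u else 0).
  have s1 := @smooth_iter_laplacian R m k _ (Hs u).
  case: (leqP s k) => sk; last first.
    have -> : combined k ^~ u = (fun y => dminus n k * iter k laplacian (H ^~ u) y).
      by apply/funext => y; rewrite /combined leqNgt sk addr0.
    by rewrite laplacianZ // addr0.
  have s2 := @smooth_iter_laplacian R m (k - s) _ (als u).
  have -> : combined k ^~ u = (fun y => dminus n k * iter k laplacian (H ^~ u) y +
      dplus n (k - s) * iter (k - s) laplacian (alpha ^~ u) y).
    by apply/funext => y; rewrite /combined sk.
  by rewrite laplacian_smooth_lin ?laplacianZ //; exact: smoothZ.
rewrite E /combined /lap_series.
have -> : (dminus n k.+1 *: iter k.+1 laplacian (H ^~ u)) x = dminus n k.+1 * lap k.+1 H x u by [].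
have -> : (if (s <= k.+1)%N then (dplus n (k.+1 - s) *: iter (k.+1 - s) laplacian (alpha ^~ u)) x else 0) =
    if (s <= k.+1)%N then dplus n (k.+1 - s) * lap (k.+1 - s) alpha x u else 0 by [].
rewrite mulrDr addrA; congr (_ + _).
  rewrite mulrA (dminusS k n0 nsc) mulrBl.
  have -> : (k.+1 == s)%:R * (n%:R * c) * lap k.+1 H x u = 0.
    have [ks|_] := eqVneq k.+1 s; last by rewrite !mul0r.
    by case: cH => [->|h]; [rewrite !mulr0 mul0r | rewrite ks h mulr0].
  rewrite denom_minus_inv.
  have <- : (k == 0%N)%:R * lap k.+1 H x u = (k == 0%N)%:R * laplacian (H ^~ u) x.
    by apply: eq_mul_natr_bool => /eqP ->.
  by move: (lap k.+1 H x u) ((k == 0%N)%:R) => L b; ring.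
case: pa => [nE|->]; last first.
  have L0 i : lap i (fun _ _ => 0) x u = 0 :> R.
    by rewrite /lap -[(fun _ => 0)]/(cst 0 : 'rV[R]_m -> R) iter_laplacian_cst0.
  by rewrite !L0 !mulr0 !if_same mulr0.
(* The recursion of alpha runs from order s on. When s = k + 1 the factor 2 s - n is 0, so that the
   coefficient alpha itself is unconstrained. *)
case: (ltngtP s k.+1) => [sk|sk|sk].
- rewrite ltnS in sk; rewrite sk subSn //.
  rewrite -(dplusS (k - s) n0); set j := (k - s)%N.
  have -> : k.+1 = (j + s).+1 by rewrite subnK.
  rewrite nE natrM -![(_.+1)%:R]natr1 natrD.
  move: (dplus _ _) (lap _ _ _ _) => a b; ring.
- by rewrite leqNgt (ltnW sk) /= mulr0.
- have -> : (s <= k)%N = false by rewrite sk ltnn.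
  by rewrite nE -sk natrM subrr mulr0 mul0r.
Qed.

Lemma combined_expansion u x0 r : cauchy_on (laplacian (H ^~ u)) x0 r -> cauchy_on (alpha ^~ u) x0 r ->
  exists2 T, 0 < T & forall t x, 0 < t < T -> ball x0 r x ->
    expansion n s c (H ^~ u) (alpha ^~ u) t x = psum (fun k => combined k x u) t.
Proof.
move=> v a; have [A [C [q [_ _ q0 _ E]]]] := combined_local v a.
exists (rad q); first exact: rad_gt0.
move=> t x /andP[t0 tq] xr; rewrite E ?gtr0_norm ?(ltW tq) // /expansion.
have -> : c * logp n (iter s laplacian (H ^~ u)) t x = 0.
  case: cH => [->|h]; first by rewrite mul0r.
  have -> : iter s laplacian (H ^~ u) = cst 0 by apply/funext => y; exact: h.
  by rewrite /logp /hom /qhom !lap_psum_cst0 mulr0 subrr mulr0.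
rewrite addr0; congr (_ + _); case: pa => [nE|->].
  by rewrite nE half_n // -nE.
by rewrite -[(fun _ => 0)]/(cst 0 : 'rV[R]_m -> R) /hom lap_psum_cst0 !mulr0.
Qed.

(** The expansion only speaks of t > 0. Agreement there identifies the coefficients by [psum_inj],
    and the power series of h extends the identity to t <= 0. *)
Lemma analytic_solution_combined h : analytic_solution n H h -> has_expansion n s c H alpha h ->
  forall u x0, exists T r, [/\ 0 < T, 0 < r, cauchy_on (laplacian (H ^~ u)) x0 r,
    cauchy_on (alpha ^~ u) x0 r &
    forall t x, `|t| < T -> ball x0 r x -> h t x u = psum (fun k => combined k x u) t].
Proof.
move=> [_ _ han _] hexp u x0.
have [T1 [r1 [T10 r10 v a hE]]] := hexp u x0.
have [T2 T20 E] := combined_expansion v a.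
have [A [C [q [_ _ q0 wB _]]]] := combined_local v a.
have [T3 T30 /nbhs_ballP[r3 /= r30 an]] := han u x0.
have m1 : Num.min r1 r3 <= r1 by rewrite ge_min lexx.
exists T3, (Num.min r1 r3); split => //; first by rewrite lt_min r10.
- exact: cauchy_on_le v.
- exact: cauchy_on_le a.
move=> t x tT xr; have xr1 := le_ball m1 xr.
have [b bE] : exists a : nat -> R, forall t, `|t| < T3 -> pseries a t N @[N --> \oo] --> h t x u.
  have m3 : Num.min r1 r3 <= r3 by rewrite ge_min lexx orbT.
  by have [b bE] := an x (le_ball m3 xr); exists b.
have hT : 0 < T3 / 2 by rewrite divr_gt0.
have [B B0 bB] : exists2 B, 0 <= B & forall k, `|b k| <= B * ((T3 / 2)^-1) ^+ k.
  apply: pseries_cvg_bd => //; apply/cvg_ex; eexists; apply: bE.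
  by rewrite gtr0_norm //; lra.
have -> : (fun k => combined k x u) = b; last by apply/esym/cvg_lim => //; exact: bE.
apply/esym.
have T0 : 0 < Num.min T1 (Num.min T2 T3) by rewrite !lt_min T10 T20.
apply: (psum_inj _ q0 bB (series_bd_coef0 wB xr1) T0); first by rewrite invr_ge0 ltW.
move=> t' /andP[t0']; rewrite !lt_min => /and3P[t1 t2 t3].
have -> : psum b t' = h t' x u by apply/cvg_lim => //; apply: bE; rewrite gtr0_norm.
by rewrite hE ?t0' // E ?t0'.
Qed.

End Combined.

End AnalyticInRho.

(** * What analyticity in t leaves of the expansion *)

Section AnalyticRemainder.
Context {R : realType} {m p : nat}.
Variables (n s : nat) (c : R) (H : 'rV[R]_m -> 'rV[R]_p -> R).
Hypotheses (n2 : (2 <= n)%N) (s0 : (0 < s)%N) (nsc : log_coef n s c) (Hs : smooth_x H).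
Implicit Types (x : 'rV[R]_m) (u : 'rV[R]_p) (t r A C q T : R).

Local Notation z := (fun t : R => t `^ (n%:R / 2)).

(** Both h and [reg] are power series in t at fixed x, so the remaining part of the expansion is one
    as well. *)
Lemma analytic_remainder alpha h u x : analytic_solution n H h -> has_expansion n s c H alpha h ->
  exists e A q T, [/\ 0 <= q, forall k : nat, `|e k| <= A * q ^+ k, 0 < T &
    forall t, 0 < t < T -> psum e t =
      z t * (hom n (alpha ^~ u) t x + c * logp n (lap s H ^~ u) t x)].
Proof.
move=> [_ _ han _] hexp.
have [T1 [r1 [T10 r10 v a hE]]] := hexp u x.
have [A [C [q [A0 C0 q0 [h1 _ _ _]]]]] := expansion_bds n2 s0 v a.
have [T3 T30 an] := han u x; have [b bE] := nbhs_singleton an.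
have hT : 0 < T3 / 2 by rewrite divr_gt0.
have [B B0 bB] : exists2 B, 0 <= B & forall k, `|b k| <= B * ((T3 / 2)^-1) ^+ k.
  apply: pseries_cvg_bd => //; apply/cvg_ex; eexists; apply: bE.
  by rewrite gtr0_norm //; lra.
have aB := series_bd_coef0 h1 (ballxx x r10).
pose Q := (T3 / 2)^-1 + q.
have i0 : 0 <= (T3 / 2)^-1 by rewrite invr_ge0 ltW.
have Q0 : 0 <= Q by rewrite addr_ge0.
have bB' k : `|b k| <= B * Q ^+ k.
  by apply: le_trans (bB k) _; rewrite ler_wpM2l // lerXn2r ?nnegrE // lerDl.
have aB' k : `|lap_series (dminus n) (H ^~ u) k x| <= A * Q ^+ k.
  by apply: le_trans (aB k) _; rewrite ler_wpM2l // lerXn2r ?nnegrE // lerDr.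
exists (fun k => 1 * b k + -1 * lap_series (dminus n) (H ^~ u) k x), (B + A), Q,
  (Num.min T1 (Num.min T3 (rad Q))); split => //.
- move=> k; rewrite mul1r mulN1r mulrDl; apply: le_trans (ler_normB _ _) _; exact: lerD.
- by rewrite !lt_min T10 T30 rad_gt0.
move=> t /andP[t0]; rewrite !lt_min => /and3P[t1 t3 tQ].
have tQ' : `|t| <= rad Q by rewrite gtr0_norm // ltW.
have [qt _ _] := rad_le Q0 tQ'; have qt1 : Q * `|t| < 1 by apply: le_lt_trans qt _; lra.
rewrite psum_lin; [|exact: pseries_bd_cvg bB' qt1|exact: pseries_bd_cvg aB' qt1].
have -> : psum b t = h t x u by apply/cvg_lim => //; apply: bE; rewrite gtr0_norm.
rewrite hE ?t0 //; last exact: ballxx.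
by rewrite /expansion -[psum _ t]/(reg n (H ^~ u) t x); ring.
Qed.

Lemma hom_bounded alpha h u x : has_expansion n s c H alpha h ->
  exists T M, [/\ 0 < T, 0 <= M & forall t, 0 < t < T ->
    [/\ `|hom n (alpha ^~ u) t x| <= M, `|hom n (lap s H ^~ u) t x| <= M & `|qhom n (lap s H ^~ u) t x| <= M]].
Proof.
move=> hexp; have [T1 [r1 [T10 r10 v a hE]]] := hexp u x.
have [A [C [q [A0 C0 q0 [_ h2 h3 h4]]]]] := expansion_bds n2 s0 v a.
exists (rad q), (2 * A); split; [exact: rad_gt0 | by rewrite mulr_ge0 |].
move=> t /andP[t0 tq]; have tq' : `|t| <= rad q by rewrite gtr0_norm // ltW.
have B e f (fB : series_bd (lap_series e f) x r1 A C q) : `|lap_psum e f t x| <= 2 * A.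
  have := (lap_psum_family A0 C0 q0 fB tq').1.2 [::] x (ballxx x r10).
  by rewrite /cauchy_bd expr0 fact0 !mulr1.
by split; exact: B.
Qed.

Lemma hom_leading alpha h u x : has_expansion n s c H alpha h ->
  hom n (alpha ^~ u) t x @[t --> 0^'+] --> alpha x u /\
  hom n (lap s H ^~ u) t x @[t --> 0^'+] --> lap s H x u.
Proof.
move=> hexp; have [T1 [r1 [T10 r10 v a hE]]] := hexp u x.
have b : cauchy_on (lap s H ^~ u) x r1.
  have : cauchy_on (iter s.-1 laplacian (laplacian (H ^~ u))) x r1.
    by elim: s.-1 => [|k IH]; [exact: v | exact: cauchy_on_laplacian IH].
  by rewrite -iterSr prednK.
split; apply: cvg_at_right_filter.
  exact: (hom_cvg0 (l := [::]) n2 a (ballxx x r10)).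
exact: (hom_cvg0 (l := [::]) n2 b (ballxx x r10)).
Qed.

End AnalyticRemainder.

(** * The case of odd n *)

Section OddCase.
Context {R : realType} {m p : nat}.
Variables (n : nat) (H : 'rV[R]_m -> 'rV[R]_p -> R).
Hypotheses (n2 : (2 <= n)%N) (on : odd n) (Hs : smooth_x H).
Implicit Types (x : 'rV[R]_m) (u : 'rV[R]_p) (alpha : 'rV[R]_m -> 'rV[R]_p -> R) (t r T : R).

Let nsc : log_coef n 1 (0 : R). Proof. by left. Qed.

Lemma expansion_c0 f al t x : expansion n 1 (0 : R) f al t x = reg n f t x + t `^ (n%:R / 2) * hom n al t x :> R.
Proof. by rewrite /expansion mul0r addr0. Qed.

Lemma odd_given_by alpha h : has_expansion n 1 0 H alpha h -> given_by_odd 0^'+ n H alpha h.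
Proof.
move=> hexp u x0; have [T [r [T0 r0 v a hE]]] := hexp u x0.
have [T2 T20 F] := odd_formula_expansion n2 v a.
apply/near2_right; exists (Num.min T T2), r; split => //; first by rewrite lt_min T0.
move=> t x /andP[t0]; rewrite lt_min => /andP[tT tT2] xr.
have tT2' : `|t| < T2 by rewrite gtr0_norm.
have [F1 ->] := F t x tT2' xr; split => //.
by rewrite hE ?t0 // expansion_c0.
Qed.

Lemma odd_formula_has_expansion alpha h : analytic_x H -> analytic_x alpha ->
  given_by_odd 0^'+ n H alpha h -> has_expansion n 1 0 H alpha h.
Proof.
move=> Ha ala hg u x0; have [r1 [r10 v]] := analytic_cauchy_on x0 (Ha u).
have [r2 [r20 a]] := analytic_cauchy_on x0 (ala u).
have /near2_right[T [r3 [T0 r30 hE]]] := hg u x0.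
pose r := Num.min r1 (Num.min r2 r3).
have [m1 m2 m3] : [/\ r <= r1, r <= r2 & r <= r3] by rewrite /r !ge_min !lexx !orbT.
have v' := cauchy_on_laplacian (cauchy_on_le m1 v); have a' := cauchy_on_le m2 a.
have [T2 T20 F] := odd_formula_expansion n2 v' a'.
exists (Num.min T T2), r; split => //; [by rewrite lt_min T0 | by rewrite !lt_min r10 r20 |].
move=> t x /andP[t0]; rewrite lt_min => /andP[tT tT2] xr.
have tT2' : `|t| < T2 by rewrite gtr0_norm.
have [_ F2] := F t x tT2' xr; rewrite expansion_c0 -F2.
have tT' : 0 < t < T by rewrite t0.
by have [_ ->] := hE t x tT' (le_ball m3 xr).
Qed.

Lemma odd_formula_given alpha : analytic_x H -> analytic_x alpha ->
  given_by_odd 0^'+ n H alpha (odd_formula n H alpha).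
Proof.
move=> Ha ala u x0; have [r1 [r10 v]] := analytic_cauchy_on x0 (Ha u).
have [r2 [r20 a]] := analytic_cauchy_on x0 (ala u).
pose r := Num.min r1 r2.
have [m1 m2] : r <= r1 /\ r <= r2 by rewrite /r !ge_min !lexx !orbT.
have v' := cauchy_on_laplacian (cauchy_on_le m1 v); have a' := cauchy_on_le m2 a.
have [T T0 F] := odd_formula_expansion n2 v' a'.
apply/near2_right; exists T, r; split => //; first by rewrite lt_min r10.
move=> t x /andP[t0 tT] xr; split => //.
by have [|F1 _] := F t x _ xr; first by rewrite gtr0_norm.
Qed.

(* An expansion in integral powers of [t] cannot start at the half-integral power [t ^ (n / 2)]. *)
Lemma odd_leading_zero alpha h : analytic_solution n H h -> has_expansion n 1 0 H alpha h ->
  alpha = (fun _ _ => 0).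
Proof.
move=> ha hexp; apply/funext => x; apply/funext => u.
have [e [A [q [T [q0 eA T0 E]]]]] := analytic_remainder n2 (ltn0Sn 0) u x ha hexp.
have [T1 [M [T10 M0 B]]] := hom_bounded n2 (ltn0Sn 0) u x hexp.
have [L _] := hom_leading n2 (ltn0Sn 0) u x hexp.
have m0 : 0 < Num.min T T1 by rewrite lt_min T0.
have n12 : n%:R / 2 = n./2%:R + 2^-1 :> R.
  have -> : n%:R = 1 + 2 * n./2%:R :> R.
    by rewrite -[in LHS](odd_double_half n) on natrD -mul2n natrM.
  by field.
(* A power series of order t^(n/2) has no coefficients up to n./2 < n/2. It starts at n./2 + 1, so
   that dividing by z leaves a factor t^(1/2), which tends to 0. *)
have e0 k : (k < n./2.+1)%N -> e k = 0.
  move=> kn; apply: (psum_vanish (kap := n%:R / 2) (K := M) q0 eA m0) => [t /andP[t0]|].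
    rewrite lt_min => /andP[tT tT1].
    have tT' : 0 < t < T by rewrite t0.
    have tT1' : 0 < t < T1 by rewrite t0.
    rewrite E // mul0r addr0 normrM (ger0_norm (powR_ge0 t _)) mulrC ler_wpM2r ?powR_ge0 //.
    by have [] := B t tT1'.
  rewrite n12; apply: le_lt_trans (_ : n./2%:R < _); first by rewrite ler_nat.
  by rewrite ltrDl invr_gt0.
have eS k : `|e (k + n./2.+1)%N| <= A * q ^+ n./2.+1 * q ^+ k.
  by apply: le_trans (eA _) _; rewrite exprD [q ^+ k * _]mulrC mulrA.
apply: (@cvg_unique _ _ (hom n (alpha ^~ u) t x @[t --> 0^'+]) _ _ _ L) => //.
have h12 : 0 < 2^-1 :> R by rewrite invr_gt0.
have c1 := cvg_at_right_filter (psum_cvg0 q0 eS).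
have := cvgM (powR_cvg0 h12) c1; rewrite mul0r => c2.
apply: cvg_trans (c2 _).
apply: near_eq_cvg; near=> t.
have t0 : 0 < t < Num.min T (rad q) by near: t; apply: near_0_right; rewrite lt_min T0 rad_gt0.
have /andP[t00] := t0; rewrite lt_min => /andP[tT tq].
have tT' : 0 < t < T by rewrite t00.
have tq' : `|t| <= rad q by rewrite gtr0_norm // ltW.
have zn0 : t `^ (n%:R / 2) != 0 by rewrite gt_eqF // powR_gt0.
apply: (mulfI zn0); have := E t tT'; rewrite mul0r addr0 => <-.
rewrite (psum_factor q0 eA e0 tq') [LHS]mulrA -gt0_powRD //; congr (_ * _).
rewrite -powR_mulrn ?(ltW t00) //; congr (t `^ _).
by rewrite n12 -natr1; field.
Unshelve. all: by end_near. Qed.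

Lemma odd_analytic_given h : analytic_x H -> analytic_solution n H h ->
  given_by_odd (nbhs (0 : R)) n H (fun _ _ => 0) h.
Proof.
move=> Ha ha; have [hs _ _ _] := ha.
have [alpha [_ hexp]] := solution_has_expansion n2 (ltn0Sn 0) nsc Hs hs.
have a0 := odd_leading_zero ha hexp; rewrite a0 {a0} in hexp.
move=> u x0.
have cH : (0 : R) = 0 \/ forall x u, lap 1 H x u = 0 by left.
have pa : n = (2 * 1)%N \/ (fun _ _ => 0) = (fun _ _ => 0) :> ('rV[R]_m -> 'rV[R]_p -> R) by right.
have [T [r [T0 r0 v a hE]]] := analytic_solution_combined n2 (ltn0Sn 0) cH pa ha hexp u x0.
have [A [C [q [_ _ q0 _ F]]]] := @combined_local R m p n H n2 1 (fun _ _ => 0) (ltn0Sn 0) u x0 r v a.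
have [T2 T20 G] := @odd_formula_expansion R m p n n2 H (fun _ _ => 0) u x0 r v a.
apply/near2_0; exists (Num.min T (Num.min (rad q) T2)), r; split => //.
  by rewrite !lt_min T0 rad_gt0.
move=> t x; rewrite !lt_min => /and3P[tT tq tT2] xr.
have [G1 ->] := G t x tT2 xr; split => //.
by rewrite hE // F ?(ltW tq) // /hom !lap_psum_cst0 !mulr0.
Qed.

Lemma odd_analytic_solution : analytic_x H -> exists h, analytic_solution n H h.
Proof.
move=> Ha; eexists; apply: (@combined_solution R m p n H n2 Hs 1 0 (fun _ _ => 0)) => //.
- by move=> u; exact: smooth0.
- move=> u x0; have [r1 [r10 v]] := analytic_cauchy_on x0 (Ha u).
  by exists r1; split => //; exact: cauchy_on_laplacian.
- by move=> u x0; exists 1; split => //; exact: cauchy_on_cst.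
- by left.
- by right.
Qed.

End OddCase.

(** * The case of even n *)

Section EvenCase.
Context {R : realType} {m p : nat}.
Variables (s : nat) (H : 'rV[R]_m -> 'rV[R]_p -> R).
Hypotheses (s0 : (0 < s)%N) (Hs : smooth_x H).
Implicit Types (x : 'rV[R]_m) (u : 'rV[R]_p) (alpha Q : 'rV[R]_m -> 'rV[R]_p -> R) (t r T : R).
Implicit Types h : R -> 'rV[R]_m -> 'rV[R]_p -> R.

Local Notation n := (2 * s)%N.
Local Notation c := (c_ n s : R).
Local Notation null := (fun (_ : 'rV[R]_m) (_ : 'rV[R]_p) => 0 : R).

Let n2 : (2 <= n)%N. Proof. by lia. Qed.
Let n0 : (0 < n)%N. Proof. by lia. Qed.
Let nsc : log_coef n s c. Proof. by right. Qed.

Lemma c_neq0 : c != 0.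
Proof.
rewrite oppr_eq0 invr_eq0 mulf_neq0 ?pnatr_eq0 -?lt0n ?fact_gt0 //.
rewrite prodf_seq_neq0; apply/allP => i; rewrite mem_index_iota /= => si.
by rewrite subr_eq0 eqr_nat; apply/eqP; lia.
Qed.

(* The convolution in the formula only shifts the free coefficient of [t ^ s]. *)
Definition shifted alpha Q x u : R := alpha x u + c * convolution (Q ^~ u) (lap s H ^~ u) x.

Lemma shifted0 alpha : shifted alpha null = alpha.
Proof. by apply/funext => x; apply/funext => u; rewrite /shifted convolution0 mulr0 addr0. Qed.

Lemma analytic_cauchy_laplacian : analytic_x H ->
  forall u x0, exists r, 0 < r /\ cauchy_on (laplacian (H ^~ u)) x0 r.
Proof.
move=> Ha u x0; have [r [r0 v]] := analytic_cauchy_on x0 (Ha u).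
by exists r; split => //; exact: cauchy_on_laplacian.
Qed.

Section Given.
Variables (alpha Q : 'rV[R]_m -> 'rV[R]_p -> R).
Hypothesis vc : forall u x0, exists r, 0 < r /\ cauchy_on (laplacian (H ^~ u)) x0 r.
Hypothesis ala : analytic_x alpha.
Hypothesis aQ : forall u, analytic_convolvable (Q ^~ u) (lap s H ^~ u).

Lemma even_formula_local u x0 : exists T r, [/\ 0 < T, 0 < r, cauchy_on (laplacian (H ^~ u)) x0 r,
    cauchy_on (shifted alpha Q ^~ u) x0 r &
    forall t x, 0 < t < T -> ball x0 r x -> even_formula_converges n s H alpha Q t x u /\
      even_formula n s H alpha Q t x u = expansion n s c (H ^~ u) (shifted alpha Q ^~ u) t x].
Proof.
have [r1 [r10 v]] := vc u x0; have [r2 [r20 a]] := analytic_cauchy_on x0 (ala u).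
have m1 : Num.min r1 r2 <= r1 by rewrite ge_min lexx.
have m2 : Num.min r1 r2 <= r2 by rewrite ge_min lexx orbT.
have r0 : 0 < Num.min r1 r2 by rewrite lt_min r10.
have als : smooth_x alpha by move=> w; exact: analytic_smooth.
exact: (even_formula_expansion s0 r0 Hs als (cauchy_on_le m1 v) (cauchy_on_le m2 a) (aQ u)).
Qed.

Lemma even_given_expansion h :
  given_by_even 0^'+ n s H alpha Q h <-> has_expansion n s c H (shifted alpha Q) h.
Proof.
split=> hE u x0; have [T [r [T0 r0 v a F]]] := even_formula_local u x0.
  have /near2_right[T' [r' [T'0 r'0 G]]] := hE u x0.
  have m1 : Num.min r r' <= r by rewrite ge_min lexx.
  have m2 : Num.min r r' <= r' by rewrite ge_min lexx orbT.
  exists (Num.min T T'), (Num.min r r'); split.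
  - by rewrite lt_min T0.
  - by rewrite lt_min r0.
  - exact: cauchy_on_le v.
  - exact: cauchy_on_le a.
  move=> t x /andP[t0]; rewrite lt_min => /andP[tT tT'] xr.
  have h1 : 0 < t < T by rewrite t0.
  have h2 : 0 < t < T' by rewrite t0.
  have [_ ->] := G t x h2 (le_ball m2 xr).
  by have [_ ->] := F t x h1 (le_ball m1 xr).
have [T' [r' [T'0 r'0 _ _ G]]] := hE u x0.
have m1 : Num.min r r' <= r by rewrite ge_min lexx.
have m2 : Num.min r r' <= r' by rewrite ge_min lexx orbT.
apply/near2_right; exists (Num.min T T'), (Num.min r r'); split.
- by rewrite lt_min T0.
- by rewrite lt_min r0.
move=> t x /andP[t0]; rewrite lt_min => /andP[tT tT'] xr.
have h1 : 0 < t < T by rewrite t0.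
have h2 : 0 < t < T' by rewrite t0.
have [F1 F2] := F t x h1 (le_ball m1 xr).
by split => //; rewrite F2; exact: (G t x h2 (le_ball m2 xr)).
Qed.

Lemma even_formula_given : given_by_even 0^'+ n s H alpha Q (even_formula n s H alpha Q).
Proof.
move=> u x0; have [T [r [T0 r0 _ _ F]]] := even_formula_local u x0.
by apply/near2_right; exists T, r; split => // t x tT xr; split => //; have [] := F t x tT xr.
Qed.

End Given.

Lemma has_expansion_cauchy alpha h : has_expansion n s c H alpha h ->
  forall u x0, exists r, 0 < r /\ cauchy_on (laplacian (H ^~ u)) x0 r.
Proof. by move=> hexp u x0; have [T [r [_ r0 v _ _]]] := hexp u x0; exists r. Qed.

Lemma even_given_by alpha h : analytic_x alpha -> has_expansion n s c H alpha h ->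
  given_by_even 0^'+ n s H alpha null h.
Proof.
move=> ala hexp; apply/even_given_expansion => //; last by rewrite shifted0.
  exact: has_expansion_cauchy hexp.
by move=> u; exact: analytic_convolvable0.
Qed.

(* The power series of an analytic solution forces [ln t * Delta^s H] to stay bounded. *)
Lemma even_analytic_obstruction h x u : analytic_solution n H h -> lap s H x u = 0.
Proof.
move=> ha; have [hs _ _ _] := ha.
have [alpha [_ hexp]] := solution_has_expansion n2 s0 nsc Hs hs.
have [e [A [q [T [q0 eA T0 E]]]]] := analytic_remainder n2 s0 u x ha hexp.
have [T1 [M [T10 M0 B]]] := hom_bounded n2 s0 u x hexp.
have [_ L] := hom_leading n2 s0 u x hexp.
have m0 : 0 < Num.min 1 (Num.min T T1) by rewrite !lt_min ltr01 T0.
have n12 : n%:R / 2 = s%:R :> R by rewrite natrM mulrC mulKf // pnatr_eq0.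
pose K := M + `|c| * (2 * M + M).
(* The logarithm costs half a power: the remainder is of order t^(s - 1/2), which still excludes all
   coefficients before s. *)
have e0 k : (k < s)%N -> e k = 0.
  move=> ks; apply: (psum_vanish (kap := n%:R / 2 - 2^-1) (K := K) q0 eA m0) => [t /andP[t0]|].
    rewrite !lt_min => /and3P[t1 tT tT1].
    have tT' : 0 < t < T by rewrite t0.
    have tT1' : 0 < t < T1 by rewrite t0.
    have t01 : 0 < t <= 1 by rewrite t0 ltW.
    have [B1 B2 B3] := B t tT1'; have zl := z_ln_le n t01.
    have zz : t `^ (n%:R / 2) <= t `^ (n%:R / 2 - 2^-1).
      by apply: ger_powR => //; rewrite gerBl invr_ge0.
    rewrite E // /logp; move: zl zz (powR_ge0 t (n%:R / 2)) B1 B2 B3 (powR_ge0 t (n%:R / 2 - 2^-1)).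
    move: (hom _ _ _ _) (hom _ _ _ _) (qhom _ _ _ _) (t `^ (n%:R / 2)) (t `^ (n%:R / 2 - 2^-1)).
    move=> b a d z w zl zz z0 B1 B2 B3 w0.
    have -> : z * (a + c * (ln t * b - d)) = z * a + c * (z * ln t * b - z * d) by ring.
    apply: le_trans (ler_normD _ _) _; rewrite normrM (ger0_norm z0) normrM /K mulrDl.
    apply: lerD; first by rewrite [M * w]mulrC ler_pM.
    rewrite -[leRHS]mulrA ler_wpM2l //; apply: le_trans (ler_normB _ _) _.
    rewrite normrM [`|z * d|]normrM (ger0_norm z0) mulrDl; apply: lerD.
      by rewrite mulrAC ler_pM.
    by rewrite [M * w]mulrC ler_pM.
  rewrite n12; have : k.+1%:R <= s%:R :> R by rewrite ler_nat.
  have : 2^-1 < 1 :> R by rewrite invf_lt1 // ltr1n.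
  rewrite -natr1; move: (2^-1 : R) => a; lra.
have eS k : `|e (k + s)%N| <= A * q ^+ s * q ^+ k.
  by apply: le_trans (eA _) _; rewrite exprD [q ^+ k * _]mulrC mulrA.
have pB t : `|t| <= rad q -> `|psum (fun k => e (k + s)%N) t| <= 2 * (A * q ^+ s).
  move=> /(rad_le q0)[qt _ _]; have qt1 : q * `|t| < 1 by apply: le_lt_trans qt _; lra.
  have cv := pseries_bd_cvg q0 eS qt1; rewrite /psum -lim_norm //.
  apply: limr_le; first exact: is_cvg_norm.
  by apply: nearW => N; exact: pseries_le q0 eS qt.
(* The bound that results from dividing the remainder by t^s and solving for ln t times [hom]; this
   uses that c is nonzero. *)
pose W := (2 * (A * q ^+ s) + M) / `|c| + M.
have c0 : 0 < `|c| by rewrite normr_gt0 c_neq0.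
have lB t : 0 < t < Num.min (Num.min T T1) (rad q) -> `|ln t * hom n (lap s H ^~ u) t x| <= W.
  move=> /andP[t0]; rewrite !lt_min -andbA => /and3P[tT tT1 tq].
  have tT' : 0 < t < T by rewrite t0.
  have tT1' : 0 < t < T1 by rewrite t0.
  have tq' : `|t| <= rad q by rewrite gtr0_norm // ltW.
  have [B1 B2 B3] := B t tT1'; have P := pB t tq'.
  have := E t tT'; rewrite (psum_factor q0 eA e0 tq') half_n // => /(mulfI _) EE.
  have := EE (lt0r_neq0 (exprn_gt0 s t0)); rewrite /logp => {EE}.
  move: P B1 B2 B3; move: (hom _ _ _ _) (hom _ _ _ _) (qhom _ _ _ _) (psum _ _) => b a d f P B1 B2 B3 EE.
  have -> : ln t * b = (f - a) / c + d by rewrite EE; field; exact: c_neq0.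
  apply: le_trans (ler_normD _ _) _; apply: lerD => //.
  rewrite normrM normfV ler_pM2r ?invr_gt0 //; apply: le_trans (ler_normB _ _) _; exact: lerD.
apply: (@cvg_unique _ _ (hom n (lap s H ^~ u) t x @[t --> 0^'+]) _ _ _ L) => //.
apply/cvgr0Pnorm_le => eta eta0; near=> t.
have W0 : 0 <= W.
  rewrite addr_ge0 // divr_ge0 // addr_ge0 // mulr_ge0 // mulr_ge0 ?exprn_ge0 //.
  by have := eA 0%N; rewrite expr0 mulr1; apply: le_trans.
have tT : 0 < t < Num.min (Num.min T T1) (rad q).
  by near: t; apply: near_0_right; rewrite !lt_min T0 T10 rad_gt0.
(* Then - ln t >= (W + 1) / eta, so that the bound W on |ln t| |hom| forces |hom| <= eta. *)
have te : 0 < t < expR (- (W + 1) / eta) by near: t; apply: near_0_right; exact: expR_gt0.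
have /andP[t0 te2] := te.
have : ln t <= - (W + 1) / eta.
  by rewrite -[leRHS]expRK; apply: ltW; rewrite ltr_ln // posrE expR_gt0.
rewrite ler_pdivlMr // => lt1.
have lt0 : 0 < - ln t.
  rewrite oppr_gt0 -(pmulr_llt0 _ eta0); apply: le_lt_trans lt1 _; rewrite oppr_lt0; lra.
have := lB t tT; rewrite normrM ler0_norm; last by lra.
move=> lB1; rewrite -(ler_pM2l lt0); apply: le_trans lB1 _; lra.
Unshelve. all: by end_near. Qed.

Section Unobstructed.
Hypotheses (Ha : analytic_x H) (H0 : forall x u, lap s H x u = 0).

(** The logarithmic terms vanish together with Delta^s H, and the rest involves integral powers of t
    only, so the formula also makes sense for t <= 0. *)
Lemma even_formula_unobstructed alpha u x0 r : cauchy_on (laplacian (H ^~ u)) x0 r ->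
  cauchy_on (alpha ^~ u) x0 r -> exists2 T, 0 < T & forall t x, `|t| < T -> ball x0 r x ->
    even_formula_converges n s H alpha null t x u /\
    even_formula n s H alpha null t x u = psum (fun k => combined n H s alpha k x u) t.
Proof.
move=> v a; have [A [C [q [A0 C0 q0 [_ h2 _ _]]]]] := expansion_bds n2 s0 v a.
have [A' [C' [q' [_ _ q'0 _ F]]]] := combined_local n2 s0 v a.
exists (Num.min (rad q) (rad q')); first by rewrite lt_min !rad_gt0.
move=> t x; rewrite lt_min => /andP[tq tq'] xr; have [qt _ _] := rad_le q0 (ltW tq).
have qt1 : q * `|t| < 1 by apply: le_lt_trans qt _; lra.
have [d1 d2] := term_plus_cvg (pseries_bd_cvg q0 (series_bd_coef0 h2 xr) qt1).
have lH : lap s H = null by apply/funext => y; apply/funext => w.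
have tp0 k y : term_plus n null t y u k = 0 :> R.
  by rewrite /term_plus /lap -[(fun _ => 0)]/(cst 0 : 'rV[R]_m -> R) iter_laplacian_cst0 !mul0r.
have l0 : (fun N => \sum_(0 <= k < N) (ln t - q_ n k) * term_plus n null t x u k) = cst 0.
  by apply/funext => N; rewrite big1 // => k _; rewrite tp0 mulr0.
have l1 : (fun y => limn (fun N => \sum_(0 <= k < N) term_plus n null t y u k)) = cst 0.
  apply/funext => y; apply/cvg_lim => //; apply: cvg_near_cst; apply: nearW => N.
  by rewrite big1 // => k _; rewrite tp0.
split.
  rewrite /even_formula_converges lH l0 l1; split => //; first exact: is_cvg_cst.
    by move=> y; rewrite eqxx.
  by rewrite (_ : _ \o _ = cst 0%E); [exact: integrable0 | apply/funext => y; rewrite /= /conv_integrand mul0r].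
rewrite /even_formula lH l0 l1 convolution0 lim_cst // !mulr0 !addr0 d2 even_reg // F //.
exact: ltW.
Qed.

Lemma combined_given alpha h :
  (forall u x0, exists T r, [/\ 0 < T, 0 < r, cauchy_on (laplacian (H ^~ u)) x0 r,
    cauchy_on (alpha ^~ u) x0 r &
    forall t x, `|t| < T -> ball x0 r x -> h t x u = psum (fun k => combined n H s alpha k x u) t]) ->
  given_by_even (nbhs (0 : R)) n s H alpha null h.
Proof.
move=> hE u x0; have [T [r [T0 r0 v a E]]] := hE u x0.
have [T' T'0 F] := even_formula_unobstructed v a.
apply/near2_0; exists (Num.min T T'), r; split => //; first by rewrite lt_min T0.
move=> t x; rewrite lt_min => /andP[tT tT'] xr.
by have [F1 ->] := F t x tT' xr; split => //; exact: E.
Qed.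

Lemma given_by_even_right alpha h :
  given_by_even (nbhs (0 : R)) n s H alpha null h -> given_by_even 0^'+ n s H alpha null h.
Proof.
move=> hE u x0; have /near2_0[T [r [T0 r0 E]]] := hE u x0.
apply/near2_right; exists T, r; split => // t x /andP[t0 tT]; apply: E; by rewrite gtr0_norm.
Qed.

Lemma given_by_even_inj alpha alpha' h : analytic_x alpha -> analytic_x alpha' ->
  given_by_even 0^'+ n s H alpha null h -> given_by_even 0^'+ n s H alpha' null h -> alpha = alpha'.
Proof.
have vc := analytic_cauchy_laplacian Ha.
have aQ u : analytic_convolvable (null ^~ u) (lap s H ^~ u) by exact: analytic_convolvable0.
move=> aa aa' /(even_given_expansion vc aa aQ) E /(even_given_expansion vc aa' aQ) E'.
by move: E E'; rewrite !shifted0; exact: has_expansion_inj.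
Qed.

Lemma even_analytic_given h : analytic_solution n H h ->
  exists! alpha, analytic_x alpha /\ given_by_even (nbhs (0 : R)) n s H alpha null h.
Proof.
move=> ha; have [hs _ _ _] := ha.
have [alpha [ala hexp]] := solution_has_expansion n2 s0 nsc Hs hs.
have hg : given_by_even (nbhs (0 : R)) n s H alpha null h.
  apply: combined_given; exact: (analytic_solution_combined n2 s0 (or_intror H0) (or_introl erefl) ha hexp).
exists alpha; split => // alpha' [ala' hg'].
exact: given_by_even_inj ala ala' (given_by_even_right hg) (given_by_even_right hg').
Qed.

Lemma even_analytic_solution alpha : analytic_x alpha -> exists2 h,
  analytic_solution n H h & given_by_even (nbhs (0 : R)) n s H alpha null h.
Proof.
move=> ala; have als : smooth_x alpha by move=> w; exact: analytic_smooth.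
have vc := analytic_cauchy_laplacian Ha.
have alc u x0 : exists r, 0 < r /\ cauchy_on (alpha ^~ u) x0 r by exact: analytic_cauchy_on.
exists (fun t x u => psum (fun k => combined n H s alpha k x u) t).
  by apply: (combined_solution n2 Hs s0 nsc als vc alc); [right | left].
apply: combined_given => u x0; have [r1 [r10 v]] := vc u x0; have [r2 [r20 a]] := alc u x0.
exists 1, (Num.min r1 r2); split => //; first by rewrite lt_min r10.
  by apply: cauchy_on_le v; rewrite ge_min lexx.
by apply: cauchy_on_le a; rewrite ge_min lexx orbT.
Qed.

Lemma even_analytic_nonunique : exists h1 h2, [/\ analytic_solution n H h1, analytic_solution n H h2 &
  ~ forall u (x0 : 'rV[R]_m), \forall t \near 0^'+ & x \near x0, h1 t x u = h2 t x u].
Proof.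
have ac (k : R) : analytic_x (fun (_ : 'rV[R]_m) (_ : 'rV[R]_p) => k).
  by move=> u x0; apply: cauchy_on_analytic; exists 1; split => //; exact: cauchy_on_cst.
have [h1 s1 g1] := even_analytic_solution (ac 0).
have [h2 s2 g2] := even_analytic_solution (ac 1).
exists h1, h2; split => // hh.
have g1' : given_by_even 0^'+ n s H (fun _ _ => 1) null h1.
  move=> u x0; have /near2_right[T [r [T0 r0 E]]] := given_by_even_right g2 u x0.
  have /near2_right[T' [r' [T'0 r'0 E']]] := hh u x0.
  have m1 : Num.min r r' <= r by rewrite ge_min lexx.
  have m2 : Num.min r r' <= r' by rewrite ge_min lexx orbT.
  apply/near2_right; exists (Num.min T T'), (Num.min r r'); split.
  - by rewrite lt_min T0.
  - by rewrite lt_min r0.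
  move=> t x /andP[t0]; rewrite lt_min => /andP[tT tT'] xr.
  rewrite (E' t x) ?t0 //; last exact: (le_ball m2 xr).
  by apply: E; [rewrite t0 | exact: (le_ball m1 xr)].
have := given_by_even_inj (ac 0) (ac 1) (given_by_even_right g1) g1'.
move=> /(congr1 (fun f => f 0 0))/eqP; by rewrite eq_sym oner_eq0.
Qed.

End Unobstructed.

End EvenCase.
Theorem theorem2p2 (R : realType) (n p : nat)
    (hp1 : (1 <= p)%N) (hp2 : (2 * p <= n)%N)
    (H : 'rV[R]_(n - 2 * p) -> 'rV[R]_p -> R) (hH : smooth_x H) :
  (odd n ->
    [/\ (* formal solutions *)
        forall a : formal,
          formal_solution n H a <->
          exists alpha, smooth_x alpha /\ a = odd_expansion n H alpha,
        (* solutions *)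
        forall h, solution n H h ->
          exists alpha, analytic_x alpha /\ given_by_odd 0^'+ n H alpha h,
        analytic_x H -> forall alpha, analytic_x alpha ->
          (exists h, given_by_odd 0^'+ n H alpha h) /\
          (forall h, given_by_odd 0^'+ n H alpha h -> solution n H h) &
        (* solutions analytic in rho *)
        analytic_x H ->
          (exists h, analytic_solution n H h) /\
          (forall h, analytic_solution n H h ->
             given_by_odd (nbhs (0 : R)) n H (fun _ _ => 0) h)]) /\
  (forall s : nat, n = (2 * s)%N ->
    [/\ (* formal solutions *)
        forall a : formal,
          formal_solution n H a <->
          exists alpha Q, [/\ smooth_x alpha,
            forall u, smooth_convolvable (Q ^~ u) (lap s H ^~ u) &
            a = even_expansion n s H alpha Q],
        (* solutions *)
        forall h, solution n H h ->
          exists alpha Q, [/\ analytic_x alpha,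
            forall u, analytic_convolvable (Q ^~ u) (lap s H ^~ u) &
            given_by_even 0^'+ n s H alpha Q h],
        analytic_x H -> forall alpha Q, analytic_x alpha ->
          (forall u, analytic_convolvable (Q ^~ u) (lap s H ^~ u)) ->
          (exists h, given_by_even 0^'+ n s H alpha Q h) /\
          (forall h, given_by_even 0^'+ n s H alpha Q h -> solution n H h),
        (* solutions analytic in rho *)
        (exists h, analytic_solution n H h) ->
          forall x u, lap s H x u = 0 &
        analytic_x H -> (forall x u, lap s H x u = 0) ->
          [/\ forall h, analytic_solution n H h ->
                exists! alpha, analytic_x alpha /\
                  given_by_even (nbhs (0 : R)) n s H alpha (fun _ _ => 0) h,
              forall alpha, analytic_x alpha -> exists2 h,
                analytic_solution n H h &
                given_by_even (nbhs (0 : R)) n s H alpha (fun _ _ => 0) h &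
              exists h1 h2, [/\ analytic_solution n H h1,
                analytic_solution n H h2 &
                ~ forall u (x0 : 'rV[R]_(n - 2 * p)),
                    \forall rho \near 0^'+ & x \near x0,
                      h1 rho x u = h2 rho x u]]]).
Proof.
have n2 : (2 <= n)%N by lia.
split=> [on|s nE].
  split.
  - exact: odd_formal_solutions.
  - move=> h hs; have [alpha [ala hexp]] := solution_has_expansion n2 (ltn0Sn 0) (or_introl (conj on erefl)) hH hs.
    by exists alpha; split => //; exact: odd_given_by hexp.
  - move=> Ha alpha ala; split; first by eexists; exact: odd_formula_given.
    move=> h /(odd_formula_has_expansion n2 Ha ala).
    exact: (has_expansion_solution n2 (ltn0Sn 0) (or_introl (conj on erefl)) hH).
  - move=> Ha; split; first exact: odd_analytic_solution.
    by move=> h; exact: odd_analytic_given.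
have s0 : (0 < s)%N by lia.
(* The number of x-variables is generalised first, so that n can be replaced by 2 s without touching
   the type of H. *)
move: H hH; move: (n - 2 * p)%N => m H hH; rewrite nE {hp2 n2}.
have n2 : (2 <= 2 * s)%N by lia.
have nsc : log_coef (2 * s) s (c_ (2 * s) s : R) by right.
split.
- exact: even_formal_solutions.
- move=> h hs; have [alpha [ala hexp]] := solution_has_expansion n2 s0 nsc hH hs.
  exists alpha, (fun _ _ => 0); split => //; first by move=> u; exact: analytic_convolvable0.
  exact: even_given_by hexp.
- move=> Ha alpha Q ala aQ; have vc := analytic_cauchy_laplacian Ha; split.
    by eexists; exact: even_formula_given.
  move=> h /(even_given_expansion s0 hH vc ala aQ); exact: has_expansion_solution.
- move=> [h ha] x u; exact: even_analytic_obstruction ha.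
- move=> Ha H0; split.
  + by move=> h; exact: even_analytic_given.
  + by move=> alpha; exact: even_analytic_solution.
  + exact: even_analytic_nonunique.
Qed.
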